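(* Let $X_n$ be the number of catastrophes of a random excursion with catastrophes of length $n$, i.e. $\Pr(X_n=k)=[z^nv^k]C(z,v)/[z^n]C(z,1)$ where $C(z,v)=\frac{E(z)}{1-vQ(z)}$. Then: (1) If $\rho_0<\rho$, then with $\mu=\frac{1}{\rho_0Q'(\rho_0)}$ and $\sigma^2=\frac{\rho_0Q''(\rho_0)+Q'(\rho_0)-\rho_0Q'(\rho_0)^2}{\rho_0^2Q'(\rho_0)^3}$, the variable $\frac{X_n-\mu n}{\sigma\sqrt n}$ converges in law to a standard Gaussian $\mathcal N(0,1)$. (2) If $\rho_0=\rho$, then $\frac{X_n}{\vartheta\sqrt n}$ with $\vartheta=\frac{\sqrt2}{\eta}$ converges in law to a Rayleigh distribution, i.e. $\lim_{n\to\infty}\Pr\big(\frac{X_n}{\vartheta\sqrt n}\le x\big)=1-e^{-x^2/2}$; in particular $\mathbb E(X_n)\sim\frac1\eta\sqrt{\pi n}$. (3) If $\rho_0$ does not exist, then \[\Pr(X_n=k)=\frac{(k\eta/\lambda+C/\tau)\lambda^k}{\eta D(\rho)^2+(C/\tau)D(\rho)}\Big(1+O\big(\tfrac1n\big)\Big),\] where $\lambda=Q(\rho)$ and $C=\sqrt{2P(\tau)/P''(\tau)}$.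
   Context: Fix integers $c,d\ge1$ and non-negative real weights $p_{-c},\dots,p_d$ with $p_{-c}\neq0\neq p_d$; jump set $\mathcal J=\{i: p_i\neq0\}$, jump polynomial $P(u)=\sum_{i=-c}^dp_iu^i$. Standing assumption: $P$ is aperiodic (there are no integer $b$, integer $p\ge2$ and Laurent polynomial $H$ with $P(u)=u^bH(u^p)$). A catastrophe is a step from an altitude $h>0$ with $-h\notin\mathcal J$ directly to altitude $0$, of weight $q>0$. Paths start at altitude $0$; each step is a jump $i\in\mathcal J$ (weight $p_i$) or a catastrophe; the weight of a path is the product of its step weights; random paths are drawn with probability proportional to weight. Meanders never go below $0$; excursions are meanders ending at $0$. Let $M(z,u)=\sum m_{n,k}z^nu^k$, with $m_{n,k}$ the total weight of catastrophe-free meanders of length $n$ ending at altitude $k$; $M_k(z)=[u^k]M(z,u)$, $M(z)=M(z,1)$, $E(z)=M_0(z)$. Let $Q(z)=zq\big(M(z)-E(z)-\sum_{j>0,-j\in\mathcal J}M_j(z)\big)$ and $D(z)=1/(1-Q(z))$. Let $\tau>0$ be the minimal positive real solution of $P'(\tau)=0$ and $\rho=1/P(\tau)$. Let $\rho_0$ be the smallest positive real zero of $1-Q(z)$ satisfying $\rho_0\le\rho$, if it exists (''$\rho_0$ does not exist'' otherwise). In the cases $\rho_0=\rho$ or $\rho_0$ nonexistent, $\eta$ is defined by the Puiseux expansion $Q(z)=Q(\rho)-\eta\sqrt{1-z/\rho}+O(1-z/\rho)$ as $z\to\rho$. *)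

(* Defs.v *)
From Stdlib Require Import Reals Lra Lia ZArith Arith List.
From Coquelicot Require Import Coquelicot.
Open Scope R_scope.

Definition zsum (a b : Z) (f : Z -> R) : R :=
  fold_right Rplus 0
    (map (fun k => f (a + Z.of_nat k)%Z) (List.seq 0 (Z.to_nat (b - a + 1)))).

Section Model.
Variables (c d : nat) (p : Z -> R) (q : R).
(* The jump weights are p (-c), ..., p d ; values of p outside are irrelevant. *)

Definition Pfun (u : R) : R :=
  zsum (- Z.of_nat c) (Z.of_nat d) (fun i => p i * powerRZ u i).

Definition aperiodic : Prop :=
  ~ exists (b : Z) (per N : nat) (h : Z -> R),
      (2 <= per)%nat /\
      forall u, 0 < u ->
        Pfun u = powerRZ u b *
                 zsum (- Z.of_nat N) (Z.of_nat N) (fun j => h j * powerRZ (u ^ per) j).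

(* m n k : total weight of catastrophe-free meanders of length n ending at
   altitude k (jumps i in -c..d of weight p i; jumps with p i = 0 are not in
   the jump set and contribute weight 0) *)
Fixpoint mea (n : nat) (k : nat) : R :=
  match n with
  | O => if Nat.eqb k 0 then 1 else 0
  | S n' =>
      zsum (- Z.of_nat c) (Z.of_nat d)
        (fun i => let h := (Z.of_nat k - i)%Z in
                  if Z.leb 0 h then p i * mea n' (Z.to_nat h) else 0)
  end.

(* [z^n] M(z) = sum_k m_{n,k}; altitudes after n steps are at most d*n *)
Definition Mcoef (n : nat) : R := sum_f_R0 (fun k => mea n k) (d * n).

Definition Ecoef (n : nat) : R := mea n 0.

(* [z^n] Q(z), where Q(z) = z q (M(z) - E(z) - sum_{j>0, -j in J} M_j(z)) *)
Definition Qcoef (n : nat) : R :=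
  match n with
  | O => 0
  | S n' =>
      q * (Mcoef n' - Ecoef n'
           - sum_f_R0 (fun j => if Nat.eqb j 0 then 0
                                else if Req_EM_T (p (- Z.of_nat j)%Z) 0 then 0
                                else mea n' j) c)
  end.

Definition Qfun (z : R) : R := PSeries Qcoef z.

Definition conv (a b : nat -> R) (n : nat) : R :=
  sum_f_R0 (fun i => a i * b (n - i)%nat) n.

Fixpoint Qpow (k : nat) : nat -> R :=
  match k with
  | O => fun n => if Nat.eqb n 0 then 1 else 0
  | S k' => conv Qcoef (Qpow k')
  end.

(* [z^n v^k] C(z,v), with C(z,v) = E(z)/(1 - v Q(z)) = sum_k E(z) v^k Q(z)^k *)
Definition Ccoef (n k : nat) : R := conv Ecoef (Qpow k) n.

(* [z^n] C(z,1) = sum_k [z^n v^k] C(z,v); terms with k > n vanish since Q(0)=0 *)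
Definition Ctot (n : nat) : R := sum_f_R0 (fun k => Ccoef n k) n.

Definition Xprob (n k : nat) : R := Ccoef n k / Ctot n.

(* Pr(g(X_n) <= x), X_n being supported on 0..n *)
Definition Xcdf (n : nat) (g : nat -> R) (x : R) : R :=
  sum_f_R0 (fun k => if Rle_dec (g k) x then Xprob n k else 0) n.

Definition Xmean (n : nat) : R := sum_f_R0 (fun k => INR k * Xprob n k) n.

Definition is_rho0 (rho r : R) : Prop :=
  0 < r <= rho /\ is_series (fun n => Qcoef n * r ^ n) 1 /\
  forall r', 0 < r' < r -> ~ is_series (fun n => Qcoef n * r' ^ n) 1.

Definition puiseux (rho eta : R) : Prop :=
  ex_series (fun n => Qcoef n * rho ^ n) /\
  exists K delta, 0 < delta /\
    forall z, rho - delta < z < rho ->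
      Rabs (Qfun z - (Qfun rho - eta * sqrt (1 - z / rho))) <= K * (1 - z / rho).

End Model.

Definition Phi (x : R) : R :=
  RInt_gen (fun t => exp (- t ^ 2 / 2) / sqrt (2 * PI))
           (Rbar_locally m_infty) (at_point x).

Definition Rayleigh_cdf (x : R) : R := 1 - exp (- (Rmax x 0) ^ 2 / 2).

(* Main.v *)
(* Everything is done on coefficient sequences, without complex analysis.
   Tilting by tau and rho makes the walk centred. Spitzer's identity writes E as the exponential of a series whose
   coefficients are known from the local limit theorem, and then gives the M_k and M as well; so E(rho z) and Q(rho z)
   have coefficients al [z^n] sqrt (1-z) + O(n^(-5/2)). This class is stable under products, exp and 1/(1-Q) with
   Q(1) < 1, whence (3).
   For (2), the powers of 1/(1 - Q(rho z)) are compared with those of (1-z)^(-1/2). It follows that the transforms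
   E[v^(X_n)], at the scale v = 1/(1 + eta g_n) with g_n = [z^n] (1-z)^(-1/2), have the same limits as for
   Q = 1 - sqrt (1-z) and E = 1. In that model P(X_n >= k) is an explicit product that tends to the Rayleigh tail, and
   Bernstein polynomials carry the comparison from transforms to distribution functions.
   For (1), Q has radius of convergence larger than rho0. Let S_k be a sum of k independent variables of law
   Q_n rho0^n. By the renewal theorem P(X_n >= k) is close to P(S_k <= n), to which the central limit theorem applies. *)
Require Import Defs.
From Stdlib Require Import Reals Lra Lia ZArith List FunctionalExtensionality.
From Coquelicot Require Import Coquelicot.

(** * Formal power series *)

(** Every asymptotic statement concerns coefficients and must survive products with an explicit
    error, so powers of n are replaced by exact comparison sequences: [gseq] and [wseq], the
    coefficients of (1-z)^(-1/2) and (1-z)^(1/2). Their recurrences are rational, their partial sums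
    telescope, and the square of the series of [gseq] is 1/(1-z). Three obstacles shape the proof. A
    geometric series in the class converges only when a norm is small, whereas 1/(1-Q) is wanted for
    every Q with Q(1) < 1; repeated squaring of Q repairs this. When Q(1) = 1 the inverse U =
    1/(1-Q) leaves the class, and its coefficients are reached through the identity z U' = z Q' U^2.
    Finally M is taken at u = 1 although the walk is tilted by tau: the weights tau^(-k) that undo
    the tilt are summable only for tau > 1. In cases (2) and (3) the convergence of Q at rho forces
    tau > 1; in case (1) tau is arbitrary, and the only obstruction inside the disc of radius rho is
    a pole of M at 1/P(1), where Q diverges. *)

Section FormalSeries.
Context {A : Type} (zero one : A) (add mul sub : A -> A -> A) (opp : A -> A).
Hypothesis Aring : ring_theory zero one add mul sub opp eq.
Add Ring base_ring : Aring.
Local Notation "0" := zero.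
Local Notation "1" := one.
Local Infix "+" := add.
Local Infix "*" := mul.

(** The ring is abstract because series are formed twice, over R and then over real series to get
    two variables; finite sums and their products are also taken over C. *)
Fixpoint fsum (f : nat -> A) (n : nat) : A :=
  match n with O => f O | S n' => fsum f n' + f (S n') end.

Definition fconv (a b : nat -> A) (n : nat) : A := fsum (fun i => a i * b (n - i)%nat) n.
Definition fadd (a b : nat -> A) (n : nat) : A := a n + b n.
Definition fsub (a b : nat -> A) (n : nat) : A := sub (a n) (b n).
Definition fopp (a : nat -> A) (n : nat) : A := opp (a n).
Definition fzero (n : nat) : A := 0.
Definition fone (n : nat) : A := if Nat.eqb n 0 then 1 else 0.

Lemma fsum_ext f g n : (forall i, (i <= n)%nat -> f i = g i) -> fsum f n = fsum g n.
Proof.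
  induction n as [|n IH]; simpl; intros H; [apply H; lia|].
  rewrite IH, H by (intros; try apply H; lia); reflexivity.
Qed.

Lemma fsum_add f g n : fsum (fun i => f i + g i) n = fsum f n + fsum g n.
Proof. induction n as [|n IH]; simpl; [ring|rewrite IH; ring]. Qed.

Lemma fsum_scal x f n : fsum (fun i => x * f i) n = x * fsum f n.
Proof. induction n as [|n IH]; simpl; [ring|rewrite IH; ring]. Qed.

Lemma fsum_zero n : fsum (fun _ => 0) n = 0.
Proof. induction n as [|n IH]; simpl; [|rewrite IH]; ring. Qed.

Lemma fsum_head f n : fsum f (S n) = f O + fsum (fun i => f (S i)) n.
Proof. induction n as [|n IH]; simpl in *; [ring|rewrite IH; ring]. Qed.

Lemma fsum_rev f n : fsum f n = fsum (fun i => f (n - i)%nat) n.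
Proof.
  revert f; induction n as [|n IH]; intros f; [reflexivity|].
  rewrite fsum_head, IH.
  change (fsum (fun i => f (S n - i)%nat) (S n))
    with (fsum (fun i => f (S n - i)%nat) n + f (S n - S n)%nat).
  rewrite (fsum_ext (fun i => f (S (n - i))) (fun i => f (S n - i)%nat)).
  - rewrite Nat.sub_diag. ring.
  - intros i Hi. f_equal. lia.
Qed.

Lemma fconv_head a b n : fconv a b (S n) = a O * b (S n) + fconv (fun i => a (S i)) b n.
Proof. unfold fconv. rewrite fsum_head. reflexivity. Qed.

Lemma fconv_ext a a' b b' n :
  (forall i, (i <= n)%nat -> a i = a' i) -> (forall i, (i <= n)%nat -> b i = b' i) ->
  fconv a b n = fconv a' b' n.
Proof. intros H H'. apply fsum_ext. intros i Hi. rewrite H, H' by lia. reflexivity. Qed.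

Lemma fconv_comm a b n : fconv a b n = fconv b a n.
Proof.
  unfold fconv. rewrite fsum_rev. apply fsum_ext. intros i Hi.
  replace (n - (n - i))%nat with i by lia. ring.
Qed.

Lemma fconv_add_l a a' b n : fconv (fadd a a') b n = fconv a b n + fconv a' b n.
Proof.
  unfold fconv. rewrite <- fsum_add. apply fsum_ext. intros i Hi. unfold fadd. ring.
Qed.

Lemma fconv_scal_l x a b n : fconv (fun i => x * a i) b n = x * fconv a b n.
Proof. unfold fconv. rewrite <- fsum_scal. apply fsum_ext. intros i Hi. ring. Qed.

(** Induction on the order with [a] generalized: removing the first coefficient of [a] turns the
    claim into one for its shift at the previous order. *)
Lemma fconv_assoc a b c n : fconv a (fconv b c) n = fconv (fconv a b) c n.
Proof.
  revert a; induction n as [|n IH]; intros a; [unfold fconv; simpl; ring|].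
  rewrite (fconv_head a (fconv b c)), (fconv_head (fconv a b) c), (fconv_head b c), IH.
  rewrite (fconv_ext (fun i => fconv a b (S i)) (fadd (fun i => a O * b (S i)) (fconv (fun i => a (S i)) b)) c c)
    by (intros; try reflexivity; apply fconv_head).
  rewrite fconv_add_l, fconv_scal_l. unfold fconv at 4. simpl. ring.
Qed.

Lemma fconv_one_l a n : fconv fone a n = a n.
Proof.
  destruct n as [|n]; [unfold fconv, fone; simpl; ring|].
  rewrite fconv_head. unfold fone at 1; simpl.
  unfold fconv. rewrite (fsum_ext _ (fun _ => 0)); [rewrite fsum_zero; ring|].
  intros i Hi. unfold fone; simpl. ring.
Qed.

Lemma fseries_ring : ring_theory fzero fone fadd fconv fsub fopp eq.
Proof.
  split; intros; extensionality n.
  - unfold fadd, fzero; ring.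
  - unfold fadd; ring.
  - unfold fadd; ring.
  - apply fconv_one_l.
  - apply fconv_comm.
  - apply fconv_assoc.
  - apply fconv_add_l.
  - unfold fsub, fadd, fopp; ring.
  - unfold fadd, fopp, fzero; ring.
Qed.

(** Multiples by repeated addition, so that the derivation z d/dz makes sense over an abstract
    ring. *)
Fixpoint nmul (n : nat) (x : A) : A := match n with O => 0 | S n' => x + nmul n' x end.

Lemma nmul_mul_l n x y : nmul n x * y = nmul n (x * y).
Proof. induction n as [|n IH]; simpl; [ring|rewrite <- IH; ring]. Qed.

Lemma nmul_add n m x : nmul (n + m) x = nmul n x + nmul m x.
Proof. induction n as [|n IH]; simpl; [ring|rewrite IH; ring]. Qed.

Lemma nmul_dist n x y : nmul n (x + y) = nmul n x + nmul n y.
Proof. induction n as [|n IH]; simpl; [ring|rewrite IH; ring]. Qed.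

(* The derivation z d/dz. *)
Definition ftheta (a : nat -> A) (n : nat) : A := nmul n (a n).

Lemma ftheta_conv a b :
  ftheta (fconv a b) = fadd (fconv (ftheta a) b) (fconv a (ftheta b)).
Proof.
  extensionality n. unfold ftheta at 1, fadd, fconv.
  rewrite <- fsum_add.
  assert (H : forall f, nmul n (fsum f n) = fsum (fun i => nmul n (f i)) n).
  { intros f. assert (H : forall m, nmul n (fsum f m) = fsum (fun i => nmul n (f i)) m).
    { induction m as [|m IH]; simpl; [reflexivity|]. rewrite nmul_dist, IH. reflexivity. }
    apply H. }
  rewrite H. apply fsum_ext. intros i Hi. unfold ftheta.
  rewrite nmul_mul_l. replace n with (i + (n - i))%nat at 1 by lia.
  rewrite nmul_add. f_equal.
  assert (H' : forall m x y, x * nmul m y = nmul m (x * y)).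
  { intros m x y. induction m as [|m IH]; simpl; [ring|rewrite <- IH; ring]. }
  rewrite H'. reflexivity.
Qed.

(** Evaluation at 1 is multiplicative on polynomials; the degree of [a] is lowered by removing its
    constant term. Other evaluation points follow by weighting the coefficients. *)
Lemma fsum_conv_low a b N M :
  (forall i, (N < i)%nat -> a i = 0) -> (forall i, (M < i)%nat -> b i = 0) ->
  fsum (fconv a b) (N + M) = fsum a N * fsum b M.
Proof.
  intros Ha Hb.
  assert (Hpad : forall f K L, (K <= L)%nat -> (forall i, (K < i)%nat -> f i = 0) -> fsum f L = fsum f K).
  { intros f K L HKL Hf. induction HKL as [|L HKL IH]; [reflexivity|].
    simpl. rewrite IH, Hf by lia. ring. }
  revert a Ha; induction N as [|N IH]; intros a Ha.
  - change (fsum a O) with (a O). rewrite <- fsum_scal. apply fsum_ext. intros n _.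
    destruct n as [|n]; [reflexivity|]. rewrite fconv_head.
    unfold fconv. rewrite (fsum_ext _ (fun _ => 0)); [rewrite fsum_zero; ring|].
    intros j Hj. rewrite Ha by lia. ring.
  - rewrite Nat.add_succ_l, fsum_head.
    rewrite (fsum_ext _ (fun n => a O * b (S n) + fconv (fun i => a (S i)) b n))
      by (intros; apply fconv_head).
    rewrite fsum_add, IH by (intros; apply Ha; lia).
    rewrite fsum_scal, (fsum_head a).
    replace (fconv a b 0) with (a O * b O) by (unfold fconv; reflexivity).
    rewrite <- (Hpad b M (S (N + M))) by (auto; lia).
    rewrite (fsum_head b). ring.
Qed.

End FormalSeries.

Ltac pos := solve [repeat first
  [ lra | assumption | apply Rgt_not_eq | apply pow_le | apply pow_lt | apply Rmult_le_pos | apply Rmult_lt_0_compat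
  | apply Rdiv_lt_0_compat | apply Rinv_0_lt_compat | apply Rlt_le, Rinv_0_lt_compat | apply sqrt_lt_R0
  | apply pos_INR | apply lt_0_INR; lia | apply pow2_ge_0 | apply Rabs_pos | apply exp_pos | solve [auto]
  | apply cond_pos_sum; intro | apply Rlt_le ]].

Open Scope R_scope.

(** * Spitzer's identity *)

Definition seqadd (a b : nat -> R) (n : nat) : R := a n + b n.
Definition seqsub (a b : nat -> R) (n : nat) : R := a n - b n.
Definition seqopp (a : nat -> R) (n : nat) : R := - a n.
Definition seqscal (x : R) (a : nat -> R) (n : nat) : R := x * a n.
Definition seq0 (n : nat) : R := 0.
Definition seq1 (n : nat) : R := if Nat.eqb n 0 then 1 else 0.
Definition mono (k n : nat) : R := if Nat.eqb n k then 1 else 0.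

Fixpoint seqpow (a : nat -> R) (k : nat) : nat -> R :=
  match k with O => seq1 | S k' => conv a (seqpow a k') end.

Lemma R_ring : ring_theory 0 1 Rplus Rmult Rminus Ropp eq.
Proof. split; intros; ring. Qed.

Lemma seq_ring : ring_theory seq0 seq1 seqadd conv seqsub seqopp eq.
Proof. exact (fseries_ring _ _ _ _ _ _ R_ring). Qed.

Add Ring seq_ring_inst : seq_ring.

Lemma conv_ext a a' b b' n :
  (forall i, (i <= n)%nat -> a i = a' i) -> (forall i, (i <= n)%nat -> b i = b' i) ->
  conv a b n = conv a' b' n.
Proof. exact (fconv_ext Rplus Rmult a a' b b' n). Qed.

Lemma conv_scal_l x a b : conv (seqscal x a) b = seqscal x (conv a b).
Proof. extensionality n. exact (fconv_scal_l _ _ _ _ _ _ R_ring x a b n). Qed.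

Lemma conv_scal_r x a b : conv a (seqscal x b) = seqscal x (conv a b).
Proof.
  replace (conv a (seqscal x b)) with (conv (seqscal x b) a) by ring.
  rewrite conv_scal_l. f_equal. ring.
Qed.

Lemma conv_mono k a n :
  conv (mono k) a n = if Nat.leb k n then a (n - k)%nat else 0.
Proof.
  unfold conv. assert (H : forall m f, (m <= n)%nat ->
    sum_f_R0 (fun i => mono k i * f i) m = if Nat.leb k m then f k else 0).
  { induction m as [|m IH]; intros f Hm; simpl.
    - unfold mono. destruct k; simpl; ring.
    - rewrite IH by lia. unfold mono.
      destruct (Nat.leb_spec k m), (Nat.eqb_spec (S m) k), k; simpl; try lia; try ring.
      + destruct (Nat.leb_spec k m); try lia; ring.
      + injection e as <-. rewrite Nat.leb_refl. ring.
      + destruct (Nat.leb_spec k m); try lia; ring. }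
  apply (H n (fun i => a (n - i)%nat)). lia.
Qed.

Lemma mono_add j k : conv (mono j) (mono k) = mono (j + k).
Proof.
  extensionality n. rewrite conv_mono. unfold mono.
  destruct (Nat.leb_spec j n), (Nat.eqb_spec n (j + k)); try lia; auto;
    destruct (Nat.eqb_spec (n - j) k); try lia; reflexivity.
Qed.

Definition low (N : nat) (a : nat -> R) := forall i, (N <= i)%nat -> a i = 0.
Definition high (N : nat) (a : nat -> R) := forall i, (i < N)%nat -> a i = 0.

Lemma sum_zero (f : nat -> R) n : (forall i, (i <= n)%nat -> f i = 0) -> sum_f_R0 f n = 0.
Proof.
  induction n as [|n IH]; simpl; intros H; [apply H; lia|].
  rewrite IH, H by (intros; try apply H; lia). ring.
Qed.

Lemma low_conv N M a b : low N a -> low M b -> low (N + M) (conv a b).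
Proof.
  intros Ha Hb n Hn. apply sum_zero. intros i Hi.
  destruct (Nat.le_gt_cases N i); [rewrite Ha by lia|rewrite Hb by lia]; ring.
Qed.

Lemma high_conv N M a b : high N a -> high M b -> high (N + M) (conv a b).
Proof.
  intros Ha Hb n Hn. apply sum_zero. intros i Hi.
  destruct (Nat.le_gt_cases N i); [rewrite Hb by lia|rewrite Ha by lia]; ring.
Qed.

Lemma high_mono N a : high N (conv (mono N) a).
Proof. intros n Hn. rewrite conv_mono. destruct (Nat.leb_spec N n); [lia|reflexivity]. Qed.

(** Series in z and u: the outer index is the power of z, the inner one the power of u. Below,
    [theta2] is z d/dz and [utheta] is u d/du. *)
Notation seq2 := (nat -> nat -> R).
Definition conv2 : seq2 -> seq2 -> seq2 := fconv seqadd conv.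
Definition add2 : seq2 -> seq2 -> seq2 := fadd seqadd.
Definition sub2 : seq2 -> seq2 -> seq2 := fsub seqsub.
Definition opp2 : seq2 -> seq2 := fopp seqopp.
Definition zero2 : seq2 := fzero seq0.
Definition one2 : seq2 := fone seq0 seq1.

Lemma seq2_ring : ring_theory zero2 one2 add2 conv2 sub2 opp2 eq.
Proof. exact (fseries_ring _ _ _ _ _ _ seq_ring). Qed.

Add Ring seq2_ring_inst : seq2_ring.

Definition theta (a : nat -> R) (n : nat) : R := INR n * a n.
Definition theta2 (a : seq2) : seq2 := fun n => seqscal (INR n) (a n).
Definition utheta (a : seq2) : seq2 := fun n => theta (a n).

Lemma nmul_R n x : nmul 0 Rplus n x = INR n * x.
Proof. induction n as [|n IH]; simpl nmul; [simpl; ring|rewrite IH, S_INR; ring]. Qed.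

Lemma nmul_seq n a : nmul seq0 seqadd n a = seqscal (INR n) a.
Proof.
  extensionality k.
  induction n as [|n IH]; simpl nmul; unfold seqscal, seqadd, seq0 in *; [simpl; ring|].
  rewrite IH, S_INR. ring.
Qed.

Lemma ftheta_R a : ftheta 0 Rplus a = theta a.
Proof. extensionality n. apply nmul_R. Qed.

Lemma ftheta_seq a : ftheta seq0 seqadd a = theta2 a.
Proof. extensionality n. apply nmul_seq. Qed.

Lemma theta_conv a b : theta (conv a b) = seqadd (conv (theta a) b) (conv a (theta b)).
Proof. rewrite <- !ftheta_R. exact (ftheta_conv _ _ _ _ _ _ R_ring a b). Qed.

Lemma theta2_conv a b : theta2 (conv2 a b) = add2 (conv2 (theta2 a) b) (conv2 a (theta2 b)).
Proof. rewrite <- !ftheta_seq. exact (ftheta_conv _ _ _ _ _ _ seq_ring a b). Qed.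

Lemma theta2_sub a b : theta2 (sub2 a b) = sub2 (theta2 a) (theta2 b).
Proof.
  extensionality n. extensionality k. unfold theta2, sub2, fsub, seqsub, seqscal. ring.
Qed.

Lemma conv2_eval a b n k :
  conv2 a b n k = sum_f_R0 (fun j => conv (a j) (b (n - j)%nat) k) n.
Proof.
  assert (H : forall (f : seq2) m, fsum seqadd f m k = sum_f_R0 (fun j => f j k) m).
  { intros f. induction m as [|m IH]; simpl; [reflexivity|].
    unfold seqadd at 1. rewrite IH. reflexivity. }
  exact (H (fun j => conv (a j) (b (n - j)%nat)) n).
Qed.

Lemma utheta_conv a b : utheta (conv2 a b) = add2 (conv2 (utheta a) b) (conv2 a (utheta b)).
Proof.
  extensionality n. extensionality k. unfold utheta at 1, theta, add2, fadd, seqadd.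
  rewrite !conv2_eval, scal_sum, <- plus_sum. apply sum_eq. intros j Hj.
  rewrite Rmult_comm. change (theta (conv (a j) (b (n - j)%nat)) k = seqadd (conv (utheta a j) (b (n - j)%nat)) (conv (a j) (utheta b (n - j)%nat)) k).
  rewrite theta_conv. reflexivity.
Qed.

Lemma utheta_theta2 a : utheta (theta2 a) = theta2 (utheta a).
Proof. extensionality n; extensionality k. unfold utheta, theta2, theta, seqscal. ring. Qed.

(** Since [b] has no constant term, the equation at order n expresses n x_n through the x_j with j <
    n. *)
Lemma theta2_ode_zero (x b : seq2) :
  theta2 x = conv2 x b -> b O = seq0 -> x O = seq0 -> x = zero2.
Proof.
  intros Hx Hb H0. extensionality n.
  induction n as [n IH] using lt_wf_ind. destruct n as [|n]; [exact H0|].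
  extensionality k. unfold zero2, fzero, seq0.
  assert (H : INR (S n) * x (S n) k = 0).
  { change (theta2 x (S n) k = 0). rewrite Hx, conv2_eval. apply sum_zero. intros j Hj.
    destruct (Nat.eq_dec j (S n)) as [->|Hne].
    - rewrite Nat.sub_diag, Hb. replace (conv (x (S n)) seq0) with seq0 by ring. reflexivity.
    - rewrite IH by lia. change (zero2 j) with seq0.
      replace (conv seq0 (b (S n - j)%nat)) with seq0 by ring. reflexivity. }
  apply Rmult_integral in H. destruct H as [H|H]; [|exact H].
  exfalso. revert H. apply not_0_INR. lia.
Qed.

Section Spitzer.
Variables (c : nat) (pi : nat -> R) (m : seq2).
Hypothesis m_0 : m O = seq1.
Hypothesis m_S : forall n k, m (S n) k = conv pi (m n) (k + c)%nat.

(* [updrift n i] is the coefficient of u^i, i >= 0, in (u^(-c) pi(u))^n for n >= 1. *)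
Definition updrift : seq2 :=
  fun n => match n with O => seq0 | S _ => fun i => seqpow pi n (i + c * n)%nat end.

(** Laurent polynomials in u are avoided by multiplying order z^n by u^(c n). With this shift [mh]
    is M, [ph] is the one-step kernel, [gh] is ph / (1 - ph), [th] and [sh] are its parts of
    nonnegative and negative original exponent, and [nh] is M (1 - ph). *)
Let mh : seq2 := fun n => conv (mono (c * n)) (m n).
Let th : seq2 := fun n => conv (mono (c * n)) (updrift n).
Let gh : seq2 := fun n => match n with O => seq0 | S _ => seqpow pi n end.
Let ph : seq2 := fun n => match n with 1%nat => pi | _ => seq0 end.
Let sh : seq2 := sub2 gh th.
Let nh : seq2 := conv2 mh (sub2 one2 ph).

Lemma conv2_ph (a : seq2) n :
  conv2 a ph n = match n with O => seq0 | S n' => conv (a n') pi end.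
Proof.
  extensionality k. rewrite conv2_eval. destruct n as [|n].
  - simpl. change (ph O) with seq0. replace (conv (a O) seq0) with seq0 by ring. reflexivity.
  - assert (H : forall j, (j <= n)%nat -> j <> n -> conv (a j) (ph (S n - j)%nat) k = 0).
    { intros j Hj Hne. destruct (S n - j)%nat as [|[|i]] eqn:E; try lia; change (conv (a j) seq0 k = 0);
      replace (conv (a j) seq0) with seq0 by ring; reflexivity. }
    rewrite tech5, Nat.sub_diag.
    change (ph O) with seq0. replace (conv (a (S n)) seq0) with seq0 by ring.
    unfold seq0 at 1. rewrite Rplus_0_r.
    destruct n as [|n]; [reflexivity|].
    rewrite tech5, sum_zero by (intros; apply H; lia).
    replace (S (S n) - S n)%nat with 1%nat by lia.
    rewrite Rplus_0_l. reflexivity.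
Qed.

Lemma gh_geometric : conv2 gh (sub2 one2 ph) = ph.
Proof.
  replace (conv2 gh (sub2 one2 ph)) with (sub2 gh (conv2 gh ph)) by ring.
  extensionality n. unfold sub2, fsub. rewrite conv2_ph. destruct n as [|[|n]].
  - unfold gh, ph. ring.
  - unfold gh, ph. simpl. ring.
  - unfold gh, ph. simpl. ring.
Qed.

Lemma theta2_ph : theta2 ph = ph.
Proof.
  extensionality n. extensionality k. unfold theta2, seqscal.
  destruct n as [|[|n]]; [change (INR 0 * 0 = 0)|change (INR 1 * pi k = pi k)|change (INR (S (S n)) * 0 = 0)];
    simpl INR; ring.
Qed.

Lemma theta2_one : theta2 one2 = zero2.
Proof.
  extensionality n. extensionality k. unfold theta2, seqscal, one2, fone, zero2, fzero, seq0.
  destruct n; [change (INR 0 * seq1 k = 0); simpl|change (INR (S n) * 0 = 0)]; ring.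
Qed.

(** At nonnegative altitudes the recurrence for [m] cancels M (1 - ph); only the steps that leave
    the half-line remain, and they lie below the shift c (n + 1). *)
Lemma nh_low n : low (c * S n) (nh (S n)).
Proof.
  intros k Hk. unfold nh.
  replace (conv2 mh (sub2 one2 ph)) with (sub2 mh (conv2 mh ph)) by ring.
  unfold sub2, fsub, seqsub. rewrite conv2_ph. unfold mh.
  replace (conv (conv (mono (c * n)) (m n)) pi) with (conv (mono (c * n)) (conv pi (m n))) by ring.
  rewrite !conv_mono.
  destruct (Nat.leb_spec (c * S n) k), (Nat.leb_spec (c * n) k); try lia.
  rewrite m_S. replace (k - c * S n + c)%nat with (k - c * n)%nat by lia. ring.
Qed.

Lemma nh_0 : nh O = seq1.
Proof.
  unfold nh. replace (conv2 mh (sub2 one2 ph)) with (sub2 mh (conv2 mh ph)) by ring.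
  unfold sub2, fsub. rewrite conv2_ph. unfold mh. rewrite m_0, Nat.mul_0_r.
  change (mono 0) with seq1. ring.
Qed.

Lemma sh_low n : low (c * n) (sh n).
Proof.
  intros k Hk. unfold sh, sub2, fsub, seqsub, th, gh. rewrite conv_mono.
  destruct (Nat.leb_spec (c * n) k); [|lia]. unfold updrift. destruct n as [|n].
  - unfold seq0; ring.
  - replace (k - c * S n + c * S n)%nat with k by lia. ring.
Qed.

(* Both factors of [(1 - z u^(-c) pi) (theta m - m T) = theta N + N S] are
   supported on opposite sides of the exponent [c n], hence vanish. *)
Lemma spitzer : theta2 m = conv2 m updrift.
Proof.
  set (x := sub2 (theta2 mh) (conv2 mh th)).
  set (y := add2 (theta2 nh) (conv2 nh sh)).
  assert (Hxy : conv2 (sub2 one2 ph) x = y).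
  { unfold x, y, sh. rewrite (eq_refl : nh = conv2 mh (sub2 one2 ph)), theta2_conv, theta2_sub, theta2_ph, theta2_one.
    replace (conv2 (conv2 mh (sub2 one2 ph)) (sub2 gh th)) with
      (sub2 (conv2 mh (conv2 gh (sub2 one2 ph))) (conv2 (conv2 mh (sub2 one2 ph)) th)) by ring.
    rewrite gh_geometric. ring. }
  assert (Hx : forall n, x n = y n -> x n = seq0).
  { intros n Hn. extensionality k. destruct (Nat.le_gt_cases (c * n) k) as [Hk|Hk].
    - rewrite Hn. unfold y, add2, fadd, seqadd. rewrite conv2_eval, sum_zero.
      + unfold theta2, seqscal. destruct n as [|n]; [simpl; unfold seq0; ring|].
        rewrite nh_low by lia. unfold seq0. ring.
      + intros j Hj. destruct j as [|j].
        * rewrite nh_0, Nat.sub_0_r. replace (conv seq1 (sh n)) with (sh n) by ring.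
          apply sh_low. lia.
        * apply (low_conv (c * S j) (c * (n - S j))); [apply nh_low|apply sh_low|].
          rewrite <- Nat.mul_add_distr_l. replace (S j + (n - S j))%nat with n by lia. lia.
    - unfold x, sub2, fsub, seqsub. rewrite conv2_eval, sum_zero.
      + unfold theta2, seqscal. unfold mh. rewrite high_mono by lia. unfold seq0. ring.
      + intros j Hj. apply (high_conv (c * j) (c * (n - j))); [apply high_mono..|].
        rewrite <- Nat.mul_add_distr_l. replace (j + (n - j))%nat with n by lia. lia. }
  (* [ph] has order 1 in z, so once x vanishes at order n the relation [Hxy] gives x = y at order n
     + 1, and [Hx] applies. *)
  assert (Hx0 : x = zero2).
  { replace (conv2 (sub2 one2 ph) x) with (sub2 x (conv2 x ph)) in Hxy by ring.
    extensionality n. induction n as [|n IH]; apply Hx; rewrite <- Hxy; unfold sub2, fsub;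
      rewrite conv2_ph; [|rewrite IH; change (zero2 n) with seq0]; ring. }
  extensionality n. extensionality k.
  assert (H : x n (k + c * n)%nat = 0) by (rewrite Hx0; reflexivity).
  unfold x, sub2, fsub, seqsub in H. apply Rminus_diag_uniq in H.
  unfold theta2, seqscal, mh in H. rewrite conv_mono in H.
  destruct (Nat.leb_spec (c * n) (k + c * n)); [|lia].
  replace (k + c * n - c * n)%nat with k in H by lia.
  unfold theta2, seqscal. rewrite H, !conv2_eval. apply sum_eq. intros j Hj. unfold th.
  replace (conv (conv (mono (c * j)) (m j)) (conv (mono (c * (n - j))) (updrift (n - j))))
    with (conv (conv (mono (c * j)) (mono (c * (n - j)))) (conv (m j) (updrift (n - j)))) by ring.
  rewrite mono_add, <- Nat.mul_add_distr_l. replace (j + (n - j))%nat with n by lia.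
  rewrite conv_mono. destruct (Nat.leb_spec (c * n) (k + c * n)); [|lia].
  f_equal. lia.
Qed.

(** The formal logarithm L of M: Spitzer's identity reads theta M = M theta L, where theta is z
    d/dz. *)
Definition logupdrift : seq2 := fun n => seqscal (/ INR n) (updrift n).

Lemma theta2_logupdrift : theta2 logupdrift = updrift.
Proof.
  extensionality n. extensionality k. unfold theta2, logupdrift, seqscal. destruct n as [|n].
  - simpl. unfold seq0. ring.
  - field. apply not_0_INR. lia.
Qed.

(** The derivations u d/du and z d/dz commute, so the difference x of the two sides solves theta x =
    x T with T = [updrift], and it vanishes at order 0. The identity determines M_k from M_0, ...,
    M_(k-1). *)
Lemma spitzer_utheta : utheta m = conv2 m (utheta logupdrift).
Proof.
  assert (H : sub2 (utheta m) (conv2 m (utheta logupdrift)) = zero2).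
  { apply theta2_ode_zero with (b := updrift); [|reflexivity|].
    - rewrite theta2_sub, theta2_conv, <- !utheta_theta2, spitzer, theta2_logupdrift, utheta_conv.
      ring.
    - unfold sub2, fsub. change (conv2 m (utheta logupdrift) O) with (conv (m O) (utheta logupdrift O)).
      unfold utheta. rewrite m_0. extensionality k.
      replace (conv seq1 (theta (logupdrift 0))) with (theta (logupdrift 0)) by ring.
      unfold seqsub, theta, seq1, logupdrift, seqscal, updrift, seq0.
      destruct (Nat.eqb_spec k 0) as [->|]; simpl; ring. }
  replace (utheta m) with (add2 (sub2 (utheta m) (conv2 m (utheta logupdrift))) (conv2 m (utheta logupdrift))) by ring.
  rewrite H. ring.
Qed.

End Spitzer.

(** * Coefficients of powers of 1 - z *)

(* Coefficients of (1-z)^(-1/2); [wseq] below is (1-z)^(1/2). *)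
Fixpoint gseq (n : nat) : R :=
  match n with O => 1 | S n' => gseq n' * (2 * INR n' + 1) / (2 * INR n' + 2) end.

Definition seqones (n : nat) : R := 1.
Definition onemz : nat -> R := seqsub seq1 (mono 1).
Definition wseq : nat -> R := conv onemz gseq.
(** [kap1] and [kap] have orders n^(-3/2) and n^(-5/2), the sizes of the coefficients of (1-z)^(1/2)
    and (1-z)^(3/2). *)
Definition kap1 (n : nat) : R := gseq n / (INR n + 1).
Definition kap (n : nat) : R := gseq n / (INR n + 1) ^ 2.

Lemma conv_onemz a n : conv onemz a n = match n with O => a O | S n' => a (S n') - a n' end.
Proof.
  unfold onemz. replace (conv (seqsub seq1 (mono 1)) a) with (seqsub a (conv (mono 1) a)) by ring.
  unfold seqsub. rewrite conv_mono. destruct n as [|n]; simpl; [ring|].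
  rewrite Nat.sub_0_r. reflexivity.
Qed.

Lemma conv_seqones a n : conv seqones a n = sum_f_R0 a n.
Proof.
  replace (conv seqones a) with (conv a seqones) by ring.
  unfold conv, seqones. apply sum_eq. intros; ring.
Qed.

Lemma onemz_ones : conv onemz seqones = seq1.
Proof.
  extensionality n. rewrite conv_onemz. destruct n; unfold seqones, seq1; simpl; ring.
Qed.

Lemma gseq_S n : gseq (S n) = gseq n * (2 * INR n + 1) / (2 * INR n + 2).
Proof. reflexivity. Qed.

Lemma gseq_pos n : 0 < gseq n.
Proof.
  induction n as [|n IH]; [simpl; lra|]. rewrite gseq_S.
  pose proof (pos_INR n). pos.
Qed.

Lemma gseq_S_le n : gseq (S n) <= gseq n.
Proof.
  rewrite gseq_S. pose proof (gseq_pos n). pose proof (pos_INR n).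
  apply Rle_div_l; nra.
Qed.

Lemma gseq_decr n m : (n <= m)%nat -> gseq m <= gseq n.
Proof. induction 1; [lra|]. pose proof (gseq_S_le m). lra. Qed.

Lemma gseq_le_1 n : gseq n <= 1.
Proof. apply (gseq_decr 0). lia. Qed.

(** The left side is nonincreasing in n. With the companion product n gseq^2, nondecreasing from n =
    1, this places [gseq] between multiples of n^(-1/2). *)
Lemma gseq_sqr_le n : gseq n ^ 2 * (2 * INR n + 1) <= 1.
Proof.
  induction n as [|n IH]; [simpl; lra|]. rewrite gseq_S, S_INR.
  pose proof (pos_INR n). pose proof (gseq_pos n).
  replace ((gseq n * (2 * INR n + 1) / (2 * INR n + 2)) ^ 2 * (2 * (INR n + 1) + 1))
    with (gseq n ^ 2 * (2 * INR n + 1) * ((2 * INR n + 1) * (2 * INR n + 3) / (2 * INR n + 2) ^ 2))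
    by (field; lra).
  assert (H1 : (2 * INR n + 1) * (2 * INR n + 3) / (2 * INR n + 2) ^ 2 <= 1).
  { apply Rle_div_l; nra. }
  assert (0 <= (2 * INR n + 1) * (2 * INR n + 3) / (2 * INR n + 2) ^ 2)
    by pos.
  assert (0 <= gseq n ^ 2 * (2 * INR n + 1)) by nra. nra.
Qed.

Lemma gseq_sqr_ge_S n : 1 <= gseq (S n) ^ 2 * (4 * INR (S n)).
Proof.
  induction n as [|n IH]; [simpl; lra|]. rewrite gseq_S. rewrite (S_INR (S n)).
  assert (0 < INR (S n)) by (apply lt_0_INR; lia). pose proof (gseq_pos (S n)).
  set (x := INR (S n)) in *.
  replace ((gseq (S n) * (2 * x + 1) / (2 * x + 2)) ^ 2 * (4 * (x + 1)))
    with (gseq (S n) ^ 2 * (4 * x) * ((2 * x + 1) ^ 2 / (4 * x * (x + 1)))) by (field; lra).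
  assert (1 <= (2 * x + 1) ^ 2 / (4 * x * (x + 1))).
  { apply Rle_div_r; nra. }
  nra.
Qed.

Lemma gseq_sqr_ge n : 1 <= gseq n ^ 2 * (4 * (INR n + 1)).
Proof.
  destruct n as [|n]; [simpl; lra|].
  pose proof (gseq_sqr_ge_S n). pose proof (pow2_ge_0 (gseq (S n))). lra.
Qed.

(** Regular variation in the form that convolutions use: of two indices with sum n, the larger one m
    satisfies n <= 2 m. The extra unit also covers the pair m, m + 1 at m = 0. *)
Lemma gseq_doubling m n : (n <= 2 * m + 1)%nat -> gseq m <= 2 * gseq n.
Proof.
  intros H. destruct n as [|n]; [simpl gseq at 2; pose proof (gseq_le_1 m); lra|].
  pose proof (gseq_sqr_le m). pose proof (gseq_sqr_ge_S n).
  pose proof (gseq_pos m). pose proof (gseq_pos (S n)).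
  apply le_INR in H. rewrite plus_INR, mult_INR in H. simpl (INR 2) in H. simpl (INR 1) in H.
  pose proof (pos_INR m).
  assert (gseq m ^ 2 * INR (S n) <= 4 * gseq (S n) ^ 2 * INR (S n)) by nra.
  assert (gseq m ^ 2 <= 4 * gseq (S n) ^ 2).
  { apply Rmult_le_reg_r with (INR (S n)); [apply lt_0_INR; lia|lra]. }
  nra.
Qed.

Lemma kap1_pos n : 0 < kap1 n.
Proof. pose proof (pos_INR n). apply Rdiv_lt_0_compat; [apply gseq_pos|lra]. Qed.

Lemma kap_pos n : 0 < kap n.
Proof. pose proof (pos_INR n). apply Rdiv_lt_0_compat; [apply gseq_pos|nra]. Qed.

Lemma kap_kap1 n : kap n * (INR n + 1) = kap1 n.
Proof. unfold kap, kap1. pose proof (pos_INR n). field. lra. Qed.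

Lemma kap1_gseq n : kap1 n * (INR n + 1) = gseq n.
Proof. unfold kap1. pose proof (pos_INR n). field. lra. Qed.

Lemma kap_le_kap1 n : kap n <= kap1 n.
Proof. rewrite <- kap_kap1. pose proof (pos_INR n). pose proof (kap_pos n). nra. Qed.

Lemma kap1_le_gseq n : kap1 n <= gseq n.
Proof. rewrite <- kap1_gseq. pose proof (pos_INR n). pose proof (kap1_pos n). nra. Qed.

Lemma kap1_doubling m n : (n <= 2 * m + 1)%nat -> kap1 m <= 4 * kap1 n.
Proof.
  intros H. pose proof (gseq_doubling m n H) as Hg. unfold kap1.
  apply le_INR in H. rewrite plus_INR, mult_INR in H. simpl (INR 2) in H. simpl (INR 1) in H.
  pose proof (pos_INR m). pose proof (pos_INR n). pose proof (gseq_pos m). pose proof (gseq_pos n).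
  apply Rle_div_l; [lra|].
  replace (4 * (gseq n / (INR n + 1)) * (INR m + 1))
    with (2 * gseq n * (2 * (INR m + 1) / (INR n + 1))) by (field; lra).
  assert (1 <= 2 * (INR m + 1) / (INR n + 1)).
  { apply Rle_div_r; lra. }
  nra.
Qed.

Lemma kap_doubling m n : (n <= 2 * m + 1)%nat -> kap m <= 8 * kap n.
Proof.
  intros H. pose proof (kap1_doubling m n H) as Hg.
  rewrite <- (kap_kap1 m), <- (kap_kap1 n) in Hg.
  apply le_INR in H. rewrite plus_INR, mult_INR in H. simpl (INR 2) in H. simpl (INR 1) in H.
  pose proof (pos_INR m). pose proof (pos_INR n). pose proof (kap_pos m). pose proof (kap_pos n).
  assert (kap m * (INR m + 1) <= 8 * kap n * (INR m + 1)) by nra.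
  apply Rmult_le_reg_r with (INR m + 1); lra.
Qed.

Lemma gseq_diff n : gseq n - gseq (S n) = kap1 n / 2.
Proof. rewrite gseq_S. unfold kap1. pose proof (pos_INR n). field. lra. Qed.

Lemma wseq_0 : wseq 0 = 1.
Proof. unfold wseq. rewrite conv_onemz. reflexivity. Qed.

Lemma wseq_S n : wseq (S n) = - kap1 n / 2.
Proof. unfold wseq. rewrite conv_onemz. pose proof (gseq_diff n). lra. Qed.

Lemma theta_gseq : seqscal 2 (conv onemz (theta gseq)) = conv (mono 1) gseq.
Proof.
  extensionality n. unfold seqscal. rewrite conv_onemz, conv_mono.
  destruct n as [|n]; simpl Nat.leb; cbv iota; [unfold theta; simpl; ring|].
  unfold theta. rewrite gseq_S, S_INR. simpl Nat.sub. rewrite Nat.sub_0_r.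
  pose proof (pos_INR n). field. lra.
Qed.

(** By [theta_gseq] the square h of the series solves (1-z) z h' = z h with h(0) = 1, and this
    recurrence makes its coefficients constant. *)
Lemma gseq_conv_gseq : conv gseq gseq = seqones.
Proof.
  set (v := conv gseq gseq).
  assert (H : conv onemz (theta v) = conv (mono 1) v).
  { unfold v. rewrite theta_conv.
    replace (conv onemz (seqadd (conv (theta gseq) gseq) (conv gseq (theta gseq))))
      with (conv (seqscal 2 (conv onemz (theta gseq))) gseq).
    - rewrite theta_gseq. ring.
    - rewrite conv_scal_l. replace (conv onemz (seqadd (conv (theta gseq) gseq) (conv gseq (theta gseq))))
        with (seqadd (conv (conv onemz (theta gseq)) gseq) (conv (conv onemz (theta gseq)) gseq)) by ring.
      extensionality n. unfold seqscal, seqadd. ring. }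
  extensionality n. unfold seqones. induction n as [|n IH].
  - unfold v, conv. simpl. ring.
  - assert (Hn := f_equal (fun f => f (S n)) H). cbv beta in Hn.
    rewrite conv_onemz, conv_mono in Hn. simpl Nat.leb in Hn. cbv iota in Hn.
    simpl Nat.sub in Hn. rewrite Nat.sub_0_r in Hn. unfold theta in Hn. rewrite S_INR, IH in Hn.
    pose proof (pos_INR n). assert ((INR n + 1) * (v (S n) - 1) = 0) by lra.
    apply Rmult_integral in H1. lra.
Qed.

Lemma wseq_conv_gseq : conv wseq gseq = seq1.
Proof.
  unfold wseq. replace (conv (conv onemz gseq) gseq) with (conv onemz (conv gseq gseq)) by ring.
  rewrite gseq_conv_gseq. apply onemz_ones.
Qed.

Lemma wseq_conv_wseq : conv wseq wseq = onemz.
Proof.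
  unfold wseq at 2. replace (conv wseq (conv onemz gseq)) with (conv onemz (conv wseq gseq)) by ring.
  rewrite wseq_conv_gseq. ring.
Qed.

Lemma sum_wseq n : sum_f_R0 wseq n = gseq n.
Proof.
  induction n as [|n IH]; [simpl sum_f_R0; rewrite wseq_0; reflexivity|].
  rewrite tech5, IH, wseq_S. pose proof (gseq_diff n). lra.
Qed.

Lemma sum_kap1 n : sum_f_R0 kap1 n = 2 * (1 - gseq (S n)).
Proof.
  induction n as [|n IH]; [simpl sum_f_R0; pose proof (gseq_diff 0); simpl gseq in *; lra|].
  rewrite tech5, IH. pose proof (gseq_diff (S n)). lra.
Qed.

Lemma sum_kap1_le n : sum_f_R0 kap1 n <= 2.
Proof. rewrite sum_kap1. pose proof (gseq_pos (S n)). lra. Qed.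

Lemma sum_kap_le n : sum_f_R0 kap n <= 2.
Proof.
  apply Rle_trans with (2 := sum_kap1_le n). apply sum_Rle. intros. apply kap_le_kap1.
Qed.

Lemma sum_INR_kap_le n : sum_f_R0 (fun i => INR i * kap i) n <= 2.
Proof.
  apply Rle_trans with (2 := sum_kap1_le n). apply sum_Rle. intros i _.
  rewrite <- kap_kap1. pose proof (kap_pos i). lra.
Qed.

Lemma Rabs_wseq_S n : Rabs (wseq (S n)) = kap1 n / 2.
Proof.
  rewrite wseq_S. pose proof (kap1_pos n). replace (- kap1 n / 2) with (- (kap1 n / 2)) by field.
  rewrite Rabs_Ropp. apply Rabs_pos_eq. lra.
Qed.

Lemma sum_Rabs_wseq n : sum_f_R0 (fun i => Rabs (wseq i)) n = 2 - gseq n.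
Proof.
  induction n as [|n IH].
  - simpl sum_f_R0. rewrite wseq_0, Rabs_R1. simpl. ring.
  - rewrite tech5, IH, Rabs_wseq_S. pose proof (gseq_diff n). lra.
Qed.

Lemma sum_Rabs_wseq_le n : sum_f_R0 (fun i => Rabs (wseq i)) n <= 2.
Proof. rewrite sum_Rabs_wseq. pose proof (gseq_pos n). lra. Qed.

Lemma Rabs_wseq_le n : Rabs (wseq n) <= 2 * kap1 n.
Proof.
  destruct n as [|n]; [rewrite wseq_0, Rabs_R1; unfold kap1; simpl; lra|].
  rewrite Rabs_wseq_S. pose proof (kap1_doubling n (S n)). assert (S n <= 2 * n + 1)%nat by lia.
  intuition lra.
Qed.

Lemma Rabs_wseq_ge n : kap1 n / 2 <= Rabs (wseq n).
Proof.
  destruct n as [|n]; [rewrite wseq_0, Rabs_R1; unfold kap1; simpl; lra|].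
  rewrite Rabs_wseq_S. assert (kap1 (S n) <= kap1 n); [|lra].
  unfold kap1. rewrite S_INR. pose proof (gseq_S_le n). pose proof (pos_INR n). pose proof (gseq_pos (S n)).
  apply Rmult_le_compat; try lra; [pos|apply Rinv_le_contravar; lra].
Qed.

Lemma kap_S_le n : kap (S n) <= kap n.
Proof.
  unfold kap. rewrite S_INR. pose proof (gseq_S_le n). pose proof (pos_INR n). pose proof (gseq_pos (S n)).
  apply Rmult_le_compat; try lra; [pos|apply Rinv_le_contravar; nra].
Qed.

Lemma kap_decr n m : (n <= m)%nat -> kap m <= kap n.
Proof. induction 1; [lra|]. pose proof (kap_S_le m). lra. Qed.

Lemma wseq_step n : Rabs (wseq (S n) - wseq n) <= 3 * kap n.
Proof.
  destruct n as [|n].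
  - rewrite wseq_S, wseq_0. unfold kap1, kap. simpl. rewrite Rabs_left; lra.
  - rewrite !wseq_S. unfold kap, kap1. rewrite gseq_S, !S_INR.
    pose proof (pos_INR n). pose proof (gseq_pos n).
    replace (- (gseq n * (2 * INR n + 1) / (2 * INR n + 2) / (INR n + 1 + 1)) / 2 - - (gseq n / (INR n + 1)) / 2)
      with (gseq n * (3 / (4 * (INR n + 1) * (INR n + 2)))) by (field; lra).
    rewrite Rabs_pos_eq.
    2:{ apply Rmult_le_pos; [lra|]. apply Rlt_le, Rdiv_lt_0_compat; nra. }
    replace (3 * (gseq n * (2 * INR n + 1) / (2 * INR n + 2) / (INR n + 1 + 1) ^ 2)) with
      (gseq n * (3 * (2 * INR n + 1) / (2 * (INR n + 1) * (INR n + 2) ^ 2))) by (field; lra).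
    apply Rmult_le_compat_l; [lra|].
    apply Rmult_le_reg_r with (4 * (INR n + 1) * (INR n + 2) ^ 2); [nra|].
    replace (3 / (4 * (INR n + 1) * (INR n + 2)) * (4 * (INR n + 1) * (INR n + 2) ^ 2))
      with (3 * (INR n + 2)) by (field; lra).
    replace (3 * (2 * INR n + 1) / (2 * (INR n + 1) * (INR n + 2) ^ 2) * (4 * (INR n + 1) * (INR n + 2) ^ 2))
      with (6 * (2 * INR n + 1)) by (field; lra).
    lra.
Qed.

Lemma wseq_step_iter m i : Rabs (wseq m - wseq (m + i)) <= 3 * INR i * kap m.
Proof.
  induction i as [|i IH].
  - rewrite Nat.add_0_r, Rminus_diag, Rabs_R0. simpl. lra.
  - rewrite Nat.add_succ_r, S_INR.
    replace (wseq m - wseq (S (m + i))) with ((wseq m - wseq (m + i)) - (wseq (S (m + i)) - wseq (m + i))) by ring.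
    pose proof (Rabs_triang (wseq m - wseq (m + i)) (- (wseq (S (m + i)) - wseq (m + i)))) as H.
    rewrite Rabs_Ropp in H. unfold Rminus at 1.
    pose proof (wseq_step (m + i)). pose proof (kap_decr m (m + i)).
    assert (m <= m + i)%nat by lia. intuition nra.
Qed.

Lemma ex_series_bounded (a : nat -> R) M :
  (forall n, 0 <= a n) -> (forall n, sum_f_R0 a n <= M) -> ex_series a.
Proof.
  intros Ha HM.
  assert (H : ex_finite_lim_seq (sum_n a)).
  { apply ex_finite_lim_seq_incr with M; intros n; [|rewrite sum_n_Reals; apply HM].
    rewrite sum_Sn. unfold plus; simpl. specialize (Ha (S n)). lra. }
  destruct H as [l Hl]. exists l. exact Hl.
Qed.

Lemma Series_bounded (a : nat -> R) M :
  (forall n, 0 <= a n) -> (forall n, sum_f_R0 a n <= M) -> Series a <= M.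
Proof.
  intros Ha HM. pose proof (ex_series_bounded a M Ha HM) as H.
  apply Series_correct in H.
  apply (is_lim_seq_le (sum_n a) (fun _ => M) (Series a) M);
    [intros n; rewrite sum_n_Reals; apply HM|exact H|apply is_lim_seq_const].
Qed.

Lemma sum_le_Series (a : nat -> R) n :
  (forall n, 0 <= a n) -> ex_series a -> sum_f_R0 a n <= Series a.
Proof.
  intros Ha H. apply Series_correct in H.
  apply (is_lim_seq_le_loc (fun _ => sum_f_R0 a n) (sum_n a) (sum_f_R0 a n) (Series a));
    [|apply is_lim_seq_const|exact H].
  exists n. intros m Hm. rewrite sum_n_Reals. induction Hm as [|m Hm IH]; [lra|].
  rewrite tech5. specialize (Ha (S m)). lra.
Qed.

Lemma Rabs_sum_le (f g : nat -> R) n :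
  (forall i, (i <= n)%nat -> Rabs (f i) <= g i) -> Rabs (sum_f_R0 f n) <= sum_f_R0 g n.
Proof.
  intros H. apply Rle_trans with (1 := Rsum_abs f n). apply sum_Rle. exact H.
Qed.

Lemma conv_Rabs_le x y X Y n :
  (forall i, (i <= n)%nat -> Rabs (x i) <= X i) -> (forall i, (i <= n)%nat -> Rabs (y i) <= Y i) ->
  Rabs (conv x y n) <= conv X Y n.
Proof.
  intros HX HY. apply Rabs_sum_le. intros i Hi. rewrite Rabs_mult.
  apply Rmult_le_compat; try apply Rabs_pos; [apply HX|apply HY]; lia.
Qed.

Lemma conv_le x y X Y n :
  (forall i, (i <= n)%nat -> 0 <= x i <= X i) -> (forall i, (i <= n)%nat -> 0 <= y i <= Y i) ->
  conv x y n <= conv X Y n.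
Proof.
  intros HX HY. apply sum_Rle. intros i Hi.
  apply Rmult_le_compat; try apply HX; try apply HY; lia.
Qed.

Lemma conv_nonneg x y n : (forall i, 0 <= x i) -> (forall i, 0 <= y i) -> 0 <= conv x y n.
Proof. intros HX HY. apply cond_pos_sum. intros i. pos. Qed.

(* Of the indices [i] and [n - i], one is at least [n / 2]. *)
Lemma conv_half_le x y X Y n :
  (forall i, 0 <= x i) -> (forall i, 0 <= y i) ->
  (forall m, (m <= n <= 2 * m)%nat -> x m <= X) -> (forall m, (m <= n <= 2 * m)%nat -> y m <= Y) ->
  conv x y n <= Y * sum_f_R0 x n + X * sum_f_R0 y n.
Proof.
  intros Hx Hy HX HY.
  assert (0 <= X) by (apply Rle_trans with (x n); [apply Hx|apply HX; lia]).
  assert (0 <= Y) by (apply Rle_trans with (y n); [apply Hy|apply HY; lia]).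
  replace (sum_f_R0 y n) with (sum_f_R0 (fun i => y (n - i)%nat) n)
    by (symmetry; exact (fsum_rev _ _ _ _ _ _ R_ring y n)).
  rewrite !scal_sum, <- plus_sum. apply sum_Rle. intros i Hi.
  pose proof (Hx i). pose proof (Hy (n - i)%nat).
  destruct (Nat.le_gt_cases n (2 * (n - i))).
  - pose proof (HY (n - i)%nat). assert (y (n - i)%nat <= Y) by (apply HY; lia). nra.
  - assert (x i <= X) by (apply HX; lia). nra.
Qed.

Lemma ex_series_kap : ex_series kap.
Proof.
  apply ex_series_bounded with 2; [intros; apply Rlt_le, kap_pos|apply sum_kap_le].
Qed.

Lemma ex_series_kap1 : ex_series kap1.
Proof.
  apply ex_series_bounded with 2; [intros; apply Rlt_le, kap1_pos|apply sum_kap1_le].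
Qed.

Lemma ex_series_dominated (a b : nat -> R) :
  (forall n, Rabs (a n) <= b n) -> ex_series b -> ex_series a.
Proof. exact (@ex_series_le R_AbsRing R_CompleteNormedModule a b). Qed.

Lemma Rabs_Series_le (a b : nat -> R) :
  (forall n, Rabs (a n) <= b n) -> ex_series b -> Rabs (Series a) <= Series b.
Proof.
  intros H Hb.
  apply Rle_trans with (Series (fun n => Rabs (a n))).
  - apply Series_Rabs. apply ex_series_dominated with b; [|exact Hb].
    intros n. rewrite Rabs_Rabsolu. apply H.
  - apply Series_le; [|exact Hb]. intros n. split; [apply Rabs_pos|apply H].
Qed.

Lemma Series_split (a : nat -> R) n :
  ex_series a -> Series a = sum_f_R0 a n + Series (fun k => a (S n + k)%nat).
Proof. intros H. apply (Series_incr_n a (S n)); [lia|exact H]. Qed.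

Lemma ex_series_shift (a : nat -> R) n : ex_series a -> ex_series (fun k => a (n + k)%nat).
Proof. apply ex_series_incr_n. Qed.

(** Beyond n one has kap k <= kap1 k / (n + 1), and the tail of [kap1] telescopes through [gseq]. *)
Lemma Series_tail_kap r R0 n :
  (forall n, Rabs (r n) <= R0 * kap n) ->
  Rabs (Series r - sum_f_R0 r n) <= 2 * R0 * kap1 n.
Proof.
  intros Hr.
  assert (HR : 0 <= R0).
  { specialize (Hr O). pose proof (Rabs_pos (r O)). pose proof (kap_pos O). nra. }
  assert (Hex : ex_series r).
  { apply ex_series_dominated with (1 := Hr). apply (ex_series_scal_l R0 kap), ex_series_kap. }
  rewrite (Series_split r n Hex).
  replace (sum_f_R0 r n + Series (fun k => r (S n + k)%nat) - sum_f_R0 r n)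
    with (Series (fun k => r (S n + k)%nat)) by ring.
  pose proof (pos_INR n).
  apply Rle_trans with (Series (fun k => R0 / (INR n + 1) * kap1 (S n + k)%nat)).
  - apply Rabs_Series_le.
    + intros k. apply Rle_trans with (1 := Hr _). rewrite <- kap_kap1.
      pose proof (kap_pos (S n + k)). unfold Rdiv. rewrite Rmult_assoc. apply Rmult_le_compat_l; [lra|].
      rewrite plus_INR, S_INR. pose proof (pos_INR k).
      apply Rmult_le_reg_l with (INR n + 1); [lra|].
      rewrite <- Rmult_assoc, Rinv_r by lra. nra.
    + apply (ex_series_scal_l (R0 / (INR n + 1)) (fun k => kap1 (S n + k)%nat)).
      apply (ex_series_shift kap1), ex_series_kap1.
  - rewrite Series_scal_l.
    assert (Series (fun k => kap1 (S n + k)%nat) <= 2 * gseq n).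
    { apply Series_bounded; [intros; apply Rlt_le, kap1_pos|]. intros k.
      assert (E : sum_f_R0 (fun k => kap1 (S n + k)%nat) k = 2 * (gseq (S n) - gseq (S (S n + k)))).
      { clear. induction k as [|k IH].
        - change (kap1 (S n + 0) = 2 * (gseq (S n) - gseq (S (S n + 0)))).
          rewrite Nat.add_0_r. pose proof (gseq_diff (S n)). lra.
        - rewrite tech5, IH. rewrite Nat.add_succ_r. pose proof (gseq_diff (S (S n + k))). lra. }
      rewrite E. pose proof (gseq_pos (S (S n + k))). pose proof (gseq_S_le n). lra. }
    apply Rle_trans with (R0 / (INR n + 1) * (2 * gseq n)).
    + apply Rmult_le_compat_l; [|lra]. pos.
    + unfold kap1. apply Req_le. field. lra.
Qed.

(** For i up to n/2 the smoothness of [wseq] gives |w_(n-i) - w_n| <= 24 i kap n, and i kap i is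
    summable; for larger i the factor r_i is itself O(kap n). The partial sum of r is then replaced
    by its full sum with [Series_tail_kap]. *)
Lemma conv_wseq_approx r R0 n :
  (forall n, Rabs (r n) <= R0 * kap n) ->
  Rabs (conv wseq r n - Series r * wseq n) <= 84 * R0 * kap n.
Proof.
  intros Hr.
  assert (HR : 0 <= R0).
  { specialize (Hr O). pose proof (Rabs_pos (r O)). pose proof (kap_pos O). nra. }
  replace (conv wseq r) with (conv r wseq) by ring.
  replace (conv r wseq n - Series r * wseq n)
    with ((conv r wseq n - sum_f_R0 r n * wseq n) - (Series r - sum_f_R0 r n) * wseq n) by ring.
  assert (H1 : Rabs ((Series r - sum_f_R0 r n) * wseq n) <= 4 * R0 * kap n).
  { rewrite Rabs_mult. pose proof (Series_tail_kap r R0 n Hr). pose proof (Rabs_wseq_le n).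
    apply Rle_trans with ((2 * R0 * kap1 n) * (2 * kap1 n)).
    - apply Rmult_le_compat; auto using Rabs_pos.
    - replace (2 * R0 * kap1 n * (2 * kap1 n)) with (4 * R0 * (kap1 n * kap1 n)) by ring.
      apply Rmult_le_compat_l; [lra|].
      unfold kap1, kap. pose proof (gseq_le_1 n). pose proof (gseq_pos n). pose proof (pos_INR n).
      replace (gseq n / (INR n + 1) * (gseq n / (INR n + 1)))
        with (gseq n * (gseq n / (INR n + 1) ^ 2)) by (field; lra).
      assert (0 < gseq n / (INR n + 1) ^ 2) by apply kap_pos. nra. }
  assert (H2 : Rabs (conv r wseq n - sum_f_R0 r n * wseq n) <= 80 * R0 * kap n).
  { replace (conv r wseq n - sum_f_R0 r n * wseq n)
      with (sum_f_R0 (fun i => r i * (wseq (n - i)%nat - wseq n)) n).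
    2:{ unfold conv. rewrite (Rmult_comm (sum_f_R0 r n)), scal_sum, <- minus_sum.
        apply sum_eq. intros; ring. }
    pose proof (kap_pos n) as Hk.
    apply Rle_trans with (sum_f_R0 (fun i => 24 * R0 * kap n * (INR i * kap i)
       + (8 * R0 * kap n * Rabs (wseq (n - i)%nat) + 8 * R0 * kap n * Rabs (wseq n))) n).
    - apply Rabs_sum_le. intros i Hi. rewrite Rabs_mult.
      pose proof (Rabs_pos (r i)). pose proof (Rabs_pos (wseq n)).
      pose proof (Rabs_pos (wseq (n - i)%nat)).
      pose proof (kap_pos i) as Hki. pose proof (pos_INR i) as Hi0. pose proof (Hr i) as Hri.
      assert (P1 : 0 <= 24 * R0 * kap n * (INR i * kap i)).
      { apply Rmult_le_pos; [apply Rmult_le_pos; lra|]. apply Rmult_le_pos; lra. }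
      assert (P2 : 0 <= 8 * R0 * kap n) by pos.
      destruct (Nat.le_gt_cases n (2 * (n - i))) as [Hc|Hc].
      + assert (Hw : Rabs (wseq (n - i)%nat - wseq n) <= 24 * INR i * kap n).
        { pose proof (wseq_step_iter (n - i) i) as Hs. replace (n - i + i)%nat with n in Hs by lia.
          assert (Hd : kap (n - i) <= 8 * kap n) by (apply kap_doubling; lia). nra. }
        apply Rle_trans with ((R0 * kap i) * (24 * INR i * kap n)).
        * apply Rmult_le_compat; auto using Rabs_pos.
        * assert (0 <= 8 * R0 * kap n * Rabs (wseq (n - i)%nat)) by pos.
          assert (0 <= 8 * R0 * kap n * Rabs (wseq n)) by pos. nra.
      + assert (Hd : kap i <= 8 * kap n) by (apply kap_doubling; lia).
        assert (Hri' : Rabs (r i) <= 8 * R0 * kap n) by nra.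
        apply Rle_trans with (8 * R0 * kap n * (Rabs (wseq (n - i)%nat) + Rabs (wseq n))); [|lra].
        apply Rmult_le_compat; auto using Rabs_pos.
        unfold Rminus. rewrite <- (Rabs_Ropp (wseq n)). apply Rabs_triang.
    - rewrite !plus_sum.
      assert (S1 : sum_f_R0 (fun i => 24 * R0 * kap n * (INR i * kap i)) n <= 48 * R0 * kap n).
      { rewrite (sum_eq _ (fun i => INR i * kap i * (24 * R0 * kap n))) by (intros; ring).
        rewrite <- scal_sum. pose proof (sum_INR_kap_le n).
        replace (48 * R0 * kap n) with (24 * R0 * kap n * 2) by ring.
        apply Rmult_le_compat_l; [|lra]. pos. }
      assert (S2 : sum_f_R0 (fun i => 8 * R0 * kap n * Rabs (wseq (n - i)%nat)) n <= 16 * R0 * kap n).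
      { rewrite (sum_eq _ (fun i => Rabs (wseq (n - i)%nat) * (8 * R0 * kap n))) by (intros; ring).
        rewrite <- scal_sum.
        assert (E : sum_f_R0 (fun i => Rabs (wseq (n - i)%nat)) n = sum_f_R0 (fun i => Rabs (wseq i)) n)
          by (symmetry; exact (fsum_rev _ _ _ _ _ _ R_ring (fun i => Rabs (wseq i)) n)).
        rewrite E. pose proof (sum_Rabs_wseq_le n).
        replace (16 * R0 * kap n) with (8 * R0 * kap n * 2) by ring.
        apply Rmult_le_compat_l; [|lra]. pos. }
      assert (S3 : sum_f_R0 (fun i => 8 * R0 * kap n * Rabs (wseq n)) n <= 16 * R0 * kap n).
      { rewrite sum_cte, S_INR. pose proof (Rabs_wseq_le n). pose proof (kap1_gseq n).
        pose proof (gseq_le_1 n). pose proof (pos_INR n). pose proof (Rabs_pos (wseq n)).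
        assert (Rabs (wseq n) * (INR n + 1) <= 2) by nra.
        replace (8 * R0 * kap n * Rabs (wseq n) * (INR n + 1))
          with (8 * R0 * kap n * (Rabs (wseq n) * (INR n + 1))) by ring.
        replace (16 * R0 * kap n) with (8 * R0 * kap n * 2) by ring.
        apply Rmult_le_compat_l; [|lra]. pos. }
      lra. }
  unfold Rminus at 1. apply Rle_trans with (1 := Rabs_triang _ _). rewrite Rabs_Ropp. lra.
Qed.

Lemma seqpow_nonneg a k n : (forall i, 0 <= a i) -> 0 <= seqpow a k n.
Proof.
  intros Ha. revert n. induction k as [|k IH]; intros n; [simpl; unfold seq1; destruct (n =? 0)%nat; lra|].
  apply conv_nonneg; [exact Ha|exact IH].
Qed.

Lemma pow_unit_interval x n : 0 <= x <= 1 -> 0 <= x ^ n <= 1.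
Proof. intros Hx. split; [pos|]. rewrite <- (pow1 n). apply pow_incr. lra. Qed.

(** * Square-root singularities *)

(* [bigA a al B] is the coefficient form of
   [sum a_n z^n = polynomial + al (1-z)^(1/2) + O((1-z)^(3/2))], with an explicit constant. *)
Definition bigA (a : nat -> R) (al B : R) := forall n, Rabs (a n - al * wseq n) <= B * kap n.
Definition InA (a : nat -> R) (al : R) := exists B, bigA a al B.

Lemma bigA_nonneg a al B : bigA a al B -> 0 <= B.
Proof. intros H. specialize (H O). pose proof (Rabs_pos (a O - al * wseq 0)). pose proof (kap_pos O). nra. Qed.

Lemma bigA_mono a al B B' : bigA a al B -> B <= B' -> bigA a al B'.
Proof. intros H HB n. apply Rle_trans with (1 := H n). pose proof (kap_pos n). nra. Qed.

Lemma is_lim_seq_gseq : is_lim_seq gseq 0.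
Proof.
  apply is_lim_seq_spec. intros eps.
  destruct (INR_archimed (eps ^ 2) 1) as [N HN]; [pose proof (cond_pos eps); nra|].
  exists N. intros n Hn. rewrite Rminus_0_r. pose proof (gseq_pos n) as Hg.
  rewrite Rabs_pos_eq by lra. pose proof (gseq_sqr_le n). apply le_INR in Hn.
  pose proof (cond_pos eps). pose proof (pos_INR N).
  destruct (Rlt_or_le (gseq n) eps) as [|Hc]; [assumption|exfalso].
  assert (eps ^ 2 <= gseq n ^ 2) by (apply pow_incr; lra). nra.
Qed.

Lemma is_series_of_lim (a : nat -> R) (l : R) : is_lim_seq (sum_f_R0 a) l -> is_series a l.
Proof.
  intros H. assert (H' : is_lim_seq (sum_n a) l); [|exact H'].
  apply (is_lim_seq_ext (sum_f_R0 a)); [intros n; symmetry; apply sum_n_Reals|exact H].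
Qed.

Lemma lim_of_is_series (a : nat -> R) (l : R) : is_series a l -> is_lim_seq (sum_f_R0 a) l.
Proof.
  intros H. apply (is_lim_seq_ext (sum_n a)); [intros n; apply sum_n_Reals|exact H].
Qed.

Lemma is_series_wseq : is_series wseq 0.
Proof.
  apply is_series_of_lim. apply (is_lim_seq_ext gseq); [intros n; symmetry; apply sum_wseq|].
  apply is_lim_seq_gseq.
Qed.

Lemma ex_series_Rabs_wseq : ex_series (fun n => Rabs (wseq n)).
Proof. apply ex_series_bounded with 2; [intros; apply Rabs_pos|apply sum_Rabs_wseq_le]. Qed.

Lemma bigA_Rabs_summable a al B : bigA a al B -> ex_series (fun n => Rabs (a n)).
Proof.
  intros H. apply ex_series_dominated with (fun n => B * kap n + Rabs al * Rabs (wseq n)).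
  - intros n. rewrite Rabs_Rabsolu. replace (a n) with ((a n - al * wseq n) + al * wseq n) by ring.
    apply Rle_trans with (1 := Rabs_triang _ _). rewrite Rabs_mult. specialize (H n). lra.
  - apply (ex_series_plus (fun n => B * kap n) (fun n => Rabs al * Rabs (wseq n))).
    + apply (ex_series_scal_l B kap), ex_series_kap.
    + apply (ex_series_scal_l (Rabs al) (fun n => Rabs (wseq n))), ex_series_Rabs_wseq.
Qed.

Lemma bigA_ex_series a al B : bigA a al B -> ex_series a.
Proof. intros H. apply ex_series_Rabs, (bigA_Rabs_summable a al B H). Qed.

Lemma Series_minus_wseq a al :
  ex_series a -> Series (fun n => a n - al * wseq n) = Series a.
Proof.
  intros H. rewrite Series_minus.
  - rewrite Series_scal_l, (is_series_unique _ _ is_series_wseq). ring.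
  - exact H.
  - apply (ex_series_scal_l al wseq). exists 0. apply is_series_wseq.
Qed.

Lemma Rabs_Series_bigA a al B : bigA a al B -> Rabs (Series a) <= 2 * B.
Proof.
  intros H. rewrite <- (Series_minus_wseq a al) by (eapply bigA_ex_series; eauto).
  apply Rle_trans with (Series (fun n => B * kap n)).
  - apply Rabs_Series_le; [exact H|apply (ex_series_scal_l B kap), ex_series_kap].
  - rewrite Series_scal_l. pose proof (bigA_nonneg _ _ _ H).
    assert (Series kap <= 2); [|nra].
    apply Series_bounded; [intros; apply Rlt_le, kap_pos|apply sum_kap_le].
Qed.

Lemma is_series_conv a b al be B B' :
  bigA a al B -> bigA b be B' -> is_series (conv a b) (Series a * Series b).
Proof.
  intros Ha Hb. apply is_series_mult.
  - apply Series_correct. eapply bigA_ex_series; eauto.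
  - apply Series_correct. eapply bigA_ex_series; eauto.
  - eapply bigA_Rabs_summable; eauto.
  - eapply bigA_Rabs_summable; eauto.
Qed.

Lemma bigA_conv a b al be B B' s t :
  bigA a al B -> bigA b be B' ->
  (forall n, sum_f_R0 (fun i => Rabs (a i - al * wseq i)) n <= s) ->
  (forall n, sum_f_R0 (fun i => Rabs (b i - be * wseq i)) n <= t) ->
  bigA (conv a b) (al * Series b + be * Series a)
    (8 * Rabs al * Rabs be + 84 * (Rabs al * B' + Rabs be * B) + 8 * (B' * s + B * t)).
Proof.
  intros Ha Hb Hs Ht n.
  set (r := fun i => a i - al * wseq i). set (q := fun i => b i - be * wseq i).
  assert (Er : Series r = Series a) by (apply Series_minus_wseq; eapply bigA_ex_series; eauto).
  assert (Eq : Series q = Series b) by (apply Series_minus_wseq; eapply bigA_ex_series; eauto).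
  assert (E : conv a b n = al * be * onemz n + al * conv wseq q n + be * conv wseq r n + conv r q n).
  { assert (E : conv a b = seqadd (seqscal (al * be) onemz) (seqadd (seqscal al (conv wseq q))
        (seqadd (seqscal be (conv wseq r)) (conv r q)))).
    { rewrite <- wseq_conv_wseq.
      assert (E1 : a = seqadd (seqscal al wseq) r) by (extensionality i; unfold seqadd, seqscal, r; ring).
      assert (E2 : b = seqadd (seqscal be wseq) q) by (extensionality i; unfold seqadd, seqscal, q; ring).
      replace (seqscal (al * be) (conv wseq wseq)) with (conv (seqscal al wseq) (seqscal be wseq)).
      - rewrite <- !conv_scal_l.
        rewrite E1 at 1. rewrite E2 at 1.
        replace (conv (seqscal be wseq) r) with (conv r (seqscal be wseq)) by ring. ring.
      - rewrite conv_scal_l, conv_scal_r. extensionality i. unfold seqscal. ring. }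
    rewrite E. unfold seqadd, seqscal. ring. }
  rewrite E.
  replace (al * be * onemz n + al * conv wseq q n + be * conv wseq r n + conv r q n -
      (al * Series b + be * Series a) * wseq n)
    with (al * be * onemz n + (al * (conv wseq q n - Series q * wseq n) +
      (be * (conv wseq r n - Series r * wseq n) + conv r q n))) by (rewrite Er, Eq; ring).
  pose proof (kap_pos n) as Hk.
  assert (H1 : Rabs (al * be * onemz n) <= 8 * Rabs al * Rabs be * kap n).
  { rewrite !Rabs_mult. replace (8 * Rabs al * Rabs be * kap n) with (Rabs al * Rabs be * (8 * kap n)) by ring.
    apply Rmult_le_compat_l; [pos|].
    unfold onemz, seqsub, seq1, mono. destruct n as [|[|n]]; simpl Nat.eqb; cbv iota.
    - rewrite Rminus_0_r, Rabs_R1. unfold kap. simpl. lra.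
    - rewrite Rminus_0_l, Rabs_Ropp, Rabs_R1. unfold kap. simpl. lra.
    - rewrite Rminus_0_r, Rabs_R0. lra. }
  assert (H2 : Rabs (al * (conv wseq q n - Series q * wseq n)) <= 84 * (Rabs al * B') * kap n).
  { rewrite Rabs_mult. pose proof (conv_wseq_approx q B' n Hb). pose proof (Rabs_pos al). nra. }
  assert (H3 : Rabs (be * (conv wseq r n - Series r * wseq n)) <= 84 * (Rabs be * B) * kap n).
  { rewrite Rabs_mult. pose proof (conv_wseq_approx r B n Ha). pose proof (Rabs_pos be). nra. }
  assert (H4 : Rabs (conv r q n) <= 8 * (B' * s + B * t) * kap n).
  { apply Rle_trans with (conv (fun i => Rabs (r i)) (fun i => Rabs (q i)) n);
      [apply conv_Rabs_le; intros; lra|].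
    pose proof (bigA_nonneg _ _ _ Ha). pose proof (bigA_nonneg _ _ _ Hb).
    apply Rle_trans with ((8 * B' * kap n) * sum_f_R0 (fun i => Rabs (r i)) n
                          + (8 * B * kap n) * sum_f_R0 (fun i => Rabs (q i)) n).
    - apply conv_half_le; try (intros; apply Rabs_pos).
      + intros m Hm. apply Rle_trans with (1 := Ha m).
        assert (kap m <= 8 * kap n) by (apply kap_doubling; lia). nra.
      + intros m Hm. apply Rle_trans with (1 := Hb m).
        assert (kap m <= 8 * kap n) by (apply kap_doubling; lia). nra.
    - specialize (Hs n). specialize (Ht n). fold r in Hs. fold q in Ht.
      change (fun i => a i - al * wseq i) with r in Hs.
      assert (0 <= 8 * B' * kap n) by pos.
      assert (0 <= 8 * B * kap n) by pos.
      replace (8 * (B' * s + B * t) * kap n) with (8 * B' * kap n * s + 8 * B * kap n * t) by ring.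
      apply Rplus_le_compat; apply Rmult_le_compat_l; auto. }
  apply Rle_trans with (1 := Rabs_triang _ _).
  pose proof (Rabs_triang (al * (conv wseq q n - Series q * wseq n))
    (be * (conv wseq r n - Series r * wseq n) + conv r q n)).
  pose proof (Rabs_triang (be * (conv wseq r n - Series r * wseq n)) (conv r q n)).
  lra.
Qed.

Lemma sum_bigA_le a al B n :
  bigA a al B -> sum_f_R0 (fun i => Rabs (a i - al * wseq i)) n <= 2 * B.
Proof.
  intros H. apply Rle_trans with (sum_f_R0 (fun i => kap i * B) n).
  - apply sum_Rle. intros i _. specialize (H i). lra.
  - rewrite <- scal_sum. pose proof (sum_kap_le n). pose proof (bigA_nonneg _ _ _ H). nra.
Qed.

(** A norm that is submultiplicative up to the factor 208 = 8 + 2 * 84 + 8 * (2 + 2), obtained from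
    [bigA_conv] with s = 2 N and t = 2 M. *)
Lemma bigA_conv_norm a b al be N M :
  bigA a al N -> bigA b be M -> Rabs al <= N -> Rabs be <= M ->
  bigA (conv a b) (al * Series b + be * Series a) (208 * N * M) /\
  Rabs (al * Series b + be * Series a) <= 208 * N * M.
Proof.
  intros Ha Hb Hal Hbe.
  pose proof (bigA_nonneg _ _ _ Ha). pose proof (bigA_nonneg _ _ _ Hb).
  pose proof (Rabs_pos al). pose proof (Rabs_pos be).
  pose proof (Rabs_Series_bigA _ _ _ Ha). pose proof (Rabs_Series_bigA _ _ _ Hb).
  assert (Rabs al * M <= N * M) by nra. assert (Rabs be * N <= N * M) by nra.
  assert (Rabs al * Rabs be <= N * M) by nra. split.
  - eapply bigA_mono; [apply bigA_conv; [exact Ha|exact Hb|intros n; apply sum_bigA_le; exact Ha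
      |intros n; apply sum_bigA_le; exact Hb]|]. nra.
  - apply Rle_trans with (1 := Rabs_triang _ _). rewrite !Rabs_mult.
    assert (Rabs al * Rabs (Series b) <= N * (2 * M)) by (apply Rmult_le_compat; auto using Rabs_pos).
    assert (Rabs be * Rabs (Series a) <= M * (2 * N)) by (apply Rmult_le_compat; auto using Rabs_pos).
    nra.
Qed.

Lemma InA_conv a b al be :
  InA a al -> InA b be -> InA (conv a b) (al * Series b + be * Series a).
Proof.
  intros [B Ha] [B' Hb]. eexists. apply bigA_conv; [exact Ha|exact Hb| |]; intros n;
    apply sum_bigA_le; eauto.
Qed.

Lemma InA_ex_series a al : InA a al -> ex_series a.
Proof. intros [B H]. eapply bigA_ex_series; eauto. Qed.

Lemma InA_Rabs_summable a al : InA a al -> ex_series (fun n => Rabs (a n)).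
Proof. intros [B H]. eapply bigA_Rabs_summable; eauto. Qed.

Lemma InA_Series_conv a b al be : InA a al -> InA b be -> Series (conv a b) = Series a * Series b.
Proof. intros [B Ha] [B' Hb]. apply is_series_unique. eapply is_series_conv; eauto. Qed.

Lemma InA_add a b al be : InA a al -> InA b be -> InA (seqadd a b) (al + be).
Proof.
  intros [B Ha] [B' Hb]. exists (B + B'). intros n. unfold seqadd.
  replace (a n + b n - (al + be) * wseq n) with ((a n - al * wseq n) + (b n - be * wseq n)) by ring.
  apply Rle_trans with (1 := Rabs_triang _ _). specialize (Ha n). specialize (Hb n). lra.
Qed.

Lemma InA_scal x a al : InA a al -> InA (seqscal x a) (x * al).
Proof.
  intros [B Ha]. exists (Rabs x * B). intros n. unfold seqscal.
  replace (x * a n - x * al * wseq n) with (x * (a n - al * wseq n)) by ring.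
  rewrite Rabs_mult, Rmult_assoc. apply Rmult_le_compat_l; [apply Rabs_pos|apply Ha].
Qed.

Lemma InA_sub a b al be : InA a al -> InA b be -> InA (seqsub a b) (al - be).
Proof.
  intros Ha Hb. replace (seqsub a b) with (seqadd a (seqscal (-1) b))
    by (extensionality n; unfold seqadd, seqsub, seqscal; ring).
  replace (al - be) with (al + -1 * be) by ring. apply InA_add, InA_scal; auto.
Qed.

Lemma InA_low N a : low N a -> InA a 0.
Proof.
  intros H. exists (sum_f_R0 (fun i => Rabs (a i) / kap i) N). intros n.
  rewrite Rmult_0_l, Rminus_0_r. pose proof (kap_pos n).
  assert (Hp : forall i, 0 <= Rabs (a i) / kap i).
  { intros i. apply Rmult_le_pos; [apply Rabs_pos|]. apply Rlt_le, Rinv_0_lt_compat, kap_pos. }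
  destruct (Nat.le_gt_cases N n) as [Hn|Hn].
  - rewrite H, Rabs_R0 by lia. apply Rmult_le_pos; [apply cond_pos_sum; exact Hp|lra].
  - apply Rle_div_l; [lra|].
    assert (G : forall m, (n <= m)%nat -> Rabs (a n) / kap n <= sum_f_R0 (fun i => Rabs (a i) / kap i) m).
    { induction 1 as [|m Hm IH].
      - destruct n; simpl; [lra|]. pose proof (cond_pos_sum _ n Hp). lra.
      - rewrite tech5. specialize (Hp (S m)). lra. }
    apply G. lia.
Qed.

Lemma InA_seq1 : InA seq1 0.
Proof.
  apply (InA_low 1). intros i Hi. unfold seq1. destruct (Nat.eqb_spec i 0); [lia|reflexivity].
Qed.

Lemma InA_mono k : InA (mono k) 0.
Proof.
  apply (InA_low (S k)). intros i Hi. unfold mono. destruct (Nat.eqb_spec i k); [lia|reflexivity].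
Qed.

(** [wseq] exceeds [kap] by a factor of order n, so no nonzero multiple of it fits into the
    error. *)
Lemma InA_unique a al be : InA a al -> InA a be -> al = be.
Proof.
  intros [B Ha] [B' Hb].
  destruct (Req_dec al be) as [|Hne]; [assumption|exfalso].
  assert (Hd : 0 < Rabs (al - be)) by (apply Rabs_pos_lt; lra).
  destruct (INR_archimed (Rabs (al - be)) (2 * (B + B')) Hd) as [n Hn].
  specialize (Ha n). specialize (Hb n).
  pose proof (Rabs_wseq_ge n). pose proof (kap_pos n). pose proof (kap_kap1 n).
  assert (Rabs (al - be) * Rabs (wseq n) <= (B + B') * kap n).
  { rewrite <- Rabs_mult.
    replace ((al - be) * wseq n) with ((a n - be * wseq n) - (a n - al * wseq n)) by ring.
    unfold Rminus at 1. apply Rle_trans with (1 := Rabs_triang _ _). rewrite Rabs_Ropp. lra. }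
  assert (Rabs (al - be) * (kap n * (INR n + 1) / 2) <= (B + B') * kap n) by nra.
  assert (HH : kap n * (Rabs (al - be) * (INR n + 1)) <= kap n * (2 * (B + B'))) by nra.
  apply Rmult_le_reg_l in HH; nra.
Qed.

Lemma Series_seq1 : Series seq1 = 1.
Proof.
  apply is_series_unique, is_series_of_lim.
  apply (is_lim_seq_ext (fun _ => 1)); [|apply is_lim_seq_const].
  intros n. induction n as [|n IH]; [reflexivity|].
  rewrite tech5, <- IH. unfold seq1. simpl. ring.
Qed.

Lemma is_series_finite (a : nat -> R) n :
  (forall k, (n < k)%nat -> a k = 0) -> is_series a (sum_f_R0 a n).
Proof.
  intros H. apply is_series_of_lim.
  apply (is_lim_seq_ext_loc (fun _ => sum_f_R0 a n)); [|apply is_lim_seq_const].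
  exists n. intros m Hm. induction Hm as [|m Hm IH]; [reflexivity|].
  rewrite tech5, H by lia. rewrite <- IH. ring.
Qed.

Lemma is_series_sum_f_R0 (t : nat -> nat -> R) (s : nat -> R) K :
  (forall k, is_series (t k) (s k)) ->
  is_series (fun n => sum_f_R0 (fun k => t k n) K) (sum_f_R0 s K).
Proof.
  intros H. induction K as [|K IH]; [exact (H O)|].
  simpl. apply (is_series_plus _ _ _ _ IH (H (S K))).
Qed.

(** Completeness of the class under summable norms. The condition t_k(n) = 0 for n < k holds for
    powers of a series without constant term and makes every coefficient of the sum finite. The
    second conclusion exchanges the sum over k with evaluation at z = 1. *)
Lemma InA_series (t : nat -> nat -> R) (al nu : nat -> R) :
  (forall k n, (n < k)%nat -> t k n = 0) ->
  (forall k, bigA (t k) (al k) (nu k)) -> (forall k, Rabs (al k) <= nu k) -> ex_series nu ->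
  let e := fun n => sum_f_R0 (fun k => t k n) n in
  InA e (Series al) /\ is_series (fun k => Series (t k)) (Series e).
Proof.
  intros Ht HA Hal Hnu e.
  assert (Hexal : ex_series al) by (apply ex_series_dominated with nu; auto).
  assert (He : forall n, is_series (fun k => t k n) (e n)) by (intros n; apply is_series_finite; auto).
  assert (Hb : InA e (Series al)).
  { exists (Series nu). intros n. rewrite <- (is_series_unique _ _ (He n)).
    rewrite (Rmult_comm _ (wseq n)), <- Series_scal_l, <- Series_minus;
      [|exists (e n); apply He|apply (ex_series_scal_l (wseq n) al), Hexal].
    rewrite (Rmult_comm (Series nu)), <- Series_scal_l. apply Rabs_Series_le.
    - intros k. specialize (HA k n). rewrite (Rmult_comm (wseq n)). lra.
    - apply (ex_series_scal_l (kap n) nu), Hnu. }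
  split; [exact Hb|].
  (* A majorant summable in n: |t_k(n)| <= nu_k mj_n, which makes the tail over k uniform in n. *)
  set (mj := fun n => Rabs (wseq n) + kap n).
  assert (Hmj : ex_series mj) by (apply (ex_series_plus _ _ ex_series_Rabs_wseq ex_series_kap)).
  assert (Hst : forall k, is_series (t k) (Series (t k))).
  { intros k. apply Series_correct. eapply bigA_ex_series, HA. }
  set (tl := fun K => Series (fun k => nu (S K + k)%nat)).
  assert (Htl : is_lim_seq tl 0).
  { apply (is_lim_seq_ext (fun K => Series nu - sum_n nu K)).
    - intros K. rewrite sum_n_Reals, (Series_split nu K Hnu). unfold tl. ring.
    - replace 0 with (Series nu - Series nu) by ring.
      apply is_lim_seq_minus'; [apply is_lim_seq_const|apply (Series_correct _ Hnu)]. }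
  assert (Hdiff : forall K, Rabs (Series e - sum_f_R0 (fun k => Series (t k)) K) <= tl K * Series mj).
  { intros K. pose proof (is_series_sum_f_R0 t _ K Hst) as HK.
    rewrite <- (is_series_unique _ _ HK), <- Series_minus;
      [|eapply InA_ex_series, Hb|eexists; apply HK].
    rewrite <- Series_scal_l. apply Rabs_Series_le; [|apply (ex_series_scal_l (tl K) mj), Hmj].
    intros n. rewrite <- (is_series_unique _ _ (He n)).
    rewrite (Series_split (fun k => t k n) K) by (exists (e n); apply He).
    replace (sum_f_R0 (fun k => t k n) K + Series (fun k => t (S K + k)%nat n) - sum_f_R0 (fun k => t k n) K)
      with (Series (fun k => t (S K + k)%nat n)) by ring.
    rewrite (Rmult_comm (tl K)). unfold tl. rewrite <- Series_scal_l. apply Rabs_Series_le.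
    - intros k. replace (t (S K + k)%nat n) with ((t (S K + k)%nat n - al (S K + k)%nat * wseq n) + al (S K + k)%nat * wseq n) by ring.
      apply Rle_trans with (1 := Rabs_triang _ _). rewrite Rabs_mult. unfold mj.
      pose proof (HA (S K + k)%nat n). pose proof (Hal (S K + k)%nat). pose proof (Rabs_pos (wseq n)). nra.
    - apply (ex_series_scal_l (mj n) (fun k => nu (S K + k)%nat)). apply (ex_series_shift nu), Hnu. }
  apply is_series_of_lim.
  apply (is_lim_seq_ext (fun K => Series e - (Series e - sum_f_R0 (fun k => Series (t k)) K))).
  { intros K. ring. }
  replace (Finite (Series e)) with (Finite (Series e - 0)) by (f_equal; ring).
  apply is_lim_seq_minus'; [apply is_lim_seq_const|].
  apply is_lim_seq_abs_0. apply (is_lim_seq_le_le (fun _ => 0) _ (fun K => tl K * Series mj)).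
  - intros K. split; [apply Rabs_pos|apply Hdiff].
  - apply is_lim_seq_const.
  - replace 0 with (0 * Series mj) by ring. apply is_lim_seq_mult'; [exact Htl|apply is_lim_seq_const].
Qed.

Lemma seqpow_vanish a k n : a O = 0 -> (n < k)%nat -> seqpow a k n = 0.
Proof.
  intros Ha. assert (H : high k (seqpow a k)).
  { induction k as [|k IH]; [intros i Hi; lia|].
    apply (high_conv 1 k); [|exact IH]. intros i Hi. replace i with O by lia. exact Ha. }
  intros Hn. apply H, Hn.
Qed.

(** The singular coefficient follows the derivative of x^k at [Series a]; at k = 0 the factor
    [INR k] hides the truncated [pred]. *)
Lemma seqpow_bigA a al N :
  bigA a al N -> Rabs al <= N ->
  forall k, bigA (seqpow a k) (INR k * Series a ^ pred k * al) ((208 * N) ^ k) /\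
    Rabs (INR k * Series a ^ pred k * al) <= (208 * N) ^ k /\
    Series (seqpow a k) = Series a ^ k.
Proof.
  intros Ha Hal. induction k as [|k (IH1 & IH2 & IH3)].
  - simpl. rewrite !Rmult_0_l, Rabs_R0. split; [|split; [lra|apply Series_seq1]].
    intros n. rewrite Rmult_0_l, Rminus_0_r. unfold seq1. destruct n; simpl.
    + rewrite Rabs_R1. unfold kap. simpl. lra.
    + rewrite Rabs_R0. pose proof (kap_pos (S n)). lra.
  - assert (E : INR (S k) * Series a ^ pred (S k) * al = al * Series (seqpow a k) + INR k * Series a ^ pred k * al * Series a).
    { rewrite IH3, S_INR. destruct k; simpl; ring. }
    destruct (bigA_conv_norm _ _ _ _ _ _ Ha IH1 Hal IH2) as [H1 H2].
    rewrite E. repeat split.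
    + exact H1.
    + exact H2.
    + simpl. rewrite <- IH3. apply is_series_unique. eapply is_series_conv; eauto.
Qed.

Lemma theta_seqpow a k : theta (seqpow a (S k)) = seqscal (INR (S k)) (conv (theta a) (seqpow a k)).
Proof.
  induction k as [|k IH].
  - simpl seqpow. replace (conv a seq1) with a by ring.
    extensionality n. unfold seqscal. simpl INR. replace (conv (theta a) seq1) with (theta a) by ring. ring.
  - simpl seqpow in *. rewrite theta_conv, IH, conv_scal_r.
    replace (conv a (conv (theta a) (seqpow a k))) with (conv (theta a) (conv a (seqpow a k))) by ring.
    extensionality n. unfold seqadd, seqscal. rewrite (S_INR (S k)). ring.
Qed.

(** The differential equation with e(0) = 1 characterizes e = exp(l). The exponential series
    converges for every norm of [l], and its singular coefficient is exp(l(1)) al. *)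
Lemma InA_exp l al e :
  InA l al -> l O = 0 -> e O = 1 -> theta e = conv (theta l) e ->
  InA e (Series e * al) /\ Series e = exp (Series l).
Proof.
  intros [B Hl] Hl0 He0 He.
  set (N := Rabs al + B). pose proof (bigA_nonneg _ _ _ Hl). pose proof (Rabs_pos al).
  assert (HlN : bigA l al N) by (apply bigA_mono with B; auto; unfold N; lra).
  assert (HalN : Rabs al <= N) by (unfold N; lra).
  set (t := fun k => seqscal (/ INR (fact k)) (seqpow l k)).
  set (be := fun k => / INR (fact k) * (INR k * Series l ^ pred k * al)).
  set (nu := fun k => / INR (fact k) * (208 * N) ^ k).
  assert (Hfact : forall k, 0 < / INR (fact k)) by (intros; apply Rinv_0_lt_compat, INR_fact_lt_0).
  assert (Hexp : forall x, is_series (fun k => / INR (fact k) * x ^ k) (exp x)).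
  { intros x. generalize (is_exp_Reals x). apply is_series_ext.
    intros n. rewrite pow_n_pow. unfold scal; simpl; unfold mult; simpl. ring. }
  destruct (InA_series t be nu) as [HA HS].
  - intros k n Hn. unfold t, seqscal. rewrite seqpow_vanish by auto. ring.
  - intros k n. unfold t, be, nu, seqscal.
    replace (/ INR (fact k) * seqpow l k n - / INR (fact k) * (INR k * Series l ^ Init.Nat.pred k * al) * wseq n)
      with (/ INR (fact k) * (seqpow l k n - INR k * Series l ^ Init.Nat.pred k * al * wseq n)) by ring.
    rewrite Rabs_mult, Rabs_pos_eq, (Rmult_assoc _ _ (kap n)) by (specialize (Hfact k); lra).
    apply Rmult_le_compat_l; [specialize (Hfact k); lra|].
    apply (seqpow_bigA l al N HlN HalN k).
  - intros k. unfold be, nu. rewrite Rabs_mult, Rabs_pos_eq by (specialize (Hfact k); lra).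
    apply Rmult_le_compat_l; [specialize (Hfact k); lra|].
    apply (seqpow_bigA l al N HlN HalN k).
  - eexists. apply Hexp.
  - assert (Hs : forall K n, (n <= K)%nat -> sum_f_R0 (fun k => t k n) K = e n).
    { intros K n. revert K. induction n as [n IH] using lt_wf_ind. intros K HK.
      destruct n as [|n].
      - rewrite He0. destruct K as [|K].
        + simpl. unfold t, seqscal. simpl. unfold seq1. simpl. field.
        + rewrite decomp_sum by lia. rewrite sum_zero.
          * unfold t, seqscal. simpl. unfold seq1. simpl. field.
          * intros i Hi. unfold t, seqscal. rewrite seqpow_vanish by (auto; lia). ring.
      - assert (Hth : forall k, theta (t (S k)) = conv (theta l) (t k)).
        { intros k. unfold t. rewrite conv_scal_r.
          replace (theta (seqscal (/ INR (fact (S k))) (seqpow l (S k))))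
            with (seqscal (/ INR (fact (S k))) (theta (seqpow l (S k))))
            by (extensionality i; unfold theta, seqscal; ring).
          rewrite theta_seqpow. extensionality i. unfold seqscal.
          rewrite fact_simpl, mult_INR. field. split; [apply INR_fact_neq_0|apply not_0_INR; lia]. }
        destruct K as [|K]; [lia|].
        assert (Hn0 : INR (S n) <> 0) by (apply not_0_INR; lia).
        apply Rmult_eq_reg_l with (INR (S n)); [|exact Hn0].
        change (INR (S n) * e (S n)) with (theta e (S n)). rewrite He.
        rewrite decomp_sum by lia. simpl pred.
        replace (t O (S n)) with 0 by (unfold t, seqscal; simpl; unfold seq1; simpl; ring).
        rewrite Rplus_0_l, scal_sum.
        rewrite (sum_eq _ (fun k => conv (theta l) (t k) (S n))).
        2:{ intros k _. rewrite <- Hth. unfold theta. ring. }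
        assert (Hex : forall J, sum_f_R0 (fun k => conv (theta l) (t k) (S n)) J =
            conv (theta l) (fun i => sum_f_R0 (fun k => t k i) J) (S n)).
        { induction J as [|J IHJ]; [reflexivity|]. rewrite tech5, IHJ.
          unfold conv. rewrite <- plus_sum. apply sum_eq. intros i Hi. rewrite tech5. ring. }
        rewrite Hex. unfold conv. apply sum_eq. intros i Hi.
        destruct i as [|i]; [unfold theta; simpl; ring|].
        rewrite IH by lia. reflexivity. }
    assert (Ee : (fun n => sum_f_R0 (fun k => t k n) n) = e) by (extensionality n; apply Hs; lia).
    cbv zeta in HA, HS. rewrite Ee in HA, HS.
    assert (HSe : Series e = exp (Series l)).
    { rewrite <- (is_series_unique _ _ HS), <- (is_series_unique _ _ (Hexp (Series l))).
      apply Series_ext. intros k. unfold t, seqscal. rewrite Series_scal_l. f_equal.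
      apply (seqpow_bigA l al N HlN HalN k). }
    split; [|exact HSe]. rewrite HSe.
    replace (exp (Series l) * al) with (Series be); [exact HA|].
    rewrite Series_incr_1_aux by (unfold be; simpl; ring).
    apply is_series_unique.
    assert (Hbe : forall k, al * (/ INR (fact k) * Series l ^ k) = be (S k)).
    { intros k. unfold be. rewrite fact_simpl, mult_INR. simpl pred.
      field. split; [apply INR_fact_neq_0|apply not_0_INR; lia]. }
    apply (is_series_ext (fun k => al * (/ INR (fact k) * Series l ^ k))).
    + exact Hbe.
    + rewrite Rmult_comm.
      exact (is_series_scal_l al (fun k => / INR (fact k) * Series l ^ k) _ (Hexp (Series l))).
Qed.

Lemma conv_inv_geometric a :
  a O = 0 -> conv (seqsub seq1 a) (fun n => sum_f_R0 (fun k => seqpow a k n) n) = seq1.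
Proof.
  intros Ha. extensionality n.
  rewrite (conv_ext _ (seqsub seq1 a) _ (fun i => sum_f_R0 (fun k => seqpow a k i) n)); [|reflexivity|].
  2:{ intros i Hi. induction n as [|n IH]; [replace i with O by lia; reflexivity|].
      destruct (Nat.eq_dec i (S n)) as [->|]; [reflexivity|].
      rewrite IH by lia. rewrite (tech5 _ n), (seqpow_vanish a (S n)) by (auto; lia). ring. }
  assert (H : forall K, conv (seqsub seq1 a) (fun i => sum_f_R0 (fun k => seqpow a k i) K)
    = seqsub seq1 (seqpow a (S K))).
  { induction K as [|K IH].
    - change (conv (seqsub seq1 a) seq1 = seqsub seq1 (conv a seq1)). ring.
    - change (fun i => sum_f_R0 (fun k => seqpow a k i) (S K))
        with (seqadd (fun i => sum_f_R0 (fun k => seqpow a k i) K) (seqpow a (S K))).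
      replace (conv (seqsub seq1 a) (seqadd (fun i => sum_f_R0 (fun k => seqpow a k i) K) (seqpow a (S K))))
        with (seqadd (conv (seqsub seq1 a) (fun i => sum_f_R0 (fun k => seqpow a k i) K))
                     (conv (seqsub seq1 a) (seqpow a (S K)))) by ring.
      rewrite IH. simpl. ring. }
  rewrite H. unfold seqsub. rewrite seqpow_vanish by (auto; lia). ring.
Qed.

(** The fixed point of x -> x/2 + b is 2 b; one more b absorbs the geometric transient. *)
Lemma half_contraction (x : nat -> R) b k0 :
  0 < b -> (forall k, (k0 <= k)%nat -> x (S k) <= x k / 2 + b) ->
  exists k1, forall k, (k1 <= k)%nat -> x k <= 3 * b.
Proof.
  intros Hb H.
  assert (H1 : forall j, x (k0 + j)%nat <= Rabs (x k0) * (1 / 2) ^ j + 2 * b).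
  { induction j as [|j IH].
    - rewrite Nat.add_0_r. simpl. pose proof (Rle_abs (x k0)). lra.
    - rewrite Nat.add_succ_r. specialize (H (k0 + j)%nat ltac:(lia)). simpl. lra. }
  destruct (pow_lt_1_zero (1 / 2) ltac:(rewrite Rabs_pos_eq; lra) (b / (Rabs (x k0) + 1))) as [j0 Hj0].
  { apply Rdiv_lt_0_compat; [lra|]. pose proof (Rabs_pos (x k0)). lra. }
  exists (k0 + j0)%nat. intros k Hk. replace k with (k0 + (k - k0))%nat by lia.
  apply Rle_trans with (1 := H1 _).
  specialize (Hj0 (k - k0)%nat ltac:(lia)). rewrite Rabs_pos_eq in Hj0 by pos.
  pose proof (Rabs_pos (x k0)). apply Rlt_div_r in Hj0; [|lra].
  assert (0 <= (1 / 2) ^ (k - k0)) by pos. nra.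
Qed.

(** The norm of [a] may be large although a(1) < 1, so the geometric series need not converge in
    norm. Squaring helps: 1/(1-a) = (1+a)(1+a^2)(1+a^4)... / (1 - a^(2^k)), and for large k the norm
    of a^(2^k) is at most 1/1000, where the geometric series converges with ratio 208/1000. *)
Lemma InA_inv a al :
  InA a al -> a O = 0 -> (forall n, 0 <= a n) -> Series a < 1 ->
  exists D al', InA D al' /\ conv (seqsub seq1 a) D = seq1.
Proof.
  intros Ha Ha0 Hap Hlt.
  set (sq := fix sq k := match k with O => a | S k' => conv (sq k') (sq k') end).
  assert (Hdesc : forall k, (exists D al', InA D al' /\ conv (seqsub seq1 (sq k)) D = seq1) ->
    (forall k, exists be, InA (sq k) be) ->
    exists D al', InA D al' /\ conv (seqsub seq1 a) D = seq1).
  { intros k. induction k as [|k IH]; intros (D & al' & HD & E) Hsq; [exists D, al'; auto|].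
    apply IH; [|exact Hsq]. destruct (Hsq k) as [be Hbe].
    exists (conv (seqadd seq1 (sq k)) D). eexists. split.
    - apply InA_conv; [apply InA_add; [apply InA_seq1|exact Hbe]|exact HD].
    - etransitivity; [|exact E]. change (sq (S k)) with (conv (sq k) (sq k)). ring. }
  destruct Ha as [B HB].
  set (lam := fix lam k := match k with O => Series a | S k' => lam k' * lam k' end).
  set (be := fix be k := match k with O => al | S k' => be k' * lam k' + be k' * lam k' end).
  set (Bk := fix Bk k := match k with O => B | S k' =>
     8 * Rabs (be k') * Rabs (be k') + 84 * (Rabs (be k') * Bk k' + Rabs (be k') * Bk k') +
     8 * (Bk k' * (lam k' + 2 * Rabs (be k')) + Bk k' * (lam k' + 2 * Rabs (be k'))) end).
  assert (Hall : forall k, bigA (sq k) (be k) (Bk k) /\ Series (sq k) = lam k /\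
     (forall n, 0 <= sq k n) /\ sq k O = 0).
  { induction k as [|k (I1 & I2 & I3 & I4)]; [simpl; auto|].
    change (sq (S k)) with (conv (sq k) (sq k)).
    change (lam (S k)) with (lam k * lam k).
    change (be (S k)) with (be k * lam k + be k * lam k).
    change (Bk (S k)) with (8 * Rabs (be k) * Rabs (be k) + 84 * (Rabs (be k) * Bk k + Rabs (be k) * Bk k) +
     8 * (Bk k * (lam k + 2 * Rabs (be k)) + Bk k * (lam k + 2 * Rabs (be k)))).
    rewrite <- I2.
    (* By nonnegativity the l1 norm of the power is its value at 1, which squaring drives to 0 even
       while the constant [Bk] is large. *)
    assert (Hsum : forall n, sum_f_R0 (fun i => Rabs (sq k i - be k * wseq i)) n <= Series (sq k) + 2 * Rabs (be k)).
    { intros n. apply Rle_trans with (sum_f_R0 (fun i => sq k i + Rabs (be k) * Rabs (wseq i)) n).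
      - apply sum_Rle. intros i _. rewrite <- Rabs_mult. unfold Rminus.
        apply Rle_trans with (1 := Rabs_triang _ _). rewrite Rabs_Ropp.
        rewrite (Rabs_pos_eq (sq k i)) by auto. lra.
      - rewrite plus_sum. apply Rplus_le_compat.
        + apply sum_le_Series; [exact I3|eapply bigA_ex_series, I1].
        + rewrite (sum_eq _ (fun i => Rabs (wseq i) * Rabs (be k))) by (intros; ring).
          rewrite <- scal_sum. pose proof (sum_Rabs_wseq_le n). pose proof (Rabs_pos (be k)). nra. }
    repeat split.
    - apply bigA_conv; auto.
    - apply is_series_unique. eapply is_series_conv; eauto.
    - intros n. apply conv_nonneg; auto.
    - change (sq k O * sq k O = 0). rewrite I4. ring. }
  assert (Hlam : exists k0, forall k, (k0 <= k)%nat -> 0 <= lam k <= 1 / 100).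
  { assert (Hl0 : forall k, 0 <= lam k).
    { intros k. destruct (Hall k) as (I1 & <- & I3 & _).
      apply Rle_trans with (sum_f_R0 (sq k) 0); [simpl; apply I3|].
      apply sum_le_Series; [exact I3|eapply bigA_ex_series, I1]. }
    assert (Hl1 : forall k, lam k <= Series a ^ S k).
    { induction k as [|k IH]; [simpl; lra|]. simpl lam.
      apply Rle_trans with (Series a ^ S k * Series a); [|simpl; lra].
      apply Rmult_le_compat; auto.
      specialize (Hl0 O). simpl in Hl0. apply Rle_trans with (1 := IH).
      simpl. assert (Series a ^ k <= 1) by (apply pow_unit_interval; lra). nra. }
    destruct (pow_lt_1_zero (Series a)) with (y := 1 / 100) as [k0 Hk0].
    { specialize (Hl0 O). simpl in Hl0. rewrite Rabs_pos_eq; auto. }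
    { lra. }
    exists k0. intros k Hk. split; [apply Hl0|]. apply Rle_trans with (1 := Hl1 k).
    specialize (Hk0 (S k) ltac:(lia)). pose proof (Rle_abs (Series a ^ S k)). lra. }
  destruct Hlam as [k0 Hk0].
  destruct (half_contraction (fun k => Rabs (be k)) (1 / 3000) k0) as [k1 Hk1]; [lra| |].
  { intros k Hk. simpl be. specialize (Hk0 k Hk).
    replace (be k * lam k + be k * lam k) with (be k * (2 * lam k)) by ring.
    rewrite Rabs_mult, (Rabs_pos_eq (2 * lam k)) by lra. pose proof (Rabs_pos (be k)). nra. }
  (* With lam <= 1/100 and |be| <= 1/1000 the factor in front of [Bk k] is at most 168/1000 + 16 *
     12/1000 = 0.36, below 1/2. *)
  destruct (half_contraction Bk (1 / 3000) (k0 + k1)) as [k2 Hk2]; [lra| |].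
  { intros k Hk. simpl Bk. specialize (Hk0 k ltac:(lia)). specialize (Hk1 k ltac:(lia)).
    cbv beta in Hk1.
    pose proof (Rabs_pos (be k)). assert (0 <= Bk k) by (eapply bigA_nonneg, Hall).
    assert (Rabs (be k) * Rabs (be k) <= 1 / 1000 * (1 / 1000)) by (apply Rmult_le_compat; lra).
    nra. }
  set (k := (k0 + k1 + k2)%nat).
  destruct (Hall k) as (I1 & I2 & I3 & I4).
  specialize (Hk1 k ltac:(unfold k; lia)). specialize (Hk2 k ltac:(unfold k; lia)). cbv beta in Hk1.
  apply (Hdesc k); [|intros j; exists (be j), (Bk j); apply Hall].
  exists (fun n => sum_f_R0 (fun j => seqpow (sq k) j n) n).
  assert (I1' : bigA (sq k) (be k) (1 / 1000)) by (apply bigA_mono with (1 := I1); lra).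
  destruct (InA_series (seqpow (sq k)) (fun j => INR j * Series (sq k) ^ pred j * be k)
    (fun j => (208 * (1 / 1000)) ^ j)) as [HA _].
  - intros j n Hj. apply seqpow_vanish; auto.
  - intros j. apply (seqpow_bigA (sq k) (be k) (1 / 1000)); auto; lra.
  - intros j. apply (seqpow_bigA (sq k) (be k) (1 / 1000)); auto; lra.
  - apply ex_series_geom. rewrite Rabs_pos_eq; lra.
  - eexists. split; [exact HA|]. apply conv_inv_geometric. exact I4.
Qed.

Lemma InA_wseq : InA wseq 1.
Proof. exists 0. intros n. rewrite Rmult_1_l, Rminus_diag, Rabs_R0. lra. Qed.

(** * Trigonometric and Gaussian estimates *)

Lemma nonneg_of_derive (f f' : R -> R) :
  f 0 = 0 -> (forall x, 0 <= x -> is_derive f x (f' x)) -> (forall x, 0 <= x -> 0 <= f' x) ->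
  forall x, 0 <= x -> 0 <= f x.
Proof.
  intros H0 Hd Hp x Hx.
  destruct (MVT_gen f 0 x f') as [c [Hc Heq]].
  - intros y Hy. rewrite Rmin_left in Hy by lra. apply Hd. lra.
  - intros y Hy. rewrite Rmin_left in Hy by lra.
    apply continuity_pt_filterlim, (ex_derive_continuous f y). eexists. apply Hd. lra.
  - rewrite Rmin_left, Rmax_right in Hc by lra. rewrite H0 in Heq.
    specialize (Hp c ltac:(lra)). nra.
Qed.

Lemma sin_le_x x : 0 <= x -> sin x <= x.
Proof.
  intros Hx. assert (0 <= x - sin x); [|lra]. revert x Hx.
  apply (nonneg_of_derive (fun x => x - sin x) (fun x => 1 - cos x)).
  - rewrite sin_0. ring.
  - intros. auto_derive; auto. ring.
  - intros x _. pose proof (COS_bound x). lra.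
Qed.

Lemma cos_ge_quad x : 0 <= x -> 1 - x ^ 2 / 2 <= cos x.
Proof.
  intros Hx. assert (0 <= cos x - (1 - x ^ 2 / 2)); [|lra]. revert x Hx.
  apply (nonneg_of_derive (fun x => cos x - (1 - x ^ 2 / 2)) (fun x => x - sin x)).
  - rewrite cos_0. field.
  - intros. auto_derive; auto. field.
  - intros x Hx. pose proof (sin_le_x x Hx). lra.
Qed.

Lemma sin_ge_cubic x : 0 <= x -> x - x ^ 3 / 6 <= sin x.
Proof.
  intros Hx. assert (0 <= sin x - (x - x ^ 3 / 6)); [|lra]. revert x Hx.
  apply (nonneg_of_derive (fun x => sin x - (x - x ^ 3 / 6)) (fun x => cos x - (1 - x ^ 2 / 2))).
  - rewrite sin_0. field.
  - intros. auto_derive; auto. field.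
  - intros x Hx. pose proof (cos_ge_quad x Hx). lra.
Qed.

Lemma cos_le_quartic x : 0 <= x -> cos x <= 1 - x ^ 2 / 2 + x ^ 4 / 24.
Proof.
  intros Hx. assert (0 <= 1 - x ^ 2 / 2 + x ^ 4 / 24 - cos x); [|lra]. revert x Hx.
  apply (nonneg_of_derive (fun x => 1 - x ^ 2 / 2 + x ^ 4 / 24 - cos x) (fun x => sin x - (x - x ^ 3 / 6))).
  - rewrite cos_0. field.
  - intros. auto_derive; auto. field.
  - intros x Hx. pose proof (sin_ge_cubic x Hx). lra.
Qed.

Lemma cos_Rabs x : cos (Rabs x) = cos x.
Proof. unfold Rabs. destruct (Rcase_abs x); [apply cos_neg|reflexivity]. Qed.

Lemma cos_quartic x : Rabs (cos x - (1 - x ^ 2 / 2)) <= x ^ 4 / 24.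
Proof.
  rewrite <- cos_Rabs, <- (pow2_abs x). replace (x ^ 4) with (Rabs x ^ 4).
  - pose proof (Rabs_pos x). pose proof (cos_ge_quad (Rabs x)). pose proof (cos_le_quartic (Rabs x)).
    apply Rabs_le. split; intuition lra.
  - replace (Rabs x ^ 4) with ((Rabs x ^ 2) ^ 2) by ring. rewrite pow2_abs. ring.
Qed.

Lemma cos_quad x : Rabs (cos x - 1) <= x ^ 2 / 2.
Proof.
  rewrite <- cos_Rabs, <- (pow2_abs x). pose proof (Rabs_pos x).
  pose proof (cos_ge_quad (Rabs x)). pose proof (COS_bound (Rabs x)).
  apply Rabs_le. split; intuition lra.
Qed.

Lemma sin_cubic x : Rabs (sin x - x) <= Rabs x ^ 3 / 6.
Proof.
  assert (H : forall y, 0 <= y -> Rabs (sin y - y) <= y ^ 3 / 6).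
  { intros y Hy. pose proof (sin_ge_cubic y Hy). pose proof (sin_le_x y Hy). apply Rabs_le. lra. }
  destruct (Rle_or_lt 0 x).
  - rewrite (Rabs_pos_eq x) by lra. auto.
  - rewrite (Rabs_left x) by lra. rewrite <- Rabs_Ropp.
    replace (- (sin x - x)) with (sin (- x) - - x) by (rewrite sin_neg; ring). apply H. lra.
Qed.

Lemma Rabs_sin_le x : Rabs (sin x) <= Rabs x.
Proof.
  assert (H : forall y, 0 <= y -> Rabs (sin y) <= y).
  { intros y Hy. apply Rabs_le. split; [|apply sin_le_x, Hy].
    enough (0 <= sin y + y) by lra. revert y Hy.
    apply (nonneg_of_derive (fun y => sin y + y) (fun y => cos y + 1)).
    - rewrite sin_0. ring.
    - intros. auto_derive; auto. ring.
    - intros y _. pose proof (COS_bound y). lra. }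
  destruct (Rle_or_lt 0 x).
  - rewrite (Rabs_pos_eq x) by lra. auto.
  - rewrite (Rabs_left x) by lra. rewrite <- Rabs_Ropp, <- sin_neg. apply H. lra.
Qed.

Lemma one_minus_cos x : 1 - cos x = 2 * sin (x / 2) ^ 2.
Proof. replace x with (2 * (x / 2)) at 1 by field. rewrite cos_2a_sin. ring. Qed.

(** 1 - cos t = 2 sin(t/2)^2, and the cubic lower bound of the sine gives sin(y/2) >= y/6 for 0 <= y
    <= 4. *)
Lemma one_minus_cos_ge t : - PI <= t <= PI -> t ^ 2 / 18 <= 1 - cos t.
Proof.
  intros Ht. rewrite <- cos_Rabs, <- (pow2_abs t).
  assert (H : 0 <= Rabs t <= PI) by (split; [apply Rabs_pos|apply Rabs_le; lra]).
  revert H. generalize (Rabs t) as y. intros y Hy. rewrite one_minus_cos.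
  pose proof PI_4. pose proof (sin_ge_cubic (y / 2) ltac:(lra)).
  assert (y / 6 <= sin (y / 2)); [|nra].
  apply Rle_trans with (2 := H0).
  replace (y / 2 - (y / 2) ^ 3 / 6) with (y / 6 + (y / 3) * (1 - (y / 2) ^ 2 / 4)) by field.
  assert (0 <= 1 - (y / 2) ^ 2 / 4) by nra. nra.
Qed.

(** 1 - cos is half a squared distance on the unit circle, so this is the triangle inequality
    squared. It makes the frequencies controlled by a characteristic function stable under
    differences. *)
Lemma one_minus_cos_minus a b : 1 - cos (a - b) <= 2 * (1 - cos a) + 2 * (1 - cos b).
Proof.
  rewrite !one_minus_cos. replace ((a - b) / 2) with (a / 2 - b / 2) by field.
  rewrite sin_minus. set (u := a / 2). set (v := b / 2).
  pose proof (sin2_cos2 u). pose proof (sin2_cos2 v). unfold Rsqr in *.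
  assert (sin u ^ 2 * cos v ^ 2 <= sin u ^ 2) by (pose proof (pow2_ge_0 (sin u)); pose proof (pow2_ge_0 (sin v)); nra).
  assert (cos u ^ 2 * sin v ^ 2 <= sin v ^ 2) by (pose proof (pow2_ge_0 (sin u)); pose proof (pow2_ge_0 (sin v)); nra).
  pose proof (pow2_ge_0 (sin u * cos v + cos u * sin v)). nra.
Qed.

(** * Laplace's method on [-pi, pi] with error O(n^(-3/2)) *)

Lemma exp_ge_pow4 x : 0 <= x -> (1 + x / 4) ^ 4 <= exp x.
Proof.
  intros Hx. replace (exp x) with (exp (x / 4) ^ 4).
  - apply pow_incr. pose proof (exp_ineq1_le (x / 4)). lra.
  - simpl. rewrite Rmult_1_r, <- !exp_plus. f_equal. field.
Qed.

Lemma exp_neg_quad x : 0 <= x -> Rabs (exp (- x) - (1 - x)) <= x ^ 2 / 2.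
Proof.
  intros Hx. apply Rabs_le. pose proof (exp_ineq1_le (- x)). split; [nra|].
  enough (0 <= x ^ 2 / 2 - (exp (- x) - (1 - x))) by lra. clear H. revert x Hx.
  apply (nonneg_of_derive (fun x => x ^ 2 / 2 - (exp (- x) - (1 - x))) (fun x => x - 1 + exp (- x))).
  - rewrite Ropp_0, exp_0. field.
  - intros. auto_derive; auto. field.
  - intros x _. pose proof (exp_ineq1_le (- x)). lra.
Qed.

(** Envelope of the integrand errors. In terms of y = n t^2 its polynomial factor is (y + y^2 + y^3)
    / n, so the integral gains a factor 1/n over the Gaussian one. *)
Definition lapl (c : R) (n : nat) (t : R) : R :=
  (t ^ 2 + INR n * t ^ 4 + INR n ^ 2 * t ^ 6) * exp (- c * INR n * t ^ 2).

Lemma poly_exp_bound c : 0 < c ->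
  exists K, 0 < K /\ forall y, 0 <= y -> (1 + y) ^ 4 * exp (- c * y) <= K.
Proof.
  intros Hc. set (m := Rmin 1 (c / 4)).
  assert (Hm : 0 < m) by (apply Rmin_glb_lt; lra).
  exists (/ m ^ 4). split; [pos|].
  intros y Hy. replace (- c * y) with (- (c * y)) by ring. rewrite exp_Ropp.
  apply Rle_div_l; [apply exp_pos|].
  apply Rle_trans with (/ m ^ 4 * (1 + c * y / 4) ^ 4).
  - apply Rmult_le_reg_l with (m ^ 4); [pos|].
    rewrite <- Rmult_assoc, Rinv_r, Rmult_1_l by (apply pow_nonzero; lra).
    rewrite <- Rpow_mult_distr. apply pow_incr.
    pose proof (Rmin_l 1 (c / 4)). pose proof (Rmin_r 1 (c / 4)). fold m in H, H0. nra.
  - apply Rmult_le_compat_l; [pos|].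
    apply exp_ge_pow4. nra.
Qed.

(** The Gaussian decay is traded for a Cauchy density, whose integral is an arctangent. *)
Lemma lapl_le c : 0 < c -> exists K, 0 < K /\ forall n t, (1 <= n)%nat ->
  lapl c n t <= K / INR n * / (1 + INR n * t ^ 2).
Proof.
  intros Hc. destruct (poly_exp_bound c Hc) as (K & HK & H). exists K. split; [exact HK|].
  intros n t Hn. assert (Hn0 : 0 < INR n) by (apply lt_0_INR; lia).
  set (y := INR n * t ^ 2). assert (Hy : 0 <= y) by (unfold y; pose proof (pow2_ge_0 t); nra).
  specialize (H y Hy). unfold lapl.
  replace (- c * INR n * t ^ 2) with (- c * y) by (unfold y; ring).
  replace ((t ^ 2 + INR n * t ^ 4 + INR n ^ 2 * t ^ 6) * exp (- c * y))
    with ((y + y ^ 2 + y ^ 3) * (1 + y) * exp (- c * y) * (/ INR n * / (1 + y))) by (unfold y; field; fold y; lra).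
  unfold Rdiv. rewrite (Rmult_assoc K).
  apply Rmult_le_compat_r; [pos|].
  apply Rle_trans with (2 := H). apply Rmult_le_compat_r; [apply Rlt_le, exp_pos|].
  assert (0 <= y ^ 2) by nra. assert (0 <= y ^ 3) by pos. nra.
Qed.

Lemma RInt_inv_quad a A : 0 < a -> 0 <= A ->
  is_RInt (fun t => / (1 + a * t ^ 2)) (- A) A (2 * atan (sqrt a * A) / sqrt a).
Proof.
  intros Ha HA. assert (Hs : 0 < sqrt a) by pos.
  replace (fun t => / (1 + a * t ^ 2)) with (fun t => / (1 + sqrt a * sqrt a * t ^ 2))
    by (rewrite sqrt_sqrt by lra; reflexivity).
  revert Hs. clear. generalize (sqrt a) as s. intros s Hs.
  replace (2 * atan (s * A) / s) with (minus (atan (s * A) / s) (atan (s * (- A)) / s)).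
  2:{ unfold minus, plus, opp; simpl. replace (s * - A) with (- (s * A)) by ring.
      rewrite atan_opp. field. lra. }
  assert (Hp : forall t, 0 < 1 + s * s * t ^ 2).
  { intros t. replace (1 + s * s * t ^ 2) with (1 + (s * t) ^ 2) by ring. pose proof (pow2_ge_0 (s * t)). lra. }
  apply (is_RInt_derive (fun t => atan (s * t) / s)).
  - intros t _. specialize (Hp t). auto_derive; auto. field. split; nra.
  - intros t _. specialize (Hp t). apply (ex_derive_continuous (fun t => / (1 + s * s * t ^ 2))).
    auto_derive. nra.
Qed.

Lemma RInt_Rabs_le (F G : R -> R) a b l :
  a <= b -> ex_RInt F a b -> is_RInt G a b l ->
  (forall t, a <= t <= b -> Rabs (F t) <= G t) -> Rabs (RInt F a b) <= l.
Proof.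
  intros Hab HF HG H.
  exact (norm_RInt_le F G a b (RInt F a b) l Hab H (RInt_correct F a b HF) HG).
Qed.

Lemma laplace_bound c : 0 < c -> exists K, 0 < K /\ forall n F B, (1 <= n)%nat -> 0 <= B ->
  ex_RInt F (- PI) PI -> (forall t, - PI <= t <= PI -> Rabs (F t) <= B * lapl c n t) ->
  Rabs (RInt F (- PI) PI) <= B * K / (INR n * sqrt (INR n)).
Proof.
  intros Hc. destruct (lapl_le c Hc) as (K & HK & H).
  pose proof PI_RGT_0 as Hpi.
  exists (K * PI). split; [pos|].
  intros n F B Hn HB HF HFB. assert (Hn0 : 0 < INR n) by (apply lt_0_INR; lia).
  assert (Hs : 0 < sqrt (INR n)) by pos.
  apply Rle_trans with (B * (K / INR n) * (2 * atan (sqrt (INR n) * PI) / sqrt (INR n))).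
  - apply (RInt_Rabs_le F (fun t => B * (K / INR n) * / (1 + INR n * t ^ 2))); [lra|exact HF| |].
    + apply (is_RInt_scal (fun t => / (1 + INR n * t ^ 2)) (- PI) PI (B * (K / INR n))).
      apply RInt_inv_quad; lra.
    + intros t Ht. apply Rle_trans with (1 := HFB t Ht). rewrite Rmult_assoc.
      apply Rmult_le_compat_l; [exact HB|]. apply H, Hn.
  - replace (B * (K * PI) / (INR n * sqrt (INR n))) with (B * (K / INR n) * (PI / sqrt (INR n))) by (field; lra).
    apply Rmult_le_compat_l.
    + apply Rmult_le_pos; [lra|]. apply Rlt_le, Rdiv_lt_0_compat; lra.
    + apply Rmult_le_compat_r; [pos|].
      pose proof (atan_bound (sqrt (INR n) * PI)). lra.
Qed.

Lemma ex_RInt_of_derivable (f : R -> R) a b : (forall x, ex_derive f x) -> ex_RInt f a b.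
Proof.
  intros H. apply (ex_RInt_continuous f). intros x _. apply (ex_derive_continuous f x), H.
Qed.

Definition gaussint (A : R) : R := RInt (fun x => exp (- x ^ 2 / 2)) (- A) A.

Lemma ex_RInt_gauss a b : ex_RInt (fun x => exp (- x ^ 2 / 2)) a b.
Proof. apply ex_RInt_of_derivable. intros x. auto_derive. auto. Qed.

Lemma gaussint_tail : exists K, 0 < K /\ forall A B, 0 < A <= B ->
  0 <= gaussint B - gaussint A <= K / A ^ 2.
Proof.
  destruct (poly_exp_bound (1 / 2)) as (K & HK & H); [lra|].
  exists (K * PI). pose proof PI_RGT_0. split; [pos|].
  intros A B [HA HAB]. set (e := fun x => exp (- x ^ 2 / 2)).
  assert (E : gaussint B - gaussint A = RInt e (- B) (- A) + RInt e A B).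
  { unfold gaussint. fold e. rewrite <- (RInt_Chasles e (- B) (- A) B) by apply ex_RInt_gauss.
    rewrite <- (RInt_Chasles e (- A) A B) by apply ex_RInt_gauss. unfold plus; simpl. ring. }
  assert (Hpos : forall x y, x <= y -> 0 <= RInt e x y).
  { intros x y Hxy. apply RInt_ge_0; [exact Hxy|apply ex_RInt_gauss|]. intros. apply Rlt_le, exp_pos. }
  rewrite E. split; [pose proof (Hpos (- B) (- A)); pose proof (Hpos A B); intuition lra|].
  set (q := fun x => K / A ^ 2 * / (1 + 1 * x ^ 2)).
  assert (Hq : forall x, 0 <= q x).
  { intros x. unfold q. apply Rmult_le_pos; [apply Rlt_le, Rdiv_lt_0_compat; [lra|apply pow_lt; lra]|].
    apply Rlt_le, Rinv_0_lt_compat. pose proof (pow2_ge_0 x). lra. }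
  assert (Hexq : forall x y, ex_RInt q x y).
  { intros. apply ex_RInt_of_derivable. intros z. unfold q. auto_derive. pose proof (pow2_ge_0 z). nra. }
  assert (Hle : forall x, A ^ 2 <= x ^ 2 -> e x <= q x).
  { intros x Hx. unfold q, e. specialize (H (x ^ 2) (pow2_ge_0 x)).
    replace (- x ^ 2 / 2) with (- (1 / 2) * x ^ 2) by field.
    assert (0 < A ^ 2) by pos.
    apply Rmult_le_reg_r with (A ^ 2 * (1 + 1 * x ^ 2)); [pos|].
    replace (K / A ^ 2 * / (1 + 1 * x ^ 2) * (A ^ 2 * (1 + 1 * x ^ 2))) with K by (field; nra).
    apply Rle_trans with (2 := H). rewrite Rmult_comm. apply Rmult_le_compat_r; [apply Rlt_le, exp_pos|].
    set (y := x ^ 2) in *. assert (0 <= y ^ 2) by nra. assert (0 <= y ^ 3) by pos.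
    assert (0 <= y ^ 4) by pos. nra. }
  apply Rle_trans with (RInt q (- B) (- A) + RInt q A B).
  - apply Rplus_le_compat.
    + apply RInt_le; [lra|apply ex_RInt_gauss|apply Hexq|]. intros x Hx. apply Hle. nra.
    + apply RInt_le; [lra|apply ex_RInt_gauss|apply Hexq|]. intros x Hx. apply Hle. nra.
  - apply Rle_trans with (RInt q (- B) B).
    + rewrite <- (RInt_Chasles q (- B) (- A) B) by apply Hexq.
      rewrite <- (RInt_Chasles q (- A) A B) by apply Hexq. unfold plus; simpl.
      assert (0 <= RInt q (- A) A) by (apply RInt_ge_0; [lra|apply Hexq|auto]). lra.
    + assert (HB : is_RInt q (- B) B (K / A ^ 2 * (2 * atan (sqrt 1 * B) / sqrt 1))).
      { apply (is_RInt_scal (fun t => / (1 + 1 * t ^ 2)) (- B) B (K / A ^ 2)). apply RInt_inv_quad; lra. }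
      rewrite (is_RInt_unique _ _ _ _ HB). rewrite sqrt_1, Rmult_1_l.
      pose proof (atan_bound B).
      replace (K * PI / A ^ 2) with (K / A ^ 2 * PI) by (field; lra).
      apply Rmult_le_compat_l; [pos|]. lra.
Qed.

(** The limit J stays abstract in Laplace's method; [gaussint_limit_value] identifies it as sqrt(2
    pi). *)
Lemma gaussint_lim : exists J K, 0 < J /\ 0 < K /\ forall A, 0 < A -> Rabs (gaussint A - J) <= K / A ^ 2.
Proof.
  destruct gaussint_tail as (K & HK & H).
  set (u := fun n => gaussint (INR n + 1)).
  assert (Hu : ex_finite_lim_seq u).
  { apply ex_finite_lim_seq_incr with (u O + K).
    - intros n. unfold u. rewrite S_INR. pose proof (pos_INR n).
      destruct (H (INR n + 1) (INR n + 1 + 1)); lra.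
    - intros n. unfold u. simpl INR. pose proof (pos_INR n).
      destruct (H (0 + 1) (INR n + 1)) as [_ H1]; [lra|]. rewrite Rplus_0_l, pow1, Rdiv_1_r in *. lra. }
  destruct Hu as [J HJ].
  assert (HJA : forall A, 0 < A -> 0 <= J - gaussint A <= K / A ^ 2).
  { intros A HA. destruct (INR_archimed 1 A Rlt_0_1) as [N HN]. rewrite Rmult_1_r in HN.
    assert (Hn : forall n, (N <= n)%nat -> 0 <= u n - gaussint A <= K / A ^ 2).
    { intros n Hn. apply H. apply le_INR in Hn. lra. }
    assert (Hl : is_lim_seq (fun n => u n - gaussint A) (J - gaussint A))
      by (apply is_lim_seq_minus'; [exact HJ|apply is_lim_seq_const]).
    split.
    - apply (is_lim_seq_le_loc (fun _ => 0) _ 0 _ (ex_intro _ N (fun n Hm => proj1 (Hn n Hm)))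
        (is_lim_seq_const 0) Hl).
    - apply (is_lim_seq_le_loc _ (fun _ => K / A ^ 2) _ (K / A ^ 2)
        (ex_intro _ N (fun n Hm => proj2 (Hn n Hm))) Hl (is_lim_seq_const _)). }
  exists J, K. split; [|split; [exact HK|]].
  - destruct (HJA 1 Rlt_0_1) as [H1 _].
    assert (0 < gaussint 1); [|lra]. unfold gaussint. apply RInt_gt_0; [lra| |].
    + intros; apply exp_pos.
    + intros x _. apply (ex_derive_continuous (fun x => exp (- x ^ 2 / 2))). auto_derive. auto.
  - intros A HA. destruct (HJA A HA). apply Rabs_le. lra.
Qed.

Lemma RInt_gauss_scale s A : 0 < s ->
  RInt (fun t => exp (- s * t ^ 2)) (- A) A = gaussint (sqrt (2 * s) * A) / sqrt (2 * s).
Proof.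
  intros Hs. assert (Hq : 0 < sqrt (2 * s)) by pos.
  assert (E : gaussint (sqrt (2 * s) * A) = sqrt (2 * s) * RInt (fun t => exp (- s * t ^ 2)) (- A) A).
  { unfold gaussint.
    rewrite <- (RInt_scal (fun t => exp (- s * t ^ 2))).
    2:{ apply ex_RInt_of_derivable. intros. auto_derive. auto. }
    transitivity (RInt (fun y => scal (sqrt (2 * s)) (exp (- (sqrt (2 * s) * y + 0) ^ 2 / 2))) (- A) A).
    - pose proof (RInt_comp_lin (fun x => exp (- x ^ 2 / 2)) (sqrt (2 * s)) 0 (- A) A (ex_RInt_gauss _ _)) as H.
      symmetry. etransitivity; [exact H|f_equal; ring].
    - apply RInt_ext. intros t _. f_equal. f_equal. rewrite Rplus_0_r, Rpow_mult_distr, pow2_sqrt by lra. field. }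
  apply Rmult_eq_reg_l with (sqrt (2 * s)); [|lra].
  transitivity (gaussint (sqrt (2 * s) * A)); [symmetry; exact E|field; lra].
Qed.

Definition cis (x : R) : C := (cos x, sin x).

Lemma cis_add x y : cis (x + y) = (cis x * cis y)%C.
Proof. unfold cis, Cmult; simpl. rewrite cos_plus, sin_plus. f_equal; ring. Qed.

Lemma cis_0 : cis 0 = 1.
Proof. unfold cis. rewrite cos_0, sin_0. reflexivity. Qed.

Lemma cis_pow x n : (cis x ^ n)%C = cis (INR n * x).
Proof.
  induction n as [|n IH]; [simpl; rewrite Rmult_0_l, cis_0; reflexivity|].
  rewrite Cpow_S, IH, <- cis_add, S_INR. f_equal. ring.
Qed.

Lemma Cmod_cis x : Cmod (cis x) = 1.
Proof.
  unfold Cmod, cis; simpl. pose proof (sin2_cos2 x). unfold Rsqr in H.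
  replace (cos x * (cos x * 1) + sin x * (sin x * 1)) with 1 by lra. apply sqrt_1.
Qed.

(** First-order expansion of z^n at the real point b. From n to n + 1 the remainder is multiplied by
    a and gains n b^(n-1) (a-b)^2. *)
Lemma Cpow_taylor (a : C) (b M : R) n : Cmod a <= M -> Rabs b <= M -> M <= 1 ->
  Cmod (a ^ n - RtoC (b ^ n) - RtoC (INR n * b ^ pred n) * (a - RtoC b))%C
  <= INR n ^ 2 * M ^ (n - 2) * Cmod (a - RtoC b)%C ^ 2.
Proof.
  intros Ha Hb HM1. pose proof (Cmod_ge_0 a). assert (HM : 0 <= M) by lra.
  set (dl := Cmod (a - RtoC b)%C). pose proof (Cmod_ge_0 (a - RtoC b)%C) as Hd. fold dl in Hd.
  induction n as [|n IH].
  - simpl. replace (1 - 1 - RtoC (0 * 1) * (a - RtoC b))%C with (RtoC 0) by (rewrite Rmult_0_l; ring).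
    rewrite Cmod_0. lra.
  - set (r := (a ^ n - RtoC (b ^ n) - RtoC (INR n * b ^ pred n) * (a - RtoC b))%C) in *.
    replace (a ^ S n - RtoC (b ^ S n) - RtoC (INR (S n) * b ^ pred (S n)) * (a - RtoC b))%C
      with (a * r + RtoC (INR n * b ^ pred n) * ((a - RtoC b) * (a - RtoC b)))%C.
    2:{ unfold r. rewrite Cpow_S, S_INR. simpl pred.
        rewrite !RtoC_mult, RtoC_plus.
        destruct n as [|n]; [simpl; rewrite !RtoC_mult; ring|].
        simpl pred. simpl (b ^ S (S n)). simpl (b ^ S n). rewrite !RtoC_mult. ring. }
    apply Rle_trans with (1 := Cmod_triangle _ _). rewrite !Cmod_mult, Cmod_R. fold dl.
    assert (Hr : Cmod a * Cmod r <= M * (INR n ^ 2 * M ^ (n - 2) * dl ^ 2))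
      by (apply Rmult_le_compat; auto using Cmod_ge_0).
    assert (Hb' : Rabs (INR n * b ^ pred n) <= INR n * M ^ pred n).
    { rewrite Rabs_mult, (Rabs_pos_eq (INR n)) by apply pos_INR. apply Rmult_le_compat_l; [apply pos_INR|].
      rewrite <- RPow_abs. apply pow_incr. split; [apply Rabs_pos|exact Hb]. }
    assert (Hb2 : Rabs (INR n * b ^ pred n) * (dl * dl) <= INR n * M ^ pred n * dl ^ 2).
    { replace (dl ^ 2) with (dl * dl) by ring. apply Rmult_le_compat_r; nra. }
    assert (Hd2 : 0 <= dl ^ 2) by nra.
    apply Rle_trans with (M * (INR n ^ 2 * M ^ (n - 2) * dl ^ 2) + INR n * M ^ pred n * dl ^ 2); [lra|].
    destruct n as [|[|n]].
    + simpl. lra.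
    + simpl. nra.
    + replace (S (S (S n)) - 2)%nat with (S n) by lia. replace (S (S n) - 2)%nat with n by lia.
      simpl pred. simpl (M ^ S n). rewrite (S_INR (S (S n))).
      set (x := INR (S (S n))). assert (0 <= x) by apply pos_INR.
      assert (0 <= M * M ^ n * dl ^ 2) by pos.
      nra.
Qed.

Lemma exp_pow x n : exp x ^ n = exp (INR n * x).
Proof.
  induction n as [|n IH]; [simpl; rewrite Rmult_0_l, exp_0; reflexivity|].
  rewrite S_INR. simpl. rewrite IH, <- exp_plus. f_equal. ring.
Qed.

Lemma Cmod_sqr (z : C) : Cmod z ^ 2 = fst z ^ 2 + snd z ^ 2.
Proof. unfold Cmod. rewrite pow2_sqrt; [reflexivity|]. pose proof (pow2_ge_0 (fst z)). pose proof (pow2_ge_0 (snd z)). lra. Qed.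

Lemma Re_le_Cmod (z : C) : Rabs (fst z) <= Cmod z.
Proof. rewrite <- (Rmax_Cmod z). apply Rmax_l. Qed.

(** phi(t)^n is expanded to first order at the Gaussian b = exp(-s t^2). In the real part, the
    imaginary part of phi, of order t^3, meets only sin(x t), so the linear term is O(n t^4) and not
    O(n |t|^3). This parity gain is what yields the error n^(-3/2) instead of 1/n. *)
Lemma laplace_pointwise phi c s K n x t :
  0 < c <= s -> 0 <= K -> - PI <= t <= PI ->
  Cmod (phi t) <= exp (- c * t ^ 2) ->
  Rabs (fst (phi t) - exp (- s * t ^ 2)) <= K * t ^ 4 ->
  Rabs (snd (phi t)) <= K * Rabs t ^ 3 ->
  Rabs (fst (phi t ^ n * cis (- (x * t)))%C - exp (- (s * INR n) * t ^ 2))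
  <= exp (32 * c) * (17 * K ^ 2 + 2 * K + 1) * (1 + x ^ 2) * lapl c n t.
Proof.
  intros [Hc Hcs] HK Ht Hphi Hre Him.
  assert (Ht2 : 0 <= t ^ 2 <= 16) by (pose proof PI_4; split; nra).
  set (a := phi t) in *. set (b := exp (- s * t ^ 2)) in *. set (M := exp (- c * t ^ 2)) in *.
  assert (HM0 : 0 < M) by apply exp_pos. assert (Hb0 : 0 < b) by apply exp_pos.
  assert (HM1 : M <= 1).
  { unfold M. rewrite <- exp_0. destruct (Rle_lt_or_eq_dec 0 (t ^ 2)) as [H|H]; [lra| |].
    - apply Rlt_le, exp_increasing. nra.
    - rewrite <- H. apply Req_le. f_equal. ring. }
  assert (HbM : b <= M).
  { unfold b, M. destruct (Rle_lt_or_eq_dec c s Hcs) as [H|H].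
    - destruct (Rle_lt_or_eq_dec 0 (t ^ 2)) as [H'|H']; [lra| |].
      + apply Rlt_le, exp_increasing. nra.
      + rewrite <- H'. apply Req_le. f_equal. ring.
    - rewrite H. lra. }
  (* The expansion loses up to two factors M = exp(-c t^2); since t^2 <= 16, restoring them costs at
     most exp(32 c). *)
  assert (HD : forall m, (n <= m + 2)%nat -> M ^ m <= exp (32 * c) * M ^ n).
  { intros m Hm.
    assert (H2 : 1 <= exp (32 * c) * M ^ 2).
    { unfold M. rewrite exp_pow, <- exp_plus, <- exp_0. simpl INR.
      destruct (Rle_lt_or_eq_dec 0 (32 * c + (1 + 1) * (- c * t ^ 2))) as [H|H]; [nra| |].
      - apply Rlt_le, exp_increasing, H.
      - rewrite <- H. lra. }
    apply Rle_trans with (exp (32 * c) * M ^ 2 * M ^ m).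
    - assert (0 < M ^ m) by pos. nra.
    - rewrite Rmult_assoc, <- pow_add. apply Rmult_le_compat_l; [apply Rlt_le, exp_pos|].
      replace (2 + m)%nat with (n + (2 + m - n))%nat by lia. rewrite pow_add.
      assert (0 < M ^ n) by pos.
      assert (M ^ (2 + m - n) <= 1) by (apply pow_unit_interval; lra). nra. }
  set (e := exp (32 * c)) in *. assert (He : 0 < e) by apply exp_pos.
  set (r := (a ^ n - RtoC (b ^ n) - RtoC (INR n * b ^ pred n) * (a - RtoC b))%C).
  assert (Hr : Cmod r <= INR n ^ 2 * M ^ (n - 2) * Cmod (a - RtoC b)%C ^ 2)
    by (apply Cpow_taylor; [exact Hphi|rewrite Rabs_pos_eq; lra|exact HM1]).
  assert (Hab : Cmod (a - RtoC b)%C ^ 2 <= 17 * K ^ 2 * t ^ 6).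
  { rewrite Cmod_sqr. simpl fst. simpl snd.
    replace (fst a + - b) with (fst a - b) by ring. replace (snd a + - 0) with (snd a) by ring.
    rewrite <- (pow2_abs (fst a - b)), <- (pow2_abs (snd a)).
    assert (H1 : Rabs (fst a - b) ^ 2 <= (K * t ^ 4) ^ 2) by (apply pow_incr; split; [apply Rabs_pos|exact Hre]).
    assert (H2 : Rabs (snd a) ^ 2 <= (K * Rabs t ^ 3) ^ 2) by (apply pow_incr; split; [apply Rabs_pos|exact Him]).
    replace ((K * Rabs t ^ 3) ^ 2) with (K ^ 2 * (Rabs t ^ 2) ^ 3) in H2 by ring. rewrite (pow2_abs t) in H2.
    replace ((K * t ^ 4) ^ 2) with (K ^ 2 * (t ^ 2) ^ 3 * t ^ 2) in H1 by ring.
    replace (t ^ 6) with ((t ^ 2) ^ 3) by ring.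
    assert (0 <= K ^ 2 * (t ^ 2) ^ 3) by pos.
    assert (K ^ 2 * (t ^ 2) ^ 3 * t ^ 2 <= K ^ 2 * (t ^ 2) ^ 3 * 16) by (apply Rmult_le_compat_l; lra). lra. }
  assert (Ebn : exp (- (s * INR n) * t ^ 2) = b ^ n) by (unfold b; rewrite exp_pow; f_equal; ring).
  rewrite Ebn.
  assert (Edec : fst (a ^ n * cis (- (x * t)))%C - b ^ n =
    fst (r * cis (- (x * t)))%C + (b ^ n * (cos (x * t) - 1) +
     INR n * b ^ pred n * ((fst a - b) * cos (x * t) + snd a * sin (x * t)))).
  { replace (a ^ n * cis (- (x * t)))%C with
      (r * cis (- (x * t)) + (RtoC (b ^ n) + RtoC (INR n * b ^ pred n) * (a - RtoC b)) * cis (- (x * t)))%C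
      by (unfold r; ring).
    unfold cis. rewrite cos_neg, sin_neg. simpl. ring. }
  rewrite Edec. clear Edec.
  assert (Hbn : 0 <= b ^ n <= M ^ n) by (split; [pos|apply pow_incr; lra]).
  assert (Hbp : 0 <= b ^ pred n <= e * M ^ n).
  { split; [pos|]. apply Rle_trans with (M ^ pred n); [apply pow_incr; lra|apply HD; lia]. }
  assert (HMn : 0 < M ^ n) by pos.
  assert (He1 : 1 <= e) by (unfold e; pose proof (exp_ineq1_le (32 * c)); lra).
  pose proof (pos_INR n) as Hn. pose proof (pow2_ge_0 x) as Hx.
  assert (B1 : Rabs (fst (r * cis (- (x * t)))%C) <= e * M ^ n * (17 * K ^ 2) * (INR n ^ 2 * t ^ 6)).
  { apply Rle_trans with (1 := Re_le_Cmod _). rewrite Cmod_mult, Cmod_cis, Rmult_1_r.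
    apply Rle_trans with (1 := Hr).
    replace (e * M ^ n * (17 * K ^ 2) * (INR n ^ 2 * t ^ 6)) with (INR n ^ 2 * (e * M ^ n) * (17 * K ^ 2 * t ^ 6)) by ring.
    apply Rmult_le_compat; [|apply pow2_ge_0| |exact Hab].
    - pos.
    - apply Rmult_le_compat_l; [apply pow2_ge_0|apply HD; lia]. }
  assert (B2 : Rabs (b ^ n * (cos (x * t) - 1)) <= e * M ^ n * (x ^ 2 * t ^ 2)).
  { rewrite Rabs_mult, (Rabs_pos_eq (b ^ n)) by lra. pose proof (cos_quad (x * t)) as Hcq.
    rewrite Rpow_mult_distr in Hcq.
    assert (0 <= x ^ 2 * t ^ 2) by pos.
    apply Rmult_le_compat; [lra|apply Rabs_pos| |lra]. nra. }
  assert (B3 : Rabs (INR n * b ^ pred n * ((fst a - b) * cos (x * t) + snd a * sin (x * t)))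
     <= e * M ^ n * (2 * K) * (1 + x ^ 2) * (INR n * t ^ 4)).
  { rewrite Rabs_mult, (Rabs_pos_eq (INR n * b ^ pred n)) by pos.
    assert (H3 : Rabs ((fst a - b) * cos (x * t) + snd a * sin (x * t)) <= 2 * K * (1 + x ^ 2) * t ^ 4).
    { apply Rle_trans with (1 := Rabs_triang _ _). rewrite !Rabs_mult.
      assert (Rabs (cos (x * t)) <= 1) by (apply Rabs_le; pose proof (COS_bound (x * t)); lra).
      pose proof (Rabs_sin_le (x * t)) as Hs. rewrite Rabs_mult in Hs.
      assert (T1 : Rabs (fst a - b) * Rabs (cos (x * t)) <= K * t ^ 4 * 1)
        by (apply Rmult_le_compat; auto using Rabs_pos).
      assert (T2 : Rabs (snd a) * Rabs (sin (x * t)) <= K * Rabs t ^ 3 * (Rabs x * Rabs t))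
        by (apply Rmult_le_compat; auto using Rabs_pos).
      replace (K * Rabs t ^ 3 * (Rabs x * Rabs t)) with (K * Rabs x * (Rabs t ^ 2) ^ 2) in T2 by ring.
      rewrite (pow2_abs t) in T2. replace ((t ^ 2) ^ 2) with (t ^ 4) in T2 by ring.
      assert (Rabs x <= 1 + x ^ 2) by (rewrite <- (pow2_abs x); pose proof (Rabs_pos x); nra).
      assert (0 <= K * t ^ 4) by (apply Rmult_le_pos; [lra|]; replace (t ^ 4) with ((t ^ 2) ^ 2) by ring; apply pow2_ge_0).
      nra. }
    replace (e * M ^ n * (2 * K) * (1 + x ^ 2) * (INR n * t ^ 4)) with ((INR n * (e * M ^ n)) * (2 * K * (1 + x ^ 2) * t ^ 4)) by ring.
    apply Rmult_le_compat; [pos|apply Rabs_pos| |exact H3].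
    apply Rmult_le_compat_l; lra. }
  unfold lapl. replace (exp (- c * INR n * t ^ 2)) with (M ^ n) by (unfold M; rewrite exp_pow; f_equal; ring).
  apply Rle_trans with (1 := Rabs_triang _ _).
  pose proof (Rabs_triang (b ^ n * (cos (x * t) - 1)) (INR n * b ^ pred n * ((fst a - b) * cos (x * t) + snd a * sin (x * t)))) as Htr.
  assert (T4 : 0 <= t ^ 4) by (replace (t ^ 4) with ((t ^ 2) ^ 2) by ring; apply pow2_ge_0).
  assert (T6 : 0 <= t ^ 6) by (replace (t ^ 6) with ((t ^ 2) ^ 3) by ring; pos).
  set (E := e * M ^ n) in *. assert (HE : 0 < E) by pos.
  set (u := INR n ^ 2 * t ^ 6) in *. assert (Hu : 0 <= u) by pos.
  set (v := INR n * t ^ 4) in *. assert (Hv : 0 <= v) by pos.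
  set (w := t ^ 2) in *. set (X := x ^ 2) in *.
  replace (e * (17 * K ^ 2 + 2 * K + 1) * (1 + X) * ((w + v + u) * M ^ n))
    with (E * ((17 * K ^ 2 + 2 * K + 1) * (1 + X) * (w + v + u))) by (unfold E; ring).
  apply Rle_trans with (E * (17 * K ^ 2 * u + X * w + 2 * K * (1 + X) * v)); [nra|].
  apply Rmult_le_compat_l; [lra|].
  assert (0 <= K ^ 2) by apply pow2_ge_0.
  set (L := 17 * K ^ 2 + 2 * K + 1). assert (HL : 0 <= L /\ 17 * K ^ 2 <= L /\ 1 <= L /\ 2 * K <= L) by (unfold L; repeat split; lra).
  destruct HL as (HL0 & HL1 & HL2 & HL3).
  assert (17 * K ^ 2 * u <= L * (1 + X) * u) by (apply Rmult_le_compat_r; nra).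
  assert (X * w <= L * (1 + X) * w) by (apply Rmult_le_compat_r; nra).
  assert (2 * K * (1 + X) * v <= L * (1 + X) * v) by (apply Rmult_le_compat_r; nra).
  lra.
Qed.

(** Stated for an abstract phi because it is applied twice: to the characteristic function of the
    walk and to cos(t/2)^2, whose powers integrate to 2 pi [gseq]. Comparing the two applications
    eliminates J. *)
Lemma laplace_C phi c s K J KJ :
  0 < c <= s -> 0 <= K -> 0 < KJ ->
  (forall A, 0 < A -> Rabs (gaussint A - J) <= KJ / A ^ 2) ->
  (forall t, - PI <= t <= PI -> Cmod (phi t) <= exp (- c * t ^ 2) /\
     Rabs (fst (phi t) - exp (- s * t ^ 2)) <= K * t ^ 4 /\
     Rabs (snd (phi t)) <= K * Rabs t ^ 3) ->
  exists B, 0 < B /\ forall n x, (1 <= n)%nat ->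
    let F := fun t => fst (phi t ^ n * cis (- (x * t)))%C in
    ex_RInt F (- PI) PI ->
    Rabs (RInt F (- PI) PI - J / sqrt (2 * s * INR n)) <= B * (1 + x ^ 2) / (INR n * sqrt (INR n)).
Proof.
  intros [Hc Hcs] HK HKJ HJ Hphi.
  destruct (laplace_bound c Hc) as (K1 & HK1 & HL).
  set (B1 := exp (32 * c) * (17 * K ^ 2 + 2 * K + 1)).
  assert (HB1 : 0 < B1).
  { apply Rmult_lt_0_compat; [apply exp_pos|]. pose proof (pow2_ge_0 K). lra. }
  pose proof PI_RGT_0 as Hpi.
  assert (Hs2 : 0 < sqrt (2 * s)) by pos.
  set (B2 := KJ / (2 * s * PI ^ 2 * sqrt (2 * s))).
  assert (Hpi2 : 0 < PI ^ 2) by pos.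
  assert (HB2 : 0 < B2).
  { apply Rdiv_lt_0_compat; [lra|]. apply Rmult_lt_0_compat; [|lra]. pos. }
  exists (B1 * K1 + B2). split; [assert (0 < B1 * K1) by pos; lra|].
  intros n x Hn F HF. assert (Hn0 : 0 < INR n) by (apply lt_0_INR; lia).
  assert (Hsn : 0 < sqrt (INR n)) by pos.
  pose proof (pow2_ge_0 x) as Hx.
  assert (Hexe : ex_RInt (fun t => exp (- (s * INR n) * t ^ 2)) (- PI) PI).
  { apply ex_RInt_of_derivable. intros. auto_derive. auto. }
  assert (E1 : Rabs (RInt F (- PI) PI - RInt (fun t => exp (- (s * INR n) * t ^ 2)) (- PI) PI)
    <= B1 * (1 + x ^ 2) * K1 / (INR n * sqrt (INR n))).
  { change (Rabs (minus (RInt F (- PI) PI) (RInt (fun t => exp (- (s * INR n) * t ^ 2)) (- PI) PI))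
      <= B1 * (1 + x ^ 2) * K1 / (INR n * sqrt (INR n))).
    rewrite <- RInt_minus by assumption.
    apply HL; [exact Hn|nra| |].
    - apply (ex_RInt_minus F); assumption.
    - intros t Ht. destruct (Hphi t Ht) as (H1 & H2 & H3).
      apply (laplace_pointwise phi c s K n x t); auto. }
  rewrite RInt_gauss_scale in E1 by pos.
  replace (2 * (s * INR n)) with (2 * s * INR n) in E1 by ring.
  assert (Hq : sqrt (2 * s * INR n) = sqrt (2 * s) * sqrt (INR n)) by (apply sqrt_mult; lra).
  assert (E2 : Rabs (gaussint (sqrt (2 * s * INR n) * PI) / sqrt (2 * s * INR n) - J / sqrt (2 * s * INR n))
    <= B2 / (INR n * sqrt (INR n))).
  { assert (Hq0 : 0 < sqrt (2 * s * INR n)) by (rewrite Hq; pos).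
    replace (gaussint (sqrt (2 * s * INR n) * PI) / sqrt (2 * s * INR n) - J / sqrt (2 * s * INR n))
      with ((gaussint (sqrt (2 * s * INR n) * PI) - J) * / sqrt (2 * s * INR n)) by (field; lra).
    rewrite Rabs_mult, (Rabs_pos_eq (/ _)) by pos.
    apply Rle_trans with (KJ / (sqrt (2 * s * INR n) * PI) ^ 2 * / sqrt (2 * s * INR n)).
    - apply Rmult_le_compat_r; [pos|].
      apply HJ. pos.
    - apply Req_le. rewrite Rpow_mult_distr, pow2_sqrt by pos.
      rewrite Hq. unfold B2. field. repeat split; lra. }
  replace (RInt F (- PI) PI - J / sqrt (2 * s * INR n)) with
    ((RInt F (- PI) PI - gaussint (sqrt (2 * s * INR n) * PI) / sqrt (2 * s * INR n)) +
     (gaussint (sqrt (2 * s * INR n) * PI) / sqrt (2 * s * INR n) - J / sqrt (2 * s * INR n))) by ring.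
  apply Rle_trans with (1 := Rabs_triang _ _).
  apply Rle_trans with (1 := Rplus_le_compat _ _ _ _ E1 E2).
  replace (B1 * (1 + x ^ 2) * K1 / (INR n * sqrt (INR n)) + B2 / (INR n * sqrt (INR n)))
    with ((B1 * (1 + x ^ 2) * K1 + B2) / (INR n * sqrt (INR n))) by (field; lra).
  apply Rmult_le_compat_r; [pos|]. nra.
Qed.

(** * Wallis integrals and the value of the Gaussian integral *)

Definition wallis (n : nat) : R := RInt (fun t => cos (t / 2) ^ n) (- PI) PI.

Lemma ex_RInt_cos_pow n a b : ex_RInt (fun t => cos (t / 2) ^ n) a b.
Proof. apply ex_RInt_of_derivable. intros. auto_derive. auto. Qed.

Lemma wallis_SS n : (INR n + 2) * wallis (S (S n)) = (INR n + 1) * wallis n.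
Proof.
  assert (H : is_RInt (fun t => (INR n + 2) / 2 * cos (t / 2) ^ S (S n) - (INR n + 1) / 2 * cos (t / 2) ^ n) (- PI) PI
    (minus (cos (PI / 2) ^ S n * sin (PI / 2)) (cos (- PI / 2) ^ S n * sin (- PI / 2)))).
  { apply (is_RInt_derive (fun t => cos (t / 2) ^ S n * sin (t / 2))).
    - intros t _. auto_derive; auto. pose proof (sin2_cos2 (t * / 2)) as E. unfold Rsqr in E.
      unfold Rdiv. set (cc := cos (t * / 2)) in *. set (ss := sin (t * / 2)) in *.
      change (match n with 0%nat => 1 | S _ => INR n + 1 end) with (INR (S n)). rewrite S_INR.
      assert (Es : ss * ss = 1 - cc * cc) by lra.
      simpl. match goal with |- ?l = _ => replace l with
        (- (INR n + 1) / 2 * cc ^ n * (ss * ss) + cc * cc * cc ^ n / 2) by field end.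
      rewrite Es. field.
    - intros t _. apply (ex_derive_continuous (fun t => (INR n + 2) / 2 * cos (t / 2) ^ S (S n) - (INR n + 1) / 2 * cos (t / 2) ^ n)).
      auto_derive. auto. }
  assert (H' : is_RInt (fun t => (INR n + 2) / 2 * cos (t / 2) ^ S (S n) - (INR n + 1) / 2 * cos (t / 2) ^ n) (- PI) PI
    ((INR n + 2) / 2 * wallis (S (S n)) - (INR n + 1) / 2 * wallis n)).
  { apply (is_RInt_minus (fun t => (INR n + 2) / 2 * cos (t / 2) ^ S (S n)) (fun t => (INR n + 1) / 2 * cos (t / 2) ^ n)).
    - apply (is_RInt_scal (fun t => cos (t / 2) ^ S (S n)) _ _ ((INR n + 2) / 2)). apply (@RInt_correct R_CompleteNormedModule), ex_RInt_cos_pow.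
    - apply (is_RInt_scal (fun t => cos (t / 2) ^ n) _ _ ((INR n + 1) / 2)). apply (@RInt_correct R_CompleteNormedModule), ex_RInt_cos_pow. }
  assert (E := eq_trans (eq_sym (is_RInt_unique _ _ _ _ H)) (is_RInt_unique _ _ _ _ H')).
  clear H H'. rename E into H'.
  replace (- PI / 2) with (- (PI / 2)) in H' by field. rewrite cos_neg, cos_PI2 in H'.
  unfold minus, plus, opp in H'; simpl in H'. lra.
Qed.

Lemma wallis_decr n : wallis (S n) <= wallis n.
Proof.
  pose proof PI_RGT_0. apply RInt_le; [lra|apply ex_RInt_cos_pow..|].
  intros t Ht. assert (0 <= cos (t / 2)) by (apply cos_ge_0; lra). pose proof (COS_bound (t / 2)).
  simpl. assert (0 <= cos (t / 2) ^ n) by pos. nra.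
Qed.

Lemma wallis_even n : wallis (2 * n) = 2 * PI * gseq n.
Proof.
  induction n as [|n IH].
  - unfold wallis. simpl. rewrite RInt_const. unfold scal; simpl; unfold mult; simpl. ring.
  - replace (2 * S n)%nat with (S (S (2 * n))) by lia.
    pose proof (wallis_SS (2 * n)) as H. rewrite mult_INR, IH in H. simpl (INR 2) in H.
    rewrite gseq_S. pose proof (pos_INR n).
    apply Rmult_eq_reg_l with ((1 + 1) * INR n + 2); [|lra]. rewrite H. field. lra.
Qed.

Lemma wallis_odd n : wallis (2 * n + 1) * ((2 * INR n + 1) * gseq n) = 4.
Proof.
  induction n as [|n IH].
  - assert (H : is_RInt (fun t => cos (t / 2) ^ 1) (- PI) PI (minus (2 * sin (PI / 2)) (2 * sin (- PI / 2)))).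
    { apply (is_RInt_derive (fun t => 2 * sin (t / 2))).
      - intros t _. auto_derive; auto. field_simplify. reflexivity.
      - intros t _. apply (ex_derive_continuous (fun t => cos (t / 2) ^ 1)). auto_derive. auto. }
    unfold wallis. simpl Nat.add. rewrite (is_RInt_unique _ _ _ _ H).
    replace (- PI / 2) with (- (PI / 2)) by field. rewrite sin_neg, sin_PI2.
    unfold minus, plus, opp; simpl. ring.
  - replace (2 * S n + 1)%nat with (S (S (2 * n + 1))) by lia.
    pose proof (wallis_SS (2 * n + 1)) as H. rewrite plus_INR, mult_INR in H. simpl (INR 2) in H. simpl (INR 1) in H.
    rewrite gseq_S, S_INR. pose proof (pos_INR n). rewrite <- IH.
    replace (wallis (S (S (2 * n + 1)))) with ((2 * INR n + 2) / (2 * INR n + 3) * wallis (2 * n + 1)).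
    + field. lra.
    + apply Rmult_eq_reg_l with ((1 + 1) * INR n + 1 + 2); [|lra]. rewrite H. field. lra.
Qed.

(** Wallis' argument: the integrals are nonincreasing in the exponent, the even ones are 2 pi
    [gseq n] and the odd ones 4 / ((2n+1) [gseq n]), so consecutive ones bound pi from both
    sides. *)
Lemma gseq_sqr_pi_ge n : 2 <= PI * (2 * INR n + 1) * gseq n ^ 2.
Proof.
  pose proof (wallis_odd n). pose proof (wallis_even n). pose proof (wallis_decr (2 * n)).
  rewrite <- Nat.add_1_r in H1. pose proof (pos_INR n). pose proof (gseq_pos n).
  assert (0 < (2 * INR n + 1) * gseq n) by pos. nra.
Qed.

Lemma gseq_sqr_pi_le n : PI * INR n * gseq n ^ 2 <= 1.
Proof.
  destruct n as [|n]; [simpl; lra|].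
  pose proof (wallis_odd n) as H. pose proof (wallis_even (S n)) as H0. pose proof (wallis_decr (2 * n + 1)) as H1.
  replace (S (2 * n + 1)) with (2 * S n)%nat in H1 by lia. pose proof (pos_INR n). pose proof (gseq_pos n).
  assert (E : (2 * INR n + 1) * gseq n = 2 * INR (S n) * gseq (S n)).
  { rewrite gseq_S, S_INR. field. lra. }
  rewrite E in H. pose proof (gseq_pos (S n)). assert (0 < INR (S n)) by (apply lt_0_INR; lia).
  assert (0 < 2 * INR (S n) * gseq (S n)) by pos. nra.
Qed.

Lemma gseq_sqr_lim : is_lim_seq (fun n => PI * INR n * gseq n ^ 2) 1.
Proof.
  apply (is_lim_seq_le_le (fun n => 1 - PI / 2 * gseq n) _ (fun _ => 1)).
  - intros n. split; [|apply gseq_sqr_pi_le].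
    pose proof (gseq_sqr_pi_ge n). pose proof (gseq_le_1 n). pose proof (gseq_pos n). pose proof PI_RGT_0.
    assert (PI * gseq n ^ 2 <= PI * gseq n) by (apply Rmult_le_compat_l; nra). nra.
  - replace (Finite 1) with (Finite (1 - PI / 2 * 0)) by (f_equal; ring).
    apply is_lim_seq_minus'; [apply is_lim_seq_const|].
    apply is_lim_seq_mult'; [apply is_lim_seq_const|apply is_lim_seq_gseq].
  - apply is_lim_seq_const.
Qed.

Lemma inv_pow32_le n : (1 <= n)%nat -> / (INR n * sqrt (INR n)) <= 4 * kap1 n.
Proof.
  intros Hn. assert (H1 : 1 <= INR n) by (apply (le_INR 1); lia).
  assert (Hs : 0 < sqrt (INR n)) by pos.
  pose proof (gseq_pos n) as Hg. pose proof (gseq_sqr_ge_S (pred n)) as Hge. replace (S (pred n)) with n in Hge by lia.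
  assert (Hgs : 1 <= 2 * (gseq n * sqrt (INR n))).
  { assert (E : 1 <= (2 * (gseq n * sqrt (INR n))) ^ 2).
    { rewrite !Rpow_mult_distr, pow2_sqrt by lra. lra. }
    assert (0 < gseq n * sqrt (INR n)) by pos. nra. }
  unfold kap1. apply Rmult_le_reg_r with (INR n * sqrt (INR n)); [pos|].
  rewrite Rinv_l by pos.
  replace (4 * (gseq n / (INR n + 1)) * (INR n * sqrt (INR n)))
    with (2 * (gseq n * sqrt (INR n)) * (2 * INR n / (INR n + 1))) by (field; lra).
  assert (1 <= 2 * INR n / (INR n + 1)) by (apply Rle_div_r; lra). nra.
Qed.

(** Laplace's method for cos(t/2)^2 = (1 + cos t)/2, the characteristic function of a law of
    variance 1/2, whence s = 1/4; the decay rate 1/36 is half the constant of [one_minus_cos_ge]. *)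
Lemma gseq_laplace J KJ : 0 < KJ -> (forall A, 0 < A -> Rabs (gaussint A - J) <= KJ / A ^ 2) ->
  exists B, 0 < B /\ forall n, (1 <= n)%nat ->
    Rabs (2 * PI * gseq n - J / sqrt (INR n / 2)) <= B / (INR n * sqrt (INR n)).
Proof.
  intros HKJ HJ.
  destruct (laplace_C (fun t => RtoC (cos (t / 2) ^ 2)) (1 / 36) (1 / 4) 1 J KJ) as (B & HB & H);
    [lra|lra|exact HKJ|exact HJ| |].
  - intros t Ht. pose proof (one_minus_cos_ge t Ht) as Hc.
    assert (E : cos (t / 2) ^ 2 = (1 + cos t) / 2).
    { replace t with (2 * (t / 2)) at 2 by field. rewrite cos_2a_cos. field. }
    rewrite E. repeat split.
    + rewrite Cmod_R. pose proof (COS_bound t). rewrite Rabs_pos_eq by lra.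
      pose proof (exp_ineq1_le (- (1 / 36) * t ^ 2)). lra.
    + simpl fst. pose proof (cos_quartic t) as H1. pose proof (exp_neg_quad (t ^ 2 / 4)) as H2.
      specialize (H2 ltac:(pose proof (pow2_ge_0 t); lra)).
      replace (- (1 / 4) * t ^ 2) with (- (t ^ 2 / 4)) by field.
      replace ((1 + cos t) / 2 - exp (- (t ^ 2 / 4))) with
        ((cos t - (1 - t ^ 2 / 2)) / 2 - (exp (- (t ^ 2 / 4)) - (1 - t ^ 2 / 4))) by field.
      apply Rabs_le_between in H1. apply Rabs_le_between in H2. apply Rabs_le.
      assert (0 <= t ^ 4) by (replace (t ^ 4) with ((t ^ 2) ^ 2) by ring; apply pow2_ge_0).
      replace ((t ^ 2 / 4) ^ 2 / 2) with (t ^ 4 / 32) in H2 by field. lra.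
    + simpl snd. rewrite Rabs_R0. pose proof (pow_le (Rabs t) 3 (Rabs_pos t)). lra.
  - exists (B * (1 + 0 ^ 2)). split; [lra|]. intros n Hn. specialize (H n 0 Hn). cbv zeta in H.
    assert (E : forall t, fst (RtoC (cos (t / 2) ^ 2) ^ n * cis (- (0 * t)))%C = cos (t / 2) ^ (2 * n)).
    { intros t. replace (- (0 * t)) with 0 by ring. rewrite cis_0, Cmult_1_r, <- RtoC_pow, <- pow_mult. reflexivity. }
    rewrite (RInt_ext _ _ _ _ (fun t _ => E t)) in H. fold (wallis (2 * n)) in H. rewrite wallis_even in H.
    replace (2 * (1 / 4) * INR n) with (INR n / 2) in H by field. apply H.
    apply (ex_RInt_ext (fun t => cos (t / 2) ^ (2 * n))); [intros; symmetry; apply E|apply ex_RInt_cos_pow].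
Qed.

(** Laplace's method gives the limit of [gseq n] sqrt n in terms of J, Wallis' formula gives its
    square in terms of pi. *)
Lemma gaussint_limit_value J KJ : 0 < J -> 0 < KJ ->
  (forall A, 0 < A -> Rabs (gaussint A - J) <= KJ / A ^ 2) -> J = sqrt (2 * PI).
Proof.
  intros HJ0 HKJ HJ. destruct (gseq_laplace J KJ HKJ HJ) as (B & HB & H).
  pose proof PI_RGT_0 as Hpi.
  assert (Hlim : is_lim_seq (fun n => 2 * PI * gseq n * sqrt (INR n)) (J * sqrt 2)).
  { apply (is_lim_seq_ext (fun n => J * sqrt 2 + (2 * PI * gseq n * sqrt (INR n) - J * sqrt 2))); [intros; ring|].
    replace (Finite (J * sqrt 2)) with (Finite (J * sqrt 2 + 0)) by (f_equal; ring).
    apply is_lim_seq_plus'; [apply is_lim_seq_const|]. apply is_lim_seq_abs_0.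
    apply (is_lim_seq_le_le_loc (fun _ => 0) _ (fun n => B / INR n)).
    - exists 1%nat. intros n Hn. split; [apply Rabs_pos|].
      assert (H0 : 0 < INR n) by (apply lt_0_INR; lia). assert (Hs : 0 < sqrt (INR n)) by pos.
      specialize (H n Hn). rewrite sqrt_div in H by lra.
      assert (H2 : 0 < sqrt 2) by pos.
      replace (2 * PI * gseq n * sqrt (INR n) - J * sqrt 2)
        with ((2 * PI * gseq n - J / (sqrt (INR n) / sqrt 2)) * sqrt (INR n)) by (field; lra).
      rewrite Rabs_mult, (Rabs_pos_eq (sqrt (INR n))) by lra.
      apply Rle_trans with (B / (INR n * sqrt (INR n)) * sqrt (INR n)).
      + apply Rmult_le_compat_r; lra.
      + apply Req_le. field. lra.
    - apply is_lim_seq_const.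
    - apply (is_lim_seq_div _ _ B p_infty _ (is_lim_seq_const B) is_lim_seq_INR); [discriminate|].
      unfold is_Rbar_div, is_Rbar_mult; simpl. f_equal. f_equal. ring. }
  assert (Hsq : is_lim_seq (fun n => 4 * PI * (PI * INR n * gseq n ^ 2)) ((J * sqrt 2) * (J * sqrt 2))).
  { apply (is_lim_seq_ext (fun n => (2 * PI * gseq n * sqrt (INR n)) * (2 * PI * gseq n * sqrt (INR n)))).
    - intros n. replace (INR n) with (sqrt (INR n) * sqrt (INR n)) at 3 by (apply sqrt_sqrt, pos_INR). ring.
    - apply is_lim_seq_mult'; exact Hlim. }
  assert (Hsq' : is_lim_seq (fun n => 4 * PI * (PI * INR n * gseq n ^ 2)) (4 * PI * 1))
    by (apply is_lim_seq_mult'; [apply is_lim_seq_const|apply gseq_sqr_lim]).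
  apply is_lim_seq_unique in Hsq. apply is_lim_seq_unique in Hsq'. rewrite Hsq in Hsq'.
  injection Hsq' as E. rewrite <- (sqrt_pow2 J) by lra. f_equal.
  assert (sqrt 2 * sqrt 2 = 2) by (apply sqrt_sqrt; lra). nra.
Qed.

(** * Local limit theorem *)

Lemma C_ring : ring_theory (RtoC 0) (RtoC 1) Cplus Cmult Cminus Copp eq.
Proof. split; intros; ring. Qed.

Definition Csum : (nat -> C) -> nat -> C := fsum Cplus.

Lemma Csum_S f n : Csum f (S n) = (Csum f n + f (S n))%C.
Proof. reflexivity. Qed.

Lemma fst_Csum f n : fst (Csum f n) = sum_f_R0 (fun i => fst (f i)) n.
Proof. induction n as [|n IH]; [reflexivity|]. rewrite Csum_S, tech5, <- IH. reflexivity. Qed.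

Lemma snd_Csum f n : snd (Csum f n) = sum_f_R0 (fun i => snd (f i)) n.
Proof. induction n as [|n IH]; [reflexivity|]. rewrite Csum_S, tech5, <- IH. reflexivity. Qed.

Lemma Csum_scal x f n : Csum (fun i => x * f i)%C n = (x * Csum f n)%C.
Proof. exact (fsum_scal _ _ _ _ _ _ C_ring x f n). Qed.

Lemma Csum_ext f g n : (forall i, (i <= n)%nat -> f i = g i) -> Csum f n = Csum g n.
Proof. exact (fsum_ext Cplus f g n). Qed.

Definition Cev (a : nat -> R) (N : nat) (z : C) : C := Csum (fun i => RtoC (a i) * z ^ i)%C N.

Lemma Cev_conv a b N M z : low (S N) a -> low (S M) b ->
  Cev (conv a b) (N + M) z = (Cev a N z * Cev b M z)%C.
Proof.
  intros Ha Hb. unfold Cev, Csum.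
  rewrite <- (fsum_conv_low _ _ _ _ _ _ C_ring).
  - apply fsum_ext. intros n _. unfold fconv, conv.
    assert (H : forall m, (m <= n)%nat ->
      (RtoC (sum_f_R0 (fun i => (a i * b (n - i)%nat)%R) m) * z ^ n)%C =
      fsum Cplus (fun i => (RtoC (a i) * z ^ i) * (RtoC (b (n - i)%nat) * z ^ (n - i)))%C m).
    { induction m as [|m IH]; intros Hm.
      - simpl. rewrite Nat.sub_0_r, RtoC_mult. ring.
      - change (fsum Cplus (fun i => (RtoC (a i) * z ^ i) * (RtoC (b (n - i)%nat) * z ^ (n - i)))%C (S m))
          with (fsum Cplus (fun i => (RtoC (a i) * z ^ i) * (RtoC (b (n - i)%nat) * z ^ (n - i)))%C m +
            (RtoC (a (S m)) * z ^ (S m)) * (RtoC (b (n - S m)%nat) * z ^ (n - S m)))%C.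
        rewrite <- IH by lia. rewrite tech5, RtoC_plus, RtoC_mult.
        replace (z ^ n)%C with (z ^ S m * z ^ (n - S m))%C at 1; [|rewrite <- Cpow_add_r; f_equal; lia].
        replace (z ^ n)%C with (z ^ S m * z ^ (n - S m))%C; [ring|rewrite <- Cpow_add_r; f_equal; lia]. }
    apply H. lia.
  - intros i Hi. rewrite Ha by lia. ring.
  - intros i Hi. rewrite Hb by lia. ring.
Qed.

Lemma low_seqpow a N n : low (S N) a -> low (S (N * n)) (seqpow a n).
Proof.
  intros Ha. induction n as [|n IH].
  - intros i Hi. simpl. unfold seq1. destruct (Nat.eqb_spec i 0); [lia|reflexivity].
  - intros k Hk. apply (sum_zero (fun i => a i * seqpow a n (k - i)%nat)). intros i Hi.
    destruct (Nat.le_gt_cases i N) as [Hc|Hc].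
    + rewrite (IH (k - i)%nat) by lia. ring.
    + rewrite Ha by lia. ring.
Qed.

Lemma Cev_pow a N n z : low (S N) a -> Cev (seqpow a n) (N * n) z = (Cev a N z ^ n)%C.
Proof.
  intros Ha. induction n as [|n IH].
  - rewrite Nat.mul_0_r. unfold Cev, Csum, seqpow, seq1. simpl. ring.
  - rewrite Nat.mul_succ_r, Nat.add_comm. simpl seqpow.
    rewrite Cev_conv, IH by (auto using low_seqpow). reflexivity.
Qed.

Lemma cos_INR_PI n : cos (INR n * PI) ^ 2 = 1 /\ sin (INR n * PI) = 0.
Proof.
  induction n as [|n [IH1 IH2]]; [simpl; rewrite Rmult_0_l, cos_0, sin_0; lra|].
  rewrite S_INR. replace ((INR n + 1) * PI) with (INR n * PI + PI) by ring.
  rewrite neg_cos, neg_sin, IH2. split; [rewrite <- IH1; ring|ring].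
Qed.

Lemma RInt_cos_freq i j :
  is_RInt (fun t => cos ((INR i - INR j) * t)) (- PI) PI (if Nat.eqb i j then 2 * PI else 0).
Proof.
  destruct (Nat.eqb_spec i j) as [->|Hij].
  - apply (is_RInt_ext (fun _ => 1)).
    + intros t _. rewrite Rminus_diag, Rmult_0_l, cos_0. reflexivity.
    + replace (2 * PI) with (scal (PI - - PI) 1) by (unfold scal; simpl; unfold mult; simpl; ring).
      apply (@is_RInt_const R_NormedModule).
  - assert (Hm : INR i - INR j <> 0) by (intros H; apply Hij, INR_eq; lra).
    assert (Hs : sin ((INR i - INR j) * PI) = 0).
    { rewrite Rmult_minus_distr_r, sin_minus.
      rewrite (proj2 (cos_INR_PI i)), (proj2 (cos_INR_PI j)). ring. }
    replace 0 with (minus (sin ((INR i - INR j) * PI) / (INR i - INR j)) (sin ((INR i - INR j) * - PI) / (INR i - INR j))).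
    + apply (is_RInt_derive (fun t => sin ((INR i - INR j) * t) / (INR i - INR j))).
      * intros t _. auto_derive; auto. field. exact Hm.
      * intros t _. apply (ex_derive_continuous (fun t => cos ((INR i - INR j) * t))). auto_derive. auto.
    + replace ((INR i - INR j) * - PI) with (- ((INR i - INR j) * PI)) by ring.
      rewrite sin_neg, Hs. unfold minus, plus, opp; simpl. field. exact Hm.
Qed.

Lemma is_RInt_sum_f_R0 (f : nat -> R -> R) (l : nat -> R) a b n :
  (forall i, is_RInt (f i) a b (l i)) ->
  is_RInt (fun t => sum_f_R0 (fun i => f i t) n) a b (sum_f_R0 l n).
Proof.
  intros H. induction n as [|n IH]; [apply H|].
  apply (is_RInt_plus (fun t => sum_f_R0 (fun i => f i t) n) (f (S n)) a b _ _ IH (H (S n))).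
Qed.

Section LocalLimit.
Variables (c N : nat) (pi : nat -> R).
Hypothesis pi_nonneg : forall i, 0 <= pi i.
Hypothesis pi_low : low (S N) pi.
Hypothesis pi_sum : sum_f_R0 pi N = 1.
Hypothesis pi_mean : sum_f_R0 (fun i => (INR i - INR c) * pi i) N = 0.
Hypothesis pi_0 : 0 < pi O.
Hypothesis pi_aperiodic : forall g, (2 <= g)%nat -> exists i, (i <= N)%nat /\ pi i <> 0 /\ ~ Nat.divide g i.

Definition variance : R := sum_f_R0 (fun i => (INR i - INR c) ^ 2 * pi i) N.

Definition charfun (t : R) : C := Csum (fun i => RtoC (pi i) * cis ((INR i - INR c) * t))%C N.

Lemma charfun_Cev t : charfun t = (cis (- (INR c * t)) * Cev pi N (cis t))%C.
Proof.
  unfold charfun, Cev. rewrite <- Csum_scal. apply Csum_ext. intros i _.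
  rewrite cis_pow. replace ((INR i - INR c) * t) with (- (INR c * t) + INR i * t) by ring.
  rewrite cis_add. ring.
Qed.

Lemma charfun_pow t n j :
  fst (charfun t ^ n * cis (- ((INR j - INR (c * n)) * t)))%C =
  sum_f_R0 (fun i => seqpow pi n i * cos ((INR i - INR j) * t)) (N * n).
Proof.
  rewrite charfun_Cev, Cpow_mult_l, <- Cev_pow, cis_pow by exact pi_low.
  unfold Cev. rewrite <- Cmult_assoc, (Cmult_comm _ (cis _)), Cmult_assoc, <- Csum_scal, fst_Csum.
  apply sum_eq. intros i _.
  replace (cis (INR n * - (INR c * t)) * cis (- ((INR j - INR (c * n)) * t)) * (RtoC (seqpow pi n i) * cis t ^ i))%C
    with (RtoC (seqpow pi n i) * (cis (INR n * - (INR c * t)) * cis (- ((INR j - INR (c * n)) * t)) * cis t ^ i))%C by ring.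
  rewrite cis_pow, <- !cis_add. rewrite mult_INR.
  replace (INR n * - (INR c * t) + - ((INR j - INR c * INR n) * t) + INR i * t) with ((INR i - INR j) * t) by ring.
  unfold cis; simpl. ring.
Qed.

Lemma seqpow_fourier n j :
  is_RInt (fun t => fst (charfun t ^ n * cis (- ((INR j - INR (c * n)) * t)))%C) (- PI) PI
    (2 * PI * seqpow pi n j).
Proof.
  apply (is_RInt_ext (fun t => sum_f_R0 (fun i => seqpow pi n i * cos ((INR i - INR j) * t)) (N * n))).
  { intros t _. symmetry. apply charfun_pow. }
  replace (2 * PI * seqpow pi n j)
    with (sum_f_R0 (fun i => seqpow pi n i * (if Nat.eqb i j then 2 * PI else 0)) (N * n)).
  - apply (is_RInt_sum_f_R0 (fun i t => seqpow pi n i * cos ((INR i - INR j) * t))).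
    intros i. apply (is_RInt_scal (fun t => cos ((INR i - INR j) * t)) _ _ (seqpow pi n i)), RInt_cos_freq.
  - destruct (Nat.le_gt_cases j (N * n)) as [Hj|Hj].
    2:{ rewrite (low_seqpow pi N n pi_low) by lia. rewrite sum_zero; [ring|].
        intros i Hi. destruct (Nat.eqb_spec i j); [lia|ring]. }
    clear - Hj. revert Hj. generalize (N * n)%nat as m. induction m as [|m IH]; intros Hj.
    + replace j with O by lia. simpl. ring.
    + rewrite tech5. destruct (Nat.eqb_spec (S m) j) as [<-|Hne].
      * rewrite sum_zero; [ring|]. intros i Hi. destruct (Nat.eqb_spec i (S m)); [lia|ring].
      * rewrite IH by lia. ring.
Qed.

(** Symmetrization: |phi|^2 is the characteristic function of the difference of two independent
    steps. *)
Lemma Cmod_charfun_sqr t :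
  1 - Cmod (charfun t) ^ 2 =
  sum_f_R0 (fun i => sum_f_R0 (fun j => pi i * pi j * (1 - cos ((INR i - INR j) * t))) N) N.
Proof.
  assert (Hprod : forall f g, sum_f_R0 f N * sum_f_R0 g N = sum_f_R0 (fun i => sum_f_R0 (fun j => f i * g j) N) N).
  { intros f g. rewrite Rmult_comm, scal_sum. apply sum_eq. intros i _. rewrite scal_sum.
    apply sum_eq. intros; ring. }
  rewrite Cmod_sqr. unfold charfun. rewrite fst_Csum, snd_Csum.
  replace 1 with (sum_f_R0 pi N * sum_f_R0 pi N) at 1 by (rewrite pi_sum; ring).
  simpl pow. rewrite !Rmult_1_r, !Hprod.
  rewrite <- plus_sum, <- minus_sum. apply sum_eq. intros i _.
  rewrite <- plus_sum, <- minus_sum. apply sum_eq. intros j _.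
  replace ((INR i - INR j) * t) with ((INR i - INR c) * t - (INR j - INR c) * t) by ring.
  rewrite cos_minus. simpl. ring.
Qed.

Lemma sum_ge_term (f : nat -> R) n k : (forall i, 0 <= f i) -> (k <= n)%nat -> f k <= sum_f_R0 f n.
Proof.
  intros Hf Hk. induction Hk as [|n Hk IH].
  - destruct k; simpl; [lra|]. pose proof (cond_pos_sum f k Hf). lra.
  - rewrite tech5. specialize (Hf (S n)). lra.
Qed.

Lemma Cmod_charfun_term t i : (i <= N)%nat ->
  pi i * pi O * (1 - cos (INR i * t)) <= 1 - Cmod (charfun t) ^ 2.
Proof.
  intros Hi. rewrite Cmod_charfun_sqr.
  assert (Hp : forall i j, 0 <= pi i * pi j * (1 - cos ((INR i - INR j) * t))).
  { intros i' j'. pose proof (COS_bound ((INR i' - INR j') * t)).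
    pos. }
  replace (INR i * t) with ((INR i - INR 0) * t) by (simpl; ring).
  apply Rle_trans with (sum_f_R0 (fun j => pi i * pi j * (1 - cos ((INR i - INR j) * t))) N).
  - apply (sum_ge_term (fun j => pi i * pi j * (1 - cos ((INR i - INR j) * t)))); [auto|lia].
  - apply (sum_ge_term (fun i => sum_f_R0 (fun j => pi i * pi j * (1 - cos ((INR i - INR j) * t))) N)); [|exact Hi].
    intros k. apply cond_pos_sum. auto.
Qed.

(** A quantitative form of the implication from |phi(t)| = 1 to m t in 2 pi Z. *)
Definition controlled (m : nat) : Prop :=
  exists K, 0 <= K /\ forall t, 1 - cos (INR m * t) <= K * (1 - Cmod (charfun t) ^ 2).

Lemma controlled_sub a b : (b <= a)%nat -> controlled a -> controlled b -> controlled (a - b).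
Proof.
  intros Hab (K & HK & Ha) (L & HL & Hb). exists (2 * K + 2 * L). split; [lra|]. intros t.
  rewrite minus_INR, Rmult_minus_distr_r by exact Hab.
  apply Rle_trans with (1 := one_minus_cos_minus _ _). specialize (Ha t). specialize (Hb t). lra.
Qed.

Lemma controlled_mod a g : (0 < g)%nat -> controlled a -> controlled g -> controlled (a mod g).
Proof.
  intros Hg Ha Hgc. induction a as [a IH] using lt_wf_ind.
  destruct (Nat.lt_ge_cases a g) as [Hlt|Hge]; [rewrite Nat.mod_small; auto|].
  replace (a mod g)%nat with ((a - g) mod g)%nat.
  - apply IH; [lia|]. apply controlled_sub; auto.
  - replace a with ((a - g) + 1 * g)%nat at 2 by lia. rewrite Nat.Div0.mod_add. reflexivity.
Qed.

(* The frequencies controlled by |phi| form a subgroup of Z, so aperiodicity puts 1 among them. *)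
Lemma controlled_1 : controlled 1.
Proof.
  assert (Hc : forall i, (i <= N)%nat -> pi i <> 0 -> controlled i).
  { intros i Hi Hp. assert (Hpi : 0 < pi i) by (destruct (pi_nonneg i); [assumption|congruence]).
    assert (Hpp : 0 < pi i * pi O) by pos.
    exists (/ (pi i * pi O)). split; [pos|].
    intros t. pose proof (Cmod_charfun_term t i Hi).
    apply Rmult_le_reg_l with (pi i * pi O); [exact Hpp|].
    rewrite <- Rmult_assoc, Rinv_r, Rmult_1_l by lra. assumption. }
  assert (Hex : exists g, (0 < g)%nat /\ controlled g).
  { destruct (pi_aperiodic 2) as (i & Hi & Hp & Hd); [lia|]. exists i. split; [|auto].
    destruct i; [exfalso; apply Hd; exists O; lia|lia]. }
  assert (Hmin : exists g, (0 < g)%nat /\ controlled g /\ forall h, (0 < h)%nat -> controlled h -> (g <= h)%nat).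
  { destruct Hex as (g & Hg & Hcg). revert Hg Hcg. induction g as [g IH] using lt_wf_ind. intros Hg Hcg.
    destruct (Classical_Prop.classic (exists h, (0 < h < g)%nat /\ controlled h)) as [(h & Hh & Hch)|Hno].
    - apply (IH h); [lia|lia|exact Hch].
    - exists g. split; [exact Hg|]. split; [exact Hcg|]. intros h Hh Hch.
      destruct (Nat.le_gt_cases g h); [assumption|]. exfalso. apply Hno. exists h. split; [lia|exact Hch]. }
  destruct Hmin as (g & Hg & Hcg & Hming).
  destruct (Nat.le_gt_cases 2 g) as [H2|H1]; [|replace 1%nat with g by lia; exact Hcg].
  exfalso. destruct (pi_aperiodic g H2) as (i & Hi & Hp & Hd). apply Hd.
  apply Nat.Lcm0.mod_divide. destruct (Nat.eq_dec (i mod g) 0) as [|Hne]; [assumption|].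
  specialize (Hming (i mod g)%nat ltac:(lia) (controlled_mod i g Hg (Hc i Hi Hp) Hcg)).
  pose proof (Nat.mod_upper_bound i g). lia.
Qed.

(** Control of the frequency 1 gives 1 - |phi|^2 >= t^2 / (18 (K+1)); the square root halves the
    rate, whence 36. *)
Lemma charfun_decay : exists k, 0 < k /\ forall t, - PI <= t <= PI -> Cmod (charfun t) <= exp (- k * t ^ 2).
Proof.
  destruct controlled_1 as (K & HK & H). exists (/ (36 * (K + 1))).
  assert (Hk : 0 < / (36 * (K + 1))) by pos. split; [exact Hk|].
  intros t Ht. specialize (H t). simpl INR in H. rewrite Rmult_1_l in H.
  pose proof (one_minus_cos_ge t Ht) as Hc. pose proof (pow2_ge_0 t).
  assert (H1 : 0 <= 1 - Cmod (charfun t) ^ 2).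
  { pose proof (Cmod_charfun_term t 0 ltac:(lia)) as H1. simpl INR in H1. rewrite Rmult_0_l, cos_0 in H1. lra. }
  assert (H2 : t ^ 2 / (18 * (K + 1)) <= 1 - Cmod (charfun t) ^ 2).
  { apply Rle_div_l; [lra|]. set (X := 1 - Cmod (charfun t) ^ 2) in *.
    replace (X * (18 * (K + 1))) with (18 * (K * X) + 18 * X) by ring. lra. }
  assert (H3 : Cmod (charfun t) ^ 2 <= exp (- / (36 * (K + 1)) * t ^ 2) ^ 2).
  { rewrite exp_pow. simpl INR. pose proof (exp_ineq1_le ((1 + 1) * (- / (36 * (K + 1)) * t ^ 2))) as He.
    replace ((1 + 1) * (- / (36 * (K + 1)) * t ^ 2)) with (- (t ^ 2 / (18 * (K + 1)))) in * by (field; lra). lra. }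
  pose proof (exp_pos (- / (36 * (K + 1)) * t ^ 2)). pose proof (Cmod_ge_0 (charfun t)). nra.
Qed.

Lemma variance_pos : 0 < variance.
Proof.
  destruct (Nat.eq_dec c 0) as [Hc|Hc].
  - destruct (pi_aperiodic 2) as (i & Hi & Hp & Hd); [lia|].
    apply Rlt_le_trans with ((INR i - INR c) ^ 2 * pi i).
    + assert (0 < pi i) by (destruct (pi_nonneg i); [assumption|congruence]).
      assert (0 < INR i - INR c); [|pos]. rewrite Hc. simpl. rewrite Rminus_0_r. apply lt_0_INR.
      destruct i; [exfalso; apply Hd; exists O; lia|lia].
    + apply (sum_ge_term (fun i => (INR i - INR c) ^ 2 * pi i)); [|exact Hi].
      intros j. apply Rmult_le_pos; [apply pow2_ge_0|auto].
  - apply Rlt_le_trans with ((INR 0 - INR c) ^ 2 * pi O).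
    + assert (0 < INR c) by (apply lt_0_INR; lia). simpl (INR 0).
      replace ((0 - INR c) ^ 2) with (INR c ^ 2) by ring.
      pos.
    + apply (sum_ge_term (fun i => (INR i - INR c) ^ 2 * pi i)); [|lia].
      intros j. apply Rmult_le_pos; [apply pow2_ge_0|auto].
Qed.

Lemma charfun_expansion : exists K, 0 <= K /\ forall t,
  Rabs (fst (charfun t) - exp (- (variance / 2) * t ^ 2)) <= K * t ^ 4 /\
  Rabs (snd (charfun t)) <= K * Rabs t ^ 3.
Proof.
  set (K1 := sum_f_R0 (fun i => (INR i - INR c) ^ 4 / 24 * pi i) N).
  set (K2 := sum_f_R0 (fun i => Rabs (INR i - INR c) ^ 3 / 6 * pi i) N).
  assert (HK1 : 0 <= K1).
  { apply cond_pos_sum. intros i. apply Rmult_le_pos; [|auto].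
    replace ((INR i - INR c) ^ 4) with (((INR i - INR c) ^ 2) ^ 2) by ring. pose proof (pow2_ge_0 ((INR i - INR c) ^ 2)). lra. }
  assert (HK2 : 0 <= K2).
  { apply cond_pos_sum. intros i. apply Rmult_le_pos; [|auto].
    pose proof (pow_le (Rabs (INR i - INR c)) 3 (Rabs_pos _)). lra. }
  pose proof variance_pos as Hv.
  exists (K1 + variance ^ 2 + K2). split; [pose proof (pow2_ge_0 variance); lra|]. intros t.
  unfold charfun. rewrite fst_Csum, snd_Csum. pose proof (pow2_ge_0 t).
  assert (H4 : 0 <= t ^ 4) by (replace (t ^ 4) with ((t ^ 2) ^ 2) by ring; apply pow2_ge_0).
  assert (H3 : 0 <= Rabs t ^ 3) by pos. split.
  - assert (E1 : Rabs (sum_f_R0 (fun i => fst (RtoC (pi i) * cis ((INR i - INR c) * t))%C) N - (1 - variance / 2 * t ^ 2)) <= K1 * t ^ 4).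
    { rewrite <- pi_sum. unfold variance. replace (sum_f_R0 (fun i => (INR i - INR c) ^ 2 * pi i) N / 2 * t ^ 2)
        with ((t ^ 2 / 2) * sum_f_R0 (fun i => (INR i - INR c) ^ 2 * pi i) N) by field.
      unfold K1. rewrite (Rmult_comm _ (t ^ 4)), !scal_sum, <- !minus_sum. apply Rabs_sum_le. intros i _.
      replace (fst (RtoC (pi i) * cis ((INR i - INR c) * t))%C - (pi i - (INR i - INR c) ^ 2 * pi i * (t ^ 2 / 2)))
        with (pi i * (cos ((INR i - INR c) * t) - (1 - ((INR i - INR c) * t) ^ 2 / 2))) by (unfold cis; simpl; field).
      rewrite Rabs_mult, (Rabs_pos_eq (pi i)) by auto.
      replace ((INR i - INR c) ^ 4 / 24 * pi i * t ^ 4) with (pi i * (((INR i - INR c) * t) ^ 4 / 24)) by field.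
      apply Rmult_le_compat_l; [auto|apply cos_quartic]. }
    pose proof (exp_neg_quad (variance / 2 * t ^ 2) ltac:(pos)) as E2.
    replace (- (variance / 2) * t ^ 2) with (- (variance / 2 * t ^ 2)) by ring.
    replace ((variance / 2 * t ^ 2) ^ 2 / 2) with (variance ^ 2 / 8 * t ^ 4) in E2 by field.
    apply Rabs_le_between in E1. apply Rabs_le_between in E2. apply Rabs_le. pose proof (pow2_ge_0 variance).
    assert (0 <= variance ^ 2 * t ^ 4) by pos.
    assert (0 <= K2 * t ^ 4) by pos. split; lra.
  - apply Rle_trans with (K2 * Rabs t ^ 3).
    + replace (sum_f_R0 (fun i => snd (RtoC (pi i) * cis ((INR i - INR c) * t))%C) N)
        with (sum_f_R0 (fun i => pi i * (sin ((INR i - INR c) * t) - (INR i - INR c) * t)) N).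
      * unfold K2. rewrite (Rmult_comm _ (Rabs t ^ 3)), scal_sum. apply Rabs_sum_le. intros i _.
        rewrite Rabs_mult, (Rabs_pos_eq (pi i)) by auto.
        replace (Rabs (INR i - INR c) ^ 3 / 6 * pi i * Rabs t ^ 3) with (pi i * (Rabs ((INR i - INR c) * t) ^ 3 / 6))
          by (rewrite Rabs_mult; field).
        apply Rmult_le_compat_l; [auto|apply sin_cubic].
      * replace (sum_f_R0 (fun i => snd (RtoC (pi i) * cis ((INR i - INR c) * t))%C) N)
          with (sum_f_R0 (fun i => snd (RtoC (pi i) * cis ((INR i - INR c) * t))%C) N - t * sum_f_R0 (fun i => (INR i - INR c) * pi i) N)
          by (rewrite pi_mean; ring).
        rewrite scal_sum, <- minus_sum. apply sum_eq. intros i _. unfold cis; simpl. ring.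
    + apply Rmult_le_compat_r; [lra|]. pose proof (pow2_ge_0 variance). lra.
Qed.

(* Comparing with [gseq] instead of [1 / sqrt (2 pi n)] makes the Gaussian integral cancel. *)
Lemma local_limit : exists B, 0 < B /\ forall n k,
  Rabs (seqpow pi n (k + c * n) - / sqrt (2 * variance) * gseq n) <= B * (1 + INR k ^ 2) * kap1 n.
Proof.
  destruct gaussint_lim as (J & KJ & HJ0 & HKJ & HJ).
  destruct charfun_decay as (k0 & Hk0 & Hdec). destruct charfun_expansion as (K & HK & Hexp).
  pose proof variance_pos as Hv.
  (* [laplace_C] asks for a decay rate not exceeding that of the Gaussian it compares with. *)
  set (k1 := Rmin k0 (variance / 2)).
  assert (Hk1 : 0 < k1 <= variance / 2) by (split; [apply Rmin_glb_lt; lra|apply Rmin_r]).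
  destruct (laplace_C charfun k1 (variance / 2) K J KJ Hk1 HK HKJ HJ) as (B1 & HB1 & H1).
  { intros t Ht. split; [|apply Hexp]. apply Rle_trans with (1 := Hdec t Ht).
    destruct (Rle_lt_or_eq_dec (- k0 * t ^ 2) (- k1 * t ^ 2)) as [Hlt|Heq].
    - pose proof (Rmin_l k0 (variance / 2)). fold k1 in H. pose proof (pow2_ge_0 t). nra.
    - apply Rlt_le, exp_increasing, Hlt.
    - rewrite Heq. lra. }
  destruct (gseq_laplace J KJ HKJ HJ) as (B2 & HB2 & H2).
  pose proof PI_RGT_0 as Hpi.
  assert (Hsv : 0 < sqrt (2 * variance)) by pos.
  assert (Hsv' : 0 < sqrt variance) by pos.
  set (ga := / sqrt (2 * variance)). assert (Hga : 0 < ga) by pos.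
  exists (4 * (B1 + ga * B2) + 1 + ga). split; [assert (0 < ga * B2) by pos; lra|].
  intros n k. pose proof (pow2_ge_0 (INR k)) as Hk2.
  destruct (Nat.eq_dec n 0) as [->|Hn0].
  { simpl seqpow. unfold seq1. replace (kap1 0) with 1 by (unfold kap1; simpl; field). simpl (gseq 0).
    assert (Rabs ((if (k + c * 0 =? 0)%nat then 1 else 0) - ga * 1) <= 1 + ga).
    { destruct (k + c * 0 =? 0)%nat; apply Rabs_le; lra. }
    assert (0 < ga * B2) by pos. nra. }
  assert (Hn : (1 <= n)%nat) by lia. assert (Hn1 : 0 < INR n) by (apply lt_0_INR; lia).
  assert (Hsn : 0 < sqrt (INR n)) by pos.
  pose proof (inv_pow32_le n Hn) as Hinv. pose proof (kap1_pos n) as Hkap.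
  pose proof (seqpow_fourier n (k + c * n)) as HF.
  assert (E : INR (k + c * n) - INR (c * n) = INR k) by (rewrite plus_INR; ring). rewrite E in HF.
  specialize (H1 n (INR k) Hn). cbv zeta in H1. specialize (H1 (ex_intro _ _ HF)).
  rewrite (is_RInt_unique _ _ _ _ HF) in H1. specialize (H2 n Hn).
  assert (E2 : ga * (J / sqrt (INR n / 2)) = J / sqrt (2 * (variance / 2) * INR n)).
  { replace (2 * (variance / 2) * INR n) with ((2 * variance) * (INR n / 2)) by field.
    unfold ga. rewrite (sqrt_mult (2 * variance)) by lra.
    assert (0 < sqrt (INR n / 2)) by pos. field. lra. }
  assert (Hsn2 : 0 < sqrt (INR n / 2)) by pos.
  set (ww := seqpow pi n (k + c * n)) in *.
  replace (ww - ga * gseq n) with (((2 * PI * ww - J / sqrt (2 * (variance / 2) * INR n))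
    - ga * (2 * PI * gseq n - J / sqrt (INR n / 2))) / (2 * PI)) by (rewrite <- E2; field; lra).
  unfold Rdiv at 1. rewrite Rabs_mult, (Rabs_pos_eq (/ (2 * PI))) by pos.
  apply Rle_trans with ((B1 * (1 + INR k ^ 2) / (INR n * sqrt (INR n)) + ga * (B2 / (INR n * sqrt (INR n)))) * 1).
  + apply Rmult_le_compat; [apply Rabs_pos|pos| |].
    * unfold Rminus at 1. apply Rle_trans with (1 := Rabs_triang _ _). rewrite Rabs_Ropp, Rabs_mult, (Rabs_pos_eq ga) by lra.
      apply Rplus_le_compat; [exact H1|]. apply Rmult_le_compat_l; lra.
    * rewrite <- Rinv_1. apply Rinv_le_contravar; [lra|]. pose proof PI2_3_2. lra.
  + rewrite Rmult_1_r.
    replace (B1 * (1 + INR k ^ 2) / (INR n * sqrt (INR n)) + ga * (B2 / (INR n * sqrt (INR n))))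
      with ((B1 * (1 + INR k ^ 2) + ga * B2) * / (INR n * sqrt (INR n))) by (field; lra).
    assert (0 < ga * B2) by pos.
    apply Rle_trans with ((B1 * (1 + INR k ^ 2) + ga * B2) * (4 * kap1 n)).
    * apply Rmult_le_compat_l; [nra|exact Hinv].
    * assert (B1 * (1 + INR k ^ 2) + ga * B2 <= (B1 + ga * B2) * (1 + INR k ^ 2)) by nra.
      apply Rle_trans with ((B1 + ga * B2) * (1 + INR k ^ 2) * (4 * kap1 n)); [apply Rmult_le_compat_r; lra|].
      replace ((4 * (B1 + ga * B2) + 1 + ga) * (1 + INR k ^ 2) * kap1 n)
        with ((B1 + ga * B2) * (1 + INR k ^ 2) * (4 * kap1 n) + (1 + ga) * (1 + INR k ^ 2) * kap1 n) by ring.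
      assert (0 <= (1 + ga) * (1 + INR k ^ 2) * kap1 n) by pos. lra.
Qed.

End LocalLimit.

(** * Meanders *)

Lemma zsum_shift (c d : nat) (f : Z -> R) :
  zsum (- Z.of_nat c) (Z.of_nat d) f = sum_f_R0 (fun i => f (Z.of_nat i - Z.of_nat c)%Z) (c + d).
Proof.
  unfold zsum. replace (Z.to_nat (Z.of_nat d - - Z.of_nat c + 1)) with (S (c + d)) by lia.
  assert (H : forall g n s, fold_right Rplus 0 (map g (List.seq s (S n))) = sum_f_R0 (fun i => g (s + i)%nat) n).
  { intros g n. induction n as [|n IH]; intros s.
    - simpl. rewrite Nat.add_0_r. ring.
    - rewrite decomp_sum by lia. change (List.seq s (S (S n))) with (s :: List.seq (S s) (S n)).
      simpl map. simpl fold_right. simpl pred. rewrite Nat.add_0_r. f_equal.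
      etransitivity; [apply (IH (S s))|]. apply sum_eq. intros. f_equal. lia. }
  rewrite H. apply sum_eq. intros i _. f_equal. lia.
Qed.

Lemma sum_pad (f : nat -> R) N M :
  (N <= M)%nat -> (forall i, (N < i)%nat -> f i = 0) -> sum_f_R0 f M = sum_f_R0 f N.
Proof.
  intros H Hf. induction H as [|M H IH]; [reflexivity|]. rewrite tech5, IH, Hf by lia. ring.
Qed.

(** The coefficients of sqrt(1-z) satisfy n w_n = -g_(n-1)/2, so n a_n close to ga g_n means that
    a_n is close to -2 ga w_n. The value a_0 is absorbed by the constant. *)
Lemma InA_of_theta a ga B :
  (forall n, (1 <= n)%nat -> Rabs (INR n * a n - ga * gseq n) <= B * kap1 n) -> InA a (- 2 * ga).
Proof.
  intros H.
  assert (HB : 0 <= B).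
  { specialize (H 1%nat ltac:(lia)). pose proof (Rabs_pos (INR 1 * a 1%nat - ga * gseq 1)).
    pose proof (kap1_pos 1). nra. }
  exists (Rabs (a O + 2 * ga) + 2 * B + 8 * Rabs ga). intros n. pose proof (Rabs_pos ga) as Hga.
  pose proof (Rabs_pos (a O + 2 * ga)) as Ha0.
  destruct n as [|n].
  - rewrite wseq_0. replace (kap 0) with 1 by (unfold kap; simpl; field).
    replace (a 0%nat - -2 * ga * 1) with (a 0%nat + 2 * ga) by ring. lra.
  - specialize (H (S n) ltac:(lia)). rewrite wseq_S.
    assert (Hn : 0 < INR (S n)) by (apply lt_0_INR; lia).
    pose proof (gseq_diff n) as Hd. pose proof (kap1_gseq n) as Hk. rewrite <- S_INR in Hk.
    replace (a (S n) - -2 * ga * (- kap1 n / 2))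
      with ((INR (S n) * a (S n) - ga * gseq (S n)) / INR (S n) - ga * (kap1 n / 2) / INR (S n)).
    2:{ rewrite <- Hd, <- Hk. field. lra. }
    unfold Rminus at 1. apply Rle_trans with (1 := Rabs_triang _ _). rewrite Rabs_Ropp.
    unfold Rdiv. rewrite !Rabs_mult, (Rabs_pos_eq (/ INR (S n))) by pos.
    rewrite (Rabs_pos_eq (kap1 n)) by (apply Rlt_le, kap1_pos). rewrite (Rabs_pos_eq (/ 2)) by lra.
    assert (Hk1 : kap1 (S n) * / INR (S n) <= 2 * kap (S n)).
    { rewrite <- kap_kap1. pose proof (kap_pos (S n)). apply Rle_div_l; [exact Hn|].
      assert (1 <= INR (S n)) by (apply (le_INR 1); lia). nra. }
    assert (Hk2 : kap1 n * / INR (S n) <= 8 * kap (S n)).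
    { rewrite <- kap_kap1. rewrite S_INR. pose proof (pos_INR n). rewrite Rmult_assoc, Rinv_r, Rmult_1_r by lra.
      apply kap_doubling. lia. }
    assert (T1 : Rabs (INR (S n) * a (S n) - ga * gseq (S n)) * / INR (S n) <= B * (2 * kap (S n))).
    { apply Rle_trans with (B * kap1 (S n) * / INR (S n)).
      - apply Rmult_le_compat_r; [pos|exact H].
      - rewrite Rmult_assoc. apply Rmult_le_compat_l; assumption. }
    assert (T2 : Rabs ga * (kap1 n * / 2) * / INR (S n) <= Rabs ga * (4 * kap (S n))).
    { rewrite Rmult_assoc. apply Rmult_le_compat_l; [assumption|]. lra. }
    pose proof (kap_pos (S n)). assert (0 <= Rabs (a O + 2 * ga) * kap (S n)) by pos.
    assert (0 <= Rabs ga * kap (S n)) by pos. lra.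
Qed.

Lemma InA_sum (f : nat -> nat -> R) N :
  (forall i, (i <= N)%nat -> exists al, InA (f i) al) ->
  exists al, InA (fun n => sum_f_R0 (fun i => f i n) N) al.
Proof.
  induction N as [|N IH]; intros H.
  - destruct (H O ltac:(lia)) as [al Hal]. exists al. exact Hal.
  - destruct IH as [al Hal]; [intros; apply H; lia|]. destruct (H (S N) ltac:(lia)) as [be Hbe].
    exists (al + be). exact (InA_add _ _ _ _ Hal Hbe).
Qed.

Lemma CV_radius_ge (a : nat -> R) r M :
  (forall n, Rabs (a n * r ^ n) <= M) -> Rbar_le r (CV_radius a).
Proof.
  intros H. destruct (CV_radius_bounded a) as [Hub _]. apply Hub. exists M. exact H.
Qed.

Lemma ex_series_quad_geom x : 0 <= x < 1 -> ex_series (fun k => (1 + INR k ^ 2) * x ^ k).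
Proof.
  intros Hx.
  assert (Hcv : Rbar_lt (Rabs x) (CV_radius (PS_derive (PS_derive seqones)))).
  { rewrite !CV_radius_derive. apply Rbar_lt_le_trans with 1.
    - simpl. rewrite Rabs_pos_eq; lra.
    - apply CV_radius_ge with 1. intros n. unfold seqones. rewrite pow1, Rmult_1_r, Rabs_R1. lra. }
  apply CV_disk_inside in Hcv. apply ex_series_dominated with (2 := Hcv). intros k.
  unfold PS_derive, seqones. pose proof (pos_INR k). pose proof (pow_le x k (proj1 Hx)).
  rewrite Rabs_pos_eq by (apply Rmult_le_pos; nra).
  rewrite Rabs_pos_eq.
  - apply Rmult_le_compat_r; [assumption|]. rewrite !S_INR. nra.
  - apply Rmult_le_pos; [|assumption]. rewrite !S_INR. nra.
Qed.

Lemma pow_div a b n : (a / b) ^ n = a ^ n / b ^ n.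
Proof. unfold Rdiv. rewrite Rpow_mult_distr, pow_inv. reflexivity. Qed.

Lemma sum_exchange (f : nat -> nat -> R) n m :
  sum_f_R0 (fun i => sum_f_R0 (fun j => f i j) m) n = sum_f_R0 (fun j => sum_f_R0 (fun i => f i j) n) m.
Proof.
  induction n as [|n IH]; [reflexivity|].
  rewrite tech5, IH, <- plus_sum. reflexivity.
Qed.

Lemma conv_weight x a b n :
  conv (fun i => a i * x ^ i) (fun i => b i * x ^ i) n = conv a b n * x ^ n.
Proof.
  unfold conv. rewrite (Rmult_comm (sum_f_R0 _ n)), scal_sum. apply sum_eq. intros i Hi.
  replace (x ^ n) with (x ^ i * x ^ (n - i)) by (rewrite <- pow_add; f_equal; lia). ring.
Qed.

Lemma sum_conv_low a b N M : low (S N) a -> low (S M) b ->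
  sum_f_R0 (conv a b) (N + M) = sum_f_R0 a N * sum_f_R0 b M.
Proof. exact (fsum_conv_low _ _ _ _ _ _ R_ring a b N M). Qed.

Section Walk.
Variables (c d : nat) (p : Z -> R) (q tau : R).
Hypothesis Hc : (1 <= c)%nat.
Hypothesis Hd : (1 <= d)%nat.
Hypothesis p_nonneg : forall i, (- Z.of_nat c <= i <= Z.of_nat d)%Z -> 0 <= p i.
Hypothesis p_c : p (- Z.of_nat c)%Z <> 0.
Hypothesis p_d : p (Z.of_nat d) <> 0.
Hypothesis p_aper : aperiodic c d p.
Hypothesis Hq : 0 < q.
Hypothesis Htau : 0 < tau.
Hypothesis Hcrit : Derive (Pfun c d p) tau = 0.

Local Notation Ptau := (Pfun c d p tau).
Local Notation rho := (/ Ptau).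

(** * Jump polynomial, recursion of meanders and tilted jump law *)

Definition pshift (i : nat) : R := if Nat.leb i (c + d) then p (Z.of_nat i - Z.of_nat c)%Z else 0.

Lemma pshift_nonneg i : 0 <= pshift i.
Proof. unfold pshift. destruct (Nat.leb_spec i (c + d)); [apply p_nonneg; lia|lra]. Qed.

Lemma pshift_low : low (S (c + d)) pshift.
Proof. intros i Hi. unfold pshift. destruct (Nat.leb_spec i (c + d)); [lia|reflexivity]. Qed.

Lemma pshift_0 : 0 < pshift O.
Proof.
  destruct (pshift_nonneg 0) as [H|H]; [exact H|]. exfalso. apply p_c.
  unfold pshift in H. simpl in H. symmetry. exact H.
Qed.

Lemma pshift_last : 0 < pshift (c + d).
Proof.
  destruct (pshift_nonneg (c + d)) as [H|H]; [exact H|]. exfalso. apply p_d.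
  unfold pshift in H. rewrite Nat.leb_refl in H. rewrite H. f_equal. lia.
Qed.

Lemma Pfun_eq u : 0 < u -> Pfun c d p u = sum_f_R0 (fun i => pshift i * (u ^ i / u ^ c)) (c + d).
Proof.
  intros Hu. unfold Pfun. rewrite zsum_shift. apply sum_eq. intros i Hi.
  unfold pshift. destruct (Nat.leb_spec i (c + d)); [|lia]. f_equal.
  replace (Z.of_nat i - Z.of_nat c)%Z with (Z.of_nat i + - Z.of_nat c)%Z by lia.
  rewrite powerRZ_add, powerRZ_neg' , <- !pow_powerRZ by lra. reflexivity.
Qed.

Lemma mea_S n k : mea c d p (S n) k = conv pshift (mea c d p n) (k + c)%nat.
Proof.
  simpl mea. rewrite zsum_shift. unfold conv.
  set (f := fun i => if Nat.leb i (k + c) then pshift i * mea c d p n (k + c - i)%nat else 0).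
  transitivity (sum_f_R0 f (c + d)).
  - apply sum_eq. intros i Hi. unfold f, pshift.
    destruct (Nat.leb_spec i (c + d)); [|lia].
    destruct (Nat.leb_spec i (k + c)), (Z.leb_spec 0 (Z.of_nat k - (Z.of_nat i - Z.of_nat c))); try lia; [|reflexivity].
    do 2 f_equal. lia.
  - transitivity (sum_f_R0 f (k + c)).
    + destruct (Nat.le_ge_cases (c + d) (k + c)); [symmetry|]; apply sum_pad; auto; intros i Hi; unfold f.
      * rewrite pshift_low by lia. destruct (i <=? k + c)%nat; ring.
      * destruct (Nat.leb_spec i (k + c)); [lia|reflexivity].
    + apply sum_eq. intros i Hi. unfold f. destruct (Nat.leb_spec i (k + c)); [reflexivity|lia].
Qed.

Lemma mea_nonneg n k : 0 <= mea c d p n k.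
Proof.
  revert k. induction n as [|n IH]; intros k.
  - simpl. destruct (k =? 0)%nat; lra.
  - rewrite mea_S. apply conv_nonneg; [apply pshift_nonneg|exact IH].
Qed.

Lemma mea_low n : low (S (d * n)) (mea c d p n).
Proof.
  induction n as [|n IH]; intros k Hk.
  - simpl. destruct (Nat.eqb_spec k 0); [lia|reflexivity].
  - rewrite mea_S. apply (sum_zero (fun i => pshift i * mea c d p n (k + c - i)%nat)). intros i Hi.
    destruct (Nat.le_gt_cases i (c + d)).
    + rewrite IH by lia. ring.
    + rewrite pshift_low by lia. ring.
Qed.

Lemma Ptau_pos : 0 < Ptau.
Proof.
  rewrite Pfun_eq by exact Htau.
  assert (Hp : forall i, 0 <= pshift i * (tau ^ i / tau ^ c)).
  { intros i. apply Rmult_le_pos; [apply pshift_nonneg|]. pos. }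
  apply Rlt_le_trans with (pshift O * (tau ^ 0 / tau ^ c)).
  - apply Rmult_lt_0_compat; [apply pshift_0|apply Rdiv_lt_0_compat; apply pow_lt, Htau].
  - apply (sum_ge_term (fun i => pshift i * (tau ^ i / tau ^ c))); [exact Hp|lia].
Qed.

Lemma rho_pos : 0 < rho.
Proof. apply Rinv_0_lt_compat, Ptau_pos. Qed.

Definition tilt (i : nat) : R := pshift i * (tau ^ i / tau ^ c) * rho.

Lemma tilt_nonneg i : 0 <= tilt i.
Proof.
  pose proof rho_pos. apply Rmult_le_pos; [apply Rmult_le_pos; [apply pshift_nonneg|]|lra].
  pos.
Qed.

Lemma tilt_low : low (S (c + d)) tilt.
Proof. intros i Hi. unfold tilt. rewrite pshift_low by lia. ring. Qed.

Lemma tilt_sum : sum_f_R0 tilt (c + d) = 1.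
Proof.
  unfold tilt. rewrite <- scal_sum, <- Pfun_eq by exact Htau. field. pose proof Ptau_pos. lra.
Qed.

Lemma tilt_0 : 0 < tilt O.
Proof.
  apply Rmult_lt_0_compat; [apply Rmult_lt_0_compat; [apply pshift_0|]|apply rho_pos].
  pos.
Qed.

Lemma is_derive_ratio_pow i u : 0 < u ->
  is_derive (fun u => u ^ i / u ^ c) u ((INR i - INR c) * (u ^ i / u ^ c) / u).
Proof.
  intros Hu. assert (Hi : forall j, INR j * u ^ pred j = INR j * u ^ j / u).
  { intros [|j]; simpl pred; [simpl; field; lra|]. simpl pow. field. lra. }
  pose proof (pow_lt u c Hu) as Hpc.
  auto_derive; [apply pow_nonzero; lra|]. rewrite !Rmult_1_l, !Hi. field. lra.
Qed.

Definition Pfun1 (u : R) := sum_f_R0 (fun i => pshift i * ((INR i - INR c) * (u ^ i / u ^ c) / u)) (c + d).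
Definition Pfun2 (u : R) :=
  sum_f_R0 (fun i => pshift i * ((INR i - INR c) * (INR i - INR c - 1) * (u ^ i / u ^ c) / u ^ 2)) (c + d).

Lemma is_derive_sum_f_R0 (f f' : nat -> R -> R) n u :
  (forall i, is_derive (f i) u (f' i u)) ->
  is_derive (fun u => sum_f_R0 (fun i => f i u) n) u (sum_f_R0 (fun i => f' i u) n).
Proof.
  intros H. induction n as [|n IH]; [apply H|].
  apply (is_derive_plus (fun u => sum_f_R0 (fun i => f i u) n) (f (S n)) u _ _ IH (H (S n))).
Qed.

Lemma is_derive_Pfun u : 0 < u -> is_derive (Pfun c d p) u (Pfun1 u).
Proof.
  intros Hu. apply (is_derive_ext_loc (fun u => sum_f_R0 (fun i => pshift i * (u ^ i / u ^ c)) (c + d))).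
  - exists (mkposreal u Hu). intros y Hy. symmetry. apply Pfun_eq.
    apply Rabs_lt_between in Hy. unfold minus, plus, opp in Hy; simpl in Hy. lra.
  - apply (is_derive_sum_f_R0 (fun i u => pshift i * (u ^ i / u ^ c))
      (fun i u => pshift i * ((INR i - INR c) * (u ^ i / u ^ c) / u))).
    intros i. apply (is_derive_scal (fun u => u ^ i / u ^ c)), is_derive_ratio_pow, Hu.
Qed.

Lemma is_derive_Pfun1 u : 0 < u -> is_derive Pfun1 u (Pfun2 u).
Proof.
  intros Hu. apply (is_derive_sum_f_R0 (fun i u => pshift i * ((INR i - INR c) * (u ^ i / u ^ c) / u))
    (fun i u => pshift i * ((INR i - INR c) * (INR i - INR c - 1) * (u ^ i / u ^ c) / u ^ 2))).
  intros i. apply (is_derive_scal (fun u => (INR i - INR c) * (u ^ i / u ^ c) / u)).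
  pose proof (pow_lt u c Hu) as Hpc.
  assert (Hext : forall t, (INR i - INR c) * ((t ^ i / t ^ c) * / t) = (INR i - INR c) * (t ^ i / t ^ c) / t)
    by (intros t; unfold Rdiv; ring).
  apply (is_derive_ext (fun u => (INR i - INR c) * ((u ^ i / u ^ c) * / u)) _ _ _ Hext).
  replace ((INR i - INR c) * (INR i - INR c - 1) * (u ^ i / u ^ c) / u ^ 2) with
    ((INR i - INR c) * ((INR i - INR c) * (u ^ i / u ^ c) / u * / u + (u ^ i / u ^ c) * (- 1 / u ^ 2))) by (field; lra).
  apply (is_derive_scal (fun u => (u ^ i / u ^ c) * / u)).
  apply (is_derive_mult (fun u => u ^ i / u ^ c) Rinv); [apply is_derive_ratio_pow, Hu| |intros; apply Rmult_comm].
  auto_derive; [lra|]. field. lra.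
Qed.

Lemma Derive2_Pfun : Derive (Derive (Pfun c d p)) tau = Pfun2 tau.
Proof.
  apply is_derive_unique. apply (is_derive_ext_loc Pfun1).
  - exists (mkposreal tau Htau). intros y Hy. symmetry. apply is_derive_unique, is_derive_Pfun.
    apply Rabs_lt_between in Hy. unfold minus, plus, opp in Hy; simpl in Hy. lra.
  - apply is_derive_Pfun1, Htau.
Qed.

Lemma tilt_mean : sum_f_R0 (fun i => (INR i - INR c) * tilt i) (c + d) = 0.
Proof.
  rewrite (is_derive_unique _ _ _ (is_derive_Pfun tau Htau)) in Hcrit.
  replace 0 with (tau * rho * Pfun1 tau) by (rewrite Hcrit; ring).
  unfold Pfun1. rewrite scal_sum. apply sum_eq. intros i _. unfold tilt.
  pose proof (pow_lt tau c Htau). pose proof Ptau_pos. field. lra.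
Qed.

Lemma variance_tilt : variance c (c + d) tilt = tau ^ 2 * Pfun2 tau / Ptau.
Proof.
  unfold variance.
  replace (tau ^ 2 * Pfun2 tau / Ptau) with (tau ^ 2 * rho * Pfun2 tau + 0) by (unfold Rdiv; ring).
  rewrite <- tilt_mean. unfold Pfun2. rewrite scal_sum, <- plus_sum. apply sum_eq. intros i _. unfold tilt.
  pose proof (pow_lt tau c Htau). pose proof Ptau_pos. field. lra.
Qed.

Lemma sum_multiples (f : nat -> R) g M : (1 <= g)%nat ->
  (forall i, ~ Nat.divide g i -> f i = 0) -> sum_f_R0 f (g * M) = sum_f_R0 (fun j => f (g * j)%nat) M.
Proof.
  intros Hg Hf. induction M as [|M IH].
  - rewrite Nat.mul_0_r. simpl. rewrite Nat.mul_0_r. reflexivity.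
  - rewrite tech5, <- IH.
    assert (H : forall r, (r < g)%nat -> sum_f_R0 f (g * M + r) = sum_f_R0 f (g * M)).
    { induction r as [|r IHr]; intros Hr; [rewrite Nat.add_0_r; reflexivity|].
      rewrite Nat.add_succ_r, tech5, IHr by lia. rewrite Hf; [ring|]. intros [y Hy].
      assert (Hyl : (g * M < g * y)%nat) by lia. assert (Hyu : (g * y < g * S M)%nat) by lia.
      apply Nat.mul_lt_mono_pos_l in Hyl; [|lia]. apply Nat.mul_lt_mono_pos_l in Hyu; lia. }
    replace (g * S M)%nat with (S (g * M + (g - 1))) by nia. rewrite tech5, H by lia. reflexivity.
Qed.

(** Index i stands for the jump i - c. If g divided every index of the support, P would be u^(-c)
    times a polynomial in u^g. *)
Lemma tilt_aperiodic g : (2 <= g)%nat ->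
  exists i, (i <= c + d)%nat /\ tilt i <> 0 /\ ~ Nat.divide g i.
Proof.
  intros Hg. destruct (Classical_Prop.classic (exists i, (i <= c + d)%nat /\ tilt i <> 0 /\ ~ Nat.divide g i)) as [H|H];
    [exact H|exfalso]. apply p_aper.
  (* The range of exponents in [aperiodic] is symmetric, so the coefficients are padded by 0 at
     negative j; only the indices that are multiples of g remain. *)
  exists (- Z.of_nat c)%Z, g, (c + d)%nat, (fun j => if Z.leb 0 j then pshift (g * Z.to_nat j) else 0).
  split; [exact Hg|]. intros u Hu. rewrite Pfun_eq by exact Hu.
  assert (Hdiv : forall i, ~ Nat.divide g i -> pshift i = 0).
  { intros i Hi. destruct (Nat.le_gt_cases i (c + d)) as [Hle|Hgt]; [|apply pshift_low; lia].
    destruct (Req_dec (pshift i) 0) as [|Hne]; [assumption|exfalso]. apply H. exists i.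
    split; [exact Hle|]. split; [|exact Hi]. unfold tilt.
    pose proof (pow_lt tau i Htau). pose proof (pow_lt tau c Htau). pose proof rho_pos.
    apply Rmult_integral_contrapositive_currified; [|lra].
    apply Rmult_integral_contrapositive_currified; [exact Hne|].
    pos. }
  rewrite powerRZ_neg', <- pow_powerRZ by lra.
  rewrite zsum_shift.
  replace (sum_f_R0 (fun i => pshift i * (u ^ i / u ^ c)) (c + d))
    with (/ u ^ c * sum_f_R0 (fun i => pshift i * u ^ i) (c + d)).
  2:{ rewrite scal_sum. apply sum_eq. intros i _. unfold Rdiv. ring. }
  f_equal.
  rewrite <- (sum_pad (fun i => pshift i * u ^ i) (c + d) (g * (c + d))).
  2:{ nia. }
  2:{ intros i Hi. rewrite pshift_low by lia. ring. }
  rewrite sum_multiples; [|lia|intros i Hi; rewrite Hdiv by exact Hi; ring].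
  set (F := fun i => (if (0 <=? Z.of_nat i - Z.of_nat (c + d))%Z
      then pshift (g * Z.to_nat (Z.of_nat i - Z.of_nat (c + d))) else 0)
      * powerRZ (u ^ g) (Z.of_nat i - Z.of_nat (c + d))).
  rewrite (tech2 F (c + d - 1) (c + d + (c + d))) by lia.
  rewrite (sum_zero F).
  2:{ intros i Hi. unfold F. destruct (Z.leb_spec 0 (Z.of_nat i - Z.of_nat (c + d))); [lia|ring]. }
  rewrite Rplus_0_l. replace (c + d + (c + d) - S (c + d - 1))%nat with (c + d)%nat by lia.
  apply sum_eq. intros i Hi. unfold F.
  replace (Z.of_nat (S (c + d - 1) + i) - Z.of_nat (c + d))%Z with (Z.of_nat i) by lia.
  destruct (Z.leb_spec 0 (Z.of_nat i)); [|lia]. rewrite Nat2Z.id, <- pow_powerRZ, <- pow_mult. reflexivity.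
Qed.

(** * Meanders ending at a fixed altitude *)

Definition mtilt (n k : nat) : R := mea c d p n k * tau ^ k * rho ^ n.

Lemma mtilt_0 : mtilt O = seq1.
Proof.
  extensionality k. unfold mtilt, seq1. simpl. destruct (Nat.eqb_spec k 0) as [->|]; simpl; ring.
Qed.

Lemma mtilt_S n k : mtilt (S n) k = conv tilt (mtilt n) (k + c)%nat.
Proof.
  unfold mtilt at 1. rewrite mea_S. unfold conv. rewrite !(Rmult_comm (sum_f_R0 _ _)), Rmult_comm, <- Rmult_assoc.
  rewrite scal_sum. apply sum_eq. intros i Hi. unfold tilt, mtilt.
  assert (E : tau ^ k * tau ^ c = tau ^ i * tau ^ (k + c - i)) by (rewrite <- !pow_add; f_equal; lia).
  pose proof (pow_lt tau c Htau).
  replace (tau ^ k) with (tau ^ i * tau ^ (k + c - i) / tau ^ c) by (rewrite <- E; field; lra).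
  simpl (rho ^ S n). pose proof Ptau_pos. field. lra.
Qed.

(** The constant of the local limit theorem relative to [gseq]; 2 [lam0] is the quantity C / tau of
    the statement. *)
Definition lam0 : R := / sqrt (2 * variance c (c + d) tilt).

Lemma tilt_local_limit : exists B, 0 < B /\ forall n k,
  Rabs (seqpow tilt n (k + c * n) - lam0 * gseq n) <= B * (1 + INR k ^ 2) * kap1 n.
Proof.
  apply local_limit; [apply tilt_nonneg|apply tilt_low|apply tilt_sum|apply tilt_mean|apply tilt_0|apply tilt_aperiodic].
Qed.

Lemma lam0_pos : 0 < lam0.
Proof.
  apply Rinv_0_lt_compat, sqrt_lt_R0.
  pose proof (variance_pos c (c + d) tilt tilt_nonneg tilt_0 tilt_aperiodic). lra.
Qed.

Lemma lam0_eq : 2 * lam0 = sqrt (2 * Ptau / Derive (Derive (Pfun c d p)) tau) / tau.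
Proof.
  pose proof (variance_pos c (c + d) tilt tilt_nonneg tilt_0 tilt_aperiodic) as Hv.
  rewrite Derive2_Pfun. unfold lam0. rewrite variance_tilt in *. pose proof Ptau_pos as HP.
  assert (H2 : 0 < Pfun2 tau).
  { apply Rmult_lt_reg_l with (tau ^ 2 * rho).
    - pos.
    - rewrite Rmult_0_r. replace (tau ^ 2 * rho * Pfun2 tau) with (tau ^ 2 * Pfun2 tau / Ptau); [exact Hv|unfold Rdiv; ring]. }
  assert (E : sqrt (2 * Ptau / Pfun2 tau) * sqrt (2 * (tau ^ 2 * Pfun2 tau / Ptau)) = 2 * tau).
  { rewrite <- sqrt_mult_alt by pos.
    replace (2 * Ptau / Pfun2 tau * (2 * (tau ^ 2 * Pfun2 tau / Ptau))) with ((2 * tau) ^ 2) by (field; lra).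
    apply sqrt_pow2. lra. }
  assert (Hs : 0 < sqrt (2 * (tau ^ 2 * Pfun2 tau / Ptau))) by pos.
  apply Rmult_eq_reg_r with (tau * sqrt (2 * (tau ^ 2 * Pfun2 tau / Ptau))); [|pos].
  replace (sqrt (2 * Ptau / Pfun2 tau) / tau * (tau * sqrt (2 * (tau ^ 2 * Pfun2 tau / Ptau))))
    with (sqrt (2 * Ptau / Pfun2 tau) * sqrt (2 * (tau ^ 2 * Pfun2 tau / Ptau))) by (field; lra).
  rewrite E. field. lra.
Qed.

(** Indices are swapped to read M as a family of series in z: [altseq k] and [logalt k] are the
    coefficients of u^k in the tilted M and in its logarithm. *)
Definition altseq (k n : nat) : R := mtilt n k.
Definition logalt (k n : nat) : R := logupdrift c tilt n k.

Lemma INA_logalt k : InA (logalt k) (- 2 * lam0).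
Proof.
  destruct tilt_local_limit as (B & HB & H).
  apply InA_of_theta with (B * (1 + INR k ^ 2)). intros n Hn.
  unfold logalt, logupdrift, seqscal, updrift. destruct n as [|n]; [lia|].
  rewrite <- Rmult_assoc, Rinv_r, Rmult_1_l by (apply not_0_INR; lia). apply H.
Qed.

(** A product of series in nonnegative powers of u involves at u^0 only the constant terms, so
    Spitzer's identity closes up on E alone. *)
Lemma altseq_0_ode : theta (altseq 0) = conv (theta (logalt 0)) (altseq 0).
Proof.
  extensionality n.
  pose proof (spitzer c tilt mtilt mtilt_0 mtilt_S) as H.
  assert (Hn := f_equal (fun f => f n O) H). cbv beta in Hn. rewrite conv2_eval in Hn.
  unfold theta at 1, altseq at 1. unfold theta2, seqscal in Hn. rewrite Hn.
  replace (conv (theta (logalt 0)) (altseq 0)) with (conv (altseq 0) (theta (logalt 0))) by ring.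
  unfold conv. apply sum_eq. intros j Hj. simpl. unfold altseq, theta, logalt, logupdrift, seqscal.
  f_equal. destruct (n - j)%nat as [|i]; [simpl; unfold seq0; ring|].
  rewrite <- Rmult_assoc, Rinv_r, Rmult_1_l by (apply not_0_INR; lia). reflexivity.
Qed.

Lemma InA_exc : InA (altseq 0) (Series (altseq 0) * (- 2 * lam0)) /\ 0 < Series (altseq 0).
Proof.
  destruct (InA_exp (logalt 0) (- 2 * lam0) (altseq 0)) as [H1 H2].
  - apply INA_logalt.
  - unfold logalt, logupdrift, seqscal, updrift, seq0. ring.
  - unfold altseq. rewrite mtilt_0. reflexivity.
  - apply altseq_0_ode.
  - split; [exact H1|]. rewrite H2. apply exp_pos.
Qed.

Lemma altseq_udiff k n : INR k * altseq k n =
  sum_f_R0 (fun i => conv (altseq i) (seqscal (INR (k - i)) (logalt (k - i))) n) k.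
Proof.
  pose proof (spitzer_utheta c tilt mtilt mtilt_0 mtilt_S) as H.
  assert (Hn := f_equal (fun f => f n k) H). cbv beta in Hn. rewrite conv2_eval in Hn.
  unfold utheta at 1, theta at 1 in Hn. unfold altseq at 1. rewrite Hn.
  unfold conv at 1. rewrite sum_exchange. apply sum_eq. intros i Hi.
  unfold conv. apply sum_eq. intros j Hj. reflexivity.
Qed.

(** In [altseq_udiff] the term i = k carries the factor 0, so k M_k is a combination of products of
    earlier M_i with [logalt], and the class is closed under these. *)
Lemma InA_altseq k : exists al, InA (altseq k) al.
Proof.
  induction k as [k IH] using lt_wf_ind. destruct k as [|k]; [eexists; apply InA_exc|].
  destruct (InA_sum (fun i => conv (altseq i) (seqscal (INR (S k - i)) (logalt (S k - i)))) k) as [al Hal].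
  - intros i Hi. destruct (IH i ltac:(lia)) as [be Hbe]. eexists.
    apply InA_conv; [exact Hbe|apply InA_scal, INA_logalt].
  - exists (/ INR (S k) * al).
    replace (altseq (S k)) with (seqscal (/ INR (S k))
      (fun n => sum_f_R0 (fun i => conv (altseq i) (seqscal (INR (S k - i)) (logalt (S k - i))) n) k)).
    + apply InA_scal, Hal.
    + extensionality n. unfold seqscal at 1.
      assert (Hk : INR (S k) <> 0) by (apply not_0_INR; lia).
      apply Rmult_eq_reg_l with (INR (S k)); [|exact Hk].
      rewrite <- Rmult_assoc, Rinv_r, Rmult_1_l, altseq_udiff, tech5 by exact Hk.
      rewrite Nat.sub_diag.
      replace (seqscal (INR 0) (logalt 0)) with seq0 by (extensionality m; unfold seqscal, seq0; simpl; ring).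
      replace (conv (altseq (S k)) seq0) with seq0 by ring. unfold seq0. ring.
Qed.

(* Unlike in [mtilt], the altitude weight tau^k is undone. *)
Definition mtot (n : nat) : R := Mcoef c d p n * rho ^ n.
Definition drift (n : nat) : R := sum_f_R0 (fun k => updrift c tilt n k * (/ tau) ^ k) (d * n).

Lemma tau_inv_pow k : tau ^ k * (/ tau) ^ k = 1.
Proof. rewrite <- Rpow_mult_distr, Rinv_r by lra. apply pow1. Qed.

Lemma mtot_eq n : mtot n = sum_f_R0 (fun k => mtilt n k * (/ tau) ^ k) (d * n).
Proof.
  unfold mtot, Mcoef. rewrite Rmult_comm, scal_sum. apply sum_eq. intros k _. unfold mtilt.
  pose proof (tau_inv_pow k) as E.
  replace (mea c d p n k * tau ^ k * rho ^ n * (/ tau) ^ k) with (mea c d p n k * rho ^ n * (tau ^ k * (/ tau) ^ k)) by ring.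
  rewrite E. ring.
Qed.

Lemma mtilt_low n : low (S (d * n)) (mtilt n).
Proof. intros k Hk. unfold mtilt. rewrite (mea_low n k Hk). ring. Qed.

Lemma updrift_low n : low (S (d * n)) (updrift c tilt n).
Proof.
  intros k Hk. destruct n as [|n]; [reflexivity|]. unfold updrift.
  apply (low_seqpow tilt (c + d) (S n) tilt_low). nia.
Qed.

(** Spitzer's identity evaluated at u = 1/tau, which is legitimate because each coefficient of z^n
    is a polynomial in u, of degree at most d n. *)
Lemma mtot_ode : theta mtot = conv mtot drift.
Proof.
  extensionality n. unfold theta. rewrite mtot_eq, scal_sum.
  pose proof (spitzer c tilt mtilt mtilt_0 mtilt_S) as H.
  rewrite (sum_eq _ (fun k => sum_f_R0 (fun j => conv (mtilt j) (updrift c tilt (n - j)) k * (/ tau) ^ k) n)).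
  2:{ intros k _. assert (Hn := f_equal (fun f => f n k) H). cbv beta in Hn. rewrite conv2_eval in Hn.
      unfold theta2, seqscal in Hn. rewrite (Rmult_comm (mtilt n k)), Rmult_assoc, (Rmult_comm _ (INR n)), <- Rmult_assoc.
      transitivity ((INR n * mtilt n k) * (/ tau) ^ k); [ring|].
      rewrite Hn, Rmult_comm, scal_sum. reflexivity. }
  rewrite sum_exchange. unfold conv at 2. apply sum_eq. intros j Hj.
  rewrite mtot_eq. unfold drift.
  replace (d * n)%nat with (d * j + d * (n - j))%nat by nia.
  rewrite <- sum_conv_low.
  - apply sum_eq. intros k _. symmetry. apply conv_weight.
  - intros k Hk. rewrite (mtilt_low j k Hk). ring.
  - intros k Hk. rewrite (updrift_low (n - j) k Hk). ring.
Qed.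

Lemma tau_inv_lt_1 : 1 < tau -> 0 < / tau < 1.
Proof. intros H. split; [pos|]. rewrite <- Rinv_1. apply Rinv_lt_contravar; lra. Qed.

Lemma sum_geom x n : x <> 1 -> sum_f_R0 (fun k => x ^ k) n = (1 - x ^ S n) / (1 - x).
Proof. intros H. apply tech3. exact H. Qed.

(** The error of the local limit theorem grows like 1 + k^2, which the weights tau^(-k) make
    summable; stopping the geometric sum at k = d n costs an exponentially small term. *)
Lemma drift_asymp : 1 < tau -> exists B, forall n, (1 <= n)%nat ->
  Rabs (drift n - lam0 / (1 - / tau) * gseq n) <= B * kap1 n.
Proof.
  intros Ht. pose proof (tau_inv_lt_1 Ht) as Hx. set (x := / tau) in *.
  destruct tilt_local_limit as (B & HB & H). pose proof lam0_pos as Hl.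
  pose proof (ex_series_quad_geom x ltac:(lra)) as Hex.
  set (S2 := Series (fun k => (1 + INR k ^ 2) * x ^ k)).
  assert (Hpos : forall k, 0 <= (1 + INR k ^ 2) * x ^ k).
  { intros k. apply Rmult_le_pos; [pose proof (pow2_ge_0 (INR k)); lra|apply pow_le; lra]. }
  exists (B * S2 + lam0 / (1 - x) * S2). intros n Hn.
  assert (E1 : Rabs (drift n - sum_f_R0 (fun k => lam0 * gseq n * x ^ k) (d * n)) <= B * S2 * kap1 n).
  { unfold drift. rewrite <- minus_sum.
    apply Rle_trans with (sum_f_R0 (fun k => (1 + INR k ^ 2) * x ^ k * (B * kap1 n)) (d * n)).
    - apply Rabs_sum_le. intros k _. fold x.
      replace (updrift c tilt n k * x ^ k - lam0 * gseq n * x ^ k) with ((updrift c tilt n k - lam0 * gseq n) * x ^ k) by ring.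
      rewrite Rabs_mult, (Rabs_pos_eq (x ^ k)) by pos.
      destruct n as [|n]; [lia|]. unfold updrift. specialize (H (S n) k).
      replace ((1 + INR k ^ 2) * x ^ k * (B * kap1 (S n))) with (B * (1 + INR k ^ 2) * kap1 (S n) * x ^ k) by ring.
      apply Rmult_le_compat_r; [pos|exact H].
    - rewrite <- scal_sum. replace (B * S2 * kap1 n) with (B * kap1 n * S2) by ring.
      apply Rmult_le_compat_l; [pose proof (kap1_pos n); nra|].
      apply (sum_le_Series (fun k => (1 + INR k ^ 2) * x ^ k)); assumption. }
  assert (E2 : Rabs (sum_f_R0 (fun k => lam0 * gseq n * x ^ k) (d * n) - lam0 / (1 - x) * gseq n)
     <= lam0 / (1 - x) * S2 * kap1 n).
  { rewrite (sum_eq _ (fun k => x ^ k * (lam0 * gseq n))) by (intros; ring).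
    rewrite <- scal_sum, sum_geom by lra.
    replace (lam0 * gseq n * ((1 - x ^ S (d * n)) / (1 - x)) - lam0 / (1 - x) * gseq n)
      with (- (lam0 / (1 - x) * (gseq n * x ^ S (d * n)))) by (field; lra).
    assert (Hlx : 0 < lam0 / (1 - x)) by pos.
    pose proof (gseq_pos n). assert (0 < x ^ S (d * n)) by pos.
    rewrite Rabs_Ropp, Rabs_mult, (Rabs_pos_eq (lam0 / (1 - x))), Rabs_pos_eq by (first [lra | pos]).
    rewrite Rmult_assoc. apply Rmult_le_compat_l; [lra|].
    rewrite <- kap1_gseq. pose proof (kap1_pos n).
    replace (kap1 n * (INR n + 1) * x ^ S (d * n)) with ((INR n + 1) * x ^ S (d * n) * kap1 n) by ring.
    apply Rmult_le_compat_r; [lra|].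
    apply Rle_trans with ((1 + INR n ^ 2) * x ^ n).
    - assert (1 <= INR n) by (apply (le_INR 1); lia).
      apply Rmult_le_compat; [lra|lra|nra|].
      replace (S (d * n)) with (n + (S (d * n) - n))%nat by nia. rewrite pow_add.
      assert (0 < x ^ n) by pos.
      assert (x ^ (S (d * n) - n) <= 1) by (apply pow_unit_interval; lra). nra.
    - apply Rle_trans with (sum_f_R0 (fun k => (1 + INR k ^ 2) * x ^ k) n).
      + apply (sum_ge_term (fun k => (1 + INR k ^ 2) * x ^ k)); auto.
      + apply (sum_le_Series (fun k => (1 + INR k ^ 2) * x ^ k)); assumption. }
  replace (drift n - lam0 / (1 - x) * gseq n) with ((drift n - sum_f_R0 (fun k => lam0 * gseq n * x ^ k) (d * n))
    + (sum_f_R0 (fun k => lam0 * gseq n * x ^ k) (d * n) - lam0 / (1 - x) * gseq n)) by ring.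
  apply Rle_trans with (1 := Rabs_triang _ _). lra.
Qed.

Lemma mtot_0 : mtot O = 1.
Proof. rewrite mtot_eq, Nat.mul_0_r. simpl. unfold mtilt. simpl. ring. Qed.

Lemma mtot_nonneg n : 0 <= mtot n.
Proof.
  unfold mtot, Mcoef. apply Rmult_le_pos; [|apply pow_le, Rlt_le, rho_pos].
  apply cond_pos_sum. intros k. apply mea_nonneg.
Qed.

Lemma InA_mtot : 1 < tau -> exists al, InA mtot al.
Proof.
  intros Ht. destruct (drift_asymp Ht) as (B & HB).
  set (l := fun n => / INR n * drift n).
  assert (Hl0 : drift O = 0) by (unfold drift; rewrite Nat.mul_0_r; simpl; unfold seq0; ring).
  assert (Hth : theta l = drift).
  { extensionality n. unfold theta, l. destruct n as [|n]; [rewrite Hl0; simpl; ring|].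
    field. apply not_0_INR. lia. }
  eexists. apply (InA_exp l (- 2 * (lam0 / (1 - / tau))) mtot).
  - apply InA_of_theta with B. intros n Hn. change (INR n * l n) with (theta l n). rewrite Hth. apply HB, Hn.
  - unfold l. rewrite Hl0. ring.
  - apply mtot_0.
  - rewrite Hth, mtot_ode. ring.
Qed.

(** * The coefficients of Q: expansion and lower bounds *)

Definition qtilt (n : nat) : R := Qcoef c d p q n * rho ^ n.

(** The factor tau^(-j) undoes the tilt of [altseq j]; the altitudes with nonzero weight are 0 and
    those j for which -j is a jump. *)
Definition cutw (j : nat) : R :=
  if Nat.eqb j 0 then 1 else if Req_EM_T (p (- Z.of_nat j)%Z) 0 then 0 else (/ tau) ^ j.

(* sum of the M_j, 0 <= j <= c, that are not followed by a catastrophe *)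
Definition qcut (n : nat) : R := sum_f_R0 (fun j => cutw j * altseq j n) c.

Lemma qtilt_S n : qtilt (S n) = q * rho * (mtot n - qcut n).
Proof.
  unfold qtilt, Qcoef, Ecoef, qcut, mtot, altseq, mtilt. simpl (rho ^ S n).
  replace (sum_f_R0 (fun j => cutw j * (mea c d p n j * tau ^ j * rho ^ n)) c)
    with (rho ^ n * (mea c d p n 0 + sum_f_R0 (fun j => if (j =? 0)%nat then 0
        else if Req_EM_T (p (- Z.of_nat j)%Z) 0 then 0 else mea c d p n j) c)); [ring|].
  assert (E : forall m, mea c d p n 0 = sum_f_R0 (fun j => if (j =? 0)%nat then mea c d p n j else 0) m).
  { induction m as [|k IH]; [reflexivity|]. rewrite tech5, <- IH. simpl. ring. }
  rewrite (E c), <- plus_sum, scal_sum. apply sum_eq. intros j _.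
  pose proof (tau_inv_pow j) as Ej. unfold cutw.
  destruct (Nat.eqb_spec j 0) as [->|]; [simpl; ring|].
  destruct (Req_EM_T (p (- Z.of_nat j)%Z) 0); [ring|].
  replace ((/ tau) ^ j * (mea c d p n j * tau ^ j * rho ^ n)) with (mea c d p n j * rho ^ n * (tau ^ j * (/ tau) ^ j)) by ring.
  rewrite Ej. ring.
Qed.

Lemma InA_qcut : exists al, InA qcut al.
Proof.
  apply (InA_sum (fun j n => cutw j * altseq j n)).
  intros j _. destruct (InA_altseq j) as [al Hal]. eexists.
  apply (InA_scal (cutw j)). exact Hal.
Qed.

Lemma qtilt_eq : qtilt = seqscal (q * rho) (conv (mono 1) (seqsub mtot qcut)).
Proof.
  extensionality n. unfold seqscal. rewrite conv_mono. destruct n as [|n].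
  - unfold qtilt. simpl. ring.
  - rewrite qtilt_S. simpl. rewrite Nat.sub_0_r. reflexivity.
Qed.

Lemma InA_qtilt : 1 < tau -> exists al, InA qtilt al.
Proof.
  intros Ht. destruct (InA_mtot Ht) as [al Hal]. destruct InA_qcut as [be Hbe].
  rewrite qtilt_eq. eexists. apply InA_scal, InA_conv; [apply InA_mono|apply InA_sub; eassumption].
Qed.

(* A meander that ends higher than c can be followed by a catastrophe. *)
Lemma Qcoef_S_ge n h : (c < h)%nat -> q * mea c d p n h <= Qcoef c d p q (S n).
Proof.
  intros Hh. unfold Qcoef. apply Rmult_le_compat_l; [lra|]. unfold Ecoef, Mcoef.
  change (sum_f_R0 (fun k => mea c d p n k) (d * n)) with (sum_f_R0 (mea c d p n) (d * n)).
  rewrite <- (sum_pad (mea c d p n) (d * n) (d * n + h)) by (try lia; intros; apply mea_low; lia).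
  assert (G : mea c d p n h + sum_f_R0 (mea c d p n) c <= sum_f_R0 (mea c d p n) (d * n + h)).
  { rewrite (tech2 _ c (d * n + h)) by lia. rewrite Rplus_comm. apply Rplus_le_compat_l.
    replace (mea c d p n h) with (mea c d p n (S c + (h - S c))%nat) by (f_equal; lia).
    apply (sum_ge_term (fun i => mea c d p n (S c + i)%nat)); [intros; apply mea_nonneg|lia]. }
  assert (G2 : forall m, mea c d p n 0 + sum_f_R0 (fun j => if (j =? 0)%nat then 0
        else if Req_EM_T (p (- Z.of_nat j)%Z) 0 then 0 else mea c d p n j) m <= sum_f_R0 (mea c d p n) m).
  { induction m as [|k IH].
    - simpl. lra.
    - rewrite !tech5. pose proof (mea_nonneg n (S k)). simpl (S k =? 0)%nat. cbv iota.
      destruct (Req_EM_T (p (- Z.of_nat (S k))%Z) 0); lra. }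
  specialize (G2 c). lra.
Qed.

Lemma Qcoef_nonneg n : 0 <= Qcoef c d p q n.
Proof.
  destruct n as [|n]; [simpl; lra|]. apply Rle_trans with (2 := Qcoef_S_ge n (S c) ltac:(lia)).
  apply Rmult_le_pos; [lra|apply mea_nonneg].
Qed.

Lemma mea_climb n m : p (Z.of_nat d) ^ m * mea c d p n 0 <= mea c d p (n + m) (d * m).
Proof.
  induction m as [|m IH].
  - rewrite Nat.add_0_r, Nat.mul_0_r. simpl. lra.
  - rewrite Nat.add_succ_r, mea_S. apply Rle_trans with (pshift (c + d) * mea c d p (n + m) (d * m)).
    + unfold pshift at 1. rewrite Nat.leb_refl. replace (Z.of_nat (c + d) - Z.of_nat c)%Z with (Z.of_nat d) by lia.
      simpl pow. rewrite Rmult_assoc. apply Rmult_le_compat_l; [apply p_nonneg; lia|exact IH].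
    + replace (d * m)%nat with (d * S m + c - (c + d))%nat by nia.
      apply (sum_ge_term (fun i => pshift i * mea c d p (n + m) (d * S m + c - i)%nat)); [|nia].
      intros i. apply Rmult_le_pos; [apply pshift_nonneg|apply mea_nonneg].
Qed.

Lemma exc_lower : exists n0 k, 0 < k /\ forall n, (n0 <= n)%nat -> k * kap1 n <= altseq 0 n.
Proof.
  destruct InA_exc as [[B HB] HS]. pose proof lam0_pos as Hl.
  set (al := Series (altseq 0) * lam0) in *. assert (Hal : 0 < al) by pos.
  destruct (INR_archimed al (2 * B) Hal) as [N HN]. exists (S N), (al / 2). split; [lra|].
  intros n Hn. specialize (HB n). apply Rabs_le_between in HB.
  pose proof (Rabs_wseq_ge n) as Hw. destruct n as [|n]; [lia|].
  rewrite Rabs_wseq_S in Hw. rewrite wseq_S in HB.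
  replace (Series (altseq 0) * (-2 * lam0) * (- kap1 n / 2)) with (al * kap1 n) in HB by (unfold al; field).
  assert (B * kap (S n) <= al / 2 * kap1 (S n)).
  { rewrite <- kap_kap1. pose proof (kap_pos (S n)). apply le_INR in Hn. rewrite (S_INR N) in Hn.
    assert (B <= al / 2 * (INR (S n) + 1)) by nra.
    replace (al / 2 * (kap (S n) * (INR (S n) + 1))) with (al / 2 * (INR (S n) + 1) * kap (S n)) by ring.
    apply Rmult_le_compat_r; lra. }
  assert (al * (kap1 (S n) / 2) <= al * (kap1 n / 2)) by (apply Rmult_le_compat_l; lra). lra.
Qed.

(** An excursion of length n - c - 2, followed by c + 1 jumps of size d, ends above c, where a
    catastrophe is allowed as step n; so Q inherits the order n^(-3/2) of the excursions from
    below. *)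
Lemma qtilt_lower : exists n0 k, 0 < k /\ forall n, (n0 <= n)%nat -> k * kap1 n <= qtilt n.
Proof.
  destruct exc_lower as (n0 & k & Hk & H). set (m := S c).
  pose proof rho_pos as Hr. pose proof pshift_last as Hpd. unfold pshift in Hpd. rewrite Nat.leb_refl in Hpd.
  replace (Z.of_nat (c + d) - Z.of_nat c)%Z with (Z.of_nat d) in Hpd by lia.
  assert (Hpm : 0 < p (Z.of_nat d) ^ m) by pos.
  assert (Hrm : 0 < rho ^ S m) by pos.
  assert (Hkk : 0 < q * p (Z.of_nat d) ^ m * rho ^ S m) by pos.
  exists (n0 + S m)%nat, (q * p (Z.of_nat d) ^ m * rho ^ S m * k). split; [pos|].
  intros n Hn. set (n' := (n - S m)%nat). assert (En : n = S (n' + m)) by (unfold n'; lia).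
  specialize (H n' ltac:(unfold n'; lia)). unfold altseq, mtilt in H. simpl (tau ^ 0) in H. rewrite Rmult_1_r in H.
  unfold qtilt. rewrite En at 2 3.
  apply Rle_trans with (q * p (Z.of_nat d) ^ m * rho ^ S m * kap1 n' * k).
  - replace (q * p (Z.of_nat d) ^ m * rho ^ S m * kap1 n' * k) with (q * p (Z.of_nat d) ^ m * rho ^ S m * k * kap1 n') by ring.
    apply Rmult_le_compat_l; [nra|]. unfold kap1.
    assert (Hle : (n' <= n)%nat) by (unfold n'; lia).
    pose proof (gseq_decr n' n Hle). pose proof (gseq_pos n). apply le_INR in Hle. pose proof (pos_INR n').
    apply Rmult_le_compat; [lra|pos|lra|apply Rinv_le_contravar; lra].
  - apply Rle_trans with (q * p (Z.of_nat d) ^ m * rho ^ S m * (mea c d p n' 0 * rho ^ n')).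
    + replace (q * p (Z.of_nat d) ^ m * rho ^ S m * kap1 n' * k) with (q * p (Z.of_nat d) ^ m * rho ^ S m * (k * kap1 n')) by ring.
      apply Rmult_le_compat_l; lra.
    + replace (rho ^ S (n' + m)) with (rho ^ S m * rho ^ n') by (rewrite <- pow_add; f_equal; lia).
      pose proof (Qcoef_S_ge (n' + m) (d * m)) as HQ. assert (c < d * m)%nat by (unfold m; nia).
      specialize (HQ H0). pose proof (mea_climb n' m) as Hcl. pose proof (pow_lt rho n' Hr).
      apply Rle_trans with (q * (p (Z.of_nat d) ^ m * mea c d p n' 0) * (rho ^ S m * rho ^ n')); [apply Req_le; ring|].
      apply Rmult_le_compat_r; [pos|]. nra.
Qed.

(** The weights tau^(-k) are now at least 1, and each of the first sqrt(dl n) altitudes, roughly,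
    contributes at least a multiple of n^(-1/2). *)
Lemma drift_lower : tau <= 1 -> exists n0 k, 0 < k /\ forall n, (n0 <= n)%nat -> k <= drift n.
Proof.
  intros Ht. destruct tilt_local_limit as (B & HB & H). pose proof lam0_pos as Hl.
  (* For k^2 <= dl (n + 1) and n large, the error B (1 + k^2) kap1 n is at most (lam0 / 2) gseq n;
     dl <= 1 keeps these altitudes below d n. *)
  set (dl := Rmin 1 (lam0 / (4 * B))).
  assert (Hdl : 0 < dl <= 1 /\ dl <= lam0 / (4 * B)).
  { split; [split|]; [apply Rmin_glb_lt; [lra|pos]|apply Rmin_l|apply Rmin_r]. }
  destruct Hdl as [Hdl Hdl2]. apply Rle_div_r in Hdl2; [|lra].
  destruct (INR_archimed lam0 (4 * B) Hl) as [N HN].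
  exists (N + 2)%nat, (lam0 / 2 * (sqrt dl / 2)).
  assert (Hsd : 0 < sqrt dl) by pos.
  split; [pos|]. intros n Hn.
  assert (Hn1 : INR N + 2 <= INR n) by (apply le_INR in Hn; rewrite plus_INR in Hn; simpl (INR 2) in Hn; lra).
  pose proof (pos_INR N) as HN0.
  assert (Hx0 : 0 <= dl * (INR n + 1)) by pos.
  destruct (nfloor_ex (sqrt (dl * (INR n + 1))) (sqrt_pos _)) as [m Hm].
  assert (Hm2 : INR m ^ 2 <= dl * (INR n + 1)).
  { rewrite <- (pow2_sqrt (dl * (INR n + 1))) by exact Hx0. apply pow_incr. split; [apply pos_INR|lra]. }
  assert (Hmn : (m <= d * n)%nat).
  { apply Nat.le_trans with n; [|nia]. apply INR_le. pose proof (pos_INR m). nra. }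
  apply Rle_trans with (sum_f_R0 (fun k => lam0 / 2 * gseq n) m).
  - rewrite sum_cte, S_INR.
    assert (Hg : sqrt dl / 2 <= gseq n * (INR m + 1)).
    { pose proof (gseq_sqr_ge n) as Hg. pose proof (gseq_pos n) as Hg0.
      assert (Hs : (sqrt dl / 2) ^ 2 <= (gseq n * (INR m + 1)) ^ 2).
      { replace ((sqrt dl / 2) ^ 2) with (dl / 4) by (rewrite pow_div, pow2_sqrt by lra; field).
        rewrite Rpow_mult_distr.
        assert (Hm3 : dl * (INR n + 1) <= (INR m + 1) ^ 2).
        { rewrite <- (pow2_sqrt (dl * (INR n + 1))) by exact Hx0. apply pow_incr. split; [apply sqrt_pos|lra]. }
        assert (0 < gseq n ^ 2) by pos. nra. }
      pose proof (pos_INR m). assert (0 <= gseq n * (INR m + 1)) by pos. nra. }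
    rewrite Rmult_assoc. apply Rmult_le_compat_l; lra.
  - assert (Hterm : forall k, (k <= m)%nat -> lam0 / 2 * gseq n <= updrift c tilt n k * (/ tau) ^ k).
    { intros k Hk. apply Rle_trans with (updrift c tilt n k).
      - destruct n as [|n]; [lia|]. unfold updrift. specialize (H (S n) k). apply Rabs_le_between in H.
        assert (B * (1 + INR k ^ 2) * kap1 (S n) <= lam0 / 2 * gseq (S n)); [|lra].
        rewrite <- (kap1_gseq (S n)). pose proof (kap1_pos (S n)).
        replace (lam0 / 2 * (kap1 (S n) * (INR (S n) + 1))) with (lam0 / 2 * (INR (S n) + 1) * kap1 (S n)) by ring.
        apply Rmult_le_compat_r; [lra|].
        assert (INR k ^ 2 <= INR m ^ 2) by (apply pow_incr; split; [apply pos_INR|apply le_INR, Hk]).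
        assert (B * INR k ^ 2 <= B * (dl * (INR (S n) + 1))) by (apply Rmult_le_compat_l; lra).
        assert (B * (dl * (INR (S n) + 1)) <= lam0 / 4 * (INR (S n) + 1)) by nra.
        assert (B <= lam0 / 4 * (INR (S n) + 1)) by nra. lra.
      - assert (0 <= updrift c tilt n k).
        { destruct n as [|n]; [unfold updrift, seq0; lra|]. unfold updrift.
          apply seqpow_nonneg, tilt_nonneg. }
        assert (1 <= (/ tau) ^ k); [|nra]. apply pow_R1_Rle. rewrite <- Rinv_1. apply Rinv_le_contravar; lra. }
    apply Rle_trans with (sum_f_R0 (fun k => updrift c tilt n k * (/ tau) ^ k) m); [apply sum_Rle; exact Hterm|].
    unfold drift. destruct (Nat.eq_dec m (d * n)) as [->|Hne]; [lra|].
    rewrite (tech2 _ m (d * n)) by lia.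
    assert (0 <= sum_f_R0 (fun i => updrift c tilt n (S m + i) * (/ tau) ^ (S m + i)) (d * n - S m)); [|lra].
    apply cond_pos_sum. intros i. apply Rmult_le_pos; [|apply pow_le, Rlt_le, Rinv_0_lt_compat, Htau].
    destruct n as [|n0]; [unfold updrift, seq0; lra|]. unfold updrift.
    apply seqpow_nonneg, tilt_nonneg.
Qed.

(** For tau <= 1 the equation theta M = M drift gives n [mtot n] >= [drift n] >= k, so [mtot]
    dominates a harmonic series. Through this lemma the Puiseux hypothesis, which contains
    convergence at rho, puts Q into the class. *)
Lemma ex_series_qtilt_tau : ex_series qtilt -> 1 < tau.
Proof.
  intros Hex. destruct (Rlt_or_le 1 tau) as [|Ht]; [assumption|exfalso].
  destruct (drift_lower Ht) as (n0 & k & Hk & H). pose proof rho_pos as Hr.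
  assert (Hqr : 0 < q * rho) by pos.
  assert (Hm : ex_series mtot).
  { apply (ex_series_ext (fun n => / (q * rho) * qtilt (1 + n) + qcut n)).
    - intros n. simpl Nat.add. rewrite qtilt_S. assert (E : / (q * rho) * (q * rho * (mtot n - qcut n)) + qcut n = mtot n)
        by (field; split; [pose proof Ptau_pos|]; lra). exact E.
    - apply (ex_series_plus (fun n => / (q * rho) * qtilt (1 + n)) qcut).
      + apply (ex_series_scal_l (/ (q * rho)) (fun n => qtilt (1 + n))), (ex_series_shift qtilt 1), Hex.
      + destruct InA_qcut as [al Hal]. eapply InA_ex_series, Hal. }
  assert (Hlow : forall n, (n0 <= n)%nat -> (1 <= n)%nat -> k / INR n <= mtot n).
  { intros n Hn Hn1. assert (Hn2 : 0 < INR n) by (apply lt_0_INR; lia). apply Rle_div_l; [exact Hn2|].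
    rewrite Rmult_comm. change (INR n * mtot n) with (theta mtot n). rewrite mtot_ode.
    apply Rle_trans with (1 := H n Hn).
    replace (drift n) with (mtot 0 * drift (n - 0)) by (rewrite mtot_0, Nat.sub_0_r; ring).
    apply (sum_ge_term (fun j => mtot j * drift (n - j))); [|lia].
    intros j. apply Rmult_le_pos; [apply mtot_nonneg|].
    apply cond_pos_sum. intros i. apply Rmult_le_pos; [|apply pow_le, Rlt_le, Rinv_0_lt_compat, Htau].
    destruct (n - j)%nat as [|n1]; [unfold updrift, seq0; lra|]. unfold updrift.
    apply seqpow_nonneg, tilt_nonneg. }
  destruct Hm as [l Hl]. apply lim_of_is_series in Hl.
  assert (Hl2 : is_lim_seq (fun n => sum_f_R0 mtot (2 * n + 1)) l).
  { apply (is_lim_seq_subseq (sum_f_R0 mtot) l (fun n => (2 * n + 1)%nat)); [|exact Hl].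
    apply eventually_subseq. intros n. lia. }
  assert (Hl3 : is_lim_seq (fun n => sum_f_R0 mtot (2 * n + 1) - sum_f_R0 mtot n) (l - l))
    by (apply is_lim_seq_minus'; assumption).
  assert (Hge : Rbar_le (k / 2) (l - l)).
  { apply (is_lim_seq_le_loc (fun _ => k / 2) (fun n => sum_f_R0 mtot (2 * n + 1) - sum_f_R0 mtot n)); [|apply is_lim_seq_const|exact Hl3].
    exists n0. intros n Hn. rewrite (tech2 _ n (2 * n + 1)) by lia.
    apply Rle_trans with (sum_f_R0 (fun i => mtot (S n + i)) (2 * n + 1 - S n)); [|lra].
    replace (2 * n + 1 - S n)%nat with n by lia.
    apply Rle_trans with (sum_f_R0 (fun i => k / (2 * INR (S n))) n).
    - rewrite sum_cte. apply Req_le. field. apply not_0_INR. lia.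
    - apply sum_Rle. intros i Hi. apply Rle_trans with (2 := Hlow (S n + i)%nat ltac:(lia) ltac:(lia)).
      apply Rmult_le_compat_l; [lra|]. apply Rinv_le_contravar; [apply lt_0_INR; lia|].
      replace (2 * INR (S n)) with (INR (2 * S n)) by (rewrite mult_INR; simpl (INR 2); ring).
      apply le_INR. lia. }
  simpl in Hge. lra.
Qed.

(** * Radius of convergence of Q below rho *)

Definition ptot : R := sum_f_R0 pshift (c + d).
(** The weight of the paths that stay nonnegative for n steps and go below 0 at step n + 1: the
    shifted indices 0 to c - 1 are the altitudes -c to -1. *)
Definition exitw (n : nat) : R := sum_f_R0 (conv pshift (mea c d p n)) (c - 1).

Lemma Mcoef_S n : Mcoef c d p (S n) = ptot * Mcoef c d p n - exitw n.
Proof.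
  unfold ptot, Mcoef.
  rewrite <- (sum_conv_low pshift (mea c d p n)) by (apply pshift_low || apply mea_low).
  rewrite (tech2 _ (c - 1) (c + d + d * n)) by lia. unfold exitw.
  replace (c + d + d * n - S (c - 1))%nat with (d * S n)%nat by lia.
  rewrite (sum_eq (fun k => mea c d p (S n) k) (fun i => conv pshift (mea c d p n) (S (c - 1) + i))); [ring|].
  intros i _. rewrite mea_S. f_equal. lia.
Qed.

Lemma exitw_nonneg n : 0 <= exitw n.
Proof. apply cond_pos_sum. intros k. apply conv_nonneg; [apply pshift_nonneg|apply mea_nonneg]. Qed.

Lemma Mcoef_nonneg n : 0 <= Mcoef c d p n.
Proof. apply cond_pos_sum. intros k. apply mea_nonneg. Qed.

Lemma ptot_pos : 0 < ptot.
Proof. apply Rlt_le_trans with (pshift 0); [apply pshift_0|apply sum_ge_term; [apply pshift_nonneg|lia]]. Qed.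

Lemma InA_bounded a al : InA a al -> exists B, 0 <= B /\ forall n, Rabs (a n) <= B.
Proof.
  intros [B HB]. exists (B + 2 * Rabs al). pose proof (bigA_nonneg _ _ _ HB). pose proof (Rabs_pos al).
  split; [lra|]. intros n. replace (a n) with ((a n - al * wseq n) + al * wseq n) by ring.
  apply Rle_trans with (1 := Rabs_triang _ _). rewrite Rabs_mult. specialize (HB n).
  pose proof (Rabs_wseq_le n). pose proof (kap_le_kap1 n). pose proof (kap1_le_gseq n). pose proof (gseq_le_1 n).
  pose proof (kap_pos n). nra.
Qed.

(** The tilted sequence lies in the class and is therefore bounded, for every tau; undoing the tilt
    at a fixed altitude costs only P(tau)^n. *)
Lemma mea_bound k : exists B, 0 <= B /\ forall n, mea c d p n k <= B * Ptau ^ n.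
Proof.
  destruct (InA_altseq k) as [al Hal]. destruct (InA_bounded _ _ Hal) as (B & HB & H).
  exists (B * (/ tau) ^ k). assert (0 <= (/ tau) ^ k) by pos.
  split; [pos|]. intros n. specialize (H n).
  pose proof (Rle_abs (altseq k n)) as H1. unfold altseq, mtilt in H, H1.
  pose proof (tau_inv_pow k) as E1. pose proof Ptau_pos as HP.
  assert (E2 : rho ^ n * Ptau ^ n = 1) by (rewrite <- Rpow_mult_distr, Rinv_l by lra; apply pow1).
  replace (mea c d p n k) with (mea c d p n k * tau ^ k * rho ^ n * ((/ tau) ^ k * Ptau ^ n)).
  2:{ replace (mea c d p n k * tau ^ k * rho ^ n * ((/ tau) ^ k * Ptau ^ n))
        with (mea c d p n k * (tau ^ k * (/ tau) ^ k) * (rho ^ n * Ptau ^ n)) by ring. rewrite E1, E2. ring. }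
  rewrite Rmult_assoc with (r1 := B). apply Rmult_le_compat_r; [|lra].
  pos.
Qed.

Lemma sum_mea_bound (f : nat -> R) m : exists B, 0 <= B /\ forall n,
  sum_f_R0 (fun j => Rabs (f j) * mea c d p n j) m <= B * Ptau ^ n.
Proof.
  induction m as [|m (B & HB & IH)].
  - destruct (mea_bound 0) as (B & HB & H). exists (Rabs (f O) * B). pose proof (Rabs_pos (f O)).
    split; [pos|]. intros n. simpl. rewrite Rmult_assoc. apply Rmult_le_compat_l; auto.
  - destruct (mea_bound (S m)) as (B' & HB' & H). exists (B + Rabs (f (S m)) * B'). pose proof (Rabs_pos (f (S m))).
    split; [assert (0 <= Rabs (f (S m)) * B') by pos; lra|].
    intros n. rewrite tech5. specialize (IH n). specialize (H n).
    assert (Rabs (f (S m)) * mea c d p n (S m) <= Rabs (f (S m)) * (B' * Ptau ^ n)) by (apply Rmult_le_compat_l; auto).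
    lra.
Qed.

Lemma exitw_bound : exists B, 0 <= B /\ forall n, exitw n <= B * Ptau ^ n.
Proof.
  assert (H : forall m, exists B, 0 <= B /\ forall n, sum_f_R0 (conv pshift (mea c d p n)) m <= B * Ptau ^ n).
  { assert (Hk : forall k, exists B, 0 <= B /\ forall n, conv pshift (mea c d p n) k <= B * Ptau ^ n).
    { intros k. destruct (sum_mea_bound (fun j => pshift (k - j)) k) as (B & HB & H). exists B.
      split; [exact HB|]. intros n. apply Rle_trans with (2 := H n).
      replace (conv pshift (mea c d p n)) with (conv (mea c d p n) pshift) by ring.
      apply sum_Rle. intros j _. rewrite Rabs_pos_eq by apply pshift_nonneg. lra. }
    induction m as [|m (B & HB & IH)]; [apply Hk|].
    destruct (Hk (S m)) as (B' & HB' & H). exists (B + B'). split; [lra|]. intros n. rewrite tech5.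
    specialize (IH n). specialize (H n). lra. }
  apply H.
Qed.

Lemma ex_series_geom_bound (a : nat -> R) B x r :
  (forall n, 0 <= a n <= B * x ^ n) -> 0 <= x -> 0 <= r -> x * r < 1 -> ex_series (fun n => a n * r ^ n).
Proof.
  intros Ha Hx Hr Hxr. apply ex_series_dominated with (fun n => B * (x * r) ^ n).
  - intros n. specialize (Ha n). rewrite Rabs_pos_eq by pos.
    rewrite Rpow_mult_distr, <- Rmult_assoc. apply Rmult_le_compat_r; [pos|lra].
  - apply (ex_series_scal_l B (fun n => (x * r) ^ n)), ex_series_geom. rewrite Rabs_pos_eq; [lra|].
    pos.
Qed.

(* M = N / (1 - z P(1)) where N has radius of convergence at least rho, so the only possible
   singularity of M inside |z| < rho is a simple pole, at which Q diverges. *)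
Lemma Qcoef_radius_open r : 0 < r < rho -> ex_series (fun n => Qcoef c d p q n * r ^ n) ->
  exists r', r < r' /\ ex_series (fun n => Qcoef c d p q n * r' ^ n).
Proof.
  intros Hr Hex. pose proof Ptau_pos as HP. pose proof ptot_pos as Hp1.
  assert (HrP : Ptau * r < 1).
  { apply Rmult_lt_reg_l with rho; [apply rho_pos|]. rewrite <- Rmult_assoc, Rinv_l by lra. lra. }
  (* A geometric bound on M with ratio x < 1/r suffices: the midpoint of r and 1/x serves as r'. *)
  assert (Hgeom : forall B x, 0 < x -> x * r < 1 -> (forall n, Mcoef c d p n <= B * x ^ n) ->
    exists r', r < r' /\ ex_series (fun n => Qcoef c d p q n * r' ^ n)).
  { intros B x Hx Hxr HB. assert (Hlt : r < / x) by (apply Rmult_lt_reg_l with x; [exact Hx|rewrite Rinv_r; lra]).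
    exists ((r + / x) / 2). split; [lra|].
    set (r' := (r + / x) / 2). assert (Hxr' : x * r' < 1).
    { apply Rmult_lt_reg_l with (/ x); [pos|]. rewrite <- Rmult_assoc, Rinv_l by lra. unfold r'. lra. }
    apply (ex_series_incr_1 (fun n => Qcoef c d p q n * r' ^ n)).
    apply (ex_series_ext (fun n => r' * (Qcoef c d p q (S n) * r' ^ n))).
    - intros n. assert (E : r' * (Qcoef c d p q (S n) * r' ^ n) = Qcoef c d p q (S n) * r' ^ S n) by (simpl pow; ring). exact E.
    - apply (ex_series_scal_l r' (fun n => Qcoef c d p q (S n) * r' ^ n)).
      apply (ex_series_geom_bound _ (q * B) x); [|lra|unfold r'; lra|exact Hxr'].
      intros n. split; [apply Qcoef_nonneg|]. unfold Qcoef, Ecoef. rewrite Rmult_assoc. apply Rmult_le_compat_l; [lra|].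
      assert (0 <= sum_f_R0 (fun j => if (j =? 0)%nat then 0 else if Req_EM_T (p (- Z.of_nat j)%Z) 0 then 0 else mea c d p n j) c).
      { apply cond_pos_sum. intros j. destruct (j =? 0)%nat; [lra|]. destruct (Req_EM_T (p (- Z.of_nat j)%Z) 0); [lra|apply mea_nonneg]. }
      pose proof (mea_nonneg n 0). specialize (HB n). lra. }
  (* Before the possible pole 1/P(1), dropping the boundary gives M_n <= P(1)^n, which is enough.
     Beyond it, convergence at r must exclude the pole. *)
  destruct (Rlt_or_le (ptot * r) 1) as [Hlt|Hge].
  - apply (Hgeom 1 ptot Hp1 Hlt). intros n. rewrite Rmult_1_l. induction n as [|n IH].
    + unfold Mcoef. rewrite Nat.mul_0_r. simpl. lra.
    + rewrite Mcoef_S. pose proof (exitw_nonneg n). simpl. nra.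
  - destruct exitw_bound as (B & HB & Hexit).
    assert (HM : ex_series (fun n => Mcoef c d p n * r ^ n)).
    { destruct (sum_mea_bound (fun j => 1) c) as (B2 & HB2 & H2).
      apply ex_series_dominated with (fun n => / (q * r) * (Qcoef c d p q (1 + n) * r ^ (1 + n)) + 2 * B2 * (Ptau * r) ^ n).
      - intros n. pose proof (pow_lt r n (proj1 Hr)).
        rewrite Rabs_pos_eq by (apply Rmult_le_pos; [apply Mcoef_nonneg|lra]).
        assert (E : Mcoef c d p n <= / q * Qcoef c d p q (S n) + 2 * B2 * Ptau ^ n).
        { unfold Qcoef, Ecoef. rewrite <- Rmult_assoc, Rinv_l, Rmult_1_l by lra.
          specialize (H2 n). rewrite (sum_eq _ (mea c d p n)) in H2 by (intros; rewrite Rabs_R1; ring).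
          assert (mea c d p n 0 <= sum_f_R0 (mea c d p n) c) by (apply sum_ge_term; [intros; apply mea_nonneg|lia]).
          assert (sum_f_R0 (fun j => if (j =? 0)%nat then 0 else if Req_EM_T (p (- Z.of_nat j)%Z) 0 then 0 else mea c d p n j) c
            <= sum_f_R0 (mea c d p n) c).
          { apply sum_Rle. intros j _. pose proof (mea_nonneg n j). destruct (j =? 0)%nat; [lra|].
            destruct (Req_EM_T (p (- Z.of_nat j)%Z) 0); lra. }
          lra. }
        apply Rle_trans with ((/ q * Qcoef c d p q (S n) + 2 * B2 * Ptau ^ n) * r ^ n); [apply Rmult_le_compat_r; lra|].
        apply Req_le. rewrite Rpow_mult_distr. simpl Nat.add. simpl (r ^ S n). field. lra.
      - apply (ex_series_plus (fun n => / (q * r) * (Qcoef c d p q (1 + n) * r ^ (1 + n))) (fun n => 2 * B2 * (Ptau * r) ^ n)).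
        + apply (ex_series_scal_l (/ (q * r)) (fun n => Qcoef c d p q (1 + n) * r ^ (1 + n))).
          apply (ex_series_shift (fun n => Qcoef c d p q n * r ^ n) 1), Hex.
        + apply (ex_series_scal_l (2 * B2) (fun n => (Ptau * r) ^ n)), ex_series_geom.
          rewrite Rabs_pos_eq by pos. exact HrP. }
    assert (Hptlt : Ptau < ptot).
    { apply Rmult_lt_reg_r with r; lra. }
    set (s := Ptau / ptot). assert (Hs : 0 < s < 1).
    { unfold s. split; [pos|]. apply Rlt_div_l; lra. }
    (* M_n r^n tends to 0 and r >= 1/P(1), so y tends to 0; its decrements are at most (B / P(1))
       s^n by the bound on [exitw]. Hence y is at most the sum of its later decrements, of order
       s^n, that is M_n = O(P(tau)^n). *)
    set (y := fun n => Mcoef c d p n / ptot ^ n).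
    assert (Hy0 : is_lim_seq y 0).
    { apply ex_series_lim_0 in HM.
      apply (is_lim_seq_le_le (fun _ => 0) y (fun n => Mcoef c d p n * r ^ n)); [|apply is_lim_seq_const|exact HM].
      intros n. unfold y. pose proof (pow_lt ptot n Hp1). pose proof (Mcoef_nonneg n).
      split; [pos|].
      apply Rmult_le_compat_l; [assumption|]. rewrite <- pow_inv. apply pow_incr.
      split; [pos|].
      apply Rmult_le_reg_l with ptot; [exact Hp1|]. rewrite Rinv_r; lra. }
    assert (Hstep : forall n, y n <= y (S n) + B / ptot * s ^ n).
    { intros n. unfold y. rewrite Mcoef_S. specialize (Hexit n). pose proof (pow_lt ptot n Hp1).
      simpl (ptot ^ S n). unfold s. rewrite pow_div.
      replace (Mcoef c d p n / ptot ^ n) with ((ptot * Mcoef c d p n) / (ptot * ptot ^ n)) by (field; lra).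
      replace (B / ptot * (Ptau ^ n / ptot ^ n)) with ((B * Ptau ^ n) / (ptot * ptot ^ n)) by (field; lra).
      assert (0 < / (ptot * ptot ^ n)) by pos.
      unfold Rdiv. rewrite <- Rmult_plus_distr_r. apply Rmult_le_compat_r; lra. }
    assert (Hiter : forall n m, y n <= y (n + m)%nat + B / ptot * s ^ n / (1 - s) * (1 - s ^ m)).
    { intros n m. induction m as [|m IH]; [rewrite Nat.add_0_r; simpl; lra|].
      rewrite Nat.add_succ_r. specialize (Hstep (n + m)%nat). rewrite pow_add in Hstep.
      apply Rle_trans with (1 := IH).
      replace (B / ptot * s ^ n / (1 - s) * (1 - s ^ S m)) with
        (B / ptot * s ^ n / (1 - s) * (1 - s ^ m) + B / ptot * (s ^ n * s ^ m)) by (simpl; field; lra). lra. }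
    assert (HyB : forall n, y n <= B / ptot * s ^ n / (1 - s)).
    { intros n.
      assert (HB0 : 0 <= B / ptot * s ^ n / (1 - s)).
      { apply Rmult_le_pos; [apply Rmult_le_pos; [apply Rmult_le_pos; [lra|]|]|].
        - apply Rlt_le, Rinv_0_lt_compat, Hp1.
        - pos.
        - pos. }
      assert (Hl : is_lim_seq (fun m => y (m + n)%nat + B / ptot * s ^ n / (1 - s)) (0 + B / ptot * s ^ n / (1 - s))).
      { apply is_lim_seq_plus'; [apply (is_lim_seq_incr_n y n), Hy0|apply is_lim_seq_const]. }
      rewrite Rplus_0_l in Hl.
      apply (is_lim_seq_le (fun _ => y n) _ (y n) _ ) with (3 := Hl); [|apply is_lim_seq_const].
      intros m. specialize (Hiter n m). rewrite Nat.add_comm in Hiter.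
      assert (0 <= s ^ m) by pos. nra. }
    apply (Hgeom (B / ptot / (1 - s)) Ptau HP HrP). intros n. specialize (HyB n). unfold y in HyB.
    pose proof (pow_lt ptot n Hp1) as Hpn. apply (proj1 (Rle_div_l _ _ _ Hpn)) in HyB.
    apply Rle_trans with (1 := HyB). apply Req_le.
    assert (E : s ^ n * ptot ^ n = Ptau ^ n).
    { rewrite <- Rpow_mult_distr. f_equal. unfold s. field. lra. }
    rewrite <- E. unfold Rdiv. ring.
Qed.

End Walk.

(** * The discrete regime *)

Lemma Rabs_minus_le x y : Rabs (x - y) <= Rabs x + Rabs y.
Proof. rewrite <- (Rabs_Ropp y). apply Rabs_triang. Qed.

(** The coefficient of z^n v^k in e / (1 - v f); [counttot] is the total at v = 1 and [geom f] is 1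
    / (1 - f), so that the law of X_n is [countw] over [counttot]. *)
Definition countw (e f : nat -> R) (n k : nat) : R := conv e (seqpow f k) n.
Definition counttot (e f : nat -> R) (n : nat) : R := sum_f_R0 (countw e f n) n.
Definition geom (f : nat -> R) (n : nat) : R := sum_f_R0 (fun k => seqpow f k n) n.

Lemma counttot_geom e f : f O = 0 -> counttot e f = conv e (geom f).
Proof.
  intros Hf. extensionality n. unfold counttot, countw, conv, geom.
  rewrite sum_exchange. apply sum_eq. intros i Hi.
  rewrite (sum_eq _ (fun k => seqpow f k (n - i) * e i)) by (intros; ring).
  rewrite <- scal_sum. f_equal. apply sum_pad; [lia|]. intros k Hk. apply seqpow_vanish; auto.
Qed.

Lemma geom_inv f : f O = 0 -> conv (seqsub seq1 f) (geom f) = seq1.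
Proof. apply conv_inv_geometric. Qed.

Lemma geom_nonneg f n : (forall i, 0 <= f i) -> 0 <= geom f n.
Proof. intros Hf. apply cond_pos_sum. intros k. apply seqpow_nonneg, Hf. Qed.

Definition masstail (f : nat -> R) (n : nat) : R := 1 - sum_f_R0 f n.

(** The series of [masstail f] is (1 - f) / (1 - z). The identity is the renewal equation: the last
    renewal before n happens somewhere. *)
Lemma masstail_conv f : f O = 0 -> conv (masstail f) (geom f) = seqones.
Proof.
  intros Hf. assert (E : masstail f = conv seqones (seqsub seq1 f)).
  { extensionality n. rewrite conv_seqones. unfold masstail, seqsub. rewrite minus_sum.
    f_equal. clear. induction n as [|n IH]; [reflexivity|]. rewrite tech5, <- IH. unfold seq1. simpl. ring. }
  rewrite E. replace (conv (conv seqones (seqsub seq1 f)) (geom f)) with (conv seqones (conv (seqsub seq1 f) (geom f))) by ring.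
  rewrite geom_inv by exact Hf. ring.
Qed.

Lemma inv_unique a x y : conv a x = seq1 -> conv a y = seq1 -> x = y.
Proof.
  intros Hx Hy. replace x with (conv x (conv a y)) by (rewrite Hy; ring).
  replace (conv x (conv a y)) with (conv (conv a x) y) by ring. rewrite Hx. ring.
Qed.

Lemma scale_conv (r : R) a b :
  conv (fun n => a n * r ^ n) (fun n => b n * r ^ n) = (fun n => conv a b n * r ^ n).
Proof. extensionality n. apply conv_weight. Qed.

Lemma scale_seqpow r a k : seqpow (fun n => a n * r ^ n) k = (fun n => seqpow a k n * r ^ n).
Proof.
  induction k as [|k IH].
  - extensionality n. simpl. unfold seq1. destruct (Nat.eqb_spec n 0) as [->|]; simpl; ring.
  - simpl seqpow. rewrite IH. apply scale_conv.
Qed.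

Lemma Qpow_seqpow c d p q k : Qpow c d p q k = seqpow (Qcoef c d p q) k.
Proof. induction k as [|k IH]; [reflexivity|]. simpl. rewrite IH. reflexivity. Qed.

(** Replacing z by r z multiplies all weights at length n by r^n, which cancels; this permits
    working at rho or at rho0. *)
Lemma Xprob_scale c d p q r n k : 0 < r ->
  let e := fun n => Ecoef c d p n * r ^ n in
  let f := fun n => Qcoef c d p q n * r ^ n in
  Xprob c d p q n k = countw e f n k / counttot e f n.
Proof.
  intros Hr e f.
  assert (H : forall k, countw e f n k = Ccoef c d p q n k * r ^ n).
  { intros j. unfold countw, e, f, Ccoef. rewrite scale_seqpow, scale_conv, Qpow_seqpow. reflexivity. }
  assert (Ht : counttot e f n = r ^ n * Ctot c d p q n).
  { unfold counttot, Ctot. rewrite scal_sum. apply sum_eq. intros; apply H. }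
  unfold Xprob. rewrite H, Ht.
  pose proof (pow_lt r n Hr).
  (* If the total weight is 0, both quotients are 0 by the convention for division by 0. *)
  destruct (Req_dec (Ctot c d p q n) 0) as [E|Hne].
  - rewrite E, Rmult_0_r. unfold Rdiv. rewrite !Rinv_0. ring.
  - field. lra.
Qed.

Section DiscreteLaw.
Variables (e f : nat -> R) (ae af : R).
Hypothesis He : InA e ae.
Hypothesis Hf : InA f af.
Hypothesis f_nonneg : forall n, 0 <= f n.
Hypothesis f_0 : f O = 0.
Hypothesis f_lt : Series f < 1.

Lemma InA_seqpow k : InA (seqpow f k) (INR k * Series f ^ pred k * af) /\ Series (seqpow f k) = Series f ^ k.
Proof.
  destruct Hf as [B HB]. pose proof (bigA_nonneg _ _ _ HB). pose proof (Rabs_pos af).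
  destruct (seqpow_bigA f af (Rabs af + B)) with (k := k) as (H1 & _ & H3).
  - apply bigA_mono with B; [exact HB|lra].
  - lra.
  - split; [eexists; exact H1|exact H3].
Qed.

(** [InA_inv] gives membership with some coefficient; the product rule applied to (1 - f) D = 1 and
    [InA_unique] force its value. *)
Lemma InA_geom : InA (geom f) (af * (/ (1 - Series f)) ^ 2) /\ Series (geom f) = / (1 - Series f).
Proof.
  destruct (InA_inv f af Hf f_0 f_nonneg f_lt) as (D & ad & HD & E).
  rewrite (inv_unique _ _ _ (geom_inv f f_0) E).
  assert (H1 : InA (seqsub seq1 f) (0 - af)) by (apply InA_sub; [apply InA_seq1|exact Hf]).
  assert (HS : Series (seqsub seq1 f) = 1 - Series f).
  { unfold seqsub. rewrite Series_minus; [rewrite Series_seq1; reflexivity| |].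
    - eapply InA_ex_series, InA_seq1.
    - eapply InA_ex_series, Hf. }
  assert (HSD : (1 - Series f) * Series D = 1).
  { rewrite <- HS, <- (InA_Series_conv _ _ _ _ H1 HD), E. apply Series_seq1. }
  assert (HD1 : Series D = / (1 - Series f)).
  { apply Rmult_eq_reg_l with (1 - Series f); [|lra]. rewrite HSD, Rinv_r; lra. }
  split; [|exact HD1].
  assert (Had : (0 - af) * Series D + ad * (1 - Series f) = 0).
  { rewrite <- HS. pose proof (InA_conv _ _ _ _ H1 HD) as H. rewrite E in H.
    exact (InA_unique _ _ _ H InA_seq1). }
  replace (af * (/ (1 - Series f)) ^ 2) with ad; [exact HD|].
  rewrite HD1 in Had. apply Rmult_eq_reg_r with (1 - Series f); [|lra].
  replace (af * (/ (1 - Series f)) ^ 2 * (1 - Series f)) with (af * / (1 - Series f)) by (field; lra). lra.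
Qed.

(** Numerator and denominator both lie in the class, so their common factor [wseq] cancels and the
    errors are of relative size [kap] / [wseq] = O(1/n). *)
Lemma discrete_limit_law k :
  let D := / (1 - Series f) in
  let ak := ae * Series f ^ k + INR k * Series f ^ pred k * af * Series e in
  let at_ := ae * D + af * D ^ 2 * Series e in
  at_ <> 0 ->
  exists K N, forall n, (N <= n)%nat ->
    Rabs (countw e f n k / counttot e f n - ak / at_) <= K / INR n.
Proof.
  intros D ak at_ Hat. unfold countw. rewrite counttot_geom by exact f_0.
  destruct (InA_seqpow k) as [H1 H2]. destruct InA_geom as [H3 H4]. fold D in H3, H4.
  destruct (InA_conv _ _ _ _ He H1) as [B1 HB1]. rewrite H2 in HB1. fold ak in HB1.
  destruct (InA_conv _ _ _ _ He H3) as [B2 HB2]. rewrite H4 in HB2. fold at_ in HB2.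
  set (a := conv e (seqpow f k)) in *. set (b := conv e (geom f)) in *.
  assert (Hat0 : 0 < Rabs at_) by (apply Rabs_pos_lt, Hat).
  pose proof (bigA_nonneg _ _ _ HB1) as HB10. pose proof (bigA_nonneg _ _ _ HB2) as HB20.
  destruct (INR_archimed (Rabs at_) (4 * B2) Hat0) as [N HN].
  exists (4 * (B1 * Rabs at_ + B2 * Rabs ak) / Rabs at_ ^ 2), (S N). intros n Hn.
  assert (Hn0 : 0 < INR n) by (apply lt_0_INR; lia).
  specialize (HB1 n). specialize (HB2 n). pose proof (kap_pos n) as Hk. pose proof (Rabs_wseq_ge n) as Hw.
  rewrite <- kap_kap1 in Hw. apply le_INR in Hn. rewrite S_INR in Hn.
  assert (Hb : Rabs at_ * (kap n * INR n) / 4 <= Rabs (b n)).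
  { pose proof (Rabs_triang_inv (at_ * wseq n) (at_ * wseq n - b n)) as Ht.
    replace (at_ * wseq n - (at_ * wseq n - b n)) with (b n) in Ht by ring.
    rewrite Rabs_mult in Ht. rewrite <- Rabs_Ropp in HB2. replace (- (b n - at_ * wseq n)) with (at_ * wseq n - b n) in HB2 by ring.
    assert (Rabs at_ * (kap n * (INR n + 1) / 2) <= Rabs at_ * Rabs (wseq n)) by (apply Rmult_le_compat_l; lra).
    assert (4 * B2 <= INR n * Rabs at_) by nra.
    assert (4 * B2 * kap n <= INR n * Rabs at_ * kap n) by (apply Rmult_le_compat_r; lra).
    assert (0 <= Rabs at_ * kap n) by pos. nra. }
  assert (Hb0 : 0 < Rabs at_ * (kap n * INR n) / 4).
  { assert (0 < kap n * INR n) by pos.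
    assert (0 < Rabs at_ * (kap n * INR n)) by pos. lra. }
  assert (Hbn : b n <> 0) by (intros H0; rewrite H0, Rabs_R0 in Hb; lra).
  replace (a n / b n - ak / at_) with (((a n - ak * wseq n) * at_ - (b n - at_ * wseq n) * ak) * / (b n * at_)) by (field; auto).
  rewrite Rabs_mult, Rabs_inv, Rabs_mult.
  apply Rle_trans with ((B1 * Rabs at_ + B2 * Rabs ak) * kap n * / (Rabs at_ * (kap n * INR n) / 4 * Rabs at_)).
  - apply Rmult_le_compat.
    + apply Rabs_pos.
    + pos.
    + apply Rle_trans with (1 := Rabs_minus_le _ _). rewrite !Rabs_mult.
      assert (Rabs (a n - ak * wseq n) * Rabs at_ <= B1 * kap n * Rabs at_) by (apply Rmult_le_compat_r; lra).
      assert (Rabs (b n - at_ * wseq n) * Rabs ak <= B2 * kap n * Rabs ak) by (apply Rmult_le_compat_r; [apply Rabs_pos|lra]).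
      lra.
    + apply Rinv_le_contravar; [pos|]. apply Rmult_le_compat_r; lra.
  - apply Req_le. field. lra.
Qed.

End DiscreteLaw.

(** * Puiseux expansion at the singularity *)

Lemma CV_disk_of_summable (a : nat -> R) x : ex_series (fun n => Rabs (a n)) -> 0 <= x <= 1 -> ex_series (fun n => a n * x ^ n).
Proof.
  intros Ha Hx. apply ex_series_dominated with (2 := Ha). intros n. rewrite Rabs_mult.
  assert (0 <= x ^ n <= 1) by (apply pow_unit_interval; lra).
  rewrite (Rabs_pos_eq (x ^ n)) by lra. pose proof (Rabs_pos (a n)). nra.
Qed.

(** The square of the sum is 1 - x. Its sign is found by comparison with x = 1, where the sum is 0:
    all coefficients after the first are negative. *)
Lemma Series_wseq_pow x : 0 <= x < 1 -> Series (fun n => wseq n * x ^ n) = sqrt (1 - x).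
Proof.
  intros Hx. set (s := Series (fun n => wseq n * x ^ n)).
  assert (Hex : ex_series (fun n => Rabs (wseq n * x ^ n))).
  { apply ex_series_dominated with (2 := ex_series_Rabs_wseq). intros n.
    rewrite Rabs_Rabsolu, Rabs_mult.
    assert (0 <= x ^ n <= 1) by (apply pow_unit_interval; lra).
    rewrite (Rabs_pos_eq (x ^ n)) by lra. pose proof (Rabs_pos (wseq n)). nra. }
  assert (Hs : is_series (fun n => wseq n * x ^ n) s) by (apply Series_correct, ex_series_Rabs, Hex).
  assert (Hsq : is_series (conv (fun n => wseq n * x ^ n) (fun n => wseq n * x ^ n)) (s * s))
    by (apply is_series_mult; assumption).
  rewrite scale_conv, wseq_conv_wseq in Hsq.
  assert (Hf : is_series (fun n => onemz n * x ^ n) (sum_f_R0 (fun n => onemz n * x ^ n) 1)).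
  { apply is_series_finite. intros [|[|k]] Hk; try lia. unfold onemz, seqsub, seq1, mono. simpl. ring. }
  assert (E : s * s = 1 - x).
  { rewrite <- (is_series_unique _ _ Hsq), (is_series_unique _ _ Hf). unfold onemz, seqsub, seq1, mono. simpl. ring. }
  assert (Hs0 : 0 <= s).
  { rewrite <- (is_series_unique _ _ is_series_wseq). unfold s.
    rewrite (Series_incr_1 wseq), (Series_incr_1 (fun n => wseq n * x ^ n));
      [|eexists; exact Hs|eexists; apply is_series_wseq].
    simpl (x ^ 0). rewrite Rmult_1_r. apply Rplus_le_compat_l.
    assert (H : Series (fun n => - wseq (S n) * x ^ S n) <= Series (fun n => - wseq (S n))).
    { apply Series_le.
      - intros n. rewrite wseq_S. pose proof (kap1_pos n).
        assert (0 <= x ^ S n <= 1) by (apply pow_unit_interval; lra). nra.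
      - apply (ex_series_opp (fun n => wseq (S n))). apply (ex_series_incr_1 wseq). eexists; apply is_series_wseq. }
    rewrite (Series_ext (fun n => - wseq (S n) * x ^ S n) (fun n => - (wseq (S n) * x ^ S n))) in H by (intros; ring).
    rewrite !Series_opp in H. lra. }
  rewrite <- E. symmetry. apply sqrt_square, Hs0.
Qed.

Lemma one_minus_pow_le x n : 0 <= x <= 1 -> 0 <= 1 - x ^ n <= INR n * (1 - x).
Proof.
  intros Hx. induction n as [|n IH]; [simpl; lra|]. rewrite S_INR. simpl.
  assert (0 <= x ^ n <= 1) by (apply pow_unit_interval; lra). nra.
Qed.

(** The remainder r satisfies sum n |r_n| < infinity, so its sum function varies by at most a
    multiple of 1 - x. *)
Lemma InA_puiseux a al : InA a al -> exists K, forall x, 0 <= x < 1 ->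
  Rabs (Series (fun n => a n * x ^ n) - (Series a + al * sqrt (1 - x))) <= K * (1 - x).
Proof.
  intros Ha. pose proof Ha as [B HB]. pose proof (bigA_nonneg _ _ _ HB) as HB0.
  exists (2 * B). intros x Hx.
  set (r := fun n => a n - al * wseq n).
  assert (Hwx : ex_series (fun n => wseq n * x ^ n)) by (apply CV_disk_of_summable; [apply ex_series_Rabs_wseq|lra]).
  assert (Hax : ex_series (fun n => a n * x ^ n)) by (apply CV_disk_of_summable; [eapply InA_Rabs_summable, Ha|lra]).
  assert (Hr : ex_series r).
  { apply ex_series_dominated with (1 := HB). apply (ex_series_scal_l B kap), ex_series_kap. }
  assert (Hrx : ex_series (fun n => r n * x ^ n)).
  { apply CV_disk_of_summable; [|lra]. apply ex_series_dominated with (fun n => B * kap n).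
    - intros n. rewrite Rabs_Rabsolu. apply HB.
    - apply (ex_series_scal_l B kap), ex_series_kap. }
  assert (E1 : Series (fun n => a n * x ^ n) = Series (fun n => r n * x ^ n) + al * sqrt (1 - x)).
  { rewrite <- (Series_wseq_pow x Hx), <- Series_scal_l, <- Series_plus; [|exact Hrx|apply (ex_series_scal_l al (fun n => wseq n * x ^ n)), Hwx].
    apply Series_ext. intros n. unfold r. ring. }
  rewrite E1, <- (Series_minus_wseq a al) by (eapply InA_ex_series, Ha). fold r.
  replace (Series (fun n => r n * x ^ n) + al * sqrt (1 - x) - (Series r + al * sqrt (1 - x)))
    with (Series (fun n => r n * x ^ n) - Series r) by ring.
  rewrite <- Series_minus by assumption.
  assert (Hik : ex_series (fun n => INR n * kap n)).
  { apply ex_series_bounded with 2; [|apply sum_INR_kap_le]. intros n. apply Rmult_le_pos; [apply pos_INR|apply Rlt_le, kap_pos]. }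
  apply Rle_trans with (Series (fun n => B * (1 - x) * (INR n * kap n))).
  - apply Rabs_Series_le; [|apply (ex_series_scal_l (B * (1 - x)) (fun n => INR n * kap n)), Hik].
    intros n. replace (r n * x ^ n - r n) with (- (r n * (1 - x ^ n))) by ring.
    rewrite Rabs_Ropp, Rabs_mult. pose proof (one_minus_pow_le x n ltac:(lra)) as Hp.
    rewrite (Rabs_pos_eq (1 - x ^ n)) by lra.
    replace (B * (1 - x) * (INR n * kap n)) with ((B * kap n) * (INR n * (1 - x))) by ring.
    apply Rmult_le_compat; [apply Rabs_pos|lra|apply HB|lra].
  - rewrite Series_scal_l. assert (Series (fun n => INR n * kap n) <= 2).
    { apply Series_bounded; [|apply sum_INR_kap_le]. intros n. apply Rmult_le_pos; [apply pos_INR|apply Rlt_le, kap_pos]. }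
    assert (0 <= B * (1 - x)) by pos. nra.
Qed.

Lemma puiseux_eta c d p q rho eta al : 0 < rho ->
  InA (fun n => Qcoef c d p q n * rho ^ n) al -> puiseux c d p q rho eta -> al = - eta.
Proof.
  intros Hrho Ha [_ (K & dl & Hdl & H)]. destruct (InA_puiseux _ _ Ha) as [K' HK'].
  destruct (Req_dec al (- eta)) as [|Hne]; [assumption|exfalso].
  assert (Hd : 0 < Rabs (al + eta)) by (apply Rabs_pos_lt; lra).
  set (L := Rabs K + Rabs K' + 1). assert (HL : 0 < L) by (unfold L; pose proof (Rabs_pos K); pose proof (Rabs_pos K'); lra).
  (* The test point is z = rho (1 - s^2), where sqrt(1 - z/rho) = s; s is so small that L s <= |al +
     eta| / 2 and that z lies in the range of the hypothesis. *)
  set (s := Rmin (1 / 2) (Rmin (Rabs (al + eta) / (2 * L)) (dl / (2 * rho)))).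
  assert (Hs : 0 < s) by (apply Rmin_glb_lt; [lra|apply Rmin_glb_lt; pos]).
  assert (Hs1 : s <= 1 / 2) by apply Rmin_l.
  assert (Hs2 : s <= Rabs (al + eta) / (2 * L)) by (apply Rle_trans with (1 := Rmin_r _ _), Rmin_l).
  assert (Hs3 : s <= dl / (2 * rho)) by (apply Rle_trans with (1 := Rmin_r _ _), Rmin_r).
  apply (Rle_div_r s (Rabs (al + eta)) (2 * L)) in Hs2; [|lra].
  apply (Rle_div_r s dl (2 * rho)) in Hs3; [|lra].
  set (x := 1 - s ^ 2). assert (Hx : 0 <= x < 1) by (unfold x; nra).
  specialize (HK' x Hx). specialize (H (rho * x)).
  assert (Hrs : 0 < rho * s) by pos.
  assert (Hz : rho - dl < rho * x < rho).
  { unfold x. replace (rho * (1 - s ^ 2)) with (rho - rho * s * s) by ring. split; nra. }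
  specialize (H Hz).
  replace (1 - rho * x / rho) with (1 - x) in H by (field; lra).
  replace (1 - x) with (s ^ 2) in * by (unfold x; ring). rewrite sqrt_pow2 in * by lra.
  assert (E1 : Qfun c d p q (rho * x) = Series (fun n => Qcoef c d p q n * rho ^ n * x ^ n)).
  { unfold Qfun, PSeries. apply Series_ext. intros n. rewrite Rpow_mult_distr. ring. }
  rewrite E1 in H. unfold Qfun at 1, PSeries at 1 in H.
  set (u := Series (fun n => Qcoef c d p q n * rho ^ n * x ^ n)) in *.
  set (v := Series (fun n => Qcoef c d p q n * rho ^ n)) in *.
  assert (H3 : Rabs ((al + eta) * s) <= L * s ^ 2).
  { replace ((al + eta) * s) with ((u - (v - eta * s)) - (u - (v + al * s))) by ring.
    apply Rle_trans with (1 := Rabs_minus_le _ _).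
    pose proof (Rle_abs K). pose proof (Rle_abs K'). assert (0 <= s ^ 2) by apply pow2_ge_0.
    assert (K * s ^ 2 <= Rabs K * s ^ 2) by (apply Rmult_le_compat_r; lra).
    assert (K' * s ^ 2 <= Rabs K' * s ^ 2) by (apply Rmult_le_compat_r; lra). unfold L. lra. }
  rewrite Rabs_mult, (Rabs_pos_eq s) in H3 by lra. nra.
Qed.

(** * Existence of rho0 when Q(rho) >= 1 *)

Section RhoZero.
Variables (c d : nat) (p : Z -> R) (q rho : R).
Hypothesis Hrho : 0 < rho.
Hypothesis Q_nonneg : forall n, 0 <= Qcoef c d p q n.
Variable n1 : nat.
Hypothesis Hn1 : (1 <= n1)%nat.
Hypothesis Q_pos : 0 < Qcoef c d p q n1.

Lemma Q_strict r r' l l' : 0 < r' < r ->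
  is_series (fun n => Qcoef c d p q n * r' ^ n) l' -> is_series (fun n => Qcoef c d p q n * r ^ n) l -> l' < l.
Proof.
  intros Hr H' H.
  assert (Hdif : is_series (fun n => Qcoef c d p q n * r ^ n - Qcoef c d p q n * r' ^ n) (l - l'))
    by (apply (is_series_minus _ _ _ _ H H')).
  assert (Hnn : forall n, 0 <= Qcoef c d p q n * r ^ n - Qcoef c d p q n * r' ^ n).
  { intros n. rewrite <- Rmult_minus_distr_l. apply Rmult_le_pos; [apply Q_nonneg|].
    assert (r' ^ n <= r ^ n) by (apply pow_incr; lra). lra. }
  pose proof (sum_le_Series _ n1 Hnn (ex_intro _ _ Hdif)) as Hs. rewrite (is_series_unique _ _ Hdif) in Hs.
  pose proof (sum_ge_term _ n1 n1 Hnn (le_n _)) as Ht. cbv beta in Ht.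
  assert (Hlt : r' ^ n1 < r ^ n1).
  { destruct n1 as [|m]; [lia|]. simpl. assert (r' ^ m <= r ^ m) by (apply pow_incr; lra).
    assert (0 < r' ^ m) by pos. nra. }
  nra.
Qed.

(** Applied contrapositively: without rho0, Q(rho) < 1. The intermediate value theorem is used
    strictly inside the disc, where Q is continuous, so a point below rho with Q > 1 is produced
    first; if Q(rho) = 1, rho itself serves. *)
Lemma rho0_exists : ex_series (fun n => Qcoef c d p q n * rho ^ n) ->
  1 <= Series (fun n => Qcoef c d p q n * rho ^ n) -> Qcoef c d p q 0 = 0 ->
  exists rho0, is_rho0 c d p q rho rho0.
Proof.
  intros Hex Hge HQ0. set (lam := Series (fun n => Qcoef c d p q n * rho ^ n)) in *.
  assert (Hmin : forall r, 0 < r <= rho -> is_series (fun n => Qcoef c d p q n * r ^ n) 1 -> is_rho0 c d p q rho r).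
  { intros r Hr Hs. split; [exact Hr|]. split; [exact Hs|]. intros r' Hr' Hs'.
    pose proof (Q_strict r r' 1 1 Hr' Hs' Hs). lra. }
  destruct Hge as [Hgt|Heq].
  2:{ exists rho. apply Hmin; [lra|]. rewrite Heq. apply Series_correct, Hex. }
  assert (Hcv : Rbar_le rho (CV_radius (Qcoef c d p q))).
  { destruct (filterlim_bounded (fun n => Qcoef c d p q n * rho ^ n)) as [M HM].
    - exists 0. apply (ex_series_lim_0 _ Hex).
    - apply CV_radius_ge with M. exact HM. }
  assert (Hpart : exists N, 1 < sum_f_R0 (fun n => Qcoef c d p q n * rho ^ n) N).
  { pose proof (lim_of_is_series _ _ (Series_correct _ Hex)) as Hl. apply is_lim_seq_spec in Hl.
    destruct (Hl (mkposreal (lam - 1) ltac:(lra))) as [N HN]. exists N. specialize (HN N (le_n _)). simpl in HN.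
    fold lam in HN. apply Rabs_lt_between in HN. lra. }
  destruct Hpart as [N HN]. set (SN := sum_f_R0 (fun n => Qcoef c d p q n * rho ^ n) N) in *.
  (* Chosen so that (1 - dl)^N >= 1 - N dl > 1 / SN: the partial sum up to N still exceeds 1 at rho
     (1 - dl). *)
  set (dl := (1 - / SN) / (2 * (INR N + 1))). pose proof (pos_INR N) as HN0.
  assert (Hinv : / SN < 1) by (rewrite <- Rinv_1; apply Rinv_lt_contravar; lra).
  assert (Hinv0 : 0 < / SN) by pos.
  assert (Hdl : 0 < dl) by pos.
  assert (Hdl2 : dl * (2 * (INR N + 1)) = 1 - / SN) by (unfold dl; field; lra).
  set (y := 1 - dl). assert (Hy : 0 < y < 1) by (unfold y; nra).
  assert (Hr1 : ex_series (fun n => Qcoef c d p q n * (rho * y) ^ n)).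
  { apply ex_series_dominated with (2 := Hex). intros n. rewrite Rpow_mult_distr.
    assert (0 <= y ^ n <= 1) by (apply pow_unit_interval; lra).
    pose proof (Q_nonneg n). pose proof (pow_lt rho n Hrho).
    rewrite Rabs_pos_eq by pos.
    apply Rmult_le_compat_l; [lra|]. nra. }
  assert (Hbig : 1 < Qfun c d p q (rho * y)).
  { apply Rlt_le_trans with (sum_f_R0 (fun n => Qcoef c d p q n * (rho * y) ^ n) N).
    - apply Rlt_le_trans with (y ^ N * SN).
      + pose proof (one_minus_pow_le y N ltac:(lra)) as Hp. unfold y at 3 in Hp.
        assert (/ SN < y ^ N) by nra. apply Rmult_lt_reg_l with (/ SN); [exact Hinv0|].
        rewrite Rmult_1_r. replace (/ SN * (y ^ N * SN)) with (y ^ N) by (field; lra). assumption.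
      + unfold SN. rewrite scal_sum. apply sum_Rle. intros n Hn. rewrite Rpow_mult_distr.
        replace (Qcoef c d p q n * (rho ^ n * y ^ n)) with (Qcoef c d p q n * rho ^ n * y ^ n) by ring.
        apply Rmult_le_compat_l; [pos|].
        replace N with (n + (N - n))%nat by lia. rewrite pow_add.
        assert (0 < y ^ n) by pos.
        assert (y ^ (N - n) <= 1) by (apply pow_unit_interval; lra). nra.
    - apply (sum_le_Series (fun n => Qcoef c d p q n * (rho * y) ^ n)); [|exact Hr1].
      intros n. pos. }
  assert (Hin : forall z, 0 <= z < rho -> Rbar_lt (Rabs z) (CV_radius (Qcoef c d p q))).
  { intros z Hz. apply Rbar_lt_le_trans with (2 := Hcv). simpl. rewrite Rabs_pos_eq; lra. }
  assert (Hry : 0 < rho * y < rho) by nra.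
  destruct (Ranalysis5.IVT_interv (fun z => Qfun c d p q z - 1) 0 (rho * y)) as [z [Hz Ez]].
  - intros z Hz. apply continuity_pt_minus; [|apply continuity_pt_const; intros ? ?; reflexivity].
    apply (PSeries_continuity (Qcoef c d p q)), Hin. lra.
  - lra.
  - unfold Qfun. rewrite PSeries_0, HQ0. lra.
  - lra.
  - assert (Hz0 : z <> 0) by (intros ->; unfold Qfun in Ez; rewrite PSeries_0, HQ0 in Ez; lra).
    exists z. apply Hmin; [lra|].
    assert (Ez' : Series (fun n => Qcoef c d p q n * z ^ n) = 1) by (change (Qfun c d p q z = 1); lra).
    rewrite <- Ez'. apply Series_correct. apply ex_series_Rabs, CV_disk_inside, Hin. lra.
Qed.

End RhoZero.

(** * Renewal sequences at a square-root singularity *)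

Lemma is_lim_seq_inv_Sn : is_lim_seq (fun n => / (INR n + 1)) 0.
Proof.
  apply (is_lim_seq_inv (fun n => INR n + 1) p_infty); [|discriminate].
  eapply is_lim_seq_plus; [apply is_lim_seq_INR|apply is_lim_seq_const|reflexivity].
Qed.

Ltac lims := solve [repeat (assumption || apply is_lim_seq_gseq || lazymatch goal with
  | |- is_lim_seq (fun _ => ?c) _ => apply is_lim_seq_const
  | |- is_lim_seq (fun n => _ + _) (Finite (_ + _)) => apply is_lim_seq_plus'
  | |- is_lim_seq (fun n => _ - _) (Finite (_ - _)) => apply is_lim_seq_minus'
  | |- is_lim_seq (fun n => _ * _) (Finite (_ * _)) => apply is_lim_seq_mult'
  end)].

Lemma is_lim_seq_sum (f : nat -> nat -> R) (l : nat -> R) N :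
  (forall i, (i <= N)%nat -> is_lim_seq (f i) (l i)) ->
  is_lim_seq (fun n => sum_f_R0 (fun i => f i n) N) (sum_f_R0 l N).
Proof.
  induction N as [|N IH]; intros H; [apply H; lia|].
  simpl. apply is_lim_seq_plus'; [apply IH; intros; apply H; lia|apply H; lia].
Qed.

Lemma is_lim_seq_0_eps (u : nat -> R) :
  (forall eps, 0 < eps -> exists N, forall n, (N <= n)%nat -> Rabs (u n) <= eps) -> is_lim_seq u 0.
Proof.
  intros H. apply is_lim_seq_spec. intros eps. destruct (H (eps / 2)) as [N HN].
  { pose proof (cond_pos eps). lra. }
  exists N. intros n Hn. rewrite Rminus_0_r. specialize (HN n Hn). pose proof (cond_pos eps). lra.
Qed.

Lemma lim_eps (u : nat -> R) (l eps : R) : is_lim_seq u l -> 0 < eps ->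
  exists N, forall n, (N <= n)%nat -> Rabs (u n - l) <= eps.
Proof.
  intros H He. apply is_lim_seq_spec in H. destruct (H (mkposreal eps He)) as [N HN].
  exists N. intros n Hn. specialize (HN n Hn). simpl in HN. lra.
Qed.

(** Beyond a fixed N, p is at most a small multiple of x. The finitely many earlier terms of p meet
    single shifts of y, each of which is negligible against x * y by the last hypothesis. *)
Lemma conv_negligible (p x y : nat -> R) :
  (forall n, 0 <= p n) -> (forall n, 0 < x n) -> (forall n, 0 <= y n) -> (forall n, 0 < conv x y n) ->
  is_lim_seq (fun n => p n / x n) 0 ->
  (forall i, is_lim_seq (fun n => y (n - i)%nat / conv x y n) 0) ->
  is_lim_seq (fun n => conv p y n / conv x y n) 0.
Proof.
  intros Hp Hx Hy Hz Hpx Hyz. apply is_lim_seq_0_eps. intros eps He.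
  destruct (lim_eps _ _ (eps / 2) Hpx ltac:(lra)) as [N HN].
  assert (Hfin : is_lim_seq (fun n => sum_f_R0 (fun i => p i * (y (n - i)%nat / conv x y n)) N) 0).
  { replace 0 with (sum_f_R0 (fun i => p i * 0) N) by (apply sum_zero; intros; ring).
    apply (is_lim_seq_sum (fun i n => p i * (y (n - i)%nat / conv x y n))). intros i _.
    apply is_lim_seq_mult'; [apply is_lim_seq_const|apply Hyz]. }
  destruct (lim_eps _ _ (eps / 2) Hfin ltac:(lra)) as [N' HN'].
  exists (N + N')%nat. intros n Hn. specialize (HN' n ltac:(lia)). rewrite Rminus_0_r in HN'.
  specialize (Hz n).
  rewrite Rabs_pos_eq.
  2:{ pos. }
  apply Rle_div_l; [exact Hz|].
  set (q := fun i => if Nat.leb i N then p i else 0).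
  apply Rle_trans with (conv (seqadd (seqscal (eps / 2) x) q) y n).
  - apply conv_le; intros i Hi; [|split; [apply Hy|lra]]. split; [apply Hp|].
    unfold seqadd, seqscal, q. specialize (Hx i). specialize (Hp i). destruct (Nat.leb_spec i N) as [Hle|Hgt].
    + assert (0 <= eps / 2 * x i) by pos. lra.
    + specialize (HN i ltac:(lia)). rewrite Rminus_0_r in HN.
      rewrite Rabs_pos_eq in HN by pos.
      apply (proj1 (Rle_div_l (p i) (eps / 2) (x i) Hx)) in HN. lra.
  - replace (conv (seqadd (seqscal (eps / 2) x) q) y) with (seqadd (conv (seqscal (eps / 2) x) y) (conv q y)) by ring.
    rewrite conv_scal_l. unfold seqadd, seqscal.
    assert (E : conv q y n = sum_f_R0 (fun i => p i * (y (n - i)%nat / conv x y n)) N * conv x y n).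
    { rewrite Rmult_comm, scal_sum. unfold conv at 1. rewrite (sum_pad _ N n).
      - apply sum_eq. intros i Hi. unfold q. destruct (Nat.leb_spec i N); [|lia]. field. lra.
      - lia.
      - intros i Hi. unfold q. destruct (Nat.leb_spec i N); [lia|ring]. }
    rewrite E. apply Rabs_le_between in HN'. nra.
Qed.

(** With * the convolution, a*b - al be x*y = (a - al x)*b + al x*(b - be y), and both terms are
    negligible by [conv_negligible]. *)
Lemma conv_asymp (a b x y : nat -> R) (al be : R) :
  (forall n, 0 < x n) -> (forall n, 0 < y n) ->
  is_lim_seq (fun n => a n / x n) al -> is_lim_seq (fun n => b n / y n) be ->
  (forall i, is_lim_seq (fun n => x (n - i)%nat / conv x y n) 0) ->
  (forall i, is_lim_seq (fun n => y (n - i)%nat / conv x y n) 0) ->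
  is_lim_seq (fun n => conv a b n / conv x y n) (al * be).
Proof.
  intros Hx Hy Ha Hb Hxz Hyz.
  assert (Hz : forall n, 0 < conv x y n).
  { intros n. apply Rlt_le_trans with (x O * y (n - 0)%nat); [pos|].
    apply (sum_ge_term (fun i => x i * y (n - i)%nat)); [|lia]. intros i. pos. }
  assert (Hbd : exists B, 0 <= B /\ forall n, Rabs (b n) <= B * y n).
  { destruct (filterlim_bounded (fun n => b n / y n)) as [B HB]; [exists be; exact Hb|].
    exists B. assert (HB' : forall n, Rabs (b n) <= B * y n).
    { intros n. specialize (HB n). change (Rabs (b n / y n) <= B) in HB. specialize (Hy n).
      unfold Rdiv in HB. rewrite Rabs_mult, (Rabs_pos_eq (/ y n)) in HB by pos.
      exact (proj1 (Rle_div_l _ _ _ Hy) HB). }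
    split; [|exact HB']. specialize (HB' O). pose proof (Rabs_pos (b O)). specialize (Hy O). nra. }
  destruct Hbd as (B & HB & HbB).
  set (p1 := fun n => Rabs (a n - al * x n)). set (p2 := fun n => Rabs (b n - be * y n)).
  assert (Hneg : forall (c0 : nat -> R) (g : R) (u : nat -> R), (forall n, 0 < u n) -> is_lim_seq (fun n => c0 n / u n) g ->
    is_lim_seq (fun n => Rabs (c0 n - g * u n) / u n) 0).
  { intros c0 g u Hu Hl. apply (is_lim_seq_ext (fun n => Rabs (c0 n / u n - g))).
    - intros n. specialize (Hu n). replace (c0 n / u n - g) with ((c0 n - g * u n) * / u n) by (field; lra).
      rewrite Rabs_mult, (Rabs_pos_eq (/ u n)) by pos. reflexivity.
    - replace (Finite 0) with (Rbar_abs (Finite (g - g))) by (simpl; f_equal; rewrite Rminus_diag; apply Rabs_R0).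
      apply is_lim_seq_abs, is_lim_seq_minus'; [exact Hl|apply is_lim_seq_const]. }
  assert (H1 : is_lim_seq (fun n => conv p1 y n / conv x y n) 0).
  { apply conv_negligible; auto; [intros; apply Rabs_pos|intros; apply Rlt_le, Hy|apply Hneg; assumption]. }
  assert (H2 : is_lim_seq (fun n => conv p2 x n / conv x y n) 0).
  { apply (is_lim_seq_ext (fun n => conv p2 x n / conv y x n)).
    { intros n. f_equal. replace (conv y x) with (conv x y) by ring. reflexivity. }
    assert (Exy : conv x y = conv y x) by ring. rewrite Exy in *.
    apply conv_negligible; auto; [intros; apply Rabs_pos|intros; apply Rlt_le, Hx|apply Hneg; assumption]. }
  apply (is_lim_seq_ext (fun n => al * be + (conv a b n - al * be * conv x y n) / conv x y n)).
  { intros n. specialize (Hz n). field. lra. }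
  replace (Finite (al * be)) with (Finite (al * be + 0)) by (f_equal; ring).
  apply is_lim_seq_plus'; [apply is_lim_seq_const|]. apply is_lim_seq_abs_0.
  apply (is_lim_seq_le_le (fun _ => 0) _ (fun n => B * (conv p1 y n / conv x y n) + Rabs al * (conv p2 x n / conv x y n))).
  - intros n. split; [apply Rabs_pos|]. specialize (Hz n).
    unfold Rdiv at 1. rewrite Rabs_mult, (Rabs_pos_eq (/ conv x y n)) by pos.
    replace (B * (conv p1 y n / conv x y n) + Rabs al * (conv p2 x n / conv x y n))
      with ((B * conv p1 y n + Rabs al * conv p2 x n) * / conv x y n) by (field; lra).
    apply Rmult_le_compat_r; [pos|].
    replace (conv a b n - al * be * conv x y n)
      with (conv (seqsub a (seqscal al x)) b n + al * conv (seqsub b (seqscal be y)) x n).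
    2:{ replace (conv (seqsub a (seqscal al x)) b) with (seqsub (conv a b) (conv (seqscal al x) b)) by ring.
        replace (conv (seqsub b (seqscal be y)) x) with (seqsub (conv x b) (conv (seqscal be y) x)) by ring.
        rewrite !conv_scal_l. replace (conv y x) with (conv x y) by ring. unfold seqsub, seqscal. ring. }
    apply Rle_trans with (1 := Rabs_triang _ _). rewrite Rabs_mult. apply Rplus_le_compat.
    + apply Rle_trans with (conv p1 (seqscal B y) n).
      * apply conv_Rabs_le; intros i _; [unfold p1, seqsub, seqscal; lra|apply HbB].
      * rewrite conv_scal_r. unfold seqscal. lra.
    + apply Rmult_le_compat_l; [apply Rabs_pos|].
      apply conv_Rabs_le; intros i _; [unfold p2, seqsub, seqscal; lra|rewrite Rabs_pos_eq; [lra|apply Rlt_le, Hx]].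
  - apply is_lim_seq_const.
  - replace 0 with (B * 0 + Rabs al * 0) by ring.
    lims.
Qed.

Lemma sum_gseq n : sum_f_R0 gseq n = (2 * INR n + 1) * gseq n.
Proof.
  induction n as [|n IH]; [simpl; ring|]. rewrite tech5, IH, gseq_S, S_INR. pose proof (pos_INR n). field. lra.
Qed.

Lemma inv_gseq_le n : (1 <= n)%nat -> / (INR n * gseq n) <= 4 * gseq n.
Proof.
  intros Hn. pose proof (gseq_sqr_ge_S (pred n)) as H. replace (S (pred n)) with n in H by lia.
  assert (0 < INR n) by (apply lt_0_INR; lia). pose proof (gseq_pos n).
  assert (Hp : 0 < INR n * gseq n) by pos.
  apply Rmult_le_reg_l with (INR n * gseq n); [exact Hp|]. rewrite Rinv_r by lra. nra.
Qed.

Lemma conv_kap1_gseq n : conv kap1 gseq n <= 12 * gseq n.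
Proof.
  apply Rle_trans with ((2 * gseq n) * sum_f_R0 kap1 n + (4 * kap1 n) * sum_f_R0 gseq n).
  - apply conv_half_le.
    + intros; apply Rlt_le, kap1_pos.
    + intros; apply Rlt_le, gseq_pos.
    + intros m Hm. apply kap1_doubling. lia.
    + intros m Hm. apply gseq_doubling. lia.
  - pose proof (sum_kap1_le n). rewrite sum_gseq. pose proof (gseq_pos n). pose proof (gseq_le_1 n).
    pose proof (kap1_gseq n). pose proof (kap1_pos n). pose proof (pos_INR n).
    assert (kap1 n * (2 * INR n + 1) <= 2 * gseq n) by nra. nra.
Qed.

Section Renewal.
Variables (f : nat -> R) (eta : R).
Hypothesis Hf : InA f (- eta).
Hypothesis f_nonneg : forall n, 0 <= f n.
Hypothesis f_0 : f O = 0.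
Hypothesis f_sum : Series f = 1.
Hypothesis f_lower : exists n0 k, 0 < k /\ forall n, (n0 <= n)%nat -> k * kap1 n <= f n.

(** [wseq] is negative after its first term, so eta <= 0 would leave f_n <= B [kap n], below the
    assumed order n^(-3/2). *)
Lemma eta_pos : 0 < eta.
Proof.
  destruct (Rlt_or_le 0 eta) as [|Hle]; [assumption|exfalso].
  destruct Hf as [B HB]. destruct f_lower as (n0 & k & Hk & Hl).
  destruct (INR_archimed k B Hk) as [N HN]. set (n := (n0 + N + 1)%nat).
  specialize (HB n). specialize (Hl n ltac:(unfold n; lia)).
  apply Rabs_le_between in HB. pose proof (kap_pos n) as Hkn. rewrite <- kap_kap1 in Hl.
  assert (Hw : wseq n < 0).
  { unfold n. rewrite Nat.add_1_r, wseq_S. pose proof (kap1_pos (n0 + N)). lra. }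
  assert (INR N <= INR n) by (apply le_INR; unfold n; lia).
  assert (B * kap n < k * (kap n * (INR n + 1))).
  { replace (k * (kap n * (INR n + 1))) with (k * (INR n + 1) * kap n) by ring. apply Rmult_lt_compat_r; [lra|]. nra. }
  nra.
Qed.

Local Notation ren := (geom f).
Local Notation tailseq := (masstail f).

Lemma tailseq_approx : exists B, 0 <= B /\ forall n, Rabs (tailseq n - eta * gseq n) <= B * kap1 n.
Proof.
  destruct Hf as [B HB]. exists (2 * B). pose proof (bigA_nonneg _ _ _ HB). split; [lra|]. intros n.
  set (r := fun i => f i - - eta * wseq i).
  assert (Er : Series r = 1).
  { unfold r. rewrite Series_minus_wseq; [exact f_sum|]. eapply bigA_ex_series, HB. }
  replace (tailseq n - eta * gseq n) with (Series r - sum_f_R0 r n).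
  - apply Series_tail_kap. exact HB.
  - rewrite Er. unfold masstail, r. rewrite minus_sum, <- sum_wseq.
    rewrite (sum_eq (fun i => - eta * wseq i) (fun i => wseq i * - eta)) by (intros; ring).
    rewrite <- scal_sum. ring.
Qed.

Lemma tailseq_decr n m : (n <= m)%nat -> tailseq m <= tailseq n.
Proof.
  induction 1 as [|m Hm IH]; [lra|]. unfold masstail in *. rewrite tech5. specialize (f_nonneg (S m)). lra.
Qed.

Lemma tailseq_lower : exists k, 0 < k /\ forall n, k * gseq n <= tailseq n.
Proof.
  destruct tailseq_approx as (B & HB & H). pose proof eta_pos as He.
  destruct (INR_archimed eta (2 * B) He) as [N HN].
  assert (HL : forall n, (N <= n)%nat -> eta / 2 * gseq n <= tailseq n).
  { intros n Hn. specialize (H n). apply Rabs_le_between in H. apply le_INR in Hn.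
    assert (B * kap1 n <= eta / 2 * gseq n); [|lra].
    rewrite <- kap1_gseq. pose proof (kap1_pos n).
    replace (eta / 2 * (kap1 n * (INR n + 1))) with (eta / 2 * (INR n + 1) * kap1 n) by ring.
    apply Rmult_le_compat_r; [lra|]. nra. }
  pose proof (gseq_pos N) as HgN. pose proof (gseq_le_1 N) as HgN1.
  exists (eta / 2 * gseq N). split; [pos|]. intros n.
  pose proof (gseq_pos n). pose proof (gseq_le_1 n).
  destruct (Nat.le_gt_cases N n) as [Hn|Hn].
  - apply Rle_trans with (2 := HL n Hn). assert (0 < eta / 2 * gseq n) by pos. nra.
  - apply Rle_trans with (tailseq N); [|apply tailseq_decr; lia].
    apply Rle_trans with (2 := HL N (le_n _)). assert (0 < eta / 2 * gseq N) by pos. nra.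
Qed.

Lemma ren_theta : theta ren = conv (conv (theta f) ren) ren.
Proof.
  assert (H := f_equal theta (geom_inv f f_0)). rewrite theta_conv in H.
  assert (E1 : theta seq1 = seq0).
  { extensionality n. unfold theta, seq1, seq0. destruct (Nat.eqb_spec n 0) as [->|]; simpl; ring. }
  assert (E2 : theta (seqsub seq1 f) = seqopp (theta f)).
  { extensionality n. unfold theta, seqsub, seqopp, seq1. destruct (Nat.eqb_spec n 0) as [->|]; simpl; ring. }
  rewrite E1, E2 in H.
  transitivity (conv (conv (seqsub seq1 f) ren) (theta ren)); [rewrite (geom_inv f f_0); ring|].
  replace (conv (conv (seqsub seq1 f) ren) (theta ren))
    with (seqadd (conv ren (seqadd (conv (seqopp (theta f)) ren) (conv (seqsub seq1 f) (theta ren))))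
                 (conv (conv (theta f) ren) ren)) by ring.
  rewrite H. ring.
Qed.

(** Since f is close to 1 - eta sqrt(1-z), both z f' and (1-f) / (2 (1-z)) have leading term (eta/2)
    (1-z)^(-1/2); the second is half the series of the tails. *)
Lemma theta_f_approx : exists B, 0 <= B /\ forall n, Rabs (theta f n - tailseq n / 2) <= B * kap1 n.
Proof.
  destruct tailseq_approx as (B1 & HB1 & H1). destruct Hf as [B HB]. pose proof (bigA_nonneg _ _ _ HB).
  pose proof eta_pos as He. exists (B + B1 + eta + 1). split; [lra|]. intros n. pose proof (kap1_pos n) as Hk.
  destruct n as [|n].
  - unfold theta, masstail. simpl. rewrite f_0. replace (kap1 0) with 1 by (unfold kap1; simpl; field).
    apply Rabs_le. lra.
  - specialize (H1 (S n)). specialize (HB (S n)).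
    assert (Hn : 0 < INR (S n)) by (apply lt_0_INR; lia).
    assert (E : - eta * wseq (S n) * INR (S n) = eta / 2 * gseq n).
    { rewrite wseq_S, <- kap1_gseq, S_INR. field. }
    pose proof (gseq_diff n) as Hd. pose proof (kap1_pos n). assert (Hkd : kap1 n <= 4 * kap1 (S n)) by (apply kap1_doubling; lia).
    replace (theta f (S n) - tailseq (S n) / 2)
      with (INR (S n) * (f (S n) - - eta * wseq (S n)) + (eta / 2 * (gseq n - gseq (S n)) - (tailseq (S n) - eta * gseq (S n)) / 2)).
    2:{ unfold theta. rewrite Rmult_minus_distr_l, (Rmult_comm _ (- eta * wseq (S n))), E. field. }
    apply Rle_trans with (1 := Rabs_triang _ _).
    assert (T1 : Rabs (INR (S n) * (f (S n) - - eta * wseq (S n))) <= B * kap1 (S n)).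
    { rewrite Rabs_mult, (Rabs_pos_eq (INR (S n))) by lra. rewrite <- kap_kap1. pose proof (kap_pos (S n)).
      assert (INR (S n) * Rabs (f (S n) - - eta * wseq (S n)) <= INR (S n) * (B * kap (S n))) by (apply Rmult_le_compat_l; lra).
      assert (0 <= B * kap (S n)) by pos. lra. }
    assert (T2 : Rabs (eta / 2 * (gseq n - gseq (S n)) - (tailseq (S n) - eta * gseq (S n)) / 2) <= (eta + B1) * kap1 (S n)).
    { rewrite Hd. apply Rabs_le_between in H1. apply Rabs_le.
      assert (0 <= B1 * kap1 (S n)) by pos.
      assert (eta * kap1 n <= eta * (4 * kap1 (S n))) by (apply Rmult_le_compat_l; lra).
      assert (0 <= eta * kap1 n) by pos. split; lra. }
    lra.
Qed.

(** The tails decrease, so the renewal equation bounds the tail at n times the partial sum of the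
    renewal sequence by 1. *)
Lemma sum_ren_le : exists B, 0 < B /\ forall n, sum_f_R0 ren n <= B / gseq n.
Proof.
  destruct tailseq_lower as (k & Hk & H). exists (/ k). split; [pos|]. intros n.
  pose proof (gseq_pos n) as Hg. specialize (H n).
  assert (H1 : tailseq n * sum_f_R0 ren n <= 1).
  { change 1 with (seqones n). rewrite <- (masstail_conv f f_0). replace (conv tailseq ren) with (conv ren tailseq) by ring.
    rewrite scal_sum. apply sum_Rle. intros i Hi. apply Rmult_le_compat_l; [intros; apply geom_nonneg, f_nonneg|apply tailseq_decr; lia]. }
  assert (H2 : 0 <= sum_f_R0 ren n) by (apply cond_pos_sum; intros; apply geom_nonneg, f_nonneg).
  apply Rle_div_r; [exact Hg|]. apply Rmult_le_reg_l with k; [exact Hk|]. rewrite Rinv_r by lra. nra.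
Qed.

(** As z f' is at most a multiple of the tails, z U' = z f' U^2 is at most a multiple of U / (1-z):
    n u_n is bounded by a multiple of the partial sum of u, which [sum_ren_le] controls. *)
Lemma ren_le : exists B, 0 < B /\ forall n, ren n <= B * gseq n.
Proof.
  destruct tailseq_lower as (k & Hk & HT). destruct theta_f_approx as (B1 & HB1 & H1).
  destruct sum_ren_le as (B2 & HB2 & H2).
  set (C3 := 1 / 2 + B1 / k).
  assert (HC3 : 0 < C3) by (unfold C3; assert (0 <= B1 / k) by pos; lra).
  exists (4 * C3 * B2 + 1). split; [assert (0 < C3 * B2) by pos; lra|].
  intros n. pose proof (gseq_pos n) as Hg.
  assert (HC : 0 < 4 * C3 * B2) by (assert (0 < C3 * B2) by pos; lra).
  destruct n as [|n]; [unfold geom; simpl; unfold seq1; simpl; lra|].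
  assert (HK : forall m, 0 <= conv (theta f) ren m <= C3).
  { intros m. split; [apply conv_nonneg; [|intros; apply geom_nonneg, f_nonneg]; intros i; pos|].
    apply Rle_trans with (conv (seqscal C3 tailseq) ren m).
    - apply conv_le; intros i _; [|split; [intros; apply geom_nonneg, f_nonneg|lra]].
      split; [pos|].
      specialize (H1 i). apply Rabs_le_between in H1. specialize (HT i). pose proof (kap1_le_gseq i).
      unfold seqscal, C3. assert (B1 * kap1 i <= B1 / k * tailseq i); [|lra].
      apply Rle_trans with (B1 / k * (k * gseq i)).
      + replace (B1 / k * (k * gseq i)) with (B1 * gseq i) by (field; lra). apply Rmult_le_compat_l; lra.
      + apply Rmult_le_compat_l; [pos|exact HT].
    - rewrite conv_scal_l, (masstail_conv f f_0). unfold seqscal, seqones. lra. }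
  assert (Hn : 0 < INR (S n)) by (apply lt_0_INR; lia).
  assert (HU : INR (S n) * ren (S n) <= C3 * sum_f_R0 ren (S n)).
  { change (INR (S n) * ren (S n)) with (theta ren (S n)). rewrite ren_theta.
    apply Rle_trans with (conv (seqscal C3 seqones) ren (S n)).
    - apply conv_le; intros i _; [unfold seqscal, seqones; rewrite Rmult_1_r; apply HK|split; [intros; apply geom_nonneg, f_nonneg|lra]].
    - rewrite conv_scal_l. unfold seqscal. rewrite conv_seqones. lra. }
  specialize (H2 (S n)). pose proof (inv_gseq_le (S n) ltac:(lia)) as Hi.
  assert (ren (S n) <= C3 * B2 * / (INR (S n) * gseq (S n))).
  { apply Rmult_le_reg_l with (INR (S n)); [exact Hn|].
    replace (INR (S n) * (C3 * B2 * / (INR (S n) * gseq (S n)))) with (C3 * (B2 / gseq (S n))) by (field; lra).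
    apply Rle_trans with (1 := HU). apply Rmult_le_compat_l; lra. }
  assert (C3 * B2 * / (INR (S n) * gseq (S n)) <= C3 * B2 * (4 * gseq (S n))) by (apply Rmult_le_compat_l; lra).
  lra.
Qed.

(** n u_n is the coefficient of z f' U^2. Replacing z f' by half the tails and using the renewal
    equation leaves half the partial sum; the error, of order [kap1] * [gseq] * [gseq] as a
    convolution, is bounded. *)
Lemma ren_sum_relation : exists B, 0 <= B /\ forall n, Rabs (INR n * ren n - sum_f_R0 ren n / 2) <= B.
Proof.
  destruct theta_f_approx as (B1 & HB1 & H1). destruct ren_le as (B2 & HB2 & H2).
  exists (B1 * B2 * 12 * B2). split; [pos|].
  intros n. set (k1 := seqsub (theta f) (seqscal (1 / 2) tailseq)).
  assert (Hk1 : forall i, Rabs (k1 i) <= B1 * kap1 i).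
  { intros i. unfold k1, seqsub, seqscal. replace (theta f i - 1 / 2 * tailseq i) with (theta f i - tailseq i / 2) by field. apply H1. }
  assert (Hr : forall i, Rabs (ren i) <= B2 * gseq i) by (intros i; rewrite Rabs_pos_eq; [apply H2|intros; apply geom_nonneg, f_nonneg]).
  assert (He : forall i, Rabs (conv k1 ren i) <= B1 * B2 * 12 * gseq i).
  { intros i. apply Rle_trans with (conv (seqscal B1 kap1) (seqscal B2 gseq) i).
    - apply conv_Rabs_le; intros j _; [apply Hk1|apply Hr].
    - rewrite conv_scal_l, conv_scal_r. unfold seqscal. pose proof (conv_kap1_gseq i).
      replace (B1 * B2 * 12 * gseq i) with (B1 * (B2 * (12 * gseq i))) by ring.
      apply Rmult_le_compat_l; [lra|]. apply Rmult_le_compat_l; lra. }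
  replace (INR n * ren n - sum_f_R0 ren n / 2) with (conv (conv k1 ren) ren n).
  - apply Rle_trans with (conv (seqscal (B1 * B2 * 12) gseq) (seqscal B2 gseq) n).
    + apply conv_Rabs_le; intros j _; [apply He|apply Hr].
    + rewrite conv_scal_l, conv_scal_r, gseq_conv_gseq. unfold seqscal, seqones. lra.
  - change (INR n * ren n) with (theta ren n). rewrite ren_theta, <- conv_seqones, <- (masstail_conv f f_0).
    unfold k1. replace (conv (conv (seqsub (theta f) (seqscal (1 / 2) tailseq)) ren) ren)
      with (seqsub (conv (conv (theta f) ren) ren) (conv (conv (seqscal (1 / 2) tailseq) ren) ren)) by ring.
    rewrite !conv_scal_l. unfold seqsub, seqscal. field.
Qed.

(* U_n g_n has summable increments, because [/ gseq n] solves the exact recurrence U_n - U_(n-1) = U_n / 2n. *)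
Lemma ren_sum_lim : exists Y, is_lim_seq (fun n => sum_f_R0 ren n * gseq n) (Y : R).
Proof.
  destruct ren_sum_relation as (B & HB & H).
  set (y := fun n => sum_f_R0 ren n * gseq n).
  assert (Hd : forall n, Rabs (y (S n) - y n) <= B * kap1 n).
  { intros n. specialize (H (S n)). unfold y. set (U := sum_f_R0 ren (S n)) in *.
    assert (E : sum_f_R0 ren n = U - ren (S n)) by (unfold U; rewrite tech5; ring).
    rewrite E. assert (Hn : 0 < INR (S n)) by (apply lt_0_INR; lia). pose proof (pos_INR n).
    pose proof (kap1_gseq n) as Hk. rewrite <- S_INR in Hk. pose proof (kap1_pos n).
    replace (U * gseq (S n) - (U - ren (S n)) * gseq n) with ((INR (S n) * ren (S n) - U / 2) * kap1 n).
    - rewrite Rabs_mult, (Rabs_pos_eq (kap1 n)) by lra. apply Rmult_le_compat_r; lra.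
    - pose proof (gseq_diff n) as Hg. replace (gseq (S n)) with (gseq n - kap1 n / 2) by lra. rewrite <- Hk. field. }
  assert (Hex : ex_series (fun n => y (S n) - y n)).
  { apply ex_series_dominated with (1 := Hd). apply (ex_series_scal_l B kap1), ex_series_kap1. }
  destruct Hex as [l Hl]. apply lim_of_is_series in Hl. exists (l + y O).
  apply is_lim_seq_incr_1. apply (is_lim_seq_ext (fun n => sum_f_R0 (fun i => y (S i) - y i) n + y O)).
  - intros n. induction n as [|n IH]; [simpl; ring|]. rewrite tech5. lra.
  - lims.
Qed.

Lemma gseq_shift_lim i : is_lim_seq (fun n => gseq (n - i)%nat) 0.
Proof.
  apply (is_lim_seq_incr_n _ i). apply (is_lim_seq_ext gseq); [|apply is_lim_seq_gseq].
  intros n. f_equal. lia.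
Qed.

(** Existence and value of the limit L have different sources: [ren_sum_lim] and [ren_sum_relation]
    give existence, and inserting the asymptotics of the tails and of u into the exact renewal
    equation gives eta L = 1. *)
Lemma ren_gseq : is_lim_seq (fun n => ren n / gseq n) (/ eta).
Proof.
  destruct ren_sum_lim as [Y HY]. destruct ren_sum_relation as (B & HB & H). pose proof PI_RGT_0 as Hpi.
  assert (Hlim : is_lim_seq (fun n => ren n / gseq n) (Y / 2 * (PI / 1) + 0)).
  { apply (is_lim_seq_ext_loc (fun n => sum_f_R0 ren n * gseq n / 2 * (PI / (PI * INR n * gseq n ^ 2))
       + (INR n * ren n - sum_f_R0 ren n / 2) * / (INR n * gseq n))).
    - exists 1%nat. intros n Hn. assert (0 < INR n) by (apply lt_0_INR; lia). pose proof (gseq_pos n). field. lra.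
    - apply is_lim_seq_plus'.
      + apply is_lim_seq_mult'.
        * apply (is_lim_seq_scal_r _ (/ 2) Y). exact HY.
        * apply is_lim_seq_div'; [apply is_lim_seq_const|apply gseq_sqr_lim|lra].
      + apply is_lim_seq_abs_0. apply (is_lim_seq_le_le_loc (fun _ => 0) _ (fun n => B * (4 * gseq n))).
        * exists 1%nat. intros n Hn. split; [apply Rabs_pos|]. rewrite Rabs_mult. pose proof (inv_gseq_le n Hn).
          assert (0 < INR n) by (apply lt_0_INR; lia). pose proof (gseq_pos n).
          assert (0 < / (INR n * gseq n)) by pos.
          rewrite (Rabs_pos_eq (/ (INR n * gseq n))) by lra.
          apply Rmult_le_compat; [apply Rabs_pos|lra|apply H|assumption].
        * apply is_lim_seq_const.
        * replace 0 with (B * (4 * 0)) by ring. lims. }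
  set (L := Y / 2 * (PI / 1) + 0) in *.
  assert (HT : is_lim_seq (fun n => tailseq n / gseq n) eta).
  { destruct tailseq_approx as (B1 & HB1 & H1).
    apply (is_lim_seq_ext (fun n => eta + (tailseq n - eta * gseq n) / gseq n)).
    { intros n. pose proof (gseq_pos n). field. lra. }
    replace (Finite eta) with (Finite (eta + 0)) by (f_equal; ring).
    apply is_lim_seq_plus'; [apply is_lim_seq_const|]. apply is_lim_seq_abs_0.
    apply (is_lim_seq_le_le (fun _ => 0) _ (fun n => B1 * / (INR n + 1))).
    - intros n. split; [apply Rabs_pos|]. pose proof (gseq_pos n). pose proof (pos_INR n).
      unfold Rdiv. rewrite Rabs_mult, (Rabs_pos_eq (/ gseq n)) by pos.
      apply Rle_div_l; [lra|]. apply Rle_trans with (1 := H1 n). unfold kap1. apply Req_le. field. lra.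
    - apply is_lim_seq_const.
    - replace 0 with (B1 * 0) by ring. apply is_lim_seq_mult'; [apply is_lim_seq_const|apply is_lim_seq_inv_Sn]. }
  assert (Hsh : forall i, is_lim_seq (fun n => gseq (n - i)%nat / conv gseq gseq n) 0).
  { intros i. rewrite gseq_conv_gseq. unfold seqones.
    apply (is_lim_seq_ext (fun n => gseq (n - i)%nat)); [intros n; field|apply gseq_shift_lim]. }
  pose proof (conv_asymp _ _ _ _ _ _ gseq_pos gseq_pos HT Hlim Hsh Hsh) as Hc.
  rewrite (masstail_conv f f_0), gseq_conv_gseq in Hc. unfold seqones in Hc.
  assert (E : eta * L = 1).
  { apply is_lim_seq_unique in Hc. rewrite Lim_seq_const in Hc. injection Hc as Hc. lra. }
  replace (/ eta) with L; [exact Hlim|]. pose proof eta_pos.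
  apply Rmult_eq_reg_l with eta; [|lra]. rewrite E, Rinv_r; lra.
Qed.

End Renewal.

(** * Moment asymptotics *)

(** Read off from the equation 2 (1-z) z h' = k z h of h = (1-z)^(-k/2). *)
Lemma gpow_rec k n : (1 <= k)%nat ->
  seqpow gseq k (S n) = seqpow gseq k n * (2 * INR n + INR k) / (2 * INR n + 2).
Proof.
  intros Hk. destruct k as [|k]; [lia|].
  assert (H : seqscal 2 (conv onemz (theta (seqpow gseq (S k)))) = seqscal (INR (S k)) (conv (mono 1) (seqpow gseq (S k)))).
  { rewrite theta_seqpow, conv_scal_r.
    replace (conv onemz (conv (theta gseq) (seqpow gseq k))) with (conv (conv onemz (theta gseq)) (seqpow gseq k)) by ring.
    simpl seqpow. replace (conv (mono 1) (conv gseq (seqpow gseq k))) with (conv (conv (mono 1) gseq) (seqpow gseq k)) by ring.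
    rewrite <- theta_gseq, conv_scal_l. extensionality m. unfold seqscal. ring. }
  assert (Hn := f_equal (fun a => a (S n)) H). cbv beta in Hn. unfold seqscal in Hn.
  rewrite conv_onemz, conv_mono in Hn. simpl Nat.leb in Hn. cbv iota in Hn. simpl Nat.sub in Hn. rewrite Nat.sub_0_r in Hn.
  unfold theta in Hn. rewrite (S_INR n) in Hn. pose proof (pos_INR n).
  apply Rmult_eq_reg_r with (2 * INR n + 2); [|lra]. unfold Rdiv. rewrite Rmult_assoc, Rinv_l, Rmult_1_r by lra. lra.
Qed.

Lemma gpow_0 k : seqpow gseq k 0 = 1.
Proof. induction k as [|k IH]; [reflexivity|]. simpl. unfold conv. simpl. rewrite IH. ring. Qed.

Lemma gpow_pos k n : (1 <= k)%nat -> 0 < seqpow gseq k n.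
Proof.
  intros Hk. induction n as [|n IH]; [rewrite gpow_0; lra|]. rewrite gpow_rec by exact Hk.
  pose proof (pos_INR n). assert (0 < INR k) by (apply lt_0_INR; lia).
  pos.
Qed.

Lemma gpow_SS k n : (1 <= k)%nat -> seqpow gseq (S (S k)) n = seqpow gseq k n * (2 * INR n + INR k) / INR k.
Proof.
  intros Hk. assert (Hk0 : 0 < INR k) by (apply lt_0_INR; lia).
  simpl. replace (conv gseq (conv gseq (seqpow gseq k))) with (conv (conv gseq gseq) (seqpow gseq k)) by ring.
  rewrite gseq_conv_gseq, conv_seqones.
  induction n as [|n IH]; [simpl; rewrite gpow_0; field; lra|].
  rewrite tech5, IH, (gpow_rec k n), S_INR by exact Hk. pose proof (pos_INR n). field. lra.
Qed.

Lemma inv_INR_gseq_lim : is_lim_seq (fun n => / ((2 * INR n + 1) * gseq n)) 0.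
Proof.
  apply (is_lim_seq_le_le_loc (fun _ => 0) _ (fun n => 4 * gseq n)).
  - exists 1%nat. intros n Hn. pose proof (inv_gseq_le n Hn) as H. pose proof (gseq_pos n).
    assert (0 < INR n) by (apply lt_0_INR; lia). split.
    + pos.
    + apply Rle_trans with (2 := H). apply Rinv_le_contravar; [pos|].
      apply Rmult_le_compat_r; lra.
  - apply is_lim_seq_const.
  - replace 0 with (4 * 0) by ring. lims.
Qed.

Lemma gpow_1 n : seqpow gseq 1 n = gseq n.
Proof. simpl. replace (conv gseq seq1) with gseq by ring. reflexivity. Qed.

Lemma gpow_2 n : seqpow gseq 2 n = 1.
Proof. simpl. replace (conv gseq (conv gseq seq1)) with (conv gseq gseq) by ring. rewrite gseq_conv_gseq. reflexivity. Qed.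

Lemma gpow_3 n : seqpow gseq 3 n = (2 * INR n + 1) * gseq n.
Proof. rewrite gpow_SS, gpow_1 by lia. simpl (INR 1). field. Qed.

Lemma two_step_ind (P : nat -> Prop) : P 1%nat -> P 2%nat -> (forall k, (1 <= k)%nat -> P k -> P (S (S k))) ->
  forall k, (1 <= k)%nat -> P k.
Proof.
  intros H1 H2 H k. enough (((1 <= k)%nat -> P k) /\ P (S k)) by tauto.
  induction k as [|k [IH1 IH2]]; [split; [lia|exact H1]|]. split; [intros _; exact IH2|].
  destruct k as [|k]; [exact H2|]. apply H; [lia|]. apply IH1. lia.
Qed.

(** With [gseq_negl] this supplies the hypotheses of [conv_asymp] for the product of [gseq] with its
    powers. The closed recursion moves k by two, hence [two_step_ind]. *)
Lemma gpow_negl k i : (1 <= k)%nat ->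
  is_lim_seq (fun n => seqpow gseq k (n - i) / seqpow gseq (S k) n) 0.
Proof.
  revert k. apply two_step_ind.
  - apply (is_lim_seq_ext (fun n => gseq (n - i)%nat)); [intros n; rewrite gpow_1, gpow_2; field|apply gseq_shift_lim].
  - apply (is_lim_seq_ext (fun n => / ((2 * INR n + 1) * gseq n))); [|apply inv_INR_gseq_lim].
    intros n. rewrite gpow_2, gpow_3. unfold Rdiv. ring.
  - intros k Hk IH. assert (Hk0 : 0 < INR k) by (apply lt_0_INR; lia).
    apply (is_lim_seq_le_le (fun _ => 0) _ (fun n => INR (S k) / INR k * (seqpow gseq k (n - i) / seqpow gseq (S k) n))).
    + intros n. rewrite !gpow_SS by lia.
      pose proof (gpow_pos k (n - i) Hk). pose proof (gpow_pos (S k) n ltac:(lia)).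
      assert (Hn : INR (n - i) <= INR n) by (apply le_INR; lia). pose proof (pos_INR (n - i)). rewrite S_INR.
      replace (seqpow gseq k (n - i) * (2 * INR (n - i) + INR k) / INR k /
         (seqpow gseq (S k) n * (2 * INR n + (INR k + 1)) / (INR k + 1)))
        with ((INR k + 1) / INR k * (seqpow gseq k (n - i) / seqpow gseq (S k) n) * ((2 * INR (n - i) + INR k) / (2 * INR n + (INR k + 1))))
        by (field; lra).
      assert (0 < (INR k + 1) / INR k * (seqpow gseq k (n - i) / seqpow gseq (S k) n))
        by pos.
      assert (0 <= (2 * INR (n - i) + INR k) / (2 * INR n + (INR k + 1)) <= 1).
      { split; [pos|]. apply Rle_div_l; lra. }
      nra.
    + apply is_lim_seq_const.
    + replace 0 with (INR (S k) / INR k * 0) by ring. lims.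
Qed.

Lemma gseq_negl k i : (1 <= k)%nat -> is_lim_seq (fun n => gseq (n - i)%nat / seqpow gseq (S k) n) 0.
Proof.
  revert k. apply two_step_ind.
  - apply (is_lim_seq_ext (fun n => gseq (n - i)%nat)); [intros n; rewrite gpow_2; field|apply gseq_shift_lim].
  - apply (is_lim_seq_le_le (fun _ => 0) _ (fun n => / ((2 * INR n + 1) * gseq n))); [|apply is_lim_seq_const|apply inv_INR_gseq_lim].
    intros n. rewrite gpow_3. pose proof (gseq_pos (n - i)). pose proof (gseq_le_1 (n - i)). pose proof (gseq_pos n). pose proof (pos_INR n).
    assert (0 < / ((2 * INR n + 1) * gseq n)) by pos.
    unfold Rdiv. nra.
  - intros k Hk IH. assert (Hk0 : 0 < INR (S k)) by (apply lt_0_INR; lia).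
    apply (is_lim_seq_le_le (fun _ => 0) _ (fun n => gseq (n - i)%nat / seqpow gseq (S k) n)); [|apply is_lim_seq_const|exact IH].
    intros n. rewrite (gpow_SS (S k)) by lia. pose proof (gseq_pos (n - i)). pose proof (gpow_pos (S k) n ltac:(lia)). pose proof (pos_INR n).
    assert (Hge : seqpow gseq (S k) n <= seqpow gseq (S k) n * (2 * INR n + INR (S k)) / INR (S k)) by (apply Rle_div_r; nra).
    split; [pos|].
    apply Rmult_le_compat_l; [lra|]. apply Rinv_le_contravar; lra.
Qed.

(* Limits of the moments of the Rayleigh law, up to normalization; the scale is [/ gseq n ~ sqrt (pi n)]. *)
Fixpoint raymom (k : nat) : R :=
  match k with
  | O => 1
  | S O => 1
  | S (S k') => raymom k' * (2 / PI) / INR (S k')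
  end.

Lemma raymom_pos k : 0 < raymom k.
Proof.
  pose proof PI_RGT_0. assert (Hp : 0 < 2 / PI) by pos.
  enough (0 < raymom k /\ 0 < raymom (S k)) by tauto.
  induction k as [|k [IH1 IH2]]; [simpl; lra|]. split; [exact IH2|].
  change (raymom (S (S k))) with (raymom k * (2 / PI) / INR (S k)).
  pos.
Qed.

Lemma raymom_lim k : is_lim_seq (fun n => seqpow gseq (S k) n * gseq n ^ k / gseq n) (raymom k).
Proof.
  enough (is_lim_seq (fun n => seqpow gseq (S k) n * gseq n ^ k / gseq n) (raymom k) /\
          is_lim_seq (fun n => seqpow gseq (S (S k)) n * gseq n ^ S k / gseq n) (raymom (S k))) by tauto.
  pose proof PI_RGT_0 as Hpi.
  induction k as [|k [IH1 IH2]].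
  - split.
    + apply (is_lim_seq_ext (fun _ => 1)); [|apply is_lim_seq_const]. intros n. rewrite gpow_1. pose proof (gseq_pos n). simpl. field. lra.
    + apply (is_lim_seq_ext (fun _ => 1)); [|apply is_lim_seq_const]. intros n. rewrite gpow_2. pose proof (gseq_pos n). simpl. field. lra.
  - split; [exact IH2|].
    change (raymom (S (S k))) with (raymom k * (2 / PI) / INR (S k)).
    assert (Hk : 0 < INR (S k)) by (apply lt_0_INR; lia).
    apply (is_lim_seq_ext (fun n => seqpow gseq (S k) n * gseq n ^ k / gseq n *
       (2 / PI * (PI * INR n * gseq n ^ 2) + INR (S k) * (gseq n * gseq n)) / INR (S k))).
    { intros n. rewrite (gpow_SS (S k)) by lia. pose proof (gseq_pos n). simpl (gseq n ^ S (S k)). field. lra. }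
    apply (is_lim_seq_scal_r _ (/ INR (S k)) (raymom k * (2 / PI))).
    apply is_lim_seq_mult'; [exact IH1|].
    replace (Finite (2 / PI)) with (Finite (2 / PI * 1 + INR (S k) * (0 * 0))) by (f_equal; field; apply PI_neq0).
    apply is_lim_seq_plus'; apply is_lim_seq_mult'; try apply is_lim_seq_const; [apply gseq_sqr_lim|].
    apply is_lim_seq_mult'; apply is_lim_seq_gseq.
Qed.

(** Along even indices the ratio of consecutive terms is s^2 (2/pi) / (2 j + 1), which tends to 0. A
    truncated transform can therefore be made as precise as desired. *)
Lemma raymom_small s eps : 0 <= s -> 0 < eps -> exists K, s ^ K * raymom K <= eps.
Proof.
  intros Hs He. pose proof PI_RGT_0 as Hpi.
  set (t := fun j => s ^ (2 * j) * raymom (2 * j)).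
  assert (Hrec : forall j, t (S j) = t j * (s ^ 2 * (2 / PI) / INR (S (2 * j)))).
  { intros j. unfold t. replace (2 * S j)%nat with (S (S (2 * j))) by lia.
    change (raymom (S (S (2 * j)))) with (raymom (2 * j) * (2 / PI) / INR (S (2 * j))).
    simpl pow. unfold Rdiv. ring. }
  assert (Ht : forall j, 0 <= t j) by (intros j; apply Rmult_le_pos; [apply pow_le, Hs|apply Rlt_le, raymom_pos]).
  destruct (INR_archimed 1 (2 * (s ^ 2 * (2 / PI))) Rlt_0_1) as [N HN]. rewrite Rmult_1_r in HN.
  destruct (half_contraction t (eps / 3) N) as [k1 Hk1]; [lra| |].
  - intros k Hk. rewrite Hrec. specialize (Ht k).
    assert (Hle : s ^ 2 * (2 / PI) / INR (S (2 * k)) <= 1 / 2).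
    { apply Rle_div_l; [apply lt_0_INR; lia|]. assert (INR N <= INR (S (2 * k))) by (apply le_INR; lia). lra. }
    nra.
  - exists (2 * k1)%nat. specialize (Hk1 k1 (le_n _)). unfold t in Hk1. lra.
Qed.

(** * Binomial moments and truncated Laplace transforms *)

Definition expect (e f : nat -> R) (n : nat) (h : nat -> R) : R :=
  sum_f_R0 (fun k => h k * (countw e f n k / counttot e f n)) n.

(** K counts the terms kept, so that the error bound is exactly the first omitted term. *)
Definition partial_laplace (s : R) (K : nat) : R :=
  match K with O => 0 | S K' => sum_f_R0 (fun k => (- s) ^ k * raymom k) K' end.

Section Law.
Variables (e f : nat -> R) (ae eta : R).
Hypothesis He : InA e ae.
Hypothesis e_nonneg : forall n, 0 <= e n.
Hypothesis e_0 : e O = 1.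
Hypothesis Hf : InA f (- eta).
Hypothesis f_nonneg : forall n, 0 <= f n.
Hypothesis f_0 : f O = 0.
Hypothesis f_sum : Series f = 1.
Hypothesis f_lower : exists n0 k, 0 < k /\ forall n, (n0 <= n)%nat -> k * kap1 n <= f n.

Lemma Heta : 0 < eta.
Proof. apply (eta_pos f); assumption. Qed.

Lemma e_sum_pos : 1 <= Series e.
Proof.
  apply Rle_trans with (sum_f_R0 e 0); [simpl; lra|].
  apply sum_le_Series; [exact e_nonneg|eapply InA_ex_series, He].
Qed.

(** The product of e with sqrt(1-z) stays in the class, with coefficient e(1) and value 0 at 1;
    taking partial sums, that is dividing by 1 - z, turns it into e (1-z)^(-1/2). *)
Lemma conv_e_gseq : is_lim_seq (fun n => conv gseq e n / gseq n) (Series e).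
Proof.
  pose proof InA_wseq as Hw.
  pose proof (InA_conv _ _ _ _ He Hw) as H. rewrite (is_series_unique _ _ is_series_wseq) in H.
  destruct H as [B HB]. replace (ae * 0 + 1 * Series e) with (Series e) in HB by ring.
  set (r := fun i => conv e wseq i - Series e * wseq i).
  assert (Er : Series r = 0).
  { unfold r. rewrite Series_minus_wseq by (eapply bigA_ex_series, HB).
    rewrite (InA_Series_conv _ _ _ _ He Hw), (is_series_unique _ _ is_series_wseq). ring. }
  pose proof (bigA_nonneg _ _ _ HB) as HB0.
  assert (Hb : forall n, Rabs (conv gseq e n - Series e * gseq n) <= 2 * B * kap1 n).
  { intros n. rewrite <- Rabs_Ropp.
    replace (- (conv gseq e n - Series e * gseq n)) with (Series r - sum_f_R0 r n); [apply Series_tail_kap, HB|].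
    rewrite Er. unfold r. rewrite minus_sum, <- sum_wseq.
    rewrite (sum_eq (fun i => Series e * wseq i) (fun i => wseq i * Series e)) by (intros; ring).
    rewrite <- scal_sum.
    assert (Eg : conv gseq e n = sum_f_R0 (conv e wseq) n).
    { rewrite <- conv_seqones.
      assert (Ew : gseq = conv seqones wseq) by (extensionality m; rewrite conv_seqones; symmetry; apply sum_wseq).
      rewrite Ew. replace (conv (conv seqones wseq) e) with (conv seqones (conv e wseq)) by ring. reflexivity. }
    rewrite Eg. change (sum_f_R0 (fun i => conv e wseq i) n) with (sum_f_R0 (conv e wseq) n). ring. }
  apply (is_lim_seq_ext (fun n => Series e + (conv gseq e n - Series e * gseq n) / gseq n)).
  { intros n. pose proof (gseq_pos n). field. lra. }
  replace (Finite (Series e)) with (Finite (Series e + 0)) by (f_equal; ring).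
  apply is_lim_seq_plus'; [apply is_lim_seq_const|]. apply is_lim_seq_abs_0.
  apply (is_lim_seq_le_le (fun _ => 0) _ (fun n => 2 * B * / (INR n + 1))).
  - intros n. split; [apply Rabs_pos|]. pose proof (gseq_pos n). pose proof (pos_INR n).
    unfold Rdiv. rewrite Rabs_mult, (Rabs_pos_eq (/ gseq n)) by pos.
    apply Rle_div_l; [lra|]. apply Rle_trans with (1 := Hb n). unfold kap1. apply Req_le. field. lra.
  - apply is_lim_seq_const.
  - replace 0 with (2 * B * 0) by ring. apply is_lim_seq_mult'; [apply is_lim_seq_const|apply is_lim_seq_inv_Sn].
Qed.

Lemma kap1_shift_negl i : is_lim_seq (fun n => kap1 (n - i) / gseq n) 0.
Proof.
  apply (is_lim_seq_le_le_loc (fun _ => 0) _ (fun n => 4 * / (INR n + 1))).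
  - exists (2 * i)%nat. intros n Hn. pose proof (kap1_pos (n - i)). pose proof (gseq_pos n). pose proof (pos_INR n).
    split; [pos|].
    apply Rle_div_l; [lra|]. apply Rle_trans with (4 * kap1 n); [apply kap1_doubling; lia|].
    unfold kap1. apply Req_le. field. lra.
  - apply is_lim_seq_const.
  - replace 0 with (4 * 0) by ring. apply is_lim_seq_mult'; [apply is_lim_seq_const|apply is_lim_seq_inv_Sn].
Qed.

Lemma conv_e_ren : is_lim_seq (fun n => conv e (geom f) n / gseq n) (Series e / eta).
Proof.
  pose proof (ren_gseq f eta Hf f_nonneg f_0 f_sum f_lower) as Hren. pose proof Heta as Het.
  set (p := fun n => Rabs (geom f n - / eta * gseq n)).
  assert (Hp : is_lim_seq (fun n => p n / gseq n) 0).
  { apply (is_lim_seq_ext (fun n => Rabs (geom f n / gseq n - / eta))).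
    - intros n. pose proof (gseq_pos n). unfold p.
      replace (geom f n / gseq n - / eta) with ((geom f n - / eta * gseq n) * / gseq n) by (field; lra).
      rewrite Rabs_mult, (Rabs_pos_eq (/ gseq n)) by pos. reflexivity.
    - replace (Finite 0) with (Rbar_abs (Finite (/ eta - / eta))) by (simpl; f_equal; rewrite Rminus_diag; apply Rabs_R0).
      apply is_lim_seq_abs, is_lim_seq_minus'; [exact Hren|apply is_lim_seq_const]. }
  assert (Hz : forall n, gseq n <= conv gseq e n).
  { intros n. replace (conv gseq e) with (conv e gseq) by ring.
    apply Rle_trans with (e O * gseq (n - 0)%nat); [rewrite e_0, Nat.sub_0_r; lra|].
    apply (sum_ge_term (fun i => e i * gseq (n - i)%nat)); [|lia].
    intros i. apply Rmult_le_pos; [auto|apply Rlt_le, gseq_pos]. }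
  assert (Hbd : exists B, 0 <= B /\ forall n, e n <= B * kap1 n).
  { destruct He as [B HB]. exists (B + 2 * Rabs ae). pose proof (bigA_nonneg _ _ _ HB). pose proof (Rabs_pos ae).
    split; [lra|]. intros n. specialize (HB n). pose proof (Rabs_wseq_le n). pose proof (kap_le_kap1 n). pose proof (kap_pos n).
    pose proof (Rle_abs (e n - ae * wseq n)). pose proof (Rle_abs (ae * wseq n)) as Hae. rewrite Rabs_mult in Hae.
    assert (Rabs ae * Rabs (wseq n) <= Rabs ae * (2 * kap1 n)) by (apply Rmult_le_compat_l; lra).
    assert (B * kap n <= B * kap1 n) by (apply Rmult_le_compat_l; lra). lra. }
  destruct Hbd as (B & HB & HeB).
  assert (Hpe : is_lim_seq (fun n => conv p e n / conv gseq e n) 0).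
  { apply conv_negligible; auto; [intros; apply Rabs_pos|apply gseq_pos| |].
    - intros n. apply Rlt_le_trans with (gseq n); [apply gseq_pos|apply Hz].
    - intros i. apply (is_lim_seq_le_le (fun _ => 0) _ (fun n => B * (kap1 (n - i) / gseq n))).
      + intros n. pose proof (gseq_pos n). specialize (Hz n). split.
        * pos.
        * unfold Rdiv. rewrite <- Rmult_assoc. apply Rmult_le_compat; [auto|pos|apply HeB|].
          apply Rinv_le_contravar; lra.
      + apply is_lim_seq_const.
      + replace 0 with (B * 0) by ring. apply is_lim_seq_mult'; [apply is_lim_seq_const|apply kap1_shift_negl]. }
  apply (is_lim_seq_ext (fun n => conv gseq e n / gseq n * (/ eta + (conv e (geom f) n - / eta * conv gseq e n) / conv gseq e n))).
  { intros n. pose proof (gseq_pos n). specialize (Hz n). field. lra. }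
  replace (Finite (Series e / eta)) with (Finite (Series e * (/ eta + 0))) by (f_equal; unfold Rdiv; ring).
  apply is_lim_seq_mult'; [apply conv_e_gseq|]. apply is_lim_seq_plus'; [apply is_lim_seq_const|].
  apply is_lim_seq_abs_0. apply (is_lim_seq_le_le (fun _ => 0) _ _ _ ) with (3 := Hpe); [|apply is_lim_seq_const].
  intros n. split; [apply Rabs_pos|]. pose proof (gseq_pos n). specialize (Hz n).
  unfold Rdiv. rewrite Rabs_mult, (Rabs_pos_eq (/ conv gseq e n)) by pos.
  apply Rmult_le_compat_r; [pos|].
  replace (conv e (geom f) n - / eta * conv gseq e n) with (conv (seqsub (geom f) (seqscal (/ eta) gseq)) e n).
  - apply conv_Rabs_le; intros i _; [unfold p, seqsub, seqscal; lra|rewrite Rabs_pos_eq; [lra|auto]].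
  - replace (conv (seqsub (geom f) (seqscal (/ eta) gseq)) e) with (seqsub (conv e (geom f)) (conv (seqscal (/ eta) gseq) e)) by ring.
    rewrite conv_scal_l. reflexivity.
Qed.

Lemma ren_pow_asymp k : (1 <= k)%nat -> is_lim_seq (fun n => seqpow (geom f) k n / seqpow gseq k n) ((/ eta) ^ k).
Proof.
  intros Hk. induction Hk as [|k Hk IH].
  - apply (is_lim_seq_ext (fun n => geom f n / gseq n)).
    + intros n. rewrite gpow_1. simpl seqpow. replace (conv (geom f) seq1) with (geom f) by ring. reflexivity.
    + simpl. rewrite Rmult_1_r. apply (ren_gseq f eta); assumption.
  - simpl seqpow. simpl pow. apply conv_asymp.
    + apply gseq_pos.
    + intros n. apply gpow_pos, Hk.
    + apply (ren_gseq f eta); assumption.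
    + exact IH.
    + intros i. apply (gseq_negl k i Hk).
    + intros i. apply (gpow_negl k i Hk).
Qed.

Lemma conv_e_ren_pow k : is_lim_seq (fun n => conv e (seqpow (geom f) (S k)) n / seqpow gseq (S k) n) (Series e * (/ eta) ^ S k).
Proof.
  destruct k as [|k].
  - apply (is_lim_seq_ext (fun n => conv e (geom f) n / gseq n)).
    + intros n. rewrite gpow_1. simpl seqpow. replace (conv (geom f) seq1) with (geom f) by ring. reflexivity.
    + simpl. rewrite Rmult_1_r. apply conv_e_ren.
  - simpl (seqpow (geom f) (S (S k))). change (seqpow gseq (S (S k))) with (conv gseq (seqpow gseq (S k))).
    apply (is_lim_seq_ext (fun n => conv (conv e (geom f)) (seqpow (geom f) (S k)) n / conv gseq (seqpow gseq (S k)) n)).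
    + intros n. f_equal. simpl seqpow.
      replace (conv (conv e (geom f)) (conv (geom f) (seqpow (geom f) k))) with (conv e (conv (geom f) (conv (geom f) (seqpow (geom f) k)))) by ring.
      reflexivity.
    + replace (Series e * (/ eta) ^ S (S k)) with (Series e / eta * (/ eta) ^ S k) by (simpl; unfold Rdiv; ring).
      apply conv_asymp.
      * apply gseq_pos.
      * intros n. apply gpow_pos. lia.
      * apply conv_e_ren.
      * apply ren_pow_asymp. lia.
      * intros i. apply gseq_negl. lia.
      * intros i. apply gpow_negl. lia.
Qed.

(** Since (1 - f)^(-(k+1)) is the sum of binom(j+k, k) f^j, this is the expectation of binom(X_n +
    k, k). *)
Definition fmom (k n : nat) : R := conv e (seqpow (geom f) (S k)) n / conv e (geom f) n.

Lemma fmom_lim k : is_lim_seq (fun n => fmom k n * gseq n ^ k) (raymom k * (/ eta) ^ k).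
Proof.
  pose proof Heta as Het. pose proof e_sum_pos as HS.
  assert (Hne : Series e / eta <> 0) by pos.
  assert (H : is_lim_seq (fun n => conv e (seqpow (geom f) (S k)) n / seqpow gseq (S k) n / (conv e (geom f) n / gseq n)
     * (seqpow gseq (S k) n * gseq n ^ k / gseq n)) (Series e * (/ eta) ^ S k / (Series e / eta) * raymom k)).
  { apply is_lim_seq_mult'; [|apply raymom_lim]. apply is_lim_seq_div'; [apply conv_e_ren_pow|apply conv_e_ren|exact Hne]. }
  replace (raymom k * (/ eta) ^ k) with (Series e * (/ eta) ^ S k / (Series e / eta) * raymom k) by (simpl; field; lra).
  revert H. apply is_lim_seq_ext. intros n. unfold fmom.
  pose proof (gseq_pos n). pose proof (gpow_pos (S k) n ltac:(lia)).
  destruct (Req_dec (conv e (geom f) n) 0) as [E|E].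
  - rewrite E. unfold Rdiv. rewrite Rmult_0_l, !Rinv_0. ring.
  - field. repeat split; (lra || exact E).
Qed.

Lemma counttot_pos : exists N, forall n, (N <= n)%nat -> 0 < counttot e f n.
Proof.
  pose proof Heta as Het. pose proof e_sum_pos as HS.
  assert (Hl : 0 < Series e / eta) by pos.
  destruct (lim_eps _ _ (Series e / eta / 2) conv_e_ren ltac:(lra)) as [N HN]. exists N. intros n Hn.
  specialize (HN n Hn). apply Rabs_le_between in HN. pose proof (gseq_pos n).
  rewrite counttot_geom by exact f_0. fold (geom f).
  assert (H1 : 0 < conv e (geom f) n / gseq n) by lra.
  replace (conv e (geom f) n) with (conv e (geom f) n / gseq n * gseq n) by (field; lra). pos.
Qed.

Lemma countw_nonneg n k : 0 <= countw e f n k.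
Proof. apply conv_nonneg; [exact e_nonneg|]. intros i. apply seqpow_nonneg, f_nonneg. Qed.

Lemma expect_mono n h h' : 0 < counttot e f n -> (forall k, (k <= n)%nat -> h k <= h' k) -> expect e f n h <= expect e f n h'.
Proof.
  intros Ht H. apply sum_Rle. intros k Hk. apply Rmult_le_compat_r; [|apply H, Hk].
  apply Rmult_le_pos; [apply countw_nonneg|apply Rlt_le, Rinv_0_lt_compat, Ht].
Qed.

Lemma expect_1 n : 0 < counttot e f n -> expect e f n (fun _ => 1) = 1.
Proof.
  intros Ht. unfold expect.
  rewrite (sum_eq _ (fun k => countw e f n k * / counttot e f n)) by (intros; unfold Rdiv; ring).
  rewrite <- scal_sum. unfold counttot at 1. apply Rinv_l. apply Rgt_not_eq, Ht.
Qed.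

Lemma seqpow_scal v k : seqpow (seqscal v f) k = seqscal (v ^ k) (seqpow f k).
Proof.
  induction k as [|k IH]; [extensionality n; unfold seqscal; simpl; ring|].
  simpl. rewrite IH, conv_scal_l, conv_scal_r. extensionality n. unfold seqscal. ring.
Qed.

(* Expansion of 1/(1 + a - f) in powers of a, where u = 1/(1 - f). *)
Lemma expect_geom n a K : 0 <= a -> 0 < counttot e f n ->
  Rabs (expect e f n (fun k => (/ (1 + a)) ^ k) / (1 + a)
    - match K with O => 0 | S K' => sum_f_R0 (fun k => (- a) ^ k * fmom k n) K' end) <= a ^ K * fmom K n.
Proof.
  intros Ha Ht. set (v := / (1 + a)). assert (Hv : 0 < v <= 1).
  { unfold v. split; [pos|]. rewrite <- Rinv_1. apply Rinv_le_contravar; lra. }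
  set (u := geom f). set (hh := geom (seqscal v f)).
  assert (Hh1 : conv (seqsub seq1 (seqscal v f)) hh = seq1) by (apply geom_inv; unfold seqscal; rewrite f_0; ring).
  assert (Hu : conv (seqsub seq1 f) u = seq1) by (apply geom_inv, f_0).
  (* h is v / (1 - v f) = 1 / (1 + a - f). [Hrel] is its fixed-point equation h = u - a u h, and
     [Hexp] iterates it. *)
  set (h := seqscal v hh).
  assert (Hva : v * (1 + a) = 1) by (unfold v; field; lra).
  assert (Hrel : h = seqsub u (seqscal a (conv u h))).
  { assert (E : conv (seqsub seq1 f) h = seqsub seq1 (seqscal a h)).
    { assert (E1 : seqsub seq1 (seqscal v f) = seqadd (seqscal v (seqsub seq1 f)) (seqscal (1 - v) seq1))
        by (extensionality i; unfold seqsub, seqadd, seqscal; ring).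
      rewrite E1 in Hh1. unfold h. rewrite conv_scal_r, <- conv_scal_l.
      replace (conv (seqadd (seqscal v (seqsub seq1 f)) (seqscal (1 - v) seq1)) hh)
        with (seqadd (conv (seqscal v (seqsub seq1 f)) hh) (conv (seqscal (1 - v) seq1) hh)) in Hh1 by ring.
      rewrite (conv_scal_l (1 - v)) in Hh1. replace (conv seq1 hh) with hh in Hh1 by ring.
      replace (1 - v) with (a * v) in Hh1 by lra.
      extensionality i. assert (Hi := f_equal (fun b => b i) Hh1). cbv beta in Hi.
      unfold seqadd at 1, seqscal at 2 in Hi. unfold seqsub at 2, seqscal at 2 3. lra. }
    assert (E2 : h = conv (conv (seqsub seq1 f) u) h) by (rewrite Hu; ring).
    rewrite E2 at 1. replace (conv (conv (seqsub seq1 f) u) h) with (conv u (conv (seqsub seq1 f) h)) by ring.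
    rewrite E. replace (conv u (seqsub seq1 (seqscal a h))) with (seqsub u (conv u (seqscal a h))) by ring.
    rewrite conv_scal_r. reflexivity. }
  assert (Hexp : forall J, h = seqadd (fun i => match J with O => 0 | S K' => sum_f_R0 (fun k => (- a) ^ k * seqpow u (S k) i) K' end)
       (seqscal ((- a) ^ J) (conv (seqpow u J) h))).
  { induction J as [|J IH].
    - extensionality i. unfold seqadd, seqscal. simpl. replace (conv seq1 h) with h by ring. ring.
    - rewrite IH at 1. rewrite Hrel at 1.
      replace (conv (seqpow u J) (seqsub u (seqscal a (conv u h)))) with
        (seqsub (conv u (seqpow u J)) (conv (seqpow u J) (seqscal a (conv u h)))) by ring.
      rewrite conv_scal_r. replace (conv (seqpow u J) (conv u h)) with (conv (conv u (seqpow u J)) h) by ring.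
      extensionality i. unfold seqadd, seqsub, seqscal. change (conv u (seqpow u J)) with (seqpow u (S J)).
      destruct J as [|J]; [simpl; ring|]. rewrite tech5. simpl ((- a) ^ S (S J)). simpl ((- a) ^ S J). ring. }
  (* Coefficientwise 0 <= h <= u, so the remainder after K terms is at most the absolute value of
     the next term. *)
  assert (Hhle : forall i, 0 <= h i <= u i).
  { intros i. assert (Hh0 : 0 <= hh i <= u i).
    { unfold hh, u, geom. split.
      - apply cond_pos_sum. intros k. apply seqpow_nonneg. intros j. pos.
      - apply sum_Rle. intros k _. rewrite seqpow_scal. unfold seqscal.
        assert (0 <= v ^ k <= 1) by (apply pow_unit_interval; lra).
        pose proof (seqpow_nonneg f k i f_nonneg). nra. }
    unfold h, seqscal. nra. }
  assert (HE : expect e f n (fun k => v ^ k) / (1 + a) = conv e h n / conv e u n).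
  { assert (Et : counttot e f n = conv e u n) by (rewrite counttot_geom by exact f_0; reflexivity).
    assert (Ew : conv e hh n = sum_f_R0 (fun k => v ^ k * countw e f n k) n).
    { unfold hh. rewrite <- counttot_geom by (unfold seqscal; rewrite f_0; ring). unfold counttot.
      apply sum_eq. intros k _. unfold countw. rewrite seqpow_scal, conv_scal_r. reflexivity. }
    unfold h. rewrite conv_scal_r. unfold seqscal. rewrite Ew. unfold expect. rewrite Et in *.
    rewrite (sum_eq _ (fun k => v ^ k * countw e f n k * / conv e u n)) by (intros; unfold Rdiv; ring).
    rewrite <- scal_sum. unfold v. field. lra. }
  rewrite HE.
  assert (Et : counttot e f n = conv e u n) by (rewrite counttot_geom by exact f_0; reflexivity). rewrite Et in Ht.
  rewrite (Hexp K) at 1.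
  set (S1 := fun i => match K with O => 0 | S K' => sum_f_R0 (fun k => (- a) ^ k * seqpow u (S k) i) K' end).
  replace (conv e (seqadd S1 (seqscal ((- a) ^ K) (conv (seqpow u K) h)))) with
    (seqadd (conv e S1) (conv e (seqscal ((- a) ^ K) (conv (seqpow u K) h)))) by ring.
  rewrite conv_scal_r. unfold seqadd, seqscal.
  assert (ES : conv e S1 n / conv e u n = match K with O => 0 | S K' => sum_f_R0 (fun k => (- a) ^ k * fmom k n) K' end).
  { unfold S1. destruct K as [|K'].
    - change (fun _ : nat => 0) with seq0. replace (conv e seq0) with seq0 by ring. unfold seq0, Rdiv. ring.
    - unfold conv at 1. rewrite (sum_eq _ (fun i => sum_f_R0 (fun k => e i * ((- a) ^ k * seqpow u (S k) (n - i))) K')).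
      + rewrite sum_exchange. unfold Rdiv. rewrite Rmult_comm, scal_sum. apply sum_eq. intros k _.
        unfold fmom. fold u. unfold Rdiv. rewrite <- Rmult_assoc. f_equal. unfold conv. rewrite scal_sum.
        apply sum_eq. intros; ring.
      + intros i _. rewrite scal_sum. apply sum_eq. intros; ring. }
  replace ((conv e S1 n + (- a) ^ K * conv e (conv (seqpow u K) h) n) / conv e u n)
    with (conv e S1 n / conv e u n + (- a) ^ K * (conv e (conv (seqpow u K) h) n / conv e u n)) by (field; lra).
  rewrite ES. match goal with |- Rabs (?x + ?y - ?x) <= _ => replace (x + y - x) with y by ring end.
  rewrite Rabs_mult, <- RPow_abs, Rabs_Ropp, (Rabs_pos_eq a) by exact Ha.
  apply Rmult_le_compat_l; [pos|].
  assert (Hpow : forall i, 0 <= seqpow u K i) by (intros i; apply seqpow_nonneg; intros j; apply (geom_nonneg f), f_nonneg).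
  assert (Hle : conv e (conv (seqpow u K) h) n <= conv e (seqpow u (S K)) n).
  { apply conv_le; intros i _; [split; [auto|lra]|]. split; [apply conv_nonneg; [exact Hpow|intros; apply Hhle]|].
    simpl. replace (conv u (seqpow u K)) with (conv (seqpow u K) u) by ring.
    apply conv_le; intros j _; [split; [apply Hpow|lra]|apply Hhle]. }
  assert (Hge : 0 <= conv e (conv (seqpow u K) h) n).
  { apply conv_nonneg; [auto|]. intros i. apply conv_nonneg; [exact Hpow|]. intros j. apply Hhle. }
  rewrite Rabs_pos_eq by pos.
  unfold fmom. fold u. apply Rmult_le_compat_r; [pos|exact Hle].
Qed.

(** As a_n tends to 0, the factor 1 / (1 + a_n) in [expect_geom] disappears in the limit, and the
    moments converge by [fmom_lim]. *)
Lemma expect_geom_lim (a : nat -> R) s K eps : 0 <= s -> (forall n, 0 <= a n) ->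
  is_lim_seq (fun n => a n / gseq n) (s * eta) -> 0 < eps ->
  exists N, forall n, (N <= n)%nat ->
    Rabs (expect e f n (fun k => (/ (1 + a n)) ^ k) - partial_laplace s K) <= s ^ K * raymom K + eps.
Proof.
  intros Hs Ha Hlim He0. pose proof Heta as Het.
  assert (Hak : forall k, is_lim_seq (fun n => (- a n) ^ k * fmom k n) ((- s) ^ k * raymom k)).
  { intros k. apply (is_lim_seq_ext (fun n => (- 1) ^ k * (a n / gseq n) ^ k * (fmom k n * gseq n ^ k))).
    - intros n. pose proof (gseq_pos n). rewrite pow_div. replace (- a n) with (- 1 * a n) by ring.
      rewrite Rpow_mult_distr. pose proof (pow_lt (gseq n) k H). field. lra.
    - replace ((- s) ^ k * raymom k) with ((- 1) ^ k * (s * eta) ^ k * (raymom k * (/ eta) ^ k)).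
      + apply is_lim_seq_mult'; [|apply fmom_lim]. apply is_lim_seq_mult'; [apply is_lim_seq_const|].
        clear - Hlim. induction k as [|k IH]; [apply is_lim_seq_const|]. simpl. apply is_lim_seq_mult'; assumption.
      + replace (- s) with (- 1 * s) by ring. rewrite !Rpow_mult_distr, pow_inv. pose proof (pow_lt eta k Het). field. lra. }
  assert (Hap : is_lim_seq (fun n => a n ^ K * fmom K n) (s ^ K * raymom K)).
  { apply (is_lim_seq_ext (fun n => (- 1) ^ K * ((- a n) ^ K * fmom K n))).
    - intros n. rewrite <- Rmult_assoc, <- Rpow_mult_distr. f_equal. f_equal. ring.
    - replace (s ^ K * raymom K) with ((- 1) ^ K * ((- s) ^ K * raymom K)).
      + apply is_lim_seq_mult'; [apply is_lim_seq_const|apply Hak].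
      + rewrite <- Rmult_assoc, <- Rpow_mult_distr. f_equal. f_equal. ring. }
  assert (Ha0 : is_lim_seq a 0).
  { apply (is_lim_seq_ext (fun n => a n / gseq n * gseq n)); [intros n; pose proof (gseq_pos n); field; lra|].
    replace 0 with (s * eta * 0) by ring. lims. }
  assert (HS : is_lim_seq (fun n => match K with O => 0 | S K' => sum_f_R0 (fun k => (- a n) ^ k * fmom k n) K' end) (partial_laplace s K)).
  { destruct K as [|K']; [apply is_lim_seq_const|]. apply (is_lim_seq_sum (fun k n => (- a n) ^ k * fmom k n)). intros k _. apply Hak. }
  destruct counttot_pos as [N0 HN0].
  destruct (lim_eps _ _ (eps / 4) HS ltac:(lra)) as [N1 HN1].
  destruct (lim_eps _ _ (eps / 4) Hap ltac:(lra)) as [N2 HN2].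
  destruct (lim_eps _ _ (eps / 4) Ha0 ltac:(lra)) as [N3 HN3].
  exists (N0 + N1 + N2 + N3)%nat. intros n Hn.
  specialize (HN0 n ltac:(lia)). specialize (HN1 n ltac:(lia)). specialize (HN2 n ltac:(lia)). specialize (HN3 n ltac:(lia)).
  pose proof (expect_geom n (a n) K (Ha n) HN0) as H. specialize (Ha n).
  set (x := expect e f n (fun k => (/ (1 + a n)) ^ k)) in *.
  assert (Hx : 0 <= x <= 1).
  { assert (Hv : 0 <= / (1 + a n) <= 1).
    { split; [pos|]. rewrite <- Rinv_1. apply Rinv_le_contravar; lra. }
    split.
    - apply Rle_trans with (expect e f n (fun _ => 0)).
      + unfold expect. rewrite sum_zero; [lra|]. intros; ring.
      + apply expect_mono; [exact HN0|]. intros k _. apply pow_le. lra.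
    - rewrite <- (expect_1 n HN0). apply expect_mono; [exact HN0|]. intros k _.
      apply Rle_trans with (1 ^ k); [apply pow_incr; lra|rewrite pow1; lra]. }
  assert (Hxa : 0 <= x - x / (1 + a n) <= a n).
  { replace (x - x / (1 + a n)) with (x * (a n / (1 + a n))) by (field; lra).
    assert (0 <= a n / (1 + a n) <= a n).
    { split; [pos|]. apply Rle_div_l; nra. }
    nra. }
  apply Rabs_le_between in H. apply Rabs_le_between in HN1. apply Rabs_le_between in HN2. apply Rabs_le_between in HN3.
  apply Rabs_le. lra.
Qed.

End Law.

(** * Comparison of two critical laws *)

(* [e] and [f] stand for the coefficients of E(rho z) and Q(rho z) when Q(rho) = 1. *)
Definition critical (e f : nat -> R) (eta : R) : Prop :=
  exists ae, InA e ae /\ (forall n, 0 <= e n) /\ e O = 1 /\ InA f (- eta) /\ (forall n, 0 <= f n) /\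
    f O = 0 /\ Series f = 1 /\ exists n0 k, 0 < k /\ forall n, (n0 <= n)%nat -> k * kap1 n <= f n.

(** The Bernstein polynomial with nodal values h 0, ..., h N in de Casteljau's form: the mean of h
    under the binomial law (N, y), with its moments available by induction. *)
Fixpoint bern (N : nat) (h : nat -> R) (y : R) : R :=
  match N with
  | O => h O
  | S N' => (1 - y) * bern N' h y + y * bern N' (fun i => h (S i)) y
  end.

Lemma bern_ext N h h' y : (forall i, h i = h' i) -> bern N h y = bern N h' y.
Proof. revert h h'. induction N as [|N IH]; intros h h' H; simpl; [apply H|]. rewrite (IH _ _ H), (IH _ _ (fun i => H (S i))). reflexivity. Qed.

Lemma bern_lin N a b h h' y : bern N (fun i => a * h i + b * h' i) y = a * bern N h y + b * bern N h' y.
Proof. revert h h'. induction N as [|N IH]; intros h h'; simpl; [reflexivity|]. rewrite !IH. ring. Qed.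

Lemma bern_le N h h' y : 0 <= y <= 1 -> (forall i, h i <= h' i) -> bern N h y <= bern N h' y.
Proof.
  intros Hy. revert h h'. induction N as [|N IH]; intros h h' H; simpl; [apply H|].
  apply Rplus_le_compat; apply Rmult_le_compat_l; try lra; apply IH; auto.
Qed.

Lemma bern_1 N y : bern N (fun _ => 1) y = 1.
Proof. induction N as [|N IH]; simpl; [|rewrite IH]; ring. Qed.

Lemma bern_INR N y : bern N INR y = INR N * y.
Proof.
  induction N as [|N IH]; [simpl; ring|]. simpl bern.
  rewrite (bern_ext N (fun i => INR (S i)) (fun i => 1 * INR i + 1 * 1)) by (intros; rewrite S_INR; ring).
  rewrite bern_lin, IH, bern_1, S_INR. ring.
Qed.

Lemma bern_sqr N y : bern N (fun i => INR i ^ 2) y = INR N * y * (1 - y) + (INR N * y) ^ 2.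
Proof.
  induction N as [|N IH]; [simpl; ring|]. rewrite S_INR. simpl bern.
  rewrite (bern_ext N (fun i => INR (S i) * (INR (S i) * 1)) (fun i => 1 * (INR i ^ 2) + 1 * (2 * INR i + 1 * 1))) by (intros; rewrite S_INR; ring).
  rewrite (bern_ext N (fun i => INR i * (INR i * 1)) (fun i => INR i ^ 2)) by (intros; ring).
  rewrite !bern_lin, IH, bern_INR, bern_1. ring.
Qed.

(** Chebyshev's argument: |t| <= del + t^2 / del, and the variance of the binomial frequency is at
    most 1/N. *)
Lemma bern_approx (F : R -> R) L N del y : (1 <= N)%nat -> 0 <= L -> 0 < del -> 0 <= y <= 1 ->
  (forall x x', Rabs (F x - F x') <= L * Rabs (x - x')) ->
  Rabs (bern N (fun i => F (INR i / INR N)) y - F y) <= L * (del + / (INR N * del)).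
Proof.
  intros HN HL Hd Hy HF. assert (HN0 : 0 < INR N) by (apply lt_0_INR; lia).
  set (r := fun i => L * (del + (INR i / INR N - y) ^ 2 / del)).
  assert (Hr : forall i, Rabs (F (INR i / INR N) - F y) <= r i).
  { intros i. apply Rle_trans with (1 := HF _ _). unfold r. apply Rmult_le_compat_l; [exact HL|].
    rewrite <- pow2_abs. set (t := Rabs _). assert (0 <= t) by apply Rabs_pos.
    replace (del + t ^ 2 / del) with (t + ((t - del) ^ 2 + t * del) / del) by (field; lra).
    assert (0 <= ((t - del) ^ 2 + t * del) / del); [|lra].
    apply Rmult_le_pos; [nra|apply Rlt_le, Rinv_0_lt_compat, Hd]. }
  assert (Hb : bern N r y <= L * (del + / (INR N * del))).
  { rewrite (bern_ext N r (fun i => (L / (INR N ^ 2 * del)) * (INR i ^ 2) + 1 * ((- 2 * L * y / (INR N * del)) * INR i + (L * (del + y ^ 2 / del)) * 1)))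
      by (intros; unfold r; field; lra).
    rewrite !bern_lin, bern_sqr, bern_INR, bern_1.
    replace (L / (INR N ^ 2 * del) * (INR N * y * (1 - y) + (INR N * y) ^ 2) +
       1 * (- 2 * L * y / (INR N * del) * (INR N * y) + L * (del + y ^ 2 / del) * 1))
      with (L * (del + y * (1 - y) * / (INR N * del))) by (field; lra).
    apply Rmult_le_compat_l; [exact HL|]. apply Rplus_le_compat_l.
    assert (0 < / (INR N * del)) by pos. nra. }
  apply Rle_trans with (2 := Hb).
  assert (E : bern N (fun i => F (INR i / INR N)) y - F y = bern N (fun i => 1 * F (INR i / INR N) + (- F y) * 1) y).
  { rewrite bern_lin, bern_1. ring. }
  rewrite E. apply Rabs_le. split.
  - replace (- bern N r y) with (bern N (fun i => -1 * r i + 0 * 0) y) by (rewrite bern_lin; ring).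
    apply bern_le; [exact Hy|]. intros i. specialize (Hr i). apply Rabs_le_between in Hr. lra.
  - apply bern_le; [exact Hy|]. intros i. specialize (Hr i). apply Rabs_le_between in Hr. lra.
Qed.

Lemma expect_ext e f n h h' : (forall k, h k = h' k) -> expect e f n h = expect e f n h'.
Proof. intros H. apply sum_eq. intros k _. rewrite H. reflexivity. Qed.

Lemma expect_lin e f n a b h h' : expect e f n (fun k => a * h k + b * h' k) = a * expect e f n h + b * expect e f n h'.
Proof.
  unfold expect. rewrite !scal_sum, <- plus_sum. apply sum_eq. intros. ring.
Qed.

(** The variable [vscale eta n ^ X_n] lies in (0, 1], where polynomials approximate continuous
    functions, and its j-th moment is the transform of X_n at [vscale eta n ^ j]. *)
Definition vscale (eta : R) (n : nat) : R := / (1 + eta * gseq n).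

Lemma vscale_bounds eta n : 0 < eta -> 0 < vscale eta n < 1.
Proof.
  intros He. pose proof (gseq_pos n) as H. assert (0 < eta * gseq n) by pos. unfold vscale. split.
  - apply Rinv_0_lt_compat. lra.
  - rewrite <- Rinv_1. apply Rinv_lt_contravar; lra.
Qed.

Lemma vscale_pow_bounds eta n k : 0 < eta -> 0 < vscale eta n ^ k <= 1.
Proof.
  intros He. pose proof (vscale_bounds eta n He). split; [pos|].
  rewrite <- (pow1 k). apply pow_incr. lra.
Qed.

Lemma critical_eta e f eta : critical e f eta -> 0 < eta.
Proof. intros (ae & H1 & H2 & H3 & H4 & H5 & H6 & H7 & H8). apply (Heta f); assumption. Qed.

Lemma critical_tot e f eta : critical e f eta -> exists N, forall n, (N <= n)%nat -> 0 < counttot e f n.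
Proof. intros (ae & H1 & H2 & H3 & H4 & H5 & H6 & H7 & H8). eapply counttot_pos; eassumption. Qed.

Lemma critical_mono e f eta n h h' : critical e f eta -> 0 < counttot e f n -> (forall k, (k <= n)%nat -> h k <= h' k) ->
  expect e f n h <= expect e f n h'.
Proof. intros (ae & H1 & H2 & H3 & H4 & H5 & H6 & H7 & H8). apply expect_mono; assumption. Qed.

Lemma expect_abs e f eta n h c : critical e f eta -> 0 < counttot e f n -> (forall k, (k <= n)%nat -> Rabs (h k) <= c) ->
  Rabs (expect e f n h) <= c.
Proof.
  intros HC Ht H. assert (E : forall a, expect e f n (fun _ => a) = a).
  { intros a. rewrite (expect_ext _ _ _ _ (fun k => a * 1 + 0 * 1)) by (intros; ring). rewrite expect_lin, expect_1 by exact Ht. ring. }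
  apply Rabs_le. split.
  - rewrite <- (E (- c)). apply (critical_mono _ _ eta); [assumption..|]. intros k Hk. specialize (H k Hk). apply Rabs_le_between in H. lra.
  - rewrite <- (E c). apply (critical_mono _ _ eta); [assumption..|]. intros k Hk. specialize (H k Hk). apply Rabs_le_between in H. lra.
Qed.

Lemma vscale_pow_lim eta j : 0 < eta -> is_lim_seq (fun n => ((1 + eta * gseq n) ^ j - 1) / gseq n) (INR j * eta).
Proof.
  intros He. induction j as [|j IH].
  - apply (is_lim_seq_ext (fun _ => 0)); [intros n; simpl; pose proof (gseq_pos n); field; lra|].
    replace (Finite (INR 0 * eta)) with (Finite 0) by (f_equal; simpl; ring). apply is_lim_seq_const.
  - apply (is_lim_seq_ext (fun n => ((1 + eta * gseq n) ^ j - 1) / gseq n * (1 + eta * gseq n) + eta)).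
    + intros n. pose proof (gseq_pos n). simpl. field. lra.
    + replace (Finite (INR (S j) * eta)) with (Finite (INR j * eta * (1 + eta * 0) + eta)) by (f_equal; rewrite S_INR; ring).
      lims.
Qed.

Lemma expect_vscale e f eta j K eps : critical e f eta -> 0 < eps ->
  exists N, forall n, (N <= n)%nat ->
    Rabs (expect e f n (fun k => (vscale eta n ^ k) ^ j) - partial_laplace (INR j) K) <= INR j ^ K * raymom K + eps.
Proof.
  intros HC Heps. pose proof (critical_eta _ _ _ HC) as He. destruct HC as (ae & H1 & H2 & H3 & H4 & H5 & H6 & H7 & H8).
  destruct (expect_geom_lim e f ae eta H1 H2 H3 H4 H5 H6 H7 H8 (fun n => (1 + eta * gseq n) ^ j - 1) (INR j) K eps) as [N HN].
  - apply pos_INR.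
  - intros n. pose proof (gseq_pos n). assert (0 < eta * gseq n) by pos.
    assert (1 ^ j <= (1 + eta * gseq n) ^ j) by (apply pow_incr; lra). rewrite pow1 in *. lra.
  - apply vscale_pow_lim, He.
  - exact Heps.
  - exists N. intros n Hn. specialize (HN n Hn).
    rewrite (expect_ext _ _ _ _ (fun k => (/ (1 + ((1 + eta * gseq n) ^ j - 1))) ^ k)); [exact HN|].
    intros k. unfold vscale. replace (1 + ((1 + eta * gseq n) ^ j - 1)) with ((1 + eta * gseq n) ^ j) by ring.
    rewrite <- pow_mult, Nat.mul_comm, pow_mult, pow_inv. reflexivity.
Qed.

Section Compare.
Variables (e1 f1 e2 f2 : nat -> R) (eta1 eta2 : R).
Hypothesis H1 : critical e1 f1 eta1.
Hypothesis H2 : critical e2 f2 eta2.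

Definition same_limit (h : R -> R) : Prop :=
  is_lim_seq (fun n => expect e1 f1 n (fun k => h (vscale eta1 n ^ k)) - expect e2 f2 n (fun k => h (vscale eta2 n ^ k))) 0.

Lemma same_limit_ext h h' : (forall y, h y = h' y) -> same_limit h -> same_limit h'.
Proof.
  intros E. apply is_lim_seq_ext. intros n. f_equal; apply expect_ext; intros; apply E.
Qed.

Lemma same_limit_lin a b h h' : same_limit h -> same_limit h' -> same_limit (fun y => a * h y + b * h' y).
Proof.
  intros Ha Hb. unfold same_limit.
  apply (is_lim_seq_ext (fun n =>
    a * (expect e1 f1 n (fun k => h (vscale eta1 n ^ k)) - expect e2 f2 n (fun k => h (vscale eta2 n ^ k))) +
    b * (expect e1 f1 n (fun k => h' (vscale eta1 n ^ k)) - expect e2 f2 n (fun k => h' (vscale eta2 n ^ k))))).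
  - intros n. rewrite !expect_lin. ring.
  - replace 0 with (a * 0 + b * 0) by ring.
    lims.
Qed.

(** Both transforms are close to the same truncated series with s = j, because (1 + eta g_n)^j - 1
    is equivalent to j eta g_n; the scale has absorbed eta. *)
Lemma same_limit_pow j : same_limit (fun y => y ^ j).
Proof.
  apply is_lim_seq_0_eps. intros eps He.
  destruct (raymom_small (INR j) (eps / 4) (pos_INR j) ltac:(lra)) as [K HK].
  destruct (expect_vscale _ _ _ j K (eps / 4) H1 ltac:(lra)) as [N1 HN1].
  destruct (expect_vscale _ _ _ j K (eps / 4) H2 ltac:(lra)) as [N2 HN2].
  exists (N1 + N2)%nat. intros n Hn. specialize (HN1 n ltac:(lia)). specialize (HN2 n ltac:(lia)).
  apply Rabs_le_between in HN1. apply Rabs_le_between in HN2. apply Rabs_le. lra.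
Qed.

(** The factors y^i (1-y)^j make the recursion of [bern] close up in the induction. *)
Lemma same_limit_bern N h i j : same_limit (fun y => y ^ i * (1 - y) ^ j * bern N h y).
Proof.
  revert h i j. induction N as [|N IH]; intros h i j.
  - simpl bern. apply (same_limit_ext (fun y => h O * (y ^ i * (1 - y) ^ j) + 0 * y ^ 0)); [intros; ring|].
    apply same_limit_lin; [|apply same_limit_pow]. revert i. induction j as [|j IHj]; intros i.
    + apply (same_limit_ext (fun y => y ^ i)); [intros; ring|apply same_limit_pow].
    + apply (same_limit_ext (fun y => 1 * (y ^ i * (1 - y) ^ j) + -1 * (y ^ S i * (1 - y) ^ j))); [intros; simpl; ring|].
      apply same_limit_lin; apply IHj.
  - apply (same_limit_ext (fun y => 1 * (y ^ i * (1 - y) ^ S j * bern N h y) + 1 * (y ^ S i * (1 - y) ^ j * bern N (fun m => h (S m)) y)));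
      [intros; simpl; ring|].
    apply same_limit_lin; apply IH.
Qed.

Lemma same_limit_lipschitz F L : 0 <= L -> (forall x x', Rabs (F x - F x') <= L * Rabs (x - x')) -> same_limit F.
Proof.
  intros HL HF. pose proof (critical_eta _ _ _ H1) as He1. pose proof (critical_eta _ _ _ H2) as He2.
  apply is_lim_seq_0_eps. intros eps He.
  set (del := eps / 8 / (L + 1)). assert (Hd : 0 < del) by pos.
  destruct (INR_archimed (del * del) 1 ltac:(nra)) as [N0 HN0].
  set (N := S N0). assert (HNp : 0 < INR N) by (apply lt_0_INR; unfold N; lia).
  assert (HB : forall y, 0 <= y <= 1 -> Rabs (bern N (fun i => F (INR i / INR N)) y - F y) <= eps / 4).
  { intros y Hy. apply Rle_trans with (1 := bern_approx F L N del y ltac:(unfold N; lia) HL Hd Hy HF).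
    assert (/ (INR N * del) <= del).
    { assert (INR N0 <= INR N) by (apply le_INR; unfold N; lia).
      apply (Rmult_le_reg_r (INR N * del)); [pos|]. rewrite Rinv_l by pos. nra. }
    apply Rle_trans with (L * (2 * del)); [apply Rmult_le_compat_l; lra|].
    apply Rle_trans with ((L + 1) * (2 * del)); [nra|]. unfold del. apply Req_le. field. lra. }
  assert (Hs := same_limit_bern N (fun i => F (INR i / INR N)) 0 0).
  destruct (lim_eps _ _ (eps / 2) Hs ltac:(lra)) as [N3 HN3].
  destruct (critical_tot _ _ _ H1) as [N1 HN1]. destruct (critical_tot _ _ _ H2) as [N2 HN2].
  exists (N1 + N2 + N3)%nat. intros n Hn. specialize (HN1 n ltac:(lia)). specialize (HN2 n ltac:(lia)). specialize (HN3 n ltac:(lia)).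
  assert (A : forall e f eta, critical e f eta -> 0 < counttot e f n ->
    Rabs (expect e f n (fun k => F (vscale eta n ^ k)) -
      expect e f n (fun k => (vscale eta n ^ k) ^ 0 * (1 - vscale eta n ^ k) ^ 0 * bern N (fun i => F (INR i / INR N)) (vscale eta n ^ k))) <= eps / 4).
  { intros e f eta HC Ht. match goal with |- Rabs (expect _ _ _ ?a - expect _ _ _ ?b) <= _ =>
      replace (expect e f n a - expect e f n b) with (expect e f n (fun k => 1 * a k + -1 * b k)) by (rewrite expect_lin; ring) end.
    apply (expect_abs _ _ eta); [exact HC|exact Ht|]. intros k _.
    pose proof (vscale_pow_bounds eta n k (critical_eta _ _ _ HC)). specialize (HB (vscale eta n ^ k) ltac:(lra)).
    rewrite <- Rabs_Ropp in HB. apply Rle_trans with (2 := HB), Req_le. f_equal. ring. }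
  pose proof (A _ _ _ H1 HN1) as A1. pose proof (A _ _ _ H2 HN2) as A2.
  apply Rabs_le_between in A1. apply Rabs_le_between in A2. apply Rabs_le_between in HN3. apply Rabs_le. lra.
Qed.

End Compare.

(** * From transforms to distribution functions *)

Lemma pow_antitone x m n : 0 <= x <= 1 -> (m <= n)%nat -> x ^ n <= x ^ m.
Proof.
  intros Hx H. replace n with (m + (n - m))%nat by lia. rewrite pow_add. pose proof (pow_le x m ltac:(lra)).
  assert (0 <= x ^ (n - m) <= 1) by (apply pow_unit_interval; lra). nra.
Qed.

Definition leind (m k : nat) : R := if le_dec k m then 1 else 0.

(** Sandwich with exp(-t) <= 1 / (1 + t) <= exp(-t / (1 + t)) at t = eta g_n, raised to the power
    K. *)
Lemma vscale_exp_lim eta (K : nat -> nat) (kappa : R) : 0 < eta -> is_lim_seq (fun n => INR (K n) * gseq n) kappa ->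
  is_lim_seq (fun n => vscale eta n ^ K n) (exp (- (eta * kappa))).
Proof.
  intros He HK.
  assert (Hc : continuous (fun x => exp (- (eta * x))) kappa).
  { apply continuity_pt_filterlim. apply derivable_continuous_pt. exists (- eta * exp (- (eta * kappa))). apply is_derive_Reals. auto_derive; [trivial|ring]. }
  assert (HL1 : is_lim_seq (fun n => exp (- (eta * (INR (K n) * gseq n)))) (exp (- (eta * kappa)))).
  { apply (is_lim_seq_continuous (fun x => exp (- (eta * x)))); [apply continuity_pt_filterlim, Hc|exact HK]. }
  assert (HL2 : is_lim_seq (fun n => exp (- (eta * (INR (K n) * gseq n * / (1 + eta * gseq n))))) (exp (- (eta * kappa)))).
  { apply (is_lim_seq_continuous (fun x => exp (- (eta * x)))); [apply continuity_pt_filterlim, Hc|].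
    replace (Finite kappa) with (Finite (kappa * / (1 + eta * 0))) by (f_equal; field).
    apply is_lim_seq_mult'; [exact HK|]. apply (is_lim_seq_inv (fun n => 1 + eta * gseq n) (1 + eta * 0)).
    - lims.
    - intros H. injection H. lra. }
  apply (is_lim_seq_le_le (fun n => exp (- (eta * (INR (K n) * gseq n)))) _ (fun n => exp (- (eta * (INR (K n) * gseq n * / (1 + eta * gseq n)))))).
  2, 3: assumption.
  intros n. pose proof (gseq_pos n) as Hg. assert (Hag : 0 < eta * gseq n) by pos.
  unfold vscale. split.
  - replace (- (eta * (INR (K n) * gseq n))) with (INR (K n) * (- (eta * gseq n))) by ring.
    rewrite <- exp_pow. apply pow_incr. split; [apply Rlt_le, exp_pos|].
    rewrite exp_Ropp. apply Rinv_le_contravar; [lra|]. left. apply exp_ineq1. lra.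
  - replace (- (eta * (INR (K n) * gseq n * / (1 + eta * gseq n)))) with (INR (K n) * (- (eta * gseq n / (1 + eta * gseq n)))) by (field; lra).
    rewrite <- exp_pow. apply pow_incr. split; [pos|].
    replace (/ (1 + eta * gseq n)) with (1 + - (eta * gseq n / (1 + eta * gseq n))) by (field; lra).
    apply exp_ineq1_le.
Qed.

Definition clamp (a b y : R) : R := Rmin 1 (Rmax 0 ((y - a) / (b - a))).

Lemma clamp_bounds a b y : 0 <= clamp a b y <= 1.
Proof. unfold clamp, Rmin, Rmax. repeat destruct Rle_dec; lra. Qed.

Lemma clamp_hi a b y : a < b -> b <= y -> clamp a b y = 1.
Proof.
  intros H Hy. assert (1 <= (y - a) / (b - a)) by (apply Rle_div_r; lra).
  unfold clamp. rewrite Rmax_right by lra. apply Rmin_left. lra.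
Qed.

Lemma clamp_lo a b y : a < b -> y <= a -> clamp a b y = 0.
Proof.
  intros H Hy. assert ((y - a) / (b - a) <= 0) by (apply Rle_div_l; lra).
  unfold clamp. rewrite Rmax_left by lra. apply Rmin_right. lra.
Qed.

Lemma clamp_lipschitz a b x y : a < b -> Rabs (clamp a b x - clamp a b y) <= / (b - a) * Rabs (x - y).
Proof.
  intros H. assert (Hi : 0 < / (b - a)) by pos.
  rewrite <- (Rabs_pos_eq (/ (b - a))) at 1 by lra. rewrite <- Rabs_mult.
  replace (/ (b - a) * (x - y)) with ((x - a) / (b - a) - (y - a) / (b - a)) by (field; lra).
  unfold clamp. set (u := (x - a) / (b - a)). set (v := (y - a) / (b - a)).
  unfold Rmin, Rmax, Rabs. repeat (destruct Rle_dec || destruct Rcase_abs); lra.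
Qed.

(** The event X <= K is the event v^X >= v^K. The strict inequality separates the limits of the two
    thresholds, and a Lipschitz ramp fits between the two indicators. *)
Lemma cdf_compare e1 f1 eta1 e2 f2 eta2 (K1 K2 : nat -> nat) (kap1' kap2' eps : R) :
  critical e1 f1 eta1 -> critical e2 f2 eta2 ->
  is_lim_seq (fun n => INR (K1 n) * gseq n) kap1' -> is_lim_seq (fun n => INR (K2 n) * gseq n) kap2' ->
  eta1 * kap1' < eta2 * kap2' -> 0 < eps ->
  exists N, forall n, (N <= n)%nat -> expect e1 f1 n (leind (K1 n)) <= expect e2 f2 n (leind (K2 n)) + eps.
Proof.
  intros HC1 HC2 HK1 HK2 Hlt He.
  pose proof (critical_eta _ _ _ HC1) as He1. pose proof (critical_eta _ _ _ HC2) as He2.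
  assert (Hexp : exp (- (eta2 * kap2')) < exp (- (eta1 * kap1'))) by (apply exp_increasing; lra).
  set (E1 := exp (- (eta1 * kap1'))) in *. set (E2 := exp (- (eta2 * kap2'))) in *.
  (* Cut points at one and two thirds: eventually the first threshold is at least b and the second
     at most a. *)
  set (a := E2 + (E1 - E2) / 3). set (b := E2 + 2 * ((E1 - E2) / 3)).
  assert (Hab : a < b) by (unfold a, b; lra).
  destruct (lim_eps _ _ ((E1 - E2) / 3) (vscale_exp_lim _ _ _ He1 HK1) ltac:(lra)) as [N1 HN1].
  destruct (lim_eps _ _ ((E1 - E2) / 3) (vscale_exp_lim _ _ _ He2 HK2) ltac:(lra)) as [N2 HN2].
  destruct (critical_tot _ _ _ HC1) as [N3 HN3]. destruct (critical_tot _ _ _ HC2) as [N4 HN4].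
  assert (HS : same_limit e1 f1 e2 f2 eta1 eta2 (clamp a b)).
  { apply (same_limit_lipschitz _ _ _ _ _ _ HC1 HC2 _ (/ (b - a))).
    - apply Rlt_le, Rinv_0_lt_compat. lra.
    - intros x x'. apply clamp_lipschitz, Hab. }
  destruct (lim_eps _ _ eps HS He) as [N5 HN5].
  exists (N1 + N2 + N3 + N4 + N5)%nat. intros n Hn.
  specialize (HN1 n ltac:(lia)). specialize (HN2 n ltac:(lia)). specialize (HN3 n ltac:(lia)). specialize (HN4 n ltac:(lia)). specialize (HN5 n ltac:(lia)).
  fold E1 in HN1. fold E2 in HN2.
  apply Rabs_le_between in HN1. apply Rabs_le_between in HN2. apply Rabs_le_between in HN5.
  assert (A1 : expect e1 f1 n (leind (K1 n)) <= expect e1 f1 n (fun k => clamp a b (vscale eta1 n ^ k))).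
  { apply (critical_mono _ _ eta1); [assumption..|]. intros k _. unfold leind. destruct le_dec as [Hk|Hk]; [|apply clamp_bounds].
    rewrite clamp_hi; [lra|exact Hab|]. pose proof (vscale_bounds eta1 n He1).
    apply Rle_trans with (vscale eta1 n ^ K1 n); [unfold b; lra|]. apply pow_antitone; [lra|exact Hk]. }
  assert (A2 : expect e2 f2 n (fun k => clamp a b (vscale eta2 n ^ k)) <= expect e2 f2 n (leind (K2 n))).
  { apply (critical_mono _ _ eta2); [assumption..|]. intros k _. unfold leind. destruct le_dec as [Hk|Hk]; [apply clamp_bounds|].
    rewrite clamp_lo; [lra|exact Hab|]. pose proof (vscale_bounds eta2 n He2).
    apply Rle_trans with (vscale eta2 n ^ K2 n); [|unfold a; lra]. apply pow_antitone; [lra|lia]. }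
  lra.
Qed.

(** * An explicit critical law *)

(** Telescoping of e f^k = x f^k - x f^(k+1) with x = e / (1 - f): the weight of the event X_n > K
    is the coefficient of x f^(K+1). *)
Lemma countw_head e f n K : f O = 0 ->
  sum_f_R0 (countw e f n) K = conv e (geom f) n - conv (seqpow f (S K)) (conv e (geom f)) n.
Proof.
  intros Hf. pose proof (geom_inv f Hf) as Hg.
  assert (Hg' : forall x : nat -> R, seqsub (conv x (geom f)) (conv (conv f x) (geom f)) = x).
  { intros x. replace (seqsub (conv x (geom f)) (conv (conv f x) (geom f))) with (conv x (conv (seqsub seq1 f) (geom f))) by ring.
    rewrite Hg. ring. }
  assert (Hstep : forall k, countw e f n k = conv (seqpow f k) (conv e (geom f)) n - conv (seqpow f (S k)) (conv e (geom f)) n).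
  { intros k. pose proof (f_equal (fun a => a n) (Hg' (conv e (seqpow f k)))) as H. unfold seqsub in H.
    unfold countw. rewrite <- H. f_equal; apply (f_equal (fun a => a n)); simpl; ring. }
  induction K as [|K IH].
  - simpl sum_f_R0. rewrite Hstep. f_equal. apply (f_equal (fun a => a n)). simpl. ring.
  - rewrite tech5, IH, Hstep. ring.
Qed.

Lemma countw_vanish e f n k : f O = 0 -> (n < k)%nat -> countw e f n k = 0.
Proof.
  intros Hf Hk. apply sum_zero. intros i Hi. rewrite seqpow_vanish; [ring|exact Hf|lia].
Qed.

Lemma sum_leind a n m : (forall k, (n < k)%nat -> a k = 0) ->
  sum_f_R0 (fun k => leind m k * a k) n = sum_f_R0 a m.
Proof.
  intros Ha. rewrite <- (sum_pad (fun k => leind m k * a k) n (n + m)); [|lia|intros i Hi; rewrite Ha by exact Hi; ring].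
  rewrite (sum_pad (fun k => leind m k * a k) m (n + m)); [|lia|].
  - apply sum_eq. intros k Hk. unfold leind. destruct le_dec; [ring|lia].
  - intros i Hi. unfold leind. destruct le_dec; [lia|ring].
Qed.

Lemma expect_leind e f n m : f O = 0 ->
  expect e f n (leind m) = (counttot e f n - conv (seqpow f (S m)) (conv e (geom f)) n) / counttot e f n.
Proof.
  intros Hf. unfold expect.
  rewrite (sum_eq _ (fun k => (leind m k * countw e f n k) * / counttot e f n)) by (intros; unfold Rdiv; ring).
  rewrite <- scal_sum, sum_leind by (intros; apply countw_vanish; assumption).
  rewrite countw_head, counttot_geom by exact Hf. unfold Rdiv. ring.
Qed.

(* For Q = 1 - sqrt (1-z) and E = 1 the law of X_n is explicit. *)
Definition canon : nat -> R := seqsub seq1 wseq.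

Lemma canon_critical : critical seq1 canon 1.
Proof.
  exists 0. split; [apply InA_seq1|]. split; [intros n; unfold seq1; destruct Nat.eqb; lra|]. split; [reflexivity|].
  assert (Hp : forall n, 0 <= canon n).
  { intros [|n]; unfold canon, seqsub, seq1; simpl Nat.eqb; cbv iota; [rewrite wseq_0; lra|rewrite wseq_S; pose proof (kap1_pos n); lra]. }
  assert (Ha : InA canon (- (1))).
  { replace (- (1)) with (0 - 1) by ring. apply InA_sub; [apply InA_seq1|apply InA_wseq]. }
  split; [exact Ha|]. split; [exact Hp|]. split; [unfold canon, seqsub, seq1; simpl Nat.eqb; cbv iota; rewrite wseq_0; ring|]. split.
  - unfold canon, seqsub. rewrite Series_minus by (eapply InA_ex_series; [apply InA_seq1 || apply InA_wseq]).
    rewrite Series_seq1, (is_series_unique _ _ is_series_wseq). ring.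
  - exists 1%nat, (1 / 8). split; [lra|]. intros [|n] Hn; [lia|].
    unfold canon, seqsub, seq1. simpl Nat.eqb. cbv iota. rewrite wseq_S.
    assert (kap1 (S n) <= 4 * kap1 n) by (apply kap1_doubling; lia).
    lra.
Qed.

Lemma canon_0 : canon O = 0.
Proof. unfold canon, seqsub, seq1. simpl Nat.eqb. cbv iota. rewrite wseq_0. ring. Qed.

Lemma geom_canon : geom canon = gseq.
Proof.
  apply (inv_unique wseq); [|apply wseq_conv_gseq].
  replace wseq with (seqsub seq1 canon) at 1 by (unfold canon; extensionality n; unfold seqsub; ring).
  apply geom_inv, canon_0.
Qed.

(** Divided by [gseq n], this is the probability that the explicit variable is at least K. *)
Definition ctail (K : nat) : nat -> R := conv (seqpow canon K) gseq.

Lemma ctail_0 : ctail 0 = gseq.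
Proof. unfold ctail. simpl. ring. Qed.

(** From canon^2 = 2 canon - z, as canon = 1 - sqrt(1-z). *)
Lemma ctail_SS K n : ctail (S (S K)) (S n) = 2 * ctail (S K) (S n) - ctail K n.
Proof.
  assert (H : ctail (S (S K)) = seqsub (seqscal 2 (ctail (S K))) (conv (mono 1) (ctail K))).
  { unfold ctail. simpl seqpow. rewrite <- conv_scal_l, <- conv_scal_l.
    assert (E : conv canon canon = seqsub (seqscal 2 canon) (mono 1)).
    { unfold canon at 1 2. replace (conv (seqsub seq1 wseq) (seqsub seq1 wseq)) with (seqadd (seqsub (seqsub seq1 wseq) wseq) (conv wseq wseq)) by ring.
      rewrite wseq_conv_wseq. unfold onemz, canon. extensionality i. unfold seqadd, seqsub, seqscal. ring. }
    replace (conv (conv canon (conv canon (seqpow canon K))) gseq) with (conv (conv (conv canon canon) (seqpow canon K)) gseq) by ring.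
    rewrite E. ring. }
  rewrite H. unfold seqsub, seqscal. rewrite conv_mono. simpl Nat.leb. cbv iota. simpl Nat.sub. rewrite Nat.sub_0_r. reflexivity.
Qed.

Lemma ctail_1 n : ctail 1 (S n) = gseq (S n).
Proof.
  assert (H : ctail 1 = seqsub gseq seq1).
  { unfold ctail. simpl. unfold canon. transitivity (seqsub gseq (conv wseq gseq)); [ring|rewrite wseq_conv_gseq; reflexivity]. }
  rewrite H. unfold seqsub, seq1. simpl Nat.eqb. cbv iota. ring.
Qed.

(** [ctail] is hypergeometric in both indices. The three-term recurrence changes n together with K,
    so the ratio in K can be advanced only with the ratio in n at hand; both are proved jointly. *)
Lemma ctail_rec K :
  (forall n, (K <= n)%nat -> (2 * INR n - INR K) * ctail (S K) n = 2 * (INR n - INR K) * ctail K n) /\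
  (forall n, (K <= n)%nat -> (2 * INR (S n) - INR K) * (2 * INR (S n) - INR K - 1) * ctail K n
       = 4 * INR (S n) * (INR (S n) - INR K) * ctail K (S n)).
Proof.
  induction K as [|K [IH1 IH2]].
  - rewrite ctail_0. split.
    + intros [|n] _; [simpl; ring|]. rewrite ctail_1. simpl (INR 0). ring.
    + intros n _. rewrite S_INR. simpl. pose proof (pos_INR n). field. lra.
  - assert (A : forall n, (K <= n)%nat -> 0 < 2 * INR (S n) - INR K).
    { intros n Hn. apply le_INR in Hn. rewrite S_INR. pose proof (pos_INR n). lra. }
    split.
    + intros [|n] Hn; [lia|]. rewrite ctail_SS. specialize (IH1 (S n) ltac:(lia)). specialize (IH2 n ltac:(lia)). specialize (A n ltac:(lia)).
      apply Rmult_eq_reg_l with (2 * INR (S n) - INR K); [|lra]. rewrite (S_INR K).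
      replace ((2 * INR (S n) - INR K) * ((2 * INR (S n) - (INR K + 1)) * (2 * ctail (S K) (S n) - ctail K n)))
        with (2 * (2 * INR (S n) - INR K - 1) * ((2 * INR (S n) - INR K) * ctail (S K) (S n)) - (2 * INR (S n) - INR K) * (2 * INR (S n) - INR K - 1) * ctail K n) by ring.
      rewrite IH2. replace (4 * INR (S n) * (INR (S n) - INR K) * ctail K (S n)) with (2 * INR (S n) * (2 * (INR (S n) - INR K) * ctail K (S n))) by ring.
      rewrite <- IH1. ring.
    + intros n Hn. pose proof (IH1 n ltac:(lia)) as I1. pose proof (IH1 (S n) ltac:(lia)) as I2. specialize (IH2 n ltac:(lia)). specialize (A n ltac:(lia)).
      apply Rmult_eq_reg_l with (2 * INR (S n) - INR K); [|lra]. rewrite (S_INR K), (S_INR n) in *.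
      replace ((2 * (INR n + 1) - INR K) * ((2 * (INR n + 1) - (INR K + 1)) * (2 * (INR n + 1) - (INR K + 1) - 1) * ctail (S K) n))
        with ((2 * (INR n + 1) - INR K) * (2 * (INR n + 1) - INR K - 1) * ((2 * INR n - INR K) * ctail (S K) n)) by ring.
      rewrite I1.
      replace ((2 * (INR n + 1) - INR K) * (2 * (INR n + 1) - INR K - 1) * (2 * (INR n - INR K) * ctail K n))
        with (2 * (INR n - INR K) * ((2 * (INR n + 1) - INR K) * (2 * (INR n + 1) - INR K - 1) * ctail K n)) by ring.
      rewrite IH2.
      replace ((2 * (INR n + 1) - INR K) * (4 * (INR n + 1) * (INR n + 1 - (INR K + 1)) * ctail (S K) (S n)))
        with (4 * (INR n + 1) * (INR n - INR K) * ((2 * (INR n + 1) - INR K) * ctail (S K) (S n))) by ring.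
      rewrite I2. ring.
Qed.

Lemma ctail_step K n : (K <= n)%nat -> (1 <= n)%nat -> ctail (S K) n = 2 * (INR n - INR K) / (2 * INR n - INR K) * ctail K n.
Proof.
  intros HK Hn. pose proof (proj1 (ctail_rec K) n HK) as H. apply le_INR in HK. apply (le_INR 1) in Hn. simpl (INR 1) in Hn.
  apply Rmult_eq_reg_l with (2 * INR n - INR K); [|lra]. rewrite H. field. lra.
Qed.

(** The ratio in [ctail_step] is 1 - j / (2n - j) <= exp(-j / (2n)), and the exponents for j < K add
    up to K (K-1) / (4n). The lower bound below replaces n by n - M. *)
Lemma ctail_upper K n : (K <= n)%nat -> (1 <= n)%nat -> 0 <= ctail K n <= gseq n * exp (- (INR K * (INR K - 1) / (4 * INR n))).
Proof.
  intros HK Hn. pose proof (gseq_pos n) as Hg. assert (Hn0 : 1 <= INR n) by (apply (le_INR 1) in Hn; exact Hn).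
  induction K as [|K IH].
  - rewrite ctail_0. simpl (INR 0). replace (- (0 * (0 - 1) / (4 * INR n))) with 0 by (field; lra). rewrite exp_0. lra.
  - specialize (IH ltac:(lia)). rewrite ctail_step by lia. apply le_INR in HK. rewrite S_INR in *. pose proof (pos_INR K).
    assert (Hr : 0 <= 2 * (INR n - INR K) / (2 * INR n - INR K) <= exp (- (INR K / (2 * INR n)))).
    { split; [pos|].
      apply Rle_trans with (1 + - (INR K / (2 * INR n))); [|apply exp_ineq1_le].
      replace (2 * (INR n - INR K) / (2 * INR n - INR K)) with (1 - INR K / (2 * INR n - INR K)) by (field; lra).
      assert (INR K / (2 * INR n) <= INR K / (2 * INR n - INR K)); [|lra].
      apply Rmult_le_compat_l; [lra|]. apply Rinv_le_contravar; lra. }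
    split; [pos|].
    replace (- ((INR K + 1) * (INR K + 1 - 1) / (4 * INR n))) with (- (INR K / (2 * INR n)) + - (INR K * (INR K - 1) / (4 * INR n))) by (field; lra).
    rewrite exp_plus. apply Rle_trans with (exp (- (INR K / (2 * INR n))) * (gseq n * exp (- (INR K * (INR K - 1) / (4 * INR n))))).
    + apply Rmult_le_compat; lra.
    + apply Req_le. ring.
Qed.

Lemma ctail_lower K M n : (K <= M)%nat -> (M < n)%nat ->
  gseq n * exp (- (INR K * (INR K - 1) / (4 * (INR n - INR M)))) <= ctail K n.
Proof.
  intros HK Hn. pose proof (gseq_pos n) as Hg. assert (Hn0 : INR M + 1 <= INR n) by (rewrite <- S_INR; apply le_INR; lia).
  pose proof (pos_INR M) as HM0.
  induction K as [|K IH].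
  - rewrite ctail_0. simpl (INR 0). replace (- (0 * (0 - 1) / (4 * (INR n - INR M)))) with 0 by (field; lra). rewrite exp_0. lra.
  - specialize (IH ltac:(lia)). rewrite ctail_step by lia. apply le_INR in HK. rewrite S_INR in *. pose proof (pos_INR K).
    assert (Hr : exp (- (INR K / (2 * (INR n - INR M)))) <= 2 * (INR n - INR K) / (2 * INR n - INR K)).
    { rewrite exp_Ropp. replace (2 * (INR n - INR K) / (2 * INR n - INR K)) with (/ (1 + INR K / (2 * (INR n - INR K)))) by (field; lra).
      assert (0 <= INR K / (2 * (INR n - INR K))) by pos.
      apply Rinv_le_contravar; [lra|]. apply Rle_trans with (1 + INR K / (2 * (INR n - INR M))); [|apply exp_ineq1_le].
      apply Rplus_le_compat_l, Rmult_le_compat_l; [lra|]. apply Rinv_le_contravar; lra. }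
    replace (- ((INR K + 1) * (INR K + 1 - 1) / (4 * (INR n - INR M)))) with (- (INR K / (2 * (INR n - INR M))) + - (INR K * (INR K - 1) / (4 * (INR n - INR M)))) by (field; lra).
    rewrite exp_plus. apply Rle_trans with (exp (- (INR K / (2 * (INR n - INR M)))) * (gseq n * exp (- (INR K * (INR K - 1) / (4 * (INR n - INR M)))))).
    + apply Req_le. ring.
    + apply Rmult_le_compat; [apply Rlt_le, exp_pos|pos|exact Hr|exact IH].
Qed.

(** The exponent K (K+1) / (4n) tends to pi y^2 / 4, because pi n gseq^2 tends to 1. *)
Lemma ctail_lim (K : nat -> nat) (y : R) : is_lim_seq (fun n => INR (K n) * gseq n) y ->
  is_lim_seq (fun n => ctail (S (K n)) n / gseq n) (exp (- (PI * y ^ 2 / 4))).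
Proof.
  intros HK. pose proof PI_RGT_0 as Hpi.
  assert (Hc : continuity_pt (fun x => exp (- x)) (PI * y ^ 2 / 4)).
  { apply derivable_continuous_pt. exists (- exp (- (PI * y ^ 2 / 4))). apply is_derive_Reals. auto_derive; [trivial|ring]. }
  assert (HKn : is_lim_seq (fun n => INR (K n) / INR n) 0).
  { apply (is_lim_seq_ext_loc (fun n => PI * (INR (K n) * gseq n) * gseq n * / (PI * INR n * gseq n ^ 2))).
    - exists 1%nat. intros n Hn. apply lt_0_INR in Hn. pose proof (gseq_pos n). field. lra.
    - replace 0 with (PI * y * 0 * / 1) by field. apply is_lim_seq_mult'.
      + lims.
      + apply (is_lim_seq_inv _ 1); [apply gseq_sqr_lim|]. intros H; injection H; lra. }
  assert (HKK : is_lim_seq (fun n => INR (S (K n)) * INR (K n) / (4 * INR n)) (PI * y ^ 2 / 4)).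
  { apply (is_lim_seq_ext_loc (fun n => PI * (INR (K n) * gseq n) * (INR (K n) * gseq n + gseq n) * / (PI * INR n * gseq n ^ 2) * / 4)).
    - exists 1%nat. intros n Hn. apply lt_0_INR in Hn. pose proof (gseq_pos n). rewrite S_INR. field. lra.
    - replace (Finite (PI * y ^ 2 / 4)) with (Finite (PI * y * (y + 0) * / 1 * / 4)) by (f_equal; field).
      apply is_lim_seq_mult'; [|apply is_lim_seq_const]. apply is_lim_seq_mult'.
      + lims.
      + apply (is_lim_seq_inv _ 1); [apply gseq_sqr_lim|]. intros H; injection H; lra. }
  assert (Hin : is_lim_seq (fun n => / INR n) 0).
  { apply (is_lim_seq_inv INR p_infty); [apply is_lim_seq_INR|discriminate]. }
  assert (HKM : is_lim_seq (fun n => INR (S (K n)) * INR (K n) / (4 * (INR n - INR (S (K n))))) (PI * y ^ 2 / 4)).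
  { assert (Hr : is_lim_seq (fun n => 1 - (INR (K n) / INR n + / INR n)) 1).
    { replace (Finite 1) with (Finite (1 - (0 + 0))) by (f_equal; ring).
      lims. }
    apply (is_lim_seq_ext_loc (fun n => INR (S (K n)) * INR (K n) / (4 * INR n) * / (1 - (INR (K n) / INR n + / INR n)))).
    - destruct (lim_eps _ _ (1/2) Hr ltac:(lra)) as [N HN]. exists (S N). intros n Hn. specialize (HN n ltac:(lia)).
      apply Rabs_le_between in HN. assert (Hn0 : 0 < INR n) by (apply lt_0_INR; lia). rewrite S_INR.
      assert (E : INR n - (INR (K n) + 1) = INR n * (1 - (INR (K n) / INR n + / INR n))) by (field; lra).
      assert (0 < INR n - (INR (K n) + 1)) by (rewrite E; pos).
      field. split; lra.
    - replace (Finite (PI * y ^ 2 / 4)) with (Finite (PI * y ^ 2 / 4 * / 1)) by (f_equal; field).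
      apply is_lim_seq_mult'; [exact HKK|]. apply (is_lim_seq_inv _ 1); [exact Hr|]. intros H; injection H; lra. }
  assert (HL1 := is_lim_seq_continuous (fun x => exp (- x)) _ _ Hc HKK).
  assert (HL2 := is_lim_seq_continuous (fun x => exp (- x)) _ _ Hc HKM). cbv beta in HL1, HL2.
  refine (is_lim_seq_le_le_loc _ _ _ _ _ HL2 HL1).
  destruct (lim_eps _ _ (1/2) HKn ltac:(lra)) as [N HN]. exists (N + 5)%nat. intros n Hn. specialize (HN n ltac:(lia)).
  apply Rabs_le_between in HN. assert (Hn0 : 0 < INR n) by (apply lt_0_INR; lia).
  assert (HKle : (S (K n) < n)%nat).
  { apply INR_lt. rewrite S_INR. assert (INR (K n) <= 1 / 2 * INR n) by (apply Rle_div_l; lra).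
    assert (5 <= INR n) by (replace 5 with (INR 5) by (simpl; ring); apply le_INR; lia). lra. }
  pose proof (gseq_pos n) as Hg.
  pose proof (ctail_upper (S (K n)) n ltac:(lia) ltac:(lia)) as [_ HU]. pose proof (ctail_lower (S (K n)) (S (K n)) n (le_n _) HKle) as HLo.
  replace (INR (S (K n)) - 1) with (INR (K n)) in * by (rewrite S_INR; ring).
  split; [apply Rle_div_r; lra|apply Rle_div_l; lra].
Qed.

Lemma canon_cdf_lim (K : nat -> nat) (y : R) : is_lim_seq (fun n => INR (K n) * gseq n) y ->
  is_lim_seq (fun n => expect seq1 canon n (leind (K n))) (1 - exp (- (PI * y ^ 2 / 4))).
Proof.
  intros HK. apply (is_lim_seq_ext (fun n => 1 - ctail (S (K n)) n / gseq n)).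
  - intros n. rewrite expect_leind, counttot_geom by apply canon_0. rewrite geom_canon.
    replace (conv seq1 gseq) with gseq by ring. fold (ctail (S (K n))). pose proof (gseq_pos n). field. lra.
  - apply is_lim_seq_minus'; [apply is_lim_seq_const|apply ctail_lim, HK].
Qed.

Lemma floor_scale_lim (y : R) : 0 <= y -> exists K : nat -> nat, is_lim_seq (fun n => INR (K n) * gseq n) y.
Proof.
  intros Hy. assert (Hp : forall n, 0 <= y / gseq n).
  { intros n. pose proof (gseq_pos n). pos. }
  exists (fun n => nfloor (y / gseq n) (Hp n)).
  apply (is_lim_seq_le_le (fun n => y - gseq n) _ (fun _ => y)).
  - intros n. pose proof (gseq_pos n). unfold nfloor. destruct nfloor_ex as [k [H1 H2]]. simpl.
    apply Rle_div_r in H1; [|lra]. apply Rlt_div_l in H2; [|lra]. lra.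
  - replace (Finite y) with (Finite (y - 0)) by (f_equal; ring). lims.
  - apply is_lim_seq_const.
Qed.

(** [cdf_compare] asks for strictly separated scales, so the distribution function is squeezed
    between those of the explicit model at y - del and y + del; the continuity of the limit closes
    the gap. *)
Lemma rayleigh_limit e f eta (K : nat -> nat) (y : R) : critical e f eta ->
  is_lim_seq (fun n => INR (K n) * gseq n) (y / eta) ->
  is_lim_seq (fun n => expect e f n (leind (K n))) (1 - exp (- (PI * y ^ 2 / 4))).
Proof.
  intros HC HK. pose proof (critical_eta _ _ _ HC) as He.
  assert (Hy : 0 <= y).
  { assert (0 <= y / eta) by (apply (is_lim_seq_le (fun _ => 0) _ 0 (y / eta)) with (2 := is_lim_seq_const 0) (3 := HK);
      intros n; apply Rmult_le_pos; [apply pos_INR|apply Rlt_le, gseq_pos]).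
    replace y with (y / eta * eta) by (field; lra). pos. }
  set (G := fun y => 1 - exp (- (PI * y ^ 2 / 4))).
  assert (HG : continuity_pt G y).
  { apply continuity_pt_filterlim, (ex_derive_continuous G). unfold G. auto_derive. trivial. }
  change (is_lim_seq (fun n => expect e f n (leind (K n))) (G y)).
  assert (Hd : forall eps, 0 < eps -> exists del, 0 < del /\ forall y', Rabs (y' - y) <= del -> Rabs (G y' - G y) < eps).
  { intros eps Heps. destruct (HG eps Heps) as (al & Ha & H). exists (al / 2). split; [lra|]. intros y' Hy'.
    destruct (Req_dec y' y) as [->|Hne]; [rewrite Rminus_diag, Rabs_R0; exact Heps|].
    apply H. split; [split; [exact I|congruence]|]. simpl. unfold R_dist. lra. }
  apply is_lim_seq_spec. intros [eps Heps]. simpl.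
  destruct (Hd (eps / 4) ltac:(lra)) as (del & Hdel & HGd).
  destruct (floor_scale_lim (y + del) ltac:(lra)) as [K1 HK1].
  destruct (cdf_compare _ _ _ _ _ _ K K1 _ _ (eps / 4) HC canon_critical HK HK1) as [N1 HN1]; [field_simplify; lra|lra|].
  destruct (lim_eps _ _ (eps / 4) (canon_cdf_lim K1 _ HK1) ltac:(lra)) as [N2 HN2].
  pose proof (HGd (y + del) ltac:(replace (y + del - y) with del by ring; rewrite Rabs_pos_eq; lra)) as HG1.
  destruct (critical_tot _ _ _ HC) as [N0 HN0].
  assert (HL : exists N3, forall n, (N3 <= n)%nat -> G y - eps < expect e f n (leind (K n))).
  (* For y <= del the point y - del is not a positive scale, but then the limit at y is below eps /
     4 and nonnegativity suffices. *)
  { destruct (Rle_lt_dec y del) as [Hs|Hs].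
    - exists N0. intros n Hn. specialize (HN0 n Hn).
      assert (0 <= expect e f n (leind (K n))).
      { apply Rle_trans with (expect e f n (fun _ => 0)); [unfold expect; rewrite sum_zero; [lra|intros; ring]|].
        apply (critical_mono _ _ eta); [assumption..|]. intros k _. unfold leind. destruct le_dec; lra. }
      pose proof (HGd 0 ltac:(rewrite Rminus_0_l, Rabs_Ropp, Rabs_pos_eq; lra)) as HG0.
      unfold G at 1 in HG0. replace (- (PI * 0 ^ 2 / 4)) with 0 in HG0 by field. rewrite exp_0 in HG0. apply Rabs_def2 in HG0. lra.
    - destruct (floor_scale_lim (y - del) ltac:(lra)) as [K2 HK2].
      destruct (cdf_compare _ _ _ _ _ _ K2 K _ _ (eps / 4) canon_critical HC HK2 HK) as [N3 HN3]; [field_simplify; lra|lra|].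
      destruct (lim_eps _ _ (eps / 4) (canon_cdf_lim K2 _ HK2) ltac:(lra)) as [N4 HN4].
      pose proof (HGd (y - del) ltac:(replace (y - del - y) with (- del) by ring; rewrite Rabs_Ropp, Rabs_pos_eq; lra)) as HG2.
      exists (N3 + N4)%nat. intros n Hn. specialize (HN3 n ltac:(lia)). specialize (HN4 n ltac:(lia)).
      fold (G (y - del)) in HN4. apply Rabs_le_between in HN4. apply Rabs_def2 in HG2. lra. }
  destruct HL as [N3 HN3]. exists (N1 + N2 + N3)%nat. intros n Hn.
  specialize (HN1 n ltac:(lia)). specialize (HN2 n ltac:(lia)). specialize (HN3 n ltac:(lia)).
  fold (G (y + del)) in HN2. apply Rabs_le_between in HN2. apply Rabs_def2 in HG1. apply Rabs_def1; lra.
Qed.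

(** * The mean in the critical case *)

Lemma sum_INR_abel a N : sum_f_R0 (fun k => INR k * a k) N + sum_f_R0 (sum_f_R0 a) N = INR (S N) * sum_f_R0 a N.
Proof.
  induction N as [|N IH]; [simpl; ring|]. rewrite !(tech5 _ N) in *.
  rewrite (S_INR (S N)). lra.
Qed.

(** The first binomial moment is the mean of X_n + 1; it is reached by Abel summation of the partial
    sums given by [countw_head]. *)
Lemma expect_INR e f n : f O = 0 -> counttot e f n <> 0 -> expect e f n INR = fmom e f 1 n - 1.
Proof.
  intros Hf Ht. set (x := conv e (geom f)).
  assert (Et : counttot e f = x) by (apply counttot_geom, Hf).
  assert (H : sum_f_R0 (fun k => INR k * countw e f n k) n = conv x (geom f) n - x n).
  { pose proof (sum_INR_abel (countw e f n) n) as A.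
    assert (B : sum_f_R0 (sum_f_R0 (countw e f n)) n = INR (S n) * x n - (counttot x f n - x n)).
    { rewrite (sum_eq _ (fun K => x n - countw x f n (S K))).
      - rewrite minus_sum, sum_cte. unfold counttot. 
        assert (C : sum_f_R0 (countw x f n) (S n) = countw x f n 0 + sum_f_R0 (fun K => countw x f n (S K)) n) by (apply decomp_sum; lia).
        rewrite tech5, (countw_vanish x f n (S n)) in C by (assumption || lia).
        assert (D : countw x f n 0 = x n) by (unfold countw; simpl; apply (f_equal (fun a => a n)); ring). lra.
      - intros K _. rewrite countw_head by exact Hf. fold x. unfold countw. f_equal. apply (f_equal (fun a => a n)). ring. }
    assert (Es : sum_f_R0 (countw e f n) n = x n) by (rewrite <- Et; reflexivity).
    rewrite B, Es, counttot_geom in A by exact Hf. lra. }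
  unfold expect. rewrite (sum_eq _ (fun k => INR k * countw e f n k * / counttot e f n)) by (intros; unfold Rdiv; ring).
  rewrite <- scal_sum, H, Et. rewrite Et in Ht. unfold fmom. fold x. simpl seqpow.
  replace (conv e (conv (geom f) (conv (geom f) seq1))) with (conv x (geom f)) by (unfold x; ring). field. exact Ht.
Qed.

Lemma mean_limit e f eta : critical e f eta -> is_lim_seq (fun n => expect e f n INR * gseq n) (/ eta).
Proof.
  intros HC. pose proof (critical_eta _ _ _ HC) as He. destruct (critical_tot _ _ _ HC) as [N HN].
  destruct HC as (ae & H1 & H2 & H3 & H4 & H5 & H6 & H7 & H8).
  pose proof (fmom_lim e f ae eta H1 H2 H3 H4 H5 H6 H7 H8 1) as HM. simpl (raymom 1) in HM.
  apply (is_lim_seq_ext_loc (fun n => fmom e f 1 n * gseq n ^ 1 - gseq n)).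
  - exists N. intros n Hn. specialize (HN n Hn). rewrite expect_INR by (exact H6 || lra). ring.
  - replace (Finite (/ eta)) with (Finite (1 * (/ eta) ^ 1 - 0)) by (f_equal; ring).
    lims.
Qed.

(** * The normal distribution *)

Definition gdens (t : R) : R := exp (- t ^ 2 / 2) / sqrt (2 * PI).

Lemma sqrt_2PI_gt_1 : 1 < sqrt (2 * PI).
Proof.
  pose proof PI2_3_2 as H. rewrite <- sqrt_1 at 1. apply sqrt_lt_1; lra.
Qed.

Lemma gdens_cont x : continuous gdens x.
Proof. apply (ex_derive_continuous gdens). unfold gdens. auto_derive. pose proof sqrt_2PI_gt_1. lra. Qed.

Lemma ex_RInt_gdens a b : ex_RInt gdens a b.
Proof. apply (ex_RInt_continuous (V := R_CompleteNormedModule)). intros; apply gdens_cont. Qed.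

Lemma gdens_pos x : 0 < gdens x.
Proof. pose proof sqrt_2PI_gt_1. pos. Qed.

Lemma gdens_even x : gdens (- x) = gdens x.
Proof. unfold gdens. do 3 f_equal. field. Qed.

Lemma gdens_RInt_neg x : RInt gdens 0 (- x) = - RInt gdens 0 x.
Proof.
  apply is_RInt_unique.
  assert (H : is_RInt gdens (- 0) (- x) (- RInt gdens 0 x)).
  { apply (is_RInt_ext (fun y => gdens y)); [reflexivity|].
    pose proof (RInt_correct (V := R_CompleteNormedModule) gdens 0 x (ex_RInt_gdens 0 x)) as H.
    assert (H2 : is_RInt (fun y => - gdens (- y)) (- 0) (- x) (RInt gdens 0 x)).
    { apply (is_RInt_comp_opp (V := R_NormedModule) gdens (- 0) (- x)). rewrite !Ropp_involutive. exact H. }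
    apply (is_RInt_opp (V := R_NormedModule)) in H2. revert H2. apply is_RInt_ext. intros y _. unfold opp. simpl.
    rewrite Ropp_involutive. apply gdens_even. }
  rewrite Ropp_0 in H. exact H.
Qed.

Lemma gdens_half_lim eps : 0 < eps -> exists A0, 0 < A0 /\ forall A, A0 <= A -> Rabs (RInt gdens 0 A - 1 / 2) <= eps.
Proof.
  intros He. destruct gaussint_lim as (J & K & HJ & HK & H).
  pose proof (gaussint_limit_value J K HJ HK H) as HJv. rewrite HJv in H. pose proof sqrt_2PI_gt_1 as H1.
  exists (1 + K / eps). assert (Hq : 0 < K / eps) by pos. split; [lra|].
  intros A HA. specialize (H A ltac:(lra)).
  assert (E : gaussint A = 2 * RInt gdens 0 A * sqrt (2 * PI)).
  { unfold gaussint.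
    rewrite (RInt_ext _ (fun x => scal (sqrt (2 * PI)) (gdens x))) by (intros; unfold scal, gdens; simpl; unfold mult; simpl; field; lra).
    rewrite (RInt_scal (V := R_CompleteNormedModule)) by apply ex_RInt_gdens. unfold scal; simpl; unfold mult; simpl.
    rewrite <- (RInt_Chasles (V := R_CompleteNormedModule) gdens (- A) 0 A) by apply ex_RInt_gdens.
    rewrite <- (opp_RInt_swap (V := R_CompleteNormedModule)) by apply ex_RInt_gdens.
    rewrite gdens_RInt_neg. unfold plus, opp. simpl. ring. }
  rewrite E in H. replace (2 * RInt gdens 0 A * sqrt (2 * PI) - sqrt (2 * PI)) with (2 * sqrt (2 * PI) * (RInt gdens 0 A - 1 / 2)) in H by field.
  rewrite Rabs_mult, (Rabs_pos_eq (2 * sqrt (2 * PI))) in H by lra. pose proof (Rabs_pos (RInt gdens 0 A - 1 / 2)) as Hp.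
  assert (HK2 : K / A ^ 2 <= eps).
  { apply Rle_div_l; [pos|]. assert (K = eps * (K / eps)) by (field; lra). assert (K / eps <= A ^ 2) by nra. nra. }
  nra.
Qed.

(** Rewriting the improper integral around 0 makes [Phi] differentiable. The mass 1/2 of the
    half-line rests on the value sqrt(2 pi) of the Gaussian integral. *)
Lemma Phi_RInt x : Phi x = 1 / 2 + RInt gdens 0 x.
Proof.
  unfold Phi. apply (is_RInt_gen_unique (V := R_CompleteNormedModule) (FFa := Proper_StrongProper _ (Rbar_locally_filter m_infty)) (FFb := Proper_StrongProper _ (at_point_filter x))).
  intros P [eps HP]. destruct (gdens_half_lim (eps / 2) ltac:(destruct eps; simpl; lra)) as (A0 & HA0 & HA).
  apply (Filter_prod _ _ _ (fun a => a < - A0) (fun b => b = x)).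
  - exists (- A0). auto.
  - reflexivity.
  - intros a b Ha ->. simpl. exists (RInt gdens a x). split.
    + apply (RInt_correct (V := R_CompleteNormedModule) gdens a x), ex_RInt_gdens.
    + apply HP. unfold ball. simpl. unfold AbsRing_ball, abs, minus, plus, opp. simpl.
      rewrite <- (RInt_Chasles (V := R_CompleteNormedModule) gdens a 0 x) by apply ex_RInt_gdens.
      rewrite <- (opp_RInt_swap (V := R_CompleteNormedModule)) by apply ex_RInt_gdens.
      replace a with (- - a) by ring. rewrite gdens_RInt_neg. unfold plus, opp. simpl.
      specialize (HA (- a) ltac:(lra)).
      match goal with |- Rabs ?t < _ => replace t with (RInt gdens 0 (- a) - 1 / 2) by (set (u := RInt gdens 0 (- a)); field) end.
      destruct eps as [eps Heps]; simpl in *; lra.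
Qed.

Lemma Phi_derive x : is_derive Phi x (gdens x).
Proof.
  apply (is_derive_ext (fun x => 1 / 2 + RInt gdens 0 x)); [intros t; symmetry; apply Phi_RInt|].
  assert (H : is_derive (fun x => RInt gdens 0 x) x (gdens x)).
  { apply (is_derive_RInt (V := R_NormedModule) gdens _ 0 x); [|apply gdens_cont].
    apply filter_forall. intros b. apply (RInt_correct (V := R_CompleteNormedModule)), ex_RInt_gdens. }
  evar_last; [apply (is_derive_plus (fun _ => 1 / 2) (fun x => RInt gdens 0 x) x 0 (gdens x)); [exact (is_derive_const (1 / 2) x)|exact H]|].
  unfold plus; simpl. ring.
Qed.

Lemma Phi_neg x : Phi (- x) = 1 - Phi x.
Proof. rewrite !Phi_RInt, gdens_RInt_neg. field. Qed.

Lemma Phi_le x y : x <= y -> Phi x <= Phi y.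
Proof.
  intros H. destruct (MVT_gen Phi x y gdens) as (c & _ & Hc).
  - intros; apply Phi_derive.
  - intros; apply continuity_pt_filterlim, (ex_derive_continuous Phi). eexists. apply Phi_derive.
  - pose proof (gdens_pos c). assert (0 <= gdens c * (y - x)) by pos. lra.
Qed.

Lemma Phi_tail eps : 0 < eps -> exists A0, 0 < A0 /\ forall A, A0 <= A -> Phi (- A) <= eps.
Proof.
  intros He. destruct (gdens_half_lim eps He) as (A0 & H0 & H). exists A0. split; [exact H0|]. intros A HA.
  specialize (H A HA). apply Rabs_le_between in H. rewrite Phi_RInt, gdens_RInt_neg. lra.
Qed.

Lemma Phi_bounds x : 0 <= Phi x <= 1.
Proof.
  assert (H : forall y, 0 <= Phi y).
  { intros y. apply le_epsilon. intros eps He. destruct (Phi_tail eps He) as (A & HA & _).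
    destruct (gdens_half_lim eps He) as (A0 & HA0 & H). set (B := Rmax A0 (- y)).
    pose proof (Rmax_l A0 (- y)). pose proof (Rmax_r A0 (- y)). fold B in H0, H1. specialize (H B H0). apply Rabs_le_between in H.
    pose proof (Phi_le (- B) y ltac:(lra)) as H2. rewrite (Phi_RInt (- B)), gdens_RInt_neg in H2. lra. }
  split; [apply H|]. pose proof (H (- x)). rewrite Phi_neg in H0. lra.
Qed.

Lemma gdens_derive x : is_derive gdens x (- x * gdens x).
Proof. unfold gdens. pose proof sqrt_2PI_gt_1. auto_derive; [lra|]. replace (x * (x * 1)) with (x ^ 2) by ring. unfold Rdiv. field. lra. Qed.

Lemma gdens_bound x : (1 + x ^ 2 / 2 + x ^ 4 / 8) * gdens x <= 1.
Proof.
  pose proof sqrt_2PI_gt_1 as H1. unfold gdens. set (z := x ^ 2 / 2). replace (- x ^ 2 / 2) with (- z) by (unfold z; field).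
  assert (Hz : 0 <= z) by (unfold z; nra). replace (x ^ 4 / 8) with (z ^ 2 / 2) by (unfold z; field).
  assert (He : 1 + z + z ^ 2 / 2 <= exp z).
  { pose proof (nonneg_of_derive (fun z => exp z - (1 + z + z ^ 2 / 2)) (fun z => exp z - (1 + z))) as N.
    cut (0 <= exp z - (1 + z + z ^ 2 / 2)); [lra|]. apply N.
    - rewrite exp_0. lra.
    - intros t _. auto_derive; [trivial|field].
    - intros t Ht. pose proof (exp_ineq1_le t). lra.
    - exact Hz. }
  rewrite exp_Ropp. pose proof (exp_pos z).
  apply Rle_trans with ((1 + z + z ^ 2 / 2) * / exp z).
  - apply Rmult_le_compat_l; [nra|]. unfold Rdiv. rewrite <- (Rmult_1_r (/ exp z)) at 2.
    apply Rmult_le_compat_l; [pos|]. rewrite <- Rinv_1. apply Rinv_le_contravar; lra.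
  - apply Rle_div_l; lra.
Qed.

(** The third derivative (x^2 - 1) [gdens x] is at most 3 in absolute value. Three uses of the mean
    value theorem carry this constant through, giving up the factor 1/6. *)
Lemma Phi_taylor w h : Rabs (Phi (w + h) - (Phi w + gdens w * h - w * gdens w * h ^ 2 / 2)) <= 3 * Rabs h ^ 3.
Proof.
  set (R2 := fun h => (w + h) * gdens (w + h) - w * gdens w).
  set (R1 := fun h => gdens (w + h) - gdens w + w * gdens w * h).
  set (R0 := fun h => Phi (w + h) - (Phi w + gdens w * h - w * gdens w * h ^ 2 / 2)).
  assert (Dg : forall h, is_derive (fun h => gdens (w + h)) h (- (w + h) * gdens (w + h))).
  { intros t. pose proof (gdens_derive (w + t)) as H. evar_last.
    - apply (is_derive_comp gdens (fun h => w + h) t); [exact H|]. auto_derive; [trivial|reflexivity].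
    - unfold scal; simpl; unfold mult; simpl. ring. }
  assert (DP : forall h, is_derive (fun h => Phi (w + h)) h (gdens (w + h))).
  { intros t. pose proof (Phi_derive (w + t)) as H. evar_last.
    - apply (is_derive_comp Phi (fun h => w + h) t); [exact H|]. auto_derive; [trivial|reflexivity].
    - unfold scal; simpl; unfold mult; simpl. ring. }
  assert (D2 : forall h, is_derive R2 h ((1 - (w + h) ^ 2) * gdens (w + h))).
  { intros t. unfold R2. auto_derive; [exists (- (w + t) * gdens (w + t)); exact (gdens_derive (w + t))|].
    replace (Derive (fun x => gdens x) (w + t)) with (- (w + t) * gdens (w + t)) by (symmetry; apply is_derive_unique, gdens_derive). ring. }
  assert (D1 : forall h, is_derive R1 h (- R2 h)).
  { intros t. unfold R1, R2. auto_derive; [exists (- (w + t) * gdens (w + t)); exact (gdens_derive (w + t))|].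
    replace (Derive (fun x => gdens x) (w + t)) with (- (w + t) * gdens (w + t)) by (symmetry; apply is_derive_unique, gdens_derive). ring. }
  assert (D0 : forall h, is_derive R0 h (R1 h)).
  { intros t. unfold R0, R1. auto_derive; [exists (gdens (w + t)); exact (Phi_derive (w + t))|].
    replace (Derive (fun x => Phi x) (w + t)) with (gdens (w + t)) by (symmetry; apply is_derive_unique, Phi_derive). field. }
  assert (M : forall (F G : R -> R), (forall h, is_derive F h (G h)) -> F 0 = 0 -> forall C k, 0 <= C -> (forall h, Rabs (G h) <= C * Rabs h ^ k) ->
     forall h, Rabs (F h) <= C * Rabs h ^ S k).
  { intros F G HD H0 C k HC HG t. destruct (MVT_gen F 0 t G) as (c & Hc & E).
    - intros; apply HD.
    - intros; apply continuity_pt_filterlim, (ex_derive_continuous F). eexists. apply HD.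
    - rewrite H0, !Rminus_0_r in E. rewrite E, Rabs_mult. simpl.
      assert (Hct : Rabs c <= Rabs t) by (revert Hc; unfold Rmin, Rmax, Rabs; destruct Rle_dec; repeat destruct Rcase_abs; lra).
      apply Rle_trans with (C * Rabs t ^ k * Rabs t); [|apply Req_le; ring].
      apply Rmult_le_compat_r; [apply Rabs_pos|]. apply Rle_trans with (1 := HG c).
      apply Rmult_le_compat_l; [exact HC|]. apply pow_incr. split; [apply Rabs_pos|exact Hct]. }
  assert (B2 : forall h, Rabs (R2 h) <= 3 * Rabs h ^ 1).
  { apply (M R2 _ D2); [unfold R2; rewrite Rplus_0_r; ring|lra|]. intros t. simpl pow at 2. rewrite Rmult_1_r.
    pose proof (gdens_bound (w + t)). pose proof (gdens_pos (w + t)). set (x := w + t) in *.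
    assert (x ^ 2 * gdens x <= 2).
    { assert (0 <= x ^ 4 * gdens x) by (apply Rmult_le_pos; [replace (x ^ 4) with ((x ^ 2) ^ 2) by ring; apply pow2_ge_0|lra]). lra. }
    assert (gdens x <= 1).
    { assert (0 <= (x ^ 2 / 2 + x ^ 4 / 8) * gdens x); [|lra].
      apply Rmult_le_pos; [|lra]. replace (x ^ 4) with ((x ^ 2) ^ 2) by ring. pose proof (pow2_ge_0 x). nra. }
    assert (0 <= x ^ 2 * gdens x) by (apply Rmult_le_pos; [apply pow2_ge_0|lra]).
    apply Rabs_le. lra. }
  assert (B1 : forall h, Rabs (R1 h) <= 3 * Rabs h ^ 2).
  { apply (M R1 _ D1); [unfold R1; rewrite Rplus_0_r; ring|lra|]. intros t. rewrite Rabs_Ropp. apply B2. }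
  apply (M R0 _ D0); [unfold R0; rewrite Rplus_0_r; field|lra|exact B1].
Qed.

(* [Phi (x / sqrt v)] solves the heat equation; this is its first-order expansion in [v]. *)
Lemma Phi_heat x v a : 0 < v -> 0 <= a ->
  Rabs (Phi (x / sqrt (v + a)) - (Phi (x / sqrt v) - x / sqrt v * gdens (x / sqrt v) * a / (2 * v))) <= 4 * a ^ 2 / v ^ 2.
Proof.
  intros Hv Ha.
  set (W := fun v => x / sqrt v). set (F1 := fun v => - (W v * gdens (W v) / (2 * v))).
  set (F2 := fun v => (3 * W v - W v ^ 3) * gdens (W v) / (4 * v ^ 2)).
  assert (DW : forall v, 0 < v -> is_derive W v (- W v / (2 * v))).
  { intros u Hu. unfold W. pose proof (sqrt_lt_R0 u Hu). auto_derive; [split; [lra|]; split; [lra|trivial]|].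
    rewrite <- (sqrt_sqrt u) at 5 by lra. field. lra. }
  assert (DF : forall v, 0 < v -> is_derive (fun v => Phi (W v)) v (F1 v)).
  { intros u Hu. evar_last; [apply (is_derive_comp Phi W u); [apply Phi_derive|apply DW, Hu]|].
    unfold F1, scal; simpl; unfold mult; simpl. field. lra. }
  assert (Dg : forall v, 0 < v -> is_derive (fun v => gdens (W v)) v (W v ^ 2 * gdens (W v) / (2 * v))).
  { intros u Hu. evar_last; [apply (is_derive_comp gdens W u); [apply gdens_derive|apply DW, Hu]|].
    unfold scal; simpl; unfold mult; simpl. field. lra. }
  assert (DF1 : forall v, 0 < v -> is_derive F1 v (F2 v)).
  { intros u Hu. unfold F1, F2. auto_derive.
    - split; [exists (- W u / (2 * u)); exact (DW u Hu)|].
      split; [exists (- W u * gdens (W u)); exact (gdens_derive (W u))|].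
      split; [exists (- W u / (2 * u)); exact (DW u Hu)|]. split; [lra|trivial].
    - replace (Derive (fun x => W x) u) with (- W u / (2 * u)) by (symmetry; apply is_derive_unique, DW, Hu).
      replace (Derive (fun x => gdens x) (W u)) with (- W u * gdens (W u)) by (symmetry; apply is_derive_unique, gdens_derive).
      field. lra. }
  assert (BF2 : forall u, v <= u -> Rabs (F2 u) <= 4 / v ^ 2).
  { intros u Hu. unfold F2. set (w := W u). pose proof (gdens_bound w) as Hb. pose proof (gdens_pos w) as Hp.
    assert (H4 : Rabs ((3 * w - w ^ 3) * gdens w) <= 16).
    { rewrite Rabs_mult, (Rabs_pos_eq (gdens w)) by lra.
      assert (Rabs (3 * w - w ^ 3) <= 16 * (1 + w ^ 2 / 2 + w ^ 4 / 8)).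
      { apply Rabs_le. assert (0 <= (w ^ 2 - w) ^ 2) by apply pow2_ge_0. assert (0 <= (w ^ 2 + w) ^ 2) by apply pow2_ge_0.
        assert (0 <= (w - 1) ^ 2) by apply pow2_ge_0. assert (0 <= (w + 1) ^ 2) by apply pow2_ge_0. split; nra. }
      apply Rle_trans with (16 * (1 + w ^ 2 / 2 + w ^ 4 / 8) * gdens w); [apply Rmult_le_compat_r; lra|]. lra. }
    unfold Rdiv. rewrite Rabs_mult. assert (0 < u ^ 2) by pos. assert (0 < v ^ 2) by pos.
    rewrite (Rabs_pos_eq (/ (4 * u ^ 2))) by pos.
    apply Rle_trans with (16 * / (4 * u ^ 2)); [apply Rmult_le_compat_r; [pos|exact H4]|].
    apply Rle_trans with (4 * / u ^ 2); [apply Req_le; field; lra|].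
    apply Rmult_le_compat_l; [lra|]. apply Rinv_le_contravar; [lra|]. apply pow_incr. lra. }
  assert (Cont : forall (G G' : R -> R), (forall v, 0 < v -> is_derive G v (G' v)) -> forall u, 0 < u -> continuity_pt G u).
  { intros G G' HG u Hu. apply continuity_pt_filterlim, (ex_derive_continuous G). eexists. apply HG, Hu. }
  destruct (MVT_gen (fun v => Phi (W v)) v (v + a) F1) as (c & Hc & E).
  { rewrite Rmin_left by lra. intros; apply DF. lra. }
  { rewrite Rmin_left by lra. intros; apply (Cont _ _ DF). lra. }
  rewrite Rmin_left, Rmax_right in Hc by lra.
  destruct (MVT_gen F1 v c F2) as (c' & Hc' & E').
  { rewrite Rmin_left by lra. intros; apply DF1. lra. }
  { rewrite Rmin_left by lra. intros; apply (Cont _ _ DF1). lra. }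
  rewrite Rmin_left, Rmax_right in Hc' by lra.
  change (x / sqrt (v + a)) with (W (v + a)). change (x / sqrt v) with (W v).
  replace (Phi (W (v + a)) - (Phi (W v) - W v * gdens (W v) * a / (2 * v))) with (F2 c' * ((c - v) * a)).
  - rewrite Rabs_mult, (Rabs_pos_eq ((c - v) * a)) by pos. specialize (BF2 c' ltac:(lra)).
    assert (0 <= (c - v) * a <= a ^ 2) by nra. pose proof (Rabs_pos (F2 c')).
    replace (4 * a ^ 2 / v ^ 2) with (4 / v ^ 2 * a ^ 2) by (field; lra). apply Rmult_le_compat; lra.
  - replace (v + a - v) with a in E by ring.
    replace (Phi (W (v + a)) - (Phi (W v) - W v * gdens (W v) * a / (2 * v))) with ((Phi (W (v + a)) - Phi (W v)) - F1 v * a) by (unfold F1; field; lra).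
    rewrite E. transitivity ((F1 c - F1 v) * a); [rewrite E'; ring|ring].
Qed.

(** * Central limit theorem *)

Section CentralLimit.
Variables (f : nat -> R) (m s2 m3 : R).
Hypothesis f_nonneg : forall i, 0 <= f i.
Hypothesis f_sum : is_series f 1.
Hypothesis f_mean : is_series (fun i => f i * (m - INR i)) 0.
Hypothesis f_var : is_series (fun i => f i * (m - INR i) ^ 2) s2.
Hypothesis f_third : is_series (fun i => f i * Rabs (m - INR i) ^ 3) m3.
Hypothesis s2_pos : 0 < s2.

(** The mean of h(x - xi) for xi of law f. Thus [steps K h x] is the mean of h(x - S_K), and for the
    indicator of [0, infinity) it is P(S_K <= x). *)
Definition step (h : R -> R) (x : R) : R := Series (fun i => f i * h (x - INR i)).

Fixpoint steps (K : nat) (h : R -> R) : R -> R := match K with O => h | S k => step (steps k h) end.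

Definition unit_bounded (h : R -> R) : Prop := forall x, 0 <= h x <= 1.

Lemma ex_series_step h x : unit_bounded h -> ex_series (fun i => f i * h (x - INR i)).
Proof.
  intros Hh. apply (ex_series_dominated _ f); [|exists 1; exact f_sum].
  intros i. specialize (Hh (x - INR i)). specialize (f_nonneg i). rewrite Rabs_pos_eq by pos. nra.
Qed.

Lemma step_le h h' c x : unit_bounded h -> unit_bounded h' -> (forall y, h y <= h' y + c) -> step h x <= step h' x + c.
Proof.
  intros Hh Hh' H. unfold step.
  assert (E : is_series (fun i => f i * h' (x - INR i) + c * f i) (Series (fun i => f i * h' (x - INR i)) + c * 1)).
  { apply (is_series_plus (fun i => f i * h' (x - INR i)) (fun i => c * f i)); [apply Series_correct, ex_series_step, Hh'|].
    exact (is_series_scal_l c f 1 f_sum). }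
  rewrite Rmult_1_r in E. rewrite <- (is_series_unique _ _ E). apply Series_le; [|eexists; exact E].
  intros i. specialize (f_nonneg i). specialize (H (x - INR i)). specialize (Hh (x - INR i)).
  split; [pos|]. nra.
Qed.

Lemma step_unit_bounded h : unit_bounded h -> unit_bounded (step h).
Proof.
  intros Hh x.
  assert (Z : unit_bounded (fun _ => 0)) by (intros y; lra).
  assert (EZ : step (fun _ => 0) x = 0).
  { unfold step. rewrite (Series_ext _ (fun _ => 0 * 0)) by (intros; ring). rewrite Series_scal_l. ring. }
  pose proof (step_le _ _ 0 x Z Hh (fun y => ltac:(specialize (Hh y); lra))).
  pose proof (step_le _ _ 1 x Hh Z (fun y => ltac:(specialize (Hh y); lra))). lra.
Qed.

Lemma steps_unit_bounded K h : unit_bounded h -> unit_bounded (steps K h).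
Proof. intros Hh. induction K as [|K IH]; [exact Hh|]. apply step_unit_bounded, IH. Qed.

Lemma steps_le K h h' c : unit_bounded h -> unit_bounded h' -> (forall y, h y <= h' y + c) ->
  forall x, steps K h x <= steps K h' x + c.
Proof.
  intros Hh Hh' H. induction K as [|K IH]; [exact H|]. intros x.
  apply step_le; [apply steps_unit_bounded, Hh|apply steps_unit_bounded, Hh'|exact IH].
Qed.

Definition nonneg_ind (x : R) : R := if Rle_dec 0 x then 1 else 0.

Lemma nonneg_ind_bounded : unit_bounded nonneg_ind.
Proof. intros x. unfold nonneg_ind. destruct Rle_dec; lra. Qed.

Lemma steps_ind K : (forall x, x < 0 -> steps K nonneg_ind x = 0) /\
  forall n, steps K nonneg_ind (INR n) = conv (seqpow f K) seqones n.
Proof.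
  induction K as [|K [IH1 IH2]].
  - split; [intros x Hx; simpl; unfold nonneg_ind; destruct Rle_dec; lra|]. intros n. simpl.
    replace (conv seq1 seqones) with seqones by ring. unfold nonneg_ind. pose proof (pos_INR n). destruct Rle_dec; [reflexivity|lra].
  - split.
    + intros x Hx. simpl. unfold step. rewrite (Series_ext _ (fun _ => 0 * 0)); [rewrite Series_scal_l; ring|].
      intros i. pose proof (pos_INR i). rewrite IH1 by lra. ring.
    + intros n. simpl. unfold step. replace (conv (conv f (seqpow f K)) seqones) with (conv f (conv (seqpow f K) seqones)) by ring.
      rewrite (Series_split _ n) by (apply (ex_series_step (steps K nonneg_ind)), steps_unit_bounded, nonneg_ind_bounded).
      rewrite (Series_ext _ (fun _ => 0 * 0)), Series_scal_l, Rmult_0_l, Rplus_0_r.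
      * apply sum_eq. intros i Hi. rewrite <- minus_INR by exact Hi. rewrite IH2. reflexivity.
      * intros k. rewrite IH1; [ring|]. rewrite plus_INR, S_INR. pose proof (pos_INR k). lra.
Qed.

Definition smooth (v b x : R) : R := Phi ((x - b) / sqrt v).

Lemma smooth_bounded v b : unit_bounded (smooth v b).
Proof. intros x. apply Phi_bounds. Qed.

Definition lind_err : R := 3 * m3 + 4 * s2 ^ 2.

Lemma m3_nonneg : 0 <= m3.
Proof.
  rewrite <- (is_series_unique _ _ f_third). apply Rle_trans with (sum_f_R0 (fun i => f i * Rabs (m - INR i) ^ 3) 0).
  - pos.
  - apply sum_le_Series; [|eexists; exact f_third]. intros; pos.
Qed.

Lemma lind_err_nonneg : 0 <= lind_err.
Proof. pose proof m3_nonneg. unfold lind_err. nra. Qed.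

(** Lindeberg's replacement within the Gaussian family. The step is expanded by [Phi_taylor] and the
    increase of the variance by [Phi_heat]; the main terms coincide in T because the mean and the
    variance match. *)
Lemma step_smooth v b x : 1 <= v -> Rabs (step (smooth v b) x - smooth (v + s2) (b + m) x) <= lind_err / sqrt v ^ 3.
Proof.
  intros Hv. pose proof (sqrt_lt_R0 v ltac:(lra)) as Hq. set (q := sqrt v) in *.
  assert (Hqq : q * q = v) by (apply sqrt_sqrt; lra).
  set (w := (x - (b + m)) / q).
  set (T := Phi w - w * gdens w * s2 / (2 * v)).
  assert (H1 : Rabs (step (smooth v b) x - T) <= 3 * m3 / q ^ 3).
  { assert (E : is_series (fun i => f i * (Phi w + gdens w * ((m - INR i) / q) - w * gdens w * ((m - INR i) / q) ^ 2 / 2)) T).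
    { replace T with (Phi w * 1 + (gdens w / q) * 0 + (- (w * gdens w / (2 * v))) * s2) by (unfold T; field; lra).
      apply (is_series_ext (fun i => Phi w * f i + (gdens w / q) * (f i * (m - INR i)) + (- (w * gdens w / (2 * v))) * (f i * (m - INR i) ^ 2))).
      - assert (A : forall i : nat, Phi w * f i + (gdens w / q) * (f i * (m - INR i)) + (- (w * gdens w / (2 * v))) * (f i * (m - INR i) ^ 2) =
          f i * (Phi w + gdens w * ((m - INR i) / q) - w * gdens w * ((m - INR i) / q) ^ 2 / 2)); [|exact A].
        intros i. rewrite <- Hqq. field. lra.
      - exact (is_series_plus _ _ _ _ (is_series_plus _ _ _ _ (is_series_scal_l (Phi w) _ _ f_sum) (is_series_scal_l (gdens w / q) _ _ f_mean))
            (is_series_scal_l (- (w * gdens w / (2 * v))) _ _ f_var)). }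
    rewrite <- (is_series_unique _ _ E). unfold step. rewrite <- Series_minus; [|apply ex_series_step, smooth_bounded|eexists; exact E].
    assert (E3 : is_series (fun i => 3 / q ^ 3 * (f i * Rabs (m - INR i) ^ 3)) (3 / q ^ 3 * m3)) by exact (is_series_scal_l (3 / q ^ 3) _ _ f_third).
    replace (3 * m3 / q ^ 3) with (3 / q ^ 3 * m3) by (field; lra). rewrite <- (is_series_unique _ _ E3).
    apply Rabs_Series_le; [|eexists; exact E3]. intros i.
    rewrite <- Rmult_minus_distr_l, Rabs_mult, (Rabs_pos_eq (f i)) by auto. unfold smooth. fold q.
    replace ((x - INR i - b) / q) with (w + (m - INR i) / q) by (unfold w; field; lra).
    pose proof (Phi_taylor w ((m - INR i) / q)) as H. specialize (f_nonneg i).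
    replace (3 / q ^ 3 * (f i * Rabs (m - INR i) ^ 3)) with (f i * (3 * Rabs ((m - INR i) / q) ^ 3)); [apply Rmult_le_compat_l; [exact f_nonneg|exact H]|].
    unfold Rdiv. rewrite Rabs_mult, (Rabs_pos_eq (/ q)), Rpow_mult_distr by pos. field. lra. }
  assert (H2 : Rabs (smooth (v + s2) (b + m) x - T) <= 4 * s2 ^ 2 / q ^ 3).
  { unfold smooth, T, w, q. apply Rle_trans with (1 := Phi_heat (x - (b + m)) v s2 ltac:(lra) ltac:(lra)). fold q.
    apply Rmult_le_compat_l; [nra|]. apply Rinv_le_contravar; [pos|]. rewrite <- Hqq.
    assert (1 <= q) by (unfold q; rewrite <- sqrt_1; apply sqrt_le_1; lra).
    replace ((q * q) ^ 2) with (q ^ 3 * q) by ring. pose proof (pow_lt q 3 Hq). nra. }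
  replace (step (smooth v b) x - smooth (v + s2) (b + m) x) with ((step (smooth v b) x - T) - (smooth (v + s2) (b + m) x - T)) by ring.
  apply Rle_trans with (1 := Rabs_minus_le _ _). apply Rle_trans with (1 := Rplus_le_compat _ _ _ _ H1 H2).
  apply Req_le. unfold lind_err. field. lra.
Qed.

Lemma steps_smooth K v b x : 1 <= v ->
  Rabs (steps K (smooth v b) x - smooth (v + INR K * s2) (b + INR K * m) x) <= INR K * (lind_err / sqrt v ^ 3).
Proof.
  intros Hv. pose proof lind_err_nonneg as HC. pose proof (sqrt_lt_R0 v ltac:(lra)) as Hq. revert x.
  induction K as [|K IH]; intros x.
  - simpl (INR 0). rewrite !Rmult_0_l, !Rplus_0_r. simpl. rewrite Rminus_diag, Rabs_R0. lra.
  - rewrite S_INR. replace (v + (INR K + 1) * s2) with (v + INR K * s2 + s2) by ring. replace (b + (INR K + 1) * m) with (b + INR K * m + m) by ring.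
    set (v' := v + INR K * s2) in *. set (b' := b + INR K * m) in *. pose proof (pos_INR K).
    assert (Hv' : v <= v') by (unfold v'; nra). set (c := INR K * (lind_err / sqrt v ^ 3)) in *.
    pose proof (step_smooth v' b' x ltac:(lra)) as H1.
    assert (H2 : lind_err / sqrt v' ^ 3 <= lind_err / sqrt v ^ 3).
    { apply Rmult_le_compat_l; [exact HC|]. apply Rinv_le_contravar; [pos|]. apply pow_incr. split; [lra|]. apply sqrt_le_1; lra. }
    assert (H3 : step (steps K (smooth v b)) x <= step (smooth v' b') x + c).
    { apply step_le; [apply steps_unit_bounded, smooth_bounded|apply smooth_bounded|]. intros y. specialize (IH y). apply Rabs_le_between in IH. lra. }
    assert (H4 : step (smooth v' b') x <= step (steps K (smooth v b)) x + c).
    { apply step_le; [apply smooth_bounded|apply steps_unit_bounded, smooth_bounded|]. intros y. specialize (IH y). apply Rabs_le_between in IH. lra. }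
    apply Rabs_le_between in H1. change (steps (S K) (smooth v b) x) with (step (steps K (smooth v b)) x).
    apply Rabs_le. unfold c in *. lra.
Qed.

(** The indicator of [0, infinity) is enclosed between Gaussian ramps of variance v shifted by A
    sqrt v to either side, up to Phi(-A); [steps_smooth] transports both ramps. *)
Lemma clt_bounds K n v A : 1 <= v ->
  Phi ((INR n - INR K * m - A * sqrt v) / sqrt (v + INR K * s2)) - INR K * (lind_err / sqrt v ^ 3) - Phi (- A) <=
  conv (seqpow f K) seqones n <=
  Phi ((INR n - INR K * m + A * sqrt v) / sqrt (v + INR K * s2)) + INR K * (lind_err / sqrt v ^ 3) + Phi (- A).
Proof.
  intros Hv. pose proof (sqrt_lt_R0 v ltac:(lra)) as Hq. rewrite <- (proj2 (steps_ind K)).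
  assert (B1 : forall y, nonneg_ind y <= smooth v (- (A * sqrt v)) y + Phi (- A)).
  { intros y. unfold nonneg_ind, smooth. replace ((y - - (A * sqrt v)) / sqrt v) with (A + y / sqrt v) by (field; lra).
    pose proof (Phi_bounds (- A)). destruct Rle_dec as [Hy|Hy]; [|pose proof (Phi_bounds (A + y / sqrt v)); lra].
    assert (0 <= y / sqrt v) by pos.
    pose proof (Phi_le A (A + y / sqrt v) ltac:(lra)). rewrite Phi_neg. lra. }
  assert (B2 : forall y, smooth v (A * sqrt v) y <= nonneg_ind y + Phi (- A)).
  { intros y. unfold nonneg_ind, smooth. replace ((y - A * sqrt v) / sqrt v) with (y / sqrt v - A) by (field; lra).
    pose proof (Phi_bounds (- A)). destruct Rle_dec as [Hy|Hy]; [pose proof (Phi_bounds (y / sqrt v - A)); lra|].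
    assert (y / sqrt v <= 0) by (apply Rle_div_l; lra).
    pose proof (Phi_le (y / sqrt v - A) (- A) ltac:(lra)). lra. }
  pose proof (steps_le K _ _ _ nonneg_ind_bounded (smooth_bounded _ _) B1 (INR n)) as C1.
  pose proof (steps_le K _ _ _ (smooth_bounded _ _) nonneg_ind_bounded B2 (INR n)) as C2.
  pose proof (steps_smooth K v (- (A * sqrt v)) (INR n) Hv) as D1.
  pose proof (steps_smooth K v (A * sqrt v) (INR n) Hv) as D2.
  unfold smooth at 2 in D1. unfold smooth at 2 in D2.
  replace (INR n - (- (A * sqrt v) + INR K * m)) with (INR n - INR K * m + A * sqrt v) in D1 by ring.
  replace (INR n - (A * sqrt v + INR K * m)) with (INR n - INR K * m - A * sqrt v) in D2 by ring.
  apply Rabs_le_between in D1. apply Rabs_le_between in D2. lra.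
Qed.

Lemma Phi_continuity x : continuity_pt Phi x.
Proof. apply continuity_pt_filterlim, (ex_derive_continuous Phi). exists (gdens x). apply Phi_derive. Qed.

Lemma is_lim_seq_sqrt_p (u : nat -> R) : is_lim_seq u p_infty -> is_lim_seq (fun n => sqrt (u n)) p_infty.
Proof.
  intros H. apply is_lim_seq_spec. intros M. apply is_lim_seq_spec in H. destruct (H (M ^ 2)) as [N HN]. exists N. intros n Hn.
  specialize (HN n Hn). apply Rle_lt_trans with (1 := Rle_abs M). rewrite <- sqrt_Rsqr_abs. apply sqrt_lt_1; [apply Rle_0_sqr| |unfold Rsqr; lra].
  assert (0 <= M ^ 2) by apply pow2_ge_0. lra.
Qed.

Lemma Phi_lim_0 (A : nat -> R) : is_lim_seq A p_infty -> is_lim_seq (fun n => Phi (- A n)) 0.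
Proof.
  intros H. apply is_lim_seq_0_eps. intros eps He. destruct (Phi_tail eps He) as (A0 & _ & HA).
  apply is_lim_seq_spec in H. destruct (H A0) as [N HN]. exists N. intros n Hn. specialize (HN n Hn).
  rewrite Rabs_pos_eq by apply Phi_bounds. apply HA. lra.
Qed.

(* [clt_bounds] with [v = K^(3/4)] and [A = K^(1/16)]. *)
Theorem clt (K N : nat -> nat) (y : R) : is_lim_seq (fun n => INR (K n)) p_infty ->
  is_lim_seq (fun n => (INR (N n) - INR (K n) * m) / sqrt (s2 * INR (K n))) y ->
  is_lim_seq (fun n => conv (seqpow f (K n)) seqones (N n)) (Phi y).
Proof.
  (* With t = K^(1/16), the accumulated error K / v^(3/2) = t^(-2), the relative shift A sqrt v /
     sqrt K = t^(-1) and the extra variance v / K = t^(-4) all vanish. *)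
  intros HK HN. set (t := fun n => sqrt (sqrt (sqrt (sqrt (INR (K n)))))).
  assert (Ht : is_lim_seq t p_infty) by (unfold t; do 4 apply is_lim_seq_sqrt_p; exact HK).
  assert (Ht16 : forall n, t n ^ 16 = INR (K n)).
  { intros n. unfold t. pose proof (pos_INR (K n)). replace 16%nat with (2 * (2 * (2 * 2)))%nat by reflexivity.
    rewrite !pow_mult, !pow2_sqrt; repeat apply sqrt_pos; try reflexivity; exact H. }
  assert (Hr : is_lim_seq (fun n => / t n) 0) by (apply (is_lim_seq_inv t p_infty); [exact Ht|discriminate]).
  assert (Hrat : is_lim_seq (fun n => sqrt (s2 / ((/ t n) ^ 4 + s2))) 1).
  { replace 1 with (sqrt (s2 / (0 ^ 4 + s2))).
    - apply (is_lim_seq_continuous (fun r => sqrt (s2 / (r ^ 4 + s2))) (fun n => / t n)); [|exact Hr].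
      apply continuity_pt_filterlim, (ex_derive_continuous (fun r => sqrt (s2 / (r ^ 4 + s2)))). auto_derive.
      replace (0 * (0 * (0 * (0 * 1))) + s2) with s2 by ring. split; [lra|]. split; [|trivial]. rewrite Rinv_r; lra.
    - replace (s2 / (0 ^ 4 + s2)) with 1 by (field; lra). apply sqrt_1. }
  set (err := fun n => lind_err * (/ t n) ^ 2 + Phi (- t n)).
  assert (Herr : is_lim_seq err 0).
  { unfold err. replace 0 with (lind_err * 0 ^ 2 + 0) by ring. apply is_lim_seq_plus'; [|apply Phi_lim_0, Ht].
    apply is_lim_seq_mult'; [apply is_lim_seq_const|]. apply (is_lim_seq_ext (fun n => / t n * / t n)); [intros; ring|].
    replace (0 ^ 2) with (0 * 0) by ring. apply is_lim_seq_mult'; exact Hr. }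
  set (arg := fun sg n => ((INR (N n) - INR (K n) * m) / sqrt (s2 * INR (K n)) + sg * / t n / sqrt s2) * sqrt (s2 / ((/ t n) ^ 4 + s2))).
  assert (Harg : forall sg, is_lim_seq (fun n => Phi (arg sg n)) (Phi y)).
  { intros sg. apply is_lim_seq_continuous; [apply Phi_continuity|]. unfold arg.
    replace (Finite y) with (Finite ((y + sg * 0 / sqrt s2) * 1)) by (f_equal; unfold Rdiv; ring).
    apply is_lim_seq_mult'; [|exact Hrat]. apply is_lim_seq_plus'; [exact HN|].
    apply is_lim_seq_mult'; [|apply is_lim_seq_const]. apply is_lim_seq_mult'; [apply is_lim_seq_const|exact Hr]. }
  apply (is_lim_seq_le_le_loc (fun n => Phi (arg (-1) n) - err n) _ (fun n => Phi (arg 1 n) + err n)).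
  - apply is_lim_seq_spec in Ht. destruct (Ht 1) as [N1 HN1]. exists N1. intros n Hn. specialize (HN1 n Hn). specialize (Ht16 n).
    set (a := t n) in *. assert (Ha : forall k, 0 < a ^ k) by (intros k; pos).
    assert (Hv : 1 <= a ^ 12) by (rewrite <- (pow1 12); apply pow_incr; lra).
    assert (Hsv : sqrt (a ^ 12) = a ^ 6) by (replace (a ^ 12) with ((a ^ 6) ^ 2) by ring; apply sqrt_pow2; specialize (Ha 6%nat); lra).
    pose proof (clt_bounds (K n) (N n) (a ^ 12) a Hv) as HB. rewrite Hsv in HB.
    assert (E1 : INR (K n) * (lind_err / (a ^ 6) ^ 3) = lind_err * (/ a) ^ 2) by (rewrite <- Ht16; field; lra).
    assert (E2 : forall sg, (INR (N n) - INR (K n) * m + sg * (a * a ^ 6)) / sqrt (a ^ 12 + INR (K n) * s2) = arg sg n).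
    { intros sg. unfold arg. fold a. pose proof (sqrt_lt_R0 s2 s2_pos) as Hs.
      assert (Ek : sqrt (s2 * INR (K n)) = sqrt s2 * a ^ 8).
      { rewrite sqrt_mult by (lra || apply pos_INR). f_equal. rewrite <- Ht16. replace (a ^ 16) with ((a ^ 8) ^ 2) by ring. apply sqrt_pow2. specialize (Ha 8%nat). lra. }
      assert (Hp : 0 < (/ a) ^ 4 + s2) by (assert (0 < (/ a) ^ 4) by pos; lra).
      assert (Ev : sqrt (a ^ 12 + INR (K n) * s2) = a ^ 8 * sqrt ((/ a) ^ 4 + s2)).
      { rewrite <- Ht16. replace (a ^ 12 + a ^ 16 * s2) with ((a ^ 8) ^ 2 * ((/ a) ^ 4 + s2)) by (field; lra).
        rewrite sqrt_mult by (lra || pos). f_equal. apply sqrt_pow2. specialize (Ha 8%nat). lra. }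
      rewrite Ek, Ev, sqrt_div by lra. pose proof (sqrt_lt_R0 _ Hp). specialize (Ha 8%nat). field. repeat split; lra. }
    rewrite E1 in HB. pose proof (E2 1) as E3. pose proof (E2 (-1)) as E4.
    replace (INR (N n) - INR (K n) * m + 1 * (a * a ^ 6)) with (INR (N n) - INR (K n) * m + a * a ^ 6) in E3 by ring.
    replace (INR (N n) - INR (K n) * m + -1 * (a * a ^ 6)) with (INR (N n) - INR (K n) * m - a * a ^ 6) in E4 by ring.
    rewrite E3, E4 in HB. unfold err. fold a. lra.
  - replace (Finite (Phi y)) with (Finite (Phi y - 0)) by (f_equal; ring). apply is_lim_seq_minus'; [apply Harg|exact Herr].
  - replace (Finite (Phi y)) with (Finite (Phi y + 0)) by (f_equal; ring). apply is_lim_seq_plus'; [apply Harg|exact Herr].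
Qed.

End CentralLimit.

(** * Renewal theorem *)

Lemma bounded_limsup (x : nat -> R) : (forall n, 0 <= x n <= 1) -> exists l, 0 <= l /\
  (forall eps, 0 < eps -> exists N, forall n, (N <= n)%nat -> x n <= l + eps) /\
  (forall eps N, 0 < eps -> exists n, (N <= n)%nat /\ l - eps <= x n).
Proof.
  intros Hx. destruct (ex_LimSup_seq x) as [[l| |] Hl]; simpl in Hl.
  - assert (A : forall eps, 0 < eps -> exists N, forall n, (N <= n)%nat -> x n <= l + eps).
    { intros eps He. destruct (Hl (mkposreal eps He)) as [_ [N HN]]. exists N. intros n Hn. left. apply HN, Hn. }
    exists l. split; [|split; [exact A|]].
    + apply le_epsilon. intros eps He. destruct (A eps He) as [N HN]. specialize (HN N (le_n _)). specialize (Hx N). lra.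
    + intros eps N He. destruct (Hl (mkposreal eps He)) as [H _]. destruct (H N) as (n & Hn & Hb). exists n. split; [exact Hn|left; exact Hb].
  - destruct (Hl 1 O) as (n & _ & Hn). specialize (Hx n). lra.
  - destruct (Hl 0) as [N HN]. specialize (HN N (le_n _)). specialize (Hx N). lra.
Qed.

Lemma sum_leind_le a m n : (m <= n)%nat -> sum_f_R0 (fun k => leind m k * a k) n = sum_f_R0 a m.
Proof.
  intros H. rewrite (sum_pad _ m n H).
  - apply sum_eq. intros k Hk. unfold leind. destruct le_dec; [ring|lia].
  - intros i Hi. unfold leind. destruct le_dec; [lia|ring].
Qed.

Lemma pos_lower_bound (f : nat -> R) n0 I : (forall n, (n0 <= n)%nat -> 0 < f n) ->
  exists c, 0 < c /\ forall i, (n0 <= i <= n0 + I)%nat -> c <= f i.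
Proof.
  intros H. induction I as [|I (c & Hc & Hf)].
  - exists (f n0). split; [apply H; lia|]. intros i Hi. replace i with n0 by lia. lra.
  - exists (Rmin c (f (n0 + S I)%nat)). split; [apply Rmin_pos; [exact Hc|apply H; lia]|]. intros i Hi.
    destruct (Nat.eq_dec i (n0 + S I)) as [->|Hne]; [apply Rmin_r|]. apply Rle_trans with (1 := Rmin_l _ _). apply Hf. lia.
Qed.

Section RenewalTheorem.
Variables (f : nat -> R) (n0 : nat) (m : R).
Hypothesis f_nonneg : forall n, 0 <= f n.
Hypothesis f_0 : f O = 0.
Hypothesis f_sum : is_series f 1.
Hypothesis f_pos : forall n, (n0 <= n)%nat -> 0 < f n.
Hypothesis f_mean : is_series (fun n => INR n * f n) m.

Local Notation ftail := (masstail f).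

Lemma ftail_nonneg n : 0 <= ftail n.
Proof.
  unfold masstail. rewrite <- (is_series_unique _ _ f_sum).
  pose proof (sum_le_Series f n f_nonneg ltac:(eexists; exact f_sum)). lra.
Qed.

Lemma ftail_lim : is_lim_seq ftail 0.
Proof.
  unfold masstail. replace (Finite 0) with (Finite (1 - 1)) by (f_equal; ring).
  apply is_lim_seq_minus'; [apply is_lim_seq_const|apply lim_of_is_series, f_sum].
Qed.

Lemma ftail_ren n : conv ftail (geom f) n = 1.
Proof. rewrite masstail_conv by exact f_0. reflexivity. Qed.

Lemma geom_le_1 n : geom f n <= 1.
Proof.
  rewrite <- (ftail_ren n). apply Rle_trans with (ftail 0 * geom f (n - 0)%nat).
  - unfold masstail. simpl. rewrite f_0, Nat.sub_0_r. lra.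
  - apply (sum_ge_term (fun i => ftail i * geom f (n - i)%nat)); [|lia].
    intros i. apply Rmult_le_pos; [apply ftail_nonneg|intros; apply geom_nonneg, f_nonneg].
Qed.

Lemma geom_rec n : geom f n = seq1 n + conv f (geom f) n.
Proof.
  pose proof (f_equal (fun a => a n) (geom_inv f f_0)) as H. cbv beta in H. rewrite <- H.
  replace (conv (seqsub seq1 f) (geom f)) with (seqsub (geom f) (conv f (geom f))) by ring. unfold seqsub. ring.
Qed.

Lemma is_series_ftail : is_series ftail m.
Proof.
  apply is_series_of_lim.
  apply (is_lim_seq_ext (fun N => sum_f_R0 (fun n => INR n * f n) N + INR (S N) * ftail N)).
  - intros N. pose proof (sum_INR_abel f N) as H. unfold masstail at 2. rewrite minus_sum, sum_cte. unfold masstail.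
    change (sum_f_R0 (fun i => sum_f_R0 f i) N) with (sum_f_R0 (sum_f_R0 f) N). lra.
  - replace (Finite m) with (Finite (m + 0)) by (f_equal; ring).
    apply is_lim_seq_plus'; [apply lim_of_is_series, f_mean|].
    apply (is_lim_seq_le_le (fun _ => 0) _ (fun N => m - sum_f_R0 (fun n => INR n * f n) N)).
    + intros N. split; [apply Rmult_le_pos; [apply pos_INR|apply ftail_nonneg]|].
      assert (E1 : ftail N = Series (fun k => f (S N + k)%nat)).
      { unfold masstail. rewrite <- (is_series_unique _ _ f_sum). rewrite (Series_split f N) by (eexists; exact f_sum). ring. }
      assert (Hex : ex_series (fun n => INR n * f n)) by (eexists; exact f_mean).
      rewrite <- (is_series_unique _ _ f_mean), (Series_split _ N Hex), E1, <- Series_scal_l.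
      match goal with |- _ <= ?a + ?b - ?a => replace (a + b - a) with b by ring end.
      apply Series_le; [|apply (ex_series_shift (fun n => INR n * f n) (S N)), Hex].
      intros k. split; [pos|].
      apply Rmult_le_compat_r; [apply f_nonneg|]. apply le_INR. lia.
    + apply is_lim_seq_const.
    + replace (Finite 0) with (Finite (m - m)) by (f_equal; ring).
      apply is_lim_seq_minus'; [apply is_lim_seq_const|apply lim_of_is_series, f_mean].
Qed.

(* [x n] is at most an average of the [x (n - i)] with weights [f i > 0]; so if [x n] is near the upper limit, they all are. *)
Lemma limsup_window (x err : nat -> R) l delta I N : (forall n, 0 <= x n <= 1) ->
  (forall n, x n <= conv f x n + err n) -> is_lim_seq err 0 -> 0 <= l ->
  (forall eps, 0 < eps -> exists N, forall n, (N <= n)%nat -> x n <= l + eps) ->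
  (forall eps N, 0 < eps -> exists n, (N <= n)%nat /\ l - eps <= x n) -> 0 < delta ->
  exists n, (N + I <= n)%nat /\ forall j, (j <= I)%nat -> l - delta <= x (n - j)%nat.
Proof.
  intros Hx Hrec Herr Hl Hup Hlow Hd.
  destruct (pos_lower_bound f n0 I f_pos) as (c & Hc & Hf).
  (* Four errors of size eps enter: the upper bound l + eps, the deficit of x_n below l, the term
     err_n, and the mass of f beyond n - N1. Their sum is at most c delta. *)
  set (eps := c * delta / 4). assert (He : 0 < eps) by (unfold eps; nra).
  destruct (Hup eps He) as [N1 HN1]. destruct (lim_eps _ _ eps Herr He) as [N2 HN2].
  destruct (lim_eps _ _ eps ftail_lim He) as [N3 HN3].
  destruct (Hlow eps (N + I + n0 + N1 + N2 + N3)%nat He) as (n & Hn & Hxn).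
  exists (n - n0)%nat. split; [lia|]. intros j Hj.
  specialize (HN2 n ltac:(lia)). specialize (HN3 (n - N1)%nat ltac:(lia)).
  apply Rabs_le_between in HN2. apply Rabs_le_between in HN3.
  set (i := (n0 + j)%nat). replace (n - n0 - j)%nat with (n - i)%nat by (unfold i; lia).
  assert (Hfi : c <= f i) by (apply Hf; unfold i; lia).
  set (z := fun k => f k * (l + eps - x (n - k)%nat + (1 - leind (n - N1) k))).
  assert (Hz : forall k, (k <= n)%nat -> 0 <= z k).
  { intros k Hk. apply Rmult_le_pos; [apply f_nonneg|]. unfold leind. destruct le_dec as [Hk'|Hk'].
    - specialize (HN1 (n - k)%nat ltac:(lia)). lra.
    - specialize (Hx (n - k)%nat). lra. }
  assert (Hzi : z i <= sum_f_R0 z n).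
  { rewrite <- (sum_eq (fun k => if le_dec k n then z k else 0) z); [|intros k Hk; destruct le_dec; [reflexivity|lia]].
    apply Rle_trans with (if le_dec i n then z i else 0); [destruct le_dec; [lra|unfold i in *; lia]|].
    apply (sum_ge_term (fun k => if le_dec k n then z k else 0)); [|unfold i; lia].
    intros k. destruct le_dec; [auto|lra]. }
  assert (Hsum : sum_f_R0 z n = (l + eps) * sum_f_R0 f n - conv f x n + (sum_f_R0 f n - sum_f_R0 f (n - N1))).
  { rewrite <- (sum_leind_le f (n - N1) n) by lia. unfold conv. rewrite scal_sum, <- minus_sum, <- minus_sum, <- plus_sum.
    apply sum_eq. intros k _. unfold z. ring. }
  assert (Hzi2 : f i * (l + eps - x (n - i)%nat) = z i).
  { unfold z, leind. destruct le_dec; [ring|unfold i in *; lia]. }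
  assert (Hsf : sum_f_R0 f n <= 1) by (pose proof (ftail_nonneg n); unfold masstail in *; lra).
  specialize (Hrec n). unfold masstail in HN3.
  assert (Htot : f i * (l + eps - x (n - i)%nat) <= 4 * eps) by (rewrite Hzi2; nra).
  destruct (Rle_lt_dec (l + eps - x (n - i)%nat) 0) as [Hneg|Hpos]; [lra|].
  assert (c * (l + eps - x (n - i)%nat) <= c * delta).
  { apply Rle_trans with (4 * eps); [|unfold eps; lra]. apply Rle_trans with (2 := Htot). apply Rmult_le_compat_r; lra. }
  apply Rmult_le_reg_l in H; [lra|exact Hc].
Qed.

Lemma mean_pos : 0 < m.
Proof.
  rewrite <- (is_series_unique _ _ is_series_ftail).
  apply Rlt_le_trans with (sum_f_R0 ftail 0); [unfold masstail; simpl; rewrite f_0; lra|].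
  apply sum_le_Series; [apply ftail_nonneg|eexists; apply is_series_ftail].
Qed.

(** On a long window where u is close to its upper limit l, the renewal equation gives l m <= 1. The
    same argument for 1 - u bounds the lower limit of u from below by 1/m. *)
Theorem renewal_limit : is_lim_seq (geom f) (/ m).
Proof.
  pose proof mean_pos as Hm. set (u := geom f).
  assert (Hu : forall n, 0 <= u n <= 1) by (intros n; split; [intros; apply geom_nonneg, f_nonneg|apply geom_le_1]).
  assert (Hser : is_lim_seq (sum_f_R0 ftail) m) by (apply lim_of_is_series, is_series_ftail).
  assert (Hsm : forall I, 0 <= sum_f_R0 ftail I <= m).
  { intros I. split; [apply cond_pos_sum, ftail_nonneg|]. rewrite <- (is_series_unique _ _ is_series_ftail).
    apply sum_le_Series; [apply ftail_nonneg|eexists; apply is_series_ftail]. }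
  destruct (bounded_limsup u Hu) as (l & Hl0 & Hup & Hlow).
  assert (Hl : l * m <= 1).
  { assert (A : forall delta I, 0 < delta -> (l - delta) * sum_f_R0 ftail I <= 1).
    { intros delta I Hd.
      destruct (limsup_window u seq1 l delta I 0 Hu) as (n & Hn & Hw); try assumption.
      - intros n. unfold u. rewrite geom_rec at 1. lra.
      - apply is_lim_seq_ext_loc with (fun _ => 0); [exists 1%nat; intros [|n] Hn; [lia|reflexivity]|apply is_lim_seq_const].
      - rewrite <- (ftail_ren n). fold u. unfold conv. rewrite scal_sum, <- (sum_leind_le (fun i => ftail i * (l - delta)) I n) by lia.
        apply sum_Rle. intros k Hk. unfold leind. pose proof (ftail_nonneg k). specialize (Hu (n - k)%nat). destruct le_dec as [Hk'|Hk'].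
        + specialize (Hw k Hk'). rewrite Rmult_1_l. apply Rmult_le_compat_l; lra.
        + rewrite Rmult_0_l. pos. }
    assert (B : forall delta, 0 < delta -> (l - delta) * m <= 1).
    { intros delta Hd. apply (is_lim_seq_le (fun I => (l - delta) * sum_f_R0 ftail I) (fun _ => 1) ((l - delta) * m) 1).
      - intros I. apply A, Hd.
      - lims.
      - apply is_lim_seq_const. }
    apply le_epsilon. intros eps He. specialize (B (eps / m) ltac:(pos)).
    replace ((l - eps / m) * m) with (l * m - eps) in B by (field; lra). lra. }
  (* 1 - u satisfies the averaging inequality of [limsup_window] with the tail of f as error, since
     the weights up to n have total mass 1 minus this tail. *)
  set (x := fun n => 1 - u n).
  assert (Hx : forall n, 0 <= x n <= 1) by (intros n; specialize (Hu n); unfold x; lra).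
  destruct (bounded_limsup x Hx) as (l' & Hl0' & Hup' & Hlow').
  assert (Hl' : 1 <= (1 - l') * m).
  { assert (A : forall delta I, 0 < delta -> 1 <= (1 - l' + delta) * sum_f_R0 ftail I + (m - sum_f_R0 ftail I)).
    { intros delta I Hd.
      destruct (limsup_window x ftail l' delta I 0 Hx) as (n & Hn & Hw); try assumption.
      - intros n. assert (E : conv f x n = sum_f_R0 f n - conv f u n).
        { unfold conv. rewrite <- minus_sum. apply sum_eq. intros i _. unfold x. ring. }
        rewrite E. unfold x, masstail. pose proof (geom_rec n) as G. fold u in G.
        assert (0 <= seq1 n) by (unfold seq1; destruct Nat.eqb; lra). lra.
      - apply ftail_lim.
      - rewrite <- (ftail_ren n) at 1. fold u. unfold conv.
        apply Rle_trans with (sum_f_R0 (fun i => leind I i * (ftail i * (1 - l' + delta)) + (ftail i - leind I i * ftail i)) n).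
        + apply sum_Rle. intros k Hk. unfold leind. pose proof (ftail_nonneg k). specialize (Hu (n - k)%nat). destruct le_dec as [Hk'|Hk'].
          * specialize (Hw k Hk'). unfold x in Hw. rewrite !Rmult_1_l, Rminus_diag, Rplus_0_r. apply Rmult_le_compat_l; lra.
          * nra.
        + rewrite plus_sum, minus_sum, !sum_leind_le, <- scal_sum by lia. pose proof (Hsm n). lra. }
    assert (B : forall delta, 0 < delta -> 1 <= (1 - l' + delta) * m).
    { intros delta Hd. apply (is_lim_seq_le (fun _ => 1) (fun I => (1 - l' + delta) * sum_f_R0 ftail I + (m - sum_f_R0 ftail I)) 1 ((1 - l' + delta) * m)).
      - intros I. apply A, Hd.
      - apply is_lim_seq_const.
      - replace (Finite ((1 - l' + delta) * m)) with (Finite ((1 - l' + delta) * m + (m - m))) by (f_equal; ring).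
        lims. }
    apply le_epsilon. intros eps He. specialize (B (eps / m) ltac:(pos)).
    replace ((1 - l' + eps / m) * m) with ((1 - l') * m + eps) in B by (field; lra). lra. }
  assert (Hl1 : l <= / m) by (apply (Rmult_le_reg_r m); [exact Hm|rewrite Rinv_l; lra]).
  assert (Hl2 : / m <= 1 - l') by (apply (Rmult_le_reg_r m); [exact Hm|rewrite Rinv_l; lra]).
  apply is_lim_seq_spec. intros [eps He]. simpl.
  destruct (Hup (eps / 2) ltac:(lra)) as [N1 HN1]. destruct (Hup' (eps / 2) ltac:(lra)) as [N2 HN2].
  exists (N1 + N2)%nat. intros n Hn. specialize (HN1 n ltac:(lia)). specialize (HN2 n ltac:(lia)). unfold x in HN2.
  fold u. apply Rabs_def1; lra.
Qed.

End RenewalTheorem.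

Lemma conv_summable_lim (e x : nat -> R) (l B : R) : (forall n, 0 <= e n) -> e O = 1 -> ex_series e ->
  is_lim_seq x l -> (forall n, Rabs (x n) <= B) -> is_lim_seq (conv e x) (Series e * l).
Proof.
  intros He He0 Hs Hx HB. set (p := fun n => Rabs (x n - l)).
  assert (Hs1 : forall n, 1 <= conv seqones e n).
  { intros n. rewrite conv_seqones. rewrite <- He0. apply (sum_ge_term e n 0 He). lia. }
  assert (Hp : is_lim_seq p 0).
  { apply (proj1 (is_lim_seq_abs_0 (fun n => x n - l))). replace (Finite 0) with (Finite (l - l)) by (f_equal; ring).
    lims. }
  assert (Hc : is_lim_seq (fun n => conv p e n / conv seqones e n) 0).
  { apply conv_negligible; [intros; apply Rabs_pos|intros; unfold seqones; lra|exact He|intros n; specialize (Hs1 n); lra| |].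
    - apply (is_lim_seq_ext p); [intros n; unfold seqones; field|exact Hp].
    - intros i. apply (is_lim_seq_le_le (fun _ => 0) _ (fun n => e (n - i)%nat)).
      + intros n. specialize (Hs1 n). specialize (He (n - i)%nat). split; [pos|].
        apply Rle_div_l; nra.
      + apply is_lim_seq_const.
      + apply (is_lim_seq_incr_n _ i). apply (is_lim_seq_ext e); [intros n; f_equal; lia|]. apply ex_series_lim_0, Hs. }
  assert (Hone : is_lim_seq (conv seqones e) (Series e)).
  { apply (is_lim_seq_ext (sum_f_R0 e)); [intros n; rewrite conv_seqones; reflexivity|]. apply lim_of_is_series, Series_correct, Hs. }
  assert (Hpe : is_lim_seq (conv p e) 0).
  { apply (is_lim_seq_ext (fun n => conv p e n / conv seqones e n * conv seqones e n)); [intros n; specialize (Hs1 n); field; lra|].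
    replace (Finite 0) with (Finite (0 * Series e)) by (f_equal; ring). lims. }
  apply (is_lim_seq_ext (fun n => conv e (fun k => x k - l) n + conv seqones e n * l)).
  - intros n. rewrite conv_seqones. unfold conv. rewrite (Rmult_comm (sum_f_R0 e n)), scal_sum, <- plus_sum. apply sum_eq. intros; ring.
  - replace (Finite (Series e * l)) with (Finite (0 + Series e * l)) by (f_equal; ring).
    apply is_lim_seq_plus'; [|apply is_lim_seq_mult'; [exact Hone|apply is_lim_seq_const]].
    apply is_lim_seq_abs_0. apply (is_lim_seq_le_le (fun _ => 0) _ (conv p e)); [|apply is_lim_seq_const|exact Hpe].
    intros n. split; [apply Rabs_pos|]. replace (conv p e) with (conv e p) by ring.
    apply conv_Rabs_le; intros i _; [rewrite Rabs_pos_eq; [lra|apply He]|unfold p; lra].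
Qed.

Section Gaussian.
Variables (e f : nat -> R) (n0 : nat) (m s2 m3 : R).
Hypothesis e_nonneg : forall n, 0 <= e n.
Hypothesis e_0 : e O = 1.
Hypothesis e_sum : ex_series e.
Hypothesis f_nonneg : forall n, 0 <= f n.
Hypothesis f_0 : f O = 0.
Hypothesis f_sum : is_series f 1.
Hypothesis f_pos : forall n, (n0 <= n)%nat -> 0 < f n.
Hypothesis f_mean : is_series (fun n => INR n * f n) m.
Hypothesis f_var : is_series (fun i => f i * (m - INR i) ^ 2) s2.
Hypothesis f_third : is_series (fun i => f i * Rabs (m - INR i) ^ 3) m3.
Hypothesis s2_pos : 0 < s2.

(** By [countw_head] the event X_n > K has weight f^(K+1) * x at n, with x = e / (1 - f) converging
    to L. The factor x_(n-i) is far from L only for the last I values of i, and S_(K+1) falls there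
    with vanishing probability. *)
Lemma gaussian_limit (K : nat -> nat) (y : R) : is_lim_seq (fun n => INR (K n)) p_infty ->
  is_lim_seq (fun n => (INR n - INR (S (K n)) * m) / sqrt (s2 * INR (S (K n)))) y ->
  is_lim_seq (fun n => expect e f n (leind (K n))) (1 - Phi y).
Proof.
  intros HK Hy. pose proof (mean_pos f m f_nonneg f_0 f_sum f_mean) as Hm.
  set (x := conv e (geom f)). set (L := Series e * / m).
  assert (Hx : is_lim_seq x L).
  { apply (conv_summable_lim e (geom f) (/ m) 1); try assumption; [apply (renewal_limit f n0); assumption|].
    intros n. rewrite Rabs_pos_eq; [apply (geom_le_1 f)|apply geom_nonneg]; assumption. }
  assert (Hes : 1 <= Series e).
  { rewrite <- e_0. apply (sum_le_Series e 0 e_nonneg e_sum). }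
  assert (HL : 0 < L) by pos.
  assert (HSK : is_lim_seq (fun n => INR (S (K n))) p_infty).
  { apply (is_lim_seq_ext (fun n => INR (K n) + 1)); [intros; rewrite S_INR; reflexivity|].
    eapply is_lim_seq_plus; [exact HK|apply is_lim_seq_const|reflexivity]. }
  assert (f_mean0 : is_series (fun i => f i * (m - INR i)) 0).
  { replace 0 with (m * 1 - m) by ring.
    assert (H := is_series_minus _ _ _ _ (is_series_scal_l m f 1 f_sum) f_mean). revert H. apply is_series_ext.
    assert (A : forall i, m * f i - INR i * f i = f i * (m - INR i)) by (intros; ring). exact A. }
  (* P(S_(K+1) <= n - I); the central limit theorem gives the same limit for every I, hence the last
     I positions carry no mass. *)
  set (W := fun n I => conv (seqpow f (S (K n))) seqones (n - I)%nat).
  assert (HW : forall I, is_lim_seq (fun n => W n I) (Phi y)).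
  { intros I. apply (clt f m s2 m3 f_nonneg f_sum f_mean0 f_var f_third s2_pos (fun n => S (K n)) (fun n => (n - I)%nat) y HSK).
    apply (is_lim_seq_ext_loc (fun n => (INR n - INR (S (K n)) * m) / sqrt (s2 * INR (S (K n))) - INR I * / sqrt (s2 * INR (S (K n))))).
    - exists I. intros n Hn. rewrite minus_INR by exact Hn. unfold Rdiv. ring.
    - replace (Finite y) with (Finite (y - INR I * 0)) by (f_equal; ring).
      apply is_lim_seq_minus'; [exact Hy|]. apply is_lim_seq_mult'; [apply is_lim_seq_const|].
      apply (is_lim_seq_inv (fun n => sqrt (s2 * INR (S (K n)))) p_infty); [|discriminate].
      apply is_lim_seq_sqrt_p. apply (is_lim_seq_ext (fun n => INR (S (K n)) * s2)); [intros; ring|].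
      apply (is_lim_seq_mult _ _ p_infty s2); [exact HSK|apply is_lim_seq_const|].
      unfold is_Rbar_mult. simpl. destruct Rle_dec as [H|H]; [|lra]. destruct Rle_lt_or_eq_dec; [reflexivity|lra]. }
  assert (Hxn : forall n, 0 <= x n) by (intros n; apply conv_nonneg; [exact e_nonneg|intros; apply geom_nonneg, f_nonneg]).
  assert (Hbd : exists B, 0 <= B /\ forall n, Rabs (x n - L) <= B).
  { exists (Series e + L). split; [lra|]. intros n. assert (x n <= Series e).
    { apply Rle_trans with (sum_f_R0 e n); [|apply sum_le_Series; assumption].
      apply sum_Rle. intros i _. pose proof (geom_nonneg f (n - i) f_nonneg). pose proof (geom_le_1 f f_nonneg f_0 f_sum (n - i)). specialize (e_nonneg i). nra. }
    specialize (Hxn n). apply Rabs_le. lra. }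
  destruct Hbd as (B & HB0 & HB).
  assert (HD : is_lim_seq (fun n => conv (seqpow f (S (K n))) x n - L * W n 0%nat) 0).
  { apply is_lim_seq_0_eps. intros eps He.
    destruct (lim_eps _ _ (eps / 2) Hx ltac:(lra)) as [I HI].
    assert (Hdiff : is_lim_seq (fun n => B * (W n 0%nat - W n I)) 0).
    { replace (Finite 0) with (Finite (B * (Phi y - Phi y))) by (f_equal; ring).
      apply is_lim_seq_mult'; [apply is_lim_seq_const|]. apply is_lim_seq_minus'; apply HW. }
    destruct (lim_eps _ _ (eps / 2) Hdiff ltac:(lra)) as [N HN]. exists (N + I)%nat. intros n Hn. specialize (HN n ltac:(lia)).
    rewrite Rminus_0_r in HN. apply Rabs_le_between in HN.
    set (F := seqpow f (S (K n))) in *.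
    assert (HF : forall i, 0 <= F i) by (intros i; apply seqpow_nonneg, f_nonneg).
    assert (EW0 : W n 0%nat = sum_f_R0 F n).
    { unfold W. fold F. rewrite Nat.sub_0_r. unfold conv. apply sum_eq. intros; unfold seqones; ring. }
    assert (EWI : W n I = sum_f_R0 F (n - I)).
    { unfold W. fold F. unfold conv. apply sum_eq. intros; unfold seqones; ring. }
    assert (HW1 : W n 0%nat <= 1).
    { unfold W. rewrite <- (proj2 (steps_ind f f_nonneg f_sum (S (K n)))). apply (steps_unit_bounded f f_nonneg f_sum), nonneg_ind_bounded. }
    assert (E : conv F x n - L * W n 0%nat = sum_f_R0 (fun i => F i * (x (n - i)%nat - L)) n).
    { rewrite EW0, scal_sum. unfold conv. rewrite <- minus_sum. apply sum_eq. intros; ring. }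
    rewrite E. apply Rle_trans with (sum_f_R0 (fun i => F i * (eps / 2) + B * (F i - leind (n - I) i * F i)) n).
    - apply Rabs_sum_le. intros i Hi. rewrite Rabs_mult, (Rabs_pos_eq (F i)) by apply HF. specialize (HF i). unfold leind.
      destruct le_dec as [Hi'|Hi'].
      + specialize (HI (n - i)%nat ltac:(lia)). rewrite Rmult_1_l, Rminus_diag, Rmult_0_r, Rplus_0_r. apply Rmult_le_compat_l; lra.
      + specialize (HB (n - i)%nat). rewrite Rmult_0_l, Rminus_0_r.
        assert (F i * Rabs (x (n - i)%nat - L) <= F i * B) by (apply Rmult_le_compat_l; lra). nra.
    - rewrite plus_sum, <- scal_sum.
      rewrite (sum_eq (fun i => B * (F i - leind (n - I) i * F i)) (fun i => (F i - leind (n - I) i * F i) * B)) by (intros; ring).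
      rewrite <- scal_sum, minus_sum, sum_leind_le by lia. rewrite <- EW0, <- EWI. nra. }
  destruct (lim_eps _ _ (L / 2) Hx ltac:(lra)) as [N0 HN0].
  apply (is_lim_seq_ext_loc (fun n => 1 - ((conv (seqpow f (S (K n))) x n - L * W n 0%nat) + L * W n 0%nat) / x n)).
  - exists N0. intros n Hn. specialize (HN0 n Hn). apply Rabs_le_between in HN0.
    rewrite expect_leind, counttot_geom by exact f_0. fold x. field. lra.
  - replace (Finite (1 - Phi y)) with (Finite (1 - (0 + L * Phi y) / L)) by (f_equal; field; lra).
    apply is_lim_seq_minus'; [apply is_lim_seq_const|]. apply is_lim_seq_div'; [|exact Hx|lra].
    apply is_lim_seq_plus'; [exact HD|]. apply is_lim_seq_mult'; [apply is_lim_seq_const|apply (HW 0%nat)].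
Qed.

End Gaussian.

(** * The limit laws *)

Lemma cube_geometric_bound r : 1 < r -> exists C, 0 < C /\ forall n, (INR n + 1) ^ 3 <= C * r ^ n.
Proof.
  (* For d <= 1 one has (1+d)^3 <= 1 + 7 d <= r, and Bernoulli gives d (n+1) <= (1+d)^n. *)
  intros Hr. set (d := Rmin 1 ((r - 1) / 7)). assert (Hd : 0 < d <= 1).
  { unfold d. split; [apply Rmin_pos; lra|apply Rmin_l]. }
  assert (Hd3 : (1 + d) ^ 3 <= r).
  { assert (d <= (r - 1) / 7) by apply Rmin_r. simpl. nra. }
  exists (/ d ^ 3). split; [pos|]. intros n.
  pose proof (poly n d ltac:(lra)) as H. pose proof (pos_INR n).
  assert (H1 : d * (INR n + 1) <= (1 + d) ^ n) by nra.
  apply (Rmult_le_reg_l (d ^ 3)); [pos|]. rewrite <- Rmult_assoc, Rinv_r, Rmult_1_l by (apply Rgt_not_eq, pow_lt; lra).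
  rewrite <- Rpow_mult_distr. apply Rle_trans with (((1 + d) ^ n) ^ 3).
  - apply pow_incr. split; [pos|exact H1].
  - rewrite <- pow_mult, Nat.mul_comm, pow_mult. apply pow_incr. split; [pos|exact Hd3].
Qed.

Lemma PSeries_moments (a : nat -> R) r r' : (forall n, 0 <= a n) -> 0 < r < r' -> ex_series (fun n => a n * r' ^ n) ->
  is_series (fun n => INR n * (a n * r ^ n)) (r * Derive (PSeries a) r) /\
  is_series (fun n => INR n ^ 2 * (a n * r ^ n)) (r ^ 2 * Derive (Derive (PSeries a)) r + r * Derive (PSeries a) r) /\
  ex_series (fun n => (INR n + 1) ^ 3 * (a n * r ^ n)).
Proof.
  intros Ha Hr Hs.
  assert (H3 : ex_series (fun n => (INR n + 1) ^ 3 * (a n * r ^ n))).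
  { destruct (cube_geometric_bound (r' / r)) as (C & HC & Hb); [apply Rlt_div_r; lra|].
    apply (ex_series_dominated _ (fun n => C * (a n * r' ^ n))).
    - intros n. specialize (Ha n). specialize (Hb n). pose proof (pos_INR n). pose proof (pow_lt r n ltac:(lra)) as Hp.
      rewrite Rabs_pos_eq by pos.
      replace (C * (a n * r' ^ n)) with (C * (r' / r) ^ n * (a n * r ^ n)).
      + apply Rmult_le_compat_r; [pos|exact Hb].
      + unfold Rdiv. rewrite Rpow_mult_distr, pow_inv. field. lra.
    - exact (ex_series_scal_l C (fun n => a n * r' ^ n) Hs). }
  assert (Hex : forall g : nat -> R, (forall n, 0 <= g n <= (INR n + 1) ^ 3) -> ex_series (fun n => g n * (a n * r ^ n))).
  { intros g Hg. apply (ex_series_dominated _ (fun n => (INR n + 1) ^ 3 * (a n * r ^ n))); [|exact H3].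
    intros n. specialize (Ha n). specialize (Hg n). pose proof (pow_lt r n ltac:(lra)) as Hp.
    rewrite Rabs_pos_eq by pos.
    apply Rmult_le_compat_r; [pos|lra]. }
  assert (Hrad : Rbar_le r' (CV_radius a)).
  { apply (CV_radius_ge a r' (Series (fun n => a n * r' ^ n))). intros n.
    assert (Hp : forall k, 0 <= a k * r' ^ k) by (intros k; pos).
    rewrite Rabs_pos_eq by apply Hp. apply Rle_trans with (sum_f_R0 (fun n => a n * r' ^ n) n).
    - apply (sum_ge_term (fun n => a n * r' ^ n)); [exact Hp|lia].
    - apply sum_le_Series; [exact Hp|exact Hs]. }
  assert (Hin : forall x, Rabs x < r' -> Rbar_lt (Rabs x) (CV_radius a)).
  { intros x Hx. apply Rbar_lt_le_trans with (2 := Hrad). exact Hx. }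
  assert (Hr0 : Rabs r < r') by (rewrite Rabs_pos_eq; lra).
  assert (E1 : Derive (PSeries a) r = PSeries (PS_derive a) r) by (apply Derive_PSeries, Hin, Hr0).
  assert (E2 : Derive (Derive (PSeries a)) r = PSeries (PS_derive (PS_derive a)) r).
  { rewrite (Derive_ext_loc (Derive (PSeries a)) (PSeries (PS_derive a))).
    - apply Derive_PSeries. rewrite CV_radius_derive. apply Hin, Hr0.
    - exists (mkposreal (r' - r) ltac:(lra)). intros t Ht. apply Derive_PSeries, Hin.
      unfold ball in Ht; simpl in Ht; unfold AbsRing_ball, abs, minus, plus, opp in Ht; simpl in Ht.
      apply Rabs_def2 in Ht. apply Rabs_def1; lra. }
  assert (Hsh : forall g : nat -> R, g O = 0 -> ex_series g -> Series g = Series (fun n => g (S n))).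
  { intros g Hg Hgs. rewrite (Series_incr_1 g Hgs), Hg. ring. }
  assert (Hc : forall n, 0 <= INR n /\ INR n <= (INR n + 1) ^ 3 /\ INR n ^ 2 <= (INR n + 1) ^ 3).
  { intros n. pose proof (pos_INR n). simpl. repeat split; nra. }
  assert (M1 : is_series (fun n => INR n * (a n * r ^ n)) (r * Derive (PSeries a) r)).
  { rewrite E1. unfold PSeries. rewrite <- Series_scal_l.
    assert (Hx : ex_series (fun n => INR n * (a n * r ^ n))) by (apply Hex; intros n; specialize (Hc n); lra).
    replace (Series (fun n => r * (PS_derive a n * r ^ n))) with (Series (fun n => INR n * (a n * r ^ n))); [apply Series_correct, Hx|].
    rewrite (Hsh _ (Rmult_0_l _) Hx). apply Series_ext. intros n. unfold PS_derive. simpl pow. ring. }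
  assert (M2 : is_series (fun n => INR n * (INR n - 1) * (a n * r ^ n)) (r ^ 2 * Derive (Derive (PSeries a)) r)).
  { rewrite E2. unfold PSeries. rewrite <- Series_scal_l.
    assert (Hx : ex_series (fun n => INR n * (INR n - 1) * (a n * r ^ n))).
    { apply Hex. intros n. specialize (Hc n). destruct n as [|n]; [simpl; lra|]. rewrite S_INR in *. pose proof (pos_INR n). nra. }
    replace (Series (fun n => r ^ 2 * (PS_derive (PS_derive a) n * r ^ n))) with (Series (fun n => INR n * (INR n - 1) * (a n * r ^ n))); [apply Series_correct, Hx|].
    assert (Hz : INR 0 * (INR 0 - 1) * (a O * r ^ 0) = 0) by (simpl; ring).
    rewrite (Hsh (fun n => INR n * (INR n - 1) * (a n * r ^ n)) Hz Hx).
    rewrite (Hsh (fun n => INR (S n) * (INR (S n) - 1) * (a (S n) * r ^ S n))); [|simpl; ring|apply (ex_series_shift (fun n => INR n * (INR n - 1) * (a n * r ^ n)) 1), Hx].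
    apply Series_ext. intros n. unfold PS_derive. rewrite !S_INR. simpl pow. ring. }
  split; [exact M1|]. split; [|exact H3].
  assert (M := is_series_plus _ _ _ _ M2 M1). revert M. apply is_series_ext.
  assert (A : forall n, INR n * (INR n - 1) * (a n * r ^ n) + INR n * (a n * r ^ n) = INR n ^ 2 * (a n * r ^ n)) by (intros; ring). exact A.
Qed.

Lemma nfloor_seq (a : nat -> R) : exists K : nat -> nat, forall n, 0 <= a n -> INR (K n) <= a n < INR (K n) + 1.
Proof.
  exists (fun n => nfloor (Rmax 0 (a n)) (Rmax_l _ _)). intros n Hn. unfold nfloor. destruct nfloor_ex as [k Hk]. simpl.
  rewrite Rmax_right in Hk by exact Hn. exact Hk.
Qed.

Lemma Xcdf_leind c d p q r n (g : nat -> R) x K : 0 < r -> (forall k, g k <= x <-> (k <= K)%nat) ->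
  Xcdf c d p q n g x = expect (fun n => Ecoef c d p n * r ^ n) (fun n => Qcoef c d p q n * r ^ n) n (leind K).
Proof.
  intros Hr H. unfold Xcdf, expect. apply sum_eq. intros k _. rewrite (Xprob_scale c d p q r) by exact Hr.
  unfold leind. destruct Rle_dec as [A|A]; destruct le_dec as [B|B]; try ring; exfalso; [apply B|apply A]; apply H; assumption.
Qed.

Lemma floor_le_iff k K a : INR K <= a < INR K + 1 -> (INR k <= a <-> (k <= K)%nat).
Proof.
  intros H. split; intros Hk.
  - assert (INR k < INR (S K)) by (rewrite S_INR; lra). apply INR_lt in H0. lia.
  - apply le_INR in Hk. lra.
Qed.

Section GaussianRegime.
Variables (a e : nat -> R) (r r' : R) (n0 : nat).
Hypothesis a_nonneg : forall n, 0 <= a n.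
Hypothesis a_0 : a O = 0.
Hypothesis a_pos : forall n, (n0 <= n)%nat -> 0 < a n.
Hypothesis Hr : 0 < r < r'.
Hypothesis Hr' : ex_series (fun n => a n * r' ^ n).
Hypothesis a_sum : is_series (fun n => a n * r ^ n) 1.
Hypothesis e_nonneg : forall n, 0 <= e n.
Hypothesis e_0 : e O = 1.
Hypothesis e_sum : ex_series e.

(** With m and s2 the mean and variance of the law a_n r^n, mu = 1/m and sigma^2 = s2 / m^3, the
    usual constants for a number of renewals. As K + 1 is mu n + x sigma sqrt n up to a bounded
    error, (n - (K+1) m) / sqrt(s2 (K+1)) tends to -x. *)
Lemma gaussian_regime (K : nat -> nat) (x : R) :
  let Q1 := Derive (PSeries a) r in
  let Q2 := Derive (Derive (PSeries a)) r in
  let mu := / (r * Q1) in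
  let sigma := sqrt ((r * Q2 + Q1 - r * Q1 ^ 2) / (r ^ 2 * Q1 ^ 3)) in
  (forall n, 0 <= mu * INR n + x * (sigma * sqrt (INR n)) ->
     INR (K n) <= mu * INR n + x * (sigma * sqrt (INR n)) < INR (K n) + 1) ->
  0 < mu /\ 0 < sigma /\
  is_lim_seq (fun n => expect e (fun n => a n * r ^ n) n (leind (K n))) (Phi x).
Proof.
  intros Q1 Q2 mu sigma HK. set (f := fun n => a n * r ^ n) in *.
  assert (f_nonneg : forall n, 0 <= f n) by (intros n; pos).
  assert (f_pos : forall n, (n0 <= n)%nat -> 0 < f n) by (intros n Hn; pos).
  assert (f_0 : f O = 0) by (unfold f; rewrite a_0; ring).
  destruct (PSeries_moments a r r' a_nonneg Hr Hr') as (M1 & M2 & M3). fold Q1 Q2 in M1, M2.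
  set (m := r * Q1) in *.
  pose proof (mean_pos f m f_nonneg f_0 a_sum M1) as Hm.
  assert (HQ1 : 0 < Q1) by (apply (Rmult_lt_reg_l r); [lra|]; rewrite Rmult_0_r; exact Hm).
  set (s2 := r ^ 2 * Q2 + m - m ^ 2).
  assert (V : is_series (fun i => f i * (m - INR i) ^ 2) s2).
  { replace s2 with (r ^ 2 * Q2 + m - 2 * m * m + m ^ 2 * 1) by (unfold s2; ring).
    assert (H := is_series_plus _ _ _ _ (is_series_minus _ _ _ _ M2 (is_series_scal_l (2 * m) _ _ M1)) (is_series_scal_l (m ^ 2) _ _ a_sum)).
    revert H. apply is_series_ext.
    assert (A : forall i, INR i ^ 2 * (a i * r ^ i) - 2 * m * (INR i * (a i * r ^ i)) + m ^ 2 * (a i * r ^ i) = f i * (m - INR i) ^ 2)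
      by (intros; unfold f; ring). exact A. }
  assert (Hs2 : 0 < s2).
  { assert (Hi : exists i, (n0 <= i)%nat /\ m - INR i <> 0).
    { destruct (Req_dec (m - INR n0) 0) as [E|E]; [|exists n0; split; [lia|exact E]].
      exists (S n0). split; [lia|]. rewrite S_INR. lra. }
    destruct Hi as (i & Hi & Hne). rewrite <- (is_series_unique _ _ V).
    assert (Hnn : forall j, 0 <= f j * (m - INR j) ^ 2) by (intros; apply Rmult_le_pos; [auto|apply pow2_ge_0]).
    apply Rlt_le_trans with (f i * (m - INR i) ^ 2).
    - apply Rmult_lt_0_compat; [auto|]. apply pow2_gt_0. exact Hne.
    - apply Rle_trans with (sum_f_R0 (fun j => f j * (m - INR j) ^ 2) i).
      + apply (sum_ge_term (fun j => f j * (m - INR j) ^ 2) i i); [exact Hnn|lia].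
      + apply sum_le_Series; [exact Hnn|eexists; exact V]. }
  assert (T : ex_series (fun i => f i * Rabs (m - INR i) ^ 3)).
  { apply (ex_series_dominated _ (fun i => (m + 1) ^ 3 * ((INR i + 1) ^ 3 * (a i * r ^ i)))).
    - intros i. pose proof (pos_INR i). rewrite Rabs_pos_eq by pos.
      assert (Hb : Rabs (m - INR i) ^ 3 <= ((m + 1) * (INR i + 1)) ^ 3).
      { apply pow_incr. split; [apply Rabs_pos|]. apply Rabs_le. nra. }
      rewrite Rpow_mult_distr in Hb. fold (f i). specialize (f_nonneg i).
      apply Rle_trans with (f i * ((m + 1) ^ 3 * (INR i + 1) ^ 3)); [apply Rmult_le_compat_l; assumption|apply Req_le; ring].
    - exact (ex_series_scal_l ((m + 1) ^ 3) _ M3). }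
  destruct T as [m3 T].
  assert (Hsig : sigma = sqrt (s2 / m ^ 3)).
  { unfold sigma. f_equal. unfold s2, m. field. lra. }
  assert (Hsm : 0 < s2 / m ^ 3) by pos.
  assert (Hsp : 0 < sigma) by (rewrite Hsig; pos).
  assert (Hmu : 0 < mu) by pos.
  split; [exact Hmu|]. split; [exact Hsp|].
  set (b := fun n => mu * INR n + x * (sigma * sqrt (INR n))) in *.
  assert (Hsq : is_lim_seq (fun n => / sqrt (INR n)) 0).
  { apply (is_lim_seq_inv (fun n => sqrt (INR n)) p_infty); [apply is_lim_seq_sqrt_p, is_lim_seq_INR|discriminate]. }
  assert (Hin : is_lim_seq (fun n => / INR n) 0) by (apply (is_lim_seq_inv INR p_infty); [apply is_lim_seq_INR|discriminate]).
  assert (Hsplit : forall n, (1 <= n)%nat -> 0 < INR n /\ 0 < sqrt (INR n) /\ sqrt (INR n) * sqrt (INR n) = INR n).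
  { intros n Hn. assert (0 < INR n) by (apply lt_0_INR; lia). split; [assumption|]. split; [pos|apply sqrt_sqrt; lra]. }
  assert (Hb : is_lim_seq (fun n => b n / INR n) mu).
  { apply (is_lim_seq_ext_loc (fun n => mu + x * sigma * / sqrt (INR n))).
    - exists 1%nat. intros n Hn. destruct (Hsplit n Hn) as (A1 & A2 & A3). unfold b. set (w := sqrt (INR n)) in *. rewrite <- A3. field. lra.
    - replace (Finite mu) with (Finite (mu + x * sigma * 0)) by (f_equal; ring).
      lims. }
  assert (Hev : exists N, forall n, (N <= n)%nat -> 0 <= b n).
  { destruct (lim_eps _ _ mu Hb Hmu) as [N HN]. exists (S N). intros n Hn. specialize (HN n ltac:(lia)). destruct (Hsplit n ltac:(lia)) as (A1 & _).
    apply Rabs_le_between in HN. replace (b n) with (b n / INR n * INR n) by (field; lra). pos. }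
  destruct Hev as [N HN].
  set (th := fun n => INR (S (K n)) - b n).
  assert (Hth : forall n, (N <= n)%nat -> 0 <= th n <= 1).
  { intros n Hn. specialize (HK n (HN n Hn)). unfold th. rewrite S_INR. fold (b n) in HK. lra. }
  assert (Hth0 : forall w : nat -> R, (forall n, 0 <= w n) -> is_lim_seq w 0 -> is_lim_seq (fun n => th n * w n) 0).
  { intros w Hw Hl. apply (is_lim_seq_le_le_loc (fun _ => 0) _ w); [|apply is_lim_seq_const|exact Hl].
    exists N. intros n Hn. specialize (Hth n Hn). specialize (Hw n). split; [pos|nra]. }
  assert (Hinv0 : forall y, 0 <= y -> 0 <= / y).
  { intros y [Hy|<-]; [left; pos|rewrite Rinv_0; lra]. }
  assert (Hratio : is_lim_seq (fun n => INR (S (K n)) / INR n) mu).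
  { apply (is_lim_seq_ext (fun n => b n / INR n + th n * / INR n)); [intros n; unfold th, Rdiv; ring|].
    replace (Finite mu) with (Finite (mu + 0)) by (f_equal; ring). apply is_lim_seq_plus'; [exact Hb|].
    apply Hth0; [intros n; apply Hinv0, pos_INR|exact Hin]. }
  replace (Phi x) with (1 - Phi (- x)) by (rewrite Phi_neg; ring).
  apply (gaussian_limit e f n0 m s2 m3); try assumption.
  - apply (is_lim_seq_ext_loc (fun n => INR (S (K n)) / INR n * INR n - 1)).
    + exists 1%nat. intros n Hn. destruct (Hsplit n Hn) as (A1 & _). rewrite S_INR. field. lra.
    + apply (is_lim_seq_minus _ _ p_infty 1 p_infty); [|apply is_lim_seq_const|reflexivity].
      apply (is_lim_seq_mult _ _ mu p_infty p_infty); [exact Hratio|apply is_lim_seq_INR|].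
      unfold is_Rbar_mult. simpl. destruct Rle_dec as [H|H]; [|lra]. destruct Rle_lt_or_eq_dec; [reflexivity|lra].
  - assert (Esig : sigma * m = sqrt (s2 * mu)).
    { rewrite Hsig. rewrite <- (sqrt_pow2 m) at 2 by lra. rewrite <- sqrt_mult by (lra || apply pow2_ge_0). f_equal. unfold mu. field. lra. }
    assert (Hsmu : 0 < s2 * mu) by pos.
    apply (is_lim_seq_ext_loc (fun n => (- (x * (sigma * m)) - th n * / sqrt (INR n) * m) / sqrt (s2 * (INR (S (K n)) / INR n)))).
    + exists (S N). intros n Hn. destruct (Hsplit n ltac:(lia)) as (A1 & A2 & A3). pose proof (pos_INR (S (K n))) as HS.
      assert (HSp : 0 < INR (S (K n))) by (apply lt_0_INR; lia).
      assert (Es : sqrt (s2 * (INR (S (K n)) / INR n)) = sqrt (s2 * INR (S (K n))) / sqrt (INR n)).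
      { rewrite <- sqrt_div by (lra || pos). f_equal. unfold Rdiv. ring. }
      rewrite Es. assert (0 < sqrt (s2 * INR (S (K n)))) by pos.
      unfold th. replace (INR n - INR (S (K n)) * m) with (- (x * (sigma * m)) * sqrt (INR n) - (INR (S (K n)) - b n) * m).
      * field. lra.
      * unfold b, mu. set (w := sqrt (INR n)) in *. rewrite <- A3. field. lra.
    + replace (Finite (- x)) with (Finite ((- (x * (sigma * m)) - 0 * m) / sqrt (s2 * mu))).
      * apply is_lim_seq_div'.
        -- apply is_lim_seq_minus'; [apply is_lim_seq_const|]. apply is_lim_seq_mult'; [|apply is_lim_seq_const].
           apply Hth0; [intros n; apply Hinv0, sqrt_pos|exact Hsq].
        -- apply (is_lim_seq_continuous sqrt (fun n => s2 * (INR (S (K n)) / INR n)) (s2 * mu)).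
           ++ apply continuity_pt_sqrt. lra.
           ++ lims.
        -- pose proof (sqrt_lt_R0 _ Hsmu). lra.
      * f_equal. rewrite Esig. pose proof (sqrt_lt_R0 _ Hsmu). field. lra.
Qed.

End GaussianRegime.

Lemma sqrt_gseq_lim : is_lim_seq (fun n => sqrt (PI * INR n) * gseq n) 1.
Proof.
  pose proof PI_RGT_0.
  apply (is_lim_seq_ext (fun n => sqrt (PI * INR n * gseq n ^ 2))).
  - intros n. pose proof (gseq_pos n). pose proof (pos_INR n). rewrite sqrt_mult, sqrt_pow2 by (try apply pow2_ge_0; try apply Rmult_le_pos; lra). reflexivity.
  - replace (Finite 1) with (Finite (sqrt 1)) by (f_equal; apply sqrt_1).
    apply (is_lim_seq_continuous sqrt); [apply continuity_pt_sqrt; lra|apply gseq_sqr_lim].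
Qed.

(** Change of scale: sqrt(pi n) [gseq n] tends to 1, so the threshold corresponds to y = x
    sqrt(2/pi), for which pi y^2 / 4 = x^2 / 2. *)
Lemma rayleigh_regime e f eta (K : nat -> nat) (x : R) : critical e f eta -> 0 <= x ->
  (forall n, INR (K n) <= x * (sqrt 2 / eta * sqrt (INR n)) < INR (K n) + 1) ->
  is_lim_seq (fun n => expect e f n (leind (K n))) (1 - exp (- x ^ 2 / 2)).
Proof.
  intros HC Hx HK. pose proof (critical_eta _ _ _ HC) as He. pose proof PI_RGT_0 as Hpi. pose proof (sqrt_lt_R0 PI Hpi) as Hsp.
  assert (Hsp2 : sqrt PI * sqrt PI = PI) by (apply sqrt_sqrt; lra). assert (Hs2 : sqrt 2 * sqrt 2 = 2) by (apply sqrt_sqrt; lra).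
  replace (- x ^ 2 / 2) with (- (PI * (x * sqrt 2 / sqrt PI) ^ 2 / 4)).
  - apply (rayleigh_limit _ _ eta); [exact HC|].
    assert (Hg : is_lim_seq (fun n => x * (sqrt 2 / eta * sqrt (INR n)) * gseq n) (x * sqrt 2 / sqrt PI / eta)).
    { apply (is_lim_seq_ext (fun n => x * sqrt 2 / sqrt PI / eta * (sqrt (PI * INR n) * gseq n))).
      - intros n. rewrite sqrt_mult by (lra || apply pos_INR). field. lra.
      - replace (Finite (x * sqrt 2 / sqrt PI / eta)) with (Finite (x * sqrt 2 / sqrt PI / eta * 1)) by (f_equal; ring).
        apply is_lim_seq_mult'; [apply is_lim_seq_const|apply sqrt_gseq_lim]. }
    apply (is_lim_seq_le_le (fun n => x * (sqrt 2 / eta * sqrt (INR n)) * gseq n - gseq n) _ (fun n => x * (sqrt 2 / eta * sqrt (INR n)) * gseq n)).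
    + intros n. specialize (HK n). pose proof (gseq_pos n). split; nra.
    + replace (Finite (x * sqrt 2 / sqrt PI / eta)) with (Finite (x * sqrt 2 / sqrt PI / eta - 0)) by (f_equal; ring).
      lims.
    + exact Hg.
  - unfold Rdiv. rewrite !Rpow_mult_distr, pow_inv. replace (sqrt 2 ^ 2) with 2 by (simpl; lra). replace (sqrt PI ^ 2) with PI by (simpl; lra). field. lra.
Qed.

Theorem theorem4p12 (c d : nat) (p : Z -> R) (q tau : R) :
  (1 <= c)%nat -> (1 <= d)%nat ->
  (forall i, (- Z.of_nat c <= i <= Z.of_nat d)%Z -> 0 <= p i) ->
  p (- Z.of_nat c)%Z <> 0 -> p (Z.of_nat d) <> 0 ->
  aperiodic c d p ->
  0 < q ->
  (* tau: minimal positive real solution of P'(tau) = 0 *)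
  0 < tau -> Derive (Pfun c d p) tau = 0 ->
  (forall u, 0 < u < tau -> Derive (Pfun c d p) u <> 0) ->
  let rho := / Pfun c d p tau in
  let Q := Qfun c d p q in
  (* (1) Gaussian regime *)
  (forall rho0, is_rho0 c d p q rho rho0 -> rho0 < rho ->
     let Q1 := Derive Q rho0 in
     let Q2 := Derive (Derive Q) rho0 in
     let mu := / (rho0 * Q1) in
     let sigma2 := (rho0 * Q2 + Q1 - rho0 * Q1 ^ 2) / (rho0 ^ 2 * Q1 ^ 3) in
     let sigma := sqrt sigma2 in
     forall x : R,
       is_lim_seq
         (fun n => Xcdf c d p q n
                     (fun k => (INR k - mu * INR n) / (sigma * sqrt (INR n))) x)
         (Phi x)) /\
  (* (2) Rayleigh regime *)
  (forall rho0 eta, is_rho0 c d p q rho rho0 -> rho0 = rho -> puiseux c d p q rho eta ->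
     let theta := sqrt 2 / eta in
     (forall x : R,
        is_lim_seq
          (fun n => Xcdf c d p q n (fun k => INR k / (theta * sqrt (INR n))) x)
          (Rayleigh_cdf x)) /\
     is_lim_seq (fun n => Xmean c d p q n / (/ eta * sqrt (PI * INR n))) 1) /\
  (* (3) rho0 does not exist: discrete limit law with O(1/n) error, k fixed *)
  ((~ exists rho0, is_rho0 c d p q rho rho0) ->
   forall eta, puiseux c d p q rho eta ->
     let lam := Q rho in
     let Drho := / (1 - Q rho) in
     let C := sqrt (2 * Pfun c d p tau / Derive (Derive (Pfun c d p)) tau) in
     forall k : nat,
       let F := (INR k * eta / lam + C / tau) * lam ^ k
                / (eta * Drho ^ 2 + (C / tau) * Drho) in
       exists K : R, exists N : nat, forall n : nat, (N <= n)%nat ->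
         Rabs (Xprob c d p q n k - F) <= K * F / INR n).
Proof.
  intros Hc Hd p_nonneg p_c p_d p_aper Hq Htau Hcrit _ rho Q.
  assert (Hrho : 0 < rho) by (apply (rho_pos c d p tau); assumption).
  pose proof (Qcoef_nonneg c d p q Hc Hd p_nonneg Hq) as HQ0.
  destruct (qtilt_lower c d p q tau Hc Hd p_nonneg p_c p_d p_aper Hq Htau Hcrit) as (n0 & kl & Hkl & Hlow).
  assert (HQpos : forall n, (n0 <= n)%nat -> 0 < Qcoef c d p q n).
  { intros n Hn. specialize (Hlow n Hn). pose proof (kap1_pos n). unfold qtilt in Hlow. fold rho in Hlow.
    pose proof (pow_lt rho n Hrho). assert (0 < Qcoef c d p q n * rho ^ n) by nra.
    destruct (HQ0 n) as [H2|H2]; [exact H2|]. rewrite <- H2 in H1. lra. }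
  assert (HE0 : forall n, 0 <= Ecoef c d p n) by (intros n; apply mea_nonneg; assumption).
  destruct (InA_exc c d p tau Hc Hd p_nonneg p_c p_aper Htau Hcrit) as [HEA HES].
  assert (Ee : altseq c d p tau 0 = (fun n => Ecoef c d p n * rho ^ n)).
  { extensionality n. unfold altseq, mtilt, Ecoef. fold rho. simpl. ring. }
  assert (Ef : qtilt c d p q tau = (fun n => Qcoef c d p q n * rho ^ n)) by reflexivity.
  rewrite Ee in HEA, HES. set (e := fun n => Ecoef c d p n * rho ^ n) in *.
  set (f := fun n => Qcoef c d p q n * rho ^ n) in *. rewrite Ef in Hlow.
  assert (e_nonneg : forall n, 0 <= e n) by (intros n; pos).
  assert (e_0 : e O = 1) by (unfold e, Ecoef; simpl; ring).
  assert (f_nonneg : forall n, 0 <= f n) by (intros n; pos).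
  assert (f_0 : f O = 0) by (unfold f; simpl; ring).
  (* The Puiseux hypothesis contains convergence at rho, which forces tau > 1 and puts Q into the
     class; its expansion then identifies the coefficient. *)
  assert (HfA : forall eta, puiseux c d p q rho eta -> InA f (- eta)).
  { intros eta HP. assert (Hex : ex_series f) by apply HP.
    assert (H1 : 1 < tau) by (apply (ex_series_qtilt_tau c d p q tau); assumption).
    destruct (InA_qtilt c d p q tau Hc Hd p_nonneg p_c p_aper Htau Hcrit H1) as [al Hal]. rewrite Ef in Hal.
    rewrite <- (puiseux_eta c d p q rho eta al Hrho Hal HP). exact Hal. }
  split; [|split].
  - intros rho0 Hrho0 Hlt Q1 Q2 mu sigma2 sigma x. destruct Hrho0 as (Hr0 & Hsum & _).
    destruct (Qcoef_radius_open c d p q tau Hc Hd p_nonneg p_c p_aper Hq Htau Hcrit rho0) as (r' & Hr' & Hex);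
      [fold rho; lra|eexists; exact Hsum|].
    set (e0 := fun n => Ecoef c d p n * rho0 ^ n).
    assert (He0 : ex_series e0).
    { apply (ex_series_dominated _ e); [|exact (InA_ex_series _ _ HEA)]. intros n. unfold e0, e.
      rewrite Rabs_pos_eq by pos.
      apply Rmult_le_compat_l; [apply HE0|]. apply pow_incr. lra. }
    destruct (nfloor_seq (fun n => mu * INR n + x * (sigma * sqrt (INR n)))) as [K HK].
    destruct (gaussian_regime (Qcoef c d p q) e0 rho0 r' n0 HQ0 eq_refl HQpos ltac:(lra) Hex Hsum
      ltac:(intros n; pos) ltac:(unfold e0, Ecoef; simpl; ring) He0 K x HK) as (Hmu & Hsig & Hlim).
    revert Hlim. apply is_lim_seq_ext_loc.
    (* K is the floor of this threshold only where it is nonnegative, which holds once sqrt n >= |x|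
       sigma / mu. *)
    assert (Hev : exists N, forall n, (N <= n)%nat -> (1 <= n)%nat /\ 0 <= mu * INR n + x * (sigma * sqrt (INR n))).
    { destruct (INR_archimed 1 ((x * sigma / mu) ^ 2 + 1) Rlt_0_1) as [N HN]. exists N. intros n Hn.
      apply le_INR in Hn. assert (Hn1 : (1 <= n)%nat) by (apply INR_le; simpl; nra). split; [exact Hn1|].
      assert (Hs : Rabs (x * sigma / mu) <= sqrt (INR n)).
      { rewrite <- sqrt_Rsqr_abs. apply sqrt_le_1; [apply Rle_0_sqr|apply pos_INR|]. unfold Rsqr. lra. }
      pose proof (sqrt_pos (INR n)). rewrite <- (sqrt_sqrt (INR n)) at 1 by apply pos_INR. set (w := sqrt (INR n)) in *.
      assert (Efac : forall m s v, 0 < m -> m * (v * v) + x * (s * v) = m * v * (v + x * s / m)) by (intros; field; lra).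
      rewrite (Efac mu sigma w Hmu).
      apply Rabs_le_between in Hs. apply Rmult_le_pos; [apply Rmult_le_pos; [left; exact Hmu|lra]|lra]. }
    destruct Hev as [N HN]. exists N. intros n Hn. destruct (HN n Hn) as [Hn1 Hb]. symmetry. unfold e0.
    apply Xcdf_leind; [lra|]. intros k. specialize (HK n Hb). rewrite <- (floor_le_iff k _ _ HK).
    assert (Hsn : 0 < sqrt (INR n)) by pos.
    assert (Hss : 0 < sigma * sqrt (INR n)) by pos.
    rewrite (Rle_div_l (INR k - mu * INR n) x _ Hss). split; intros; lra.
  - intros rho0 eta (Hr0 & Hsum & _) Heq HP theta. rewrite Heq in Hsum. specialize (HfA eta HP).
    assert (HC : critical e f eta).
    { exists (Series e * (-2 * lam0 c d p tau)). repeat (split; [assumption|]).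
      split; [apply is_series_unique, Hsum|]. exists n0, kl. split; assumption. }
    pose proof (critical_eta _ _ _ HC) as Heta.
    assert (Hth : 0 < theta) by pos.
    split.
    + intros x. unfold Rayleigh_cdf. destruct (Rle_or_lt 0 x) as [Hx|Hx].
      * rewrite Rmax_left by exact Hx.
        destruct (nfloor_seq (fun n => x * (theta * sqrt (INR n)))) as [K HK].
        assert (Hb : forall n, 0 <= x * (theta * sqrt (INR n))) by (intros n; apply Rmult_le_pos; [exact Hx|apply Rmult_le_pos; [lra|apply sqrt_pos]]).
        assert (HL := rayleigh_regime e f eta K x HC Hx (fun n => HK n (Hb n))). revert HL. apply is_lim_seq_ext_loc.
        exists 1%nat. intros n Hn. symmetry. apply Xcdf_leind; [exact Hrho|]. intros k. rewrite <- (floor_le_iff k _ _ (HK n (Hb n))).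
        assert (Hsn : 0 < theta * sqrt (INR n)) by pos.
        apply (Rle_div_l (INR k) x _ Hsn).
      * rewrite Rmax_right by lra. replace (1 - exp (- 0 ^ 2 / 2)) with 0.
        -- apply (is_lim_seq_ext_loc (fun _ => 0)); [|apply is_lim_seq_const]. exists 1%nat. intros n Hn. symmetry.
           apply sum_zero. intros k _. destruct Rle_dec as [H|H]; [|reflexivity]. exfalso.
           assert (Hsn : 0 < theta * sqrt (INR n)) by pos.
           apply (Rle_div_l (INR k) x _ Hsn) in H. pose proof (pos_INR k). nra.
        -- replace (- 0 ^ 2 / 2) with 0 by field. rewrite exp_0. ring.
    + apply (is_lim_seq_ext_loc (fun n => expect e f n INR * gseq n * eta / (sqrt (PI * INR n) * gseq n))).
      * exists 1%nat. intros n Hn. pose proof (gseq_pos n). pose proof PI_RGT_0.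
        assert (0 < sqrt (PI * INR n)) by pos.
        replace (Xmean c d p q n) with (expect e f n INR); [field; lra|].
        apply sum_eq. intros k _. rewrite (Xprob_scale c d p q rho n k Hrho). reflexivity.
      * replace (Finite 1) with (Finite (/ eta * eta / 1)) by (f_equal; field; lra).
        apply is_lim_seq_div'; [|apply sqrt_gseq_lim|lra]. apply is_lim_seq_mult'; [apply mean_limit, HC|apply is_lim_seq_const].
  - intros Hno eta HP lam Drho C k F. specialize (HfA eta HP).
    assert (Heta : 0 < eta) by (apply (eta_pos f); [exact HfA|exists n0, kl; split; assumption]).
    assert (Hlam : lam = Series f) by reflexivity.
    assert (Hlam1 : Series f < 1).
    { destruct (Rlt_or_le (Series f) 1) as [|Hle]; [assumption|exfalso]. apply Hno.
      apply (rho0_exists c d p q rho Hrho HQ0 (S n0)); [lia|apply HQpos; lia|apply HP|exact Hle|reflexivity]. }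
    assert (Hlam0 : 0 < Series f).
    { apply Rlt_le_trans with (f n0); [pos|].
      apply Rle_trans with (sum_f_R0 f n0); [apply (sum_ge_term f n0 n0 f_nonneg); lia|].
      apply sum_le_Series; [exact f_nonneg|apply HP]. }
    pose proof (lam0_eq c d p tau Hc Hd p_nonneg p_c p_aper Htau Hcrit) as HCt. fold C in HCt.
    pose proof (lam0_pos c d p tau Hc Hd p_nonneg p_c p_aper Htau) as Hl0.
    set (ct := C / tau) in *. assert (Hct : 0 < ct) by lra.
    assert (HD : 0 < Drho) by (apply Rinv_0_lt_compat; fold lam; rewrite Hlam; lra).
    assert (Hden : 0 < eta * Drho ^ 2 + ct * Drho).
    { pose proof (pow_lt Drho 2 HD). assert (0 < eta * Drho ^ 2) by pos.
      assert (0 < ct * Drho) by pos. lra. }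
    assert (HF : 0 < F).
    { unfold F. apply Rdiv_lt_0_compat; [|exact Hden]. rewrite Hlam. apply Rmult_lt_0_compat; [|apply pow_lt, Hlam0].
      assert (0 <= INR k * eta / Series f); [|fold ct; lra].
      pos. }
    assert (HDe : Drho = / (1 - Series f)) by reflexivity.
    pose proof (discrete_limit_law e f _ _ HEA HfA f_nonneg f_0 Hlam1 k) as HL. cbv zeta in HL. rewrite <- HDe in HL.
    replace (-2 * lam0 c d p tau) with (- ct) in HL by lra.
    (* Both singular coefficients carry the factor -E(rho), which cancels in the quotient and leaves
       F. *)
    match type of HL with ?t <> 0 -> _ => assert (Et : t = - Series e * (eta * Drho ^ 2 + ct * Drho)) by ring end.
    destruct HL as (K & N & HKN); [rewrite Et; apply Rlt_not_eq; nra|].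
    (* The additive error K / n becomes a relative one because F is a fixed positive number. *)
    exists (K / F), N. intros n Hn. specialize (HKN n Hn).
    replace (K / F * F / INR n) with (K / INR n) by (unfold Rdiv; rewrite (Rmult_assoc K (/ F) F), Rinv_l, Rmult_1_r by lra; reflexivity).
    rewrite (Xprob_scale c d p q rho n k Hrho). fold e f.
    replace F with ((Series e * - ct * Series f ^ k + INR k * Series f ^ Init.Nat.pred k * - eta * Series e) /
       (Series e * - ct * Drho + - eta * Drho ^ 2 * Series e)); [exact HKN|].
    rewrite Et. unfold F. rewrite Hlam. fold ct.
    assert (Hk : INR k * Series f ^ Init.Nat.pred k = INR k * Series f ^ k / Series f).
    { destruct k as [|k']; [simpl; field; lra|]. simpl Init.Nat.pred. simpl pow. field. lra. }
    rewrite Hk. field. lra.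
Qed.
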